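(* Let $n\ge2$ and let $F:S^1\times S^{n-1}\times[0,T_{\mathrm{sing}})\to\mathbb{C}^n$ be a smooth solution of the equivariant Lagrangian mean curvature flow with corresponding profile curves $z_t=z(\cdot,t):S^1\to\mathbb{C}^*$, where $[0,T_{\mathrm{sing}})$ is the maximal time interval on which a smooth solution exists. If the initial profile curve $z_0$ is starshaped with respect to the origin, then $$\liminf_{t\to T_{\mathrm{sing}}} r=0,\qquad r:=|z|,$$ i.e. $\liminf_{t\to T_{\mathrm{sing}}}\min_{\phi\in S^1}|z(\phi,t)|=0$.
   Context: $\mathbb{C}^n\cong\mathbb{R}^n\times\mathbb{R}^n$ with complex structure $J(x,y)=(-y,x)$ and $\mathbb{C}^*=\mathbb{C}\setminus\{0\}$. Let $G:S^{n-1}\to\mathbb{R}^n$ be the standard embedding of the unit sphere. Given a smooth closed immersed curve $z=u+iv:S^1\to\mathbb{C}^*$ (the profile curve), the associated equivariant Lagrangian immersion is $F(\phi,x)=(u(\phi)G(x),v(\phi)G(x))$ of $S^1\times S^{n-1}$ into $\mathbb{C}^n$. Mean curvature flow $\frac{d}{dt}F=\overrightarrow H$ ($\overrightarrow H$ the trace of the second fundamental form) starting from such an immersion stays of this form, $F(\phi,x,t)=(u_t(\phi)G(x),v_t(\phi)G(x))$, and is equivalent to the flow of profile curves $$\frac{d}{dt}z=-f\nu,\qquad f:=k+(n-1)\frac{\langle z,\nu\rangle}{|z|^2},$$ where $\nu=-J(z'/|z'|)$ is the outward pointing unit normal and $k=-\langle z'',\nu\rangle/|z'|^2$ is the curvature.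 A curve is called starshaped (with respect to the origin) if $\langle z,\nu\rangle>0$ everywhere on it, whether it is embedded or only immersed. *)

(* Defs.v *)
From HB Require Import structures.
From mathcomp Require Import all_boot all_order all_algebra.
From mathcomp Require Import all_classical all_reals all_analysis.
Import Order.TTheory GRing.Theory Num.Theory.
Import numFieldNormedType.Exports.

Set Implicit Arguments.
Unset Strict Implicit.
Unset Printing Implicit Defensive.

Local Open Scope classical_set_scope.
Local Open Scope ring_scope.

(* Smoothness on a possibly non-open set [D] means having a C^oo extension to
   an open neighbourhood; for [D = [0, T) x S^1] this includes smoothness up to
   the initial time. On a finite-dimensional [V], [smooth_open] is C^oo. *)
Section Smooth.
Context {R : realType} {V W : normedModType R}.

Definition iter_derive (f : V -> W) (s : seq V) : V -> W :=
  foldr (fun v g => fun a => 'D_v g a) f s.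

Definition smooth_open (U : set V) (f : V -> W) : Prop :=
  forall (s : seq V) (a : V), U a ->
    {for a, continuous (iter_derive f s)} /\
    (forall v, derivable (iter_derive f s) a v).

Definition smooth_on (D : set V) (f : V -> W) : Prop :=
  exists (U : set V) (g : V -> W),
    [/\ open U, D `<=` U, smooth_open U g & forall a, D a -> f a = g a].

End Smooth.

(* The norms carried by the library on products and matrices are sup norms,
   hence the explicit Euclidean structures below. *)
Section Euclidean.
Context {R : realType}.

Definition dotv {n : nat} (x y : 'rV[R]_n) : R := \sum_(i < n) x 0 i * y 0 i.

Definition unit_sphere {n : nat} : set 'rV[R]_n := [set x | dotv x x = 1].

Definition normalize {n : nat} (y : 'rV[R]_n) : 'rV[R]_n :=
  (Num.sqrt (dotv y y))^-1 *: y.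

(* C^n = R^n x R^n; [J] serves both C and C^n, [dot2] is the product on C. *)
Definition dotC {n : nat} (p q : 'rV[R]_n * 'rV[R]_n) : R :=
  dotv p.1 q.1 + dotv p.2 q.2.

Definition J {V : zmodType} (p : V * V) : V * V := (- p.2, p.1).

Definition dot2 (p q : R * R) : R := p.1 * q.1 + p.2 * q.2.

Definition norm2 (p : R * R) : R := Num.sqrt (dot2 p p).

End Euclidean.

(* Extrinsic geometry of Phi : S^1 x S^(n-1) -> C^n, with S^1 = R / 2 pi Z. The
   0-homogeneous extension [hom_ext Phi], restricted to the affine space
   (phi, x) + T_(phi,x), is Phi read in a chart centred at (phi, x); thus the
   differential of Phi at (phi, x) is the directional derivative of
   [hom_ext Phi] along tangent vectors, and the second fundamental form is the
   normal part of its second directional derivative. *)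
Section MeanCurvature.
Context {R : realType} {n : nat}.
Variable Phi : R -> 'rV[R]_n -> 'rV[R]_n * 'rV[R]_n.

Definition hom_ext (p : R * 'rV[R]_n) : 'rV[R]_n * 'rV[R]_n :=
  Phi p.1 (normalize p.2).

Definition tangent (x : 'rV[R]_n) : set (R * 'rV[R]_n) :=
  [set X | dotv x X.2 = 0].

Definition differential (phi : R) (x : 'rV[R]_n) (X : R * 'rV[R]_n) :=
  'D_X hom_ext (phi, x).

(* Being n in number, the vectors of such a frame form a basis of the tangent
   space, orthonormal for the induced metric. *)
Definition orthonormal_frame (phi : R) (x : 'rV[R]_n)
    (e : 'I_n -> R * 'rV[R]_n) : Prop :=
  (forall i, tangent x (e i)) /\
  (forall i j, dotC (differential phi x (e i)) (differential phi x (e j))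
               = (i == j)%:R).

Definition normal_part (phi : R) (x : 'rV[R]_n) (e : 'I_n -> R * 'rV[R]_n)
    (w : 'rV[R]_n * 'rV[R]_n) : 'rV[R]_n * 'rV[R]_n :=
  w - \sum_(i < n) dotC w (differential phi x (e i))
                     *: differential phi x (e i).

Definition second_fundamental_form (phi : R) (x : 'rV[R]_n)
    (e : 'I_n -> R * 'rV[R]_n) (X Y : R * 'rV[R]_n) :=
  normal_part phi x e ('D_X (fun p => 'D_Y hom_ext p) (phi, x)).

(* The value does not depend on the orthonormal frame [e]. *)
Definition mean_curvature_vector (phi : R) (x : 'rV[R]_n)
    (e : 'I_n -> R * 'rV[R]_n) : 'rV[R]_n * 'rV[R]_n :=
  \sum_(i < n) second_fundamental_form phi x e (e i) (e i).

End MeanCurvature.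

Section Flow.
Context {R : realType}.

Definition equivariant_map (n : nat) (c : R -> R * R)
    (phi : R) (x : 'rV[R]_n) : 'rV[R]_n * 'rV[R]_n :=
  ((c phi).1 *: x, (c phi).2 *: x).

Definition closed_immersed_in_Cstar (c : R -> R * R) : Prop :=
  [/\ forall phi, c (phi + 2 * pi) = c phi,
      forall phi, c phi != 0
    & forall phi, derive1 c phi != 0].

Definition outward_normal (c : R -> R * R) (phi : R) : R * R :=
  - J ((norm2 (derive1 c phi))^-1 *: derive1 c phi).

Definition starshaped (c : R -> R * R) : Prop :=
  forall phi, 0 < dot2 (c phi) (outward_normal c phi).

Definition time_interval (T : \bar R) : set R :=
  [set t | 0 <= t /\ (t%:E < T)%E].

(* [z t phi] is the profile curve at time [t]; its values for [t] outside
   [0, T) are irrelevant, whence the time derivative taken within [0, T). At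
   each point of S^1 x S^(n-1) orthonormal frames exist, since the curves
   are immersed and avoid 0. *)
Definition equivariant_lmcf (n : nat) (T : \bar R) (z : R -> R -> R * R) : Prop :=
  [/\ smooth_on [set p : R * R | time_interval T p.1] (fun p => z p.1 p.2),
      forall t, time_interval T t -> closed_immersed_in_Cstar (z t)
    & forall t phi (x : 'rV[R]_n) (e : 'I_n -> R * 'rV[R]_n),
        time_interval T t -> unit_sphere x ->
        orthonormal_frame (equivariant_map (z t)) phi x e ->
        (s - t)^-1 *: (equivariant_map (z s) phi x - equivariant_map (z t) phi x)
          @[s --> within (time_interval T) (t^')]
          --> mean_curvature_vector (equivariant_map (z t)) phi x e].

(* [0, T) is the maximal existence interval for the initial curve of [z]. *)
Definition maximal_equivariant_lmcf (n : nat) (T : \bar R)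
    (z : R -> R -> R * R) : Prop :=
  equivariant_lmcf n T z /\
  forall (T' : \bar R) (z' : R -> R -> R * R), (T < T')%E ->
    equivariant_lmcf n T' z' -> z' 0 = z 0 -> False.

Definition min_radius (c : R -> R * R) : \bar R :=
  ereal_inf (range (fun phi => (norm2 (c phi))%:E)).

(* The filter t -> T, t < T, for T in (0, +oo]. *)
Definition at_left_ereal (T : \bar R) : set_system R :=
  match T with
  | r%:E => r^'-
  | +oo%E => pinfty_nbhs R
  | -oo%E => ninfty_nbhs R
  end.

End Flow.

(* Main.v *)
(* Write r = |z|, s = <z, nu>, p for the tangential component of z and suppose that
   liminf min r > 0. The maximum principle for r^2 + 2 n t shows that T_sing is finite; then r
   is bounded below on [0, T_sing), by compactness away from T_sing. At a spatial minimum of s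
   either k or p vanishes, so that s >= c exp(-C t): the curves stay uniformly starshaped.
   Since, with L = d_ss + (n-1) (p / r^2) d_s,
     f_t = L f + f (k^2 + (n-1) (s^2 - p^2) / r^4) and
     s_t = L s + s (k^2 - 2 (n-1) p^2 / r^4) - f - k,
   Tso's quotient f / (s - beta) bounds f, hence k. Every arclength derivative of f satisfies
   a linear equation whose coefficients are controlled by lower derivatives, so all of them
   are bounded, and so is the length element.

   Hence the flow can be restarted arbitrarily close to T_sing with an existence time that
   depends on these bounds only, and thus continued past T_sing. To restart it, one uses the
   arclength parameter of the initial curve: the flow with tangential velocity
   z_t = z'' / |z'|^2 - (n-1) z / |z|^2 is solved by a fixed-point iteration on absolutely
   convergent Fourier series, and composing with the flow of the tangential part of z_t removes
   the latter. The space derivatives of the solution are jointly continuous, and the equation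
   trades time derivatives for them, so that the concatenation of the two flows is smooth. *)

Require Import Defs.
From mathcomp Require Import all_boot all_order all_algebra.
From mathcomp Require Import all_classical all_reals all_analysis.
From mathcomp Require Import ring lra.
Import Order.TTheory GRing.Theory Num.Theory.
Import numFieldNormedType.Exports.
Set Implicit Arguments.
Unset Strict Implicit.
Unset Printing Implicit Defensive.
Local Open Scope classical_set_scope.
Local Open Scope ring_scope.

(** What shapes the short-time existence: in the arclength parameter the coefficient h = 1 / |z'|^2
    equals 1 at the start, so the equation is a heat equation perturbed by (h - 1) z''. This term
    costs two derivatives. Duhamel's formula gives back exactly two in absolutely convergent Fourier
    series (it would not in sup norms), but with a constant 4 instead of a small factor. The
    iteration closes only because h - 1 is small, and that is seen one order lower, where the
    formula gains one derivative together with a small factor; hence every iterate carries two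
    norms. The reciprocals h and w = 1 / |z|^2 are unknowns with fixed-point equations of their own,
    so that only sums and products ever act on the series.

    Five arclength derivatives of the initial curve fix the existence time: three for the norm of
    the data, two for the summability of Fourier coefficients. Higher derivatives enter only through
    the scales [eta], which do not influence the time; smoothness therefore costs no time. *)

Notation isd f x d := (is_derive x 1%R f d).

(** * One-variable calculus *)

Section Calculus.
Context {R : realType}.
Implicit Types (f g df dg A B dA dB : R -> R) (a b c d e x y t C : R).

(** The little-o form has no quotient, so that the point y = x needs no exclusion; uniform limits,
    parameter integrals and flows are differentiated through it. *)
Lemma isdP f x d :
  isd f x d <->
  forall e, 0 < e -> exists2 r : R, 0 < r & forall y, `|y - x| < r ->
    `|f y - f x - d * (y - x)| <= e * `|y - x|.
Proof.
split=> [[df <-] e e0|H].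
  have /cvgrPdist_lt/(_ e e0) := df.
  move=> /nbhs_ballP[r/= r0 Hr]; exists r => // y yx.
  have [->|yx0] := eqVneq y x; first by rewrite !subrr mulr0 subr0 normr0 mulr0.
  have h0 : y - x != 0 by rewrite subr_eq0.
  have := Hr (y - x); rewrite /ball /= sub0r normrN => /(_ yx h0).
  rewrite [(y - x) *: _]mulr1 subrK => /ltW; rewrite distrC => Hl.
  have -> : f y - f x - 'D_1 f x * (y - x) =
     ((y - x)^-1 *: (f y - f x) - 'D_1 f x) * (y - x).
    by rewrite mulrBl /GRing.scale /= mulrAC mulVf // mul1r.
  by rewrite normrM ler_wpM2r.
have C : (fun h => h^-1 *: ((f \o shift x) (h *: (1:R)) - f x)) @ 0^' --> d.
  apply/cvgrPdist_le => e e0; have [r r0 Hr] := H e e0.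
  near=> h => /=.
  have h0 : h != 0 by near: h; exact: nbhs_dnbhs_neq.
  have := Hr (h *: 1 + x); rewrite addrK [h *: 1]mulr1 => Hh.
  rewrite distrC.
  have -> : h^-1 *: (f (h + x) - f x) - d = h^-1 * (f (h + x) - f x - d * h).
    by rewrite mulrBr [d * h]mulrC mulKf.
  rewrite normrM normfV ler_pdivrMl ?normr_gt0 // [`|h| * e]mulrC; apply: Hh.
  by near: h; apply: dnbhs0_lt.
by apply: DeriveDef; [apply/cvg_ex; exists d|apply/cvg_lim].
Unshelve. all: by end_near. Qed.

Lemma isd_uniq f x d d' : isd f x d -> isd f x d' -> d = d'.
Proof. by move=> [_ <-] [_ <-]. Qed.

Lemma isd_cont f x d : isd f x d -> {for x, continuous f}.
Proof.
by move=> [df _]; apply: differentiable_continuous; apply/derivable1_diffP.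
Qed.

Lemma isd_near f g x d : (\near x, f x = g x) -> isd f x d -> isd g x d.
Proof. by move=> fg; apply: near_eq_is_derive => //; rewrite oner_eq0. Qed.

Lemma isd_eq f x d d' : isd f x d -> d = d' -> isd f x d'.
Proof. by move=> H <-. Qed.

Lemma isd_ext f g x d : f =1 g -> isd f x d -> isd g x d.
Proof. by move=> /funext ->. Qed.

Lemma isd_chain f g x c d : isd f (g x) c -> isd g x d -> isd (f \o g) x (c * d).
Proof. by move=> Hf Hg; apply: is_derive_eq; rewrite mulrC. Qed.

Lemma mvt_ex f df a b : a <= b ->
  (forall x, a < x < b -> isd f x (df x)) ->
  {within `[a, b], continuous f} ->
  exists2 c, a <= c <= b & f b - f a = df c * (b - a).
Proof.
move=> ab H cf; have [c cab E] : exists2 c, c \in `[a, b]%R & f b - f a = df c * (b - a).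
  by apply: MVT_segment => // x; rewrite in_itv /=; apply: H.
by exists c => //; move: cab; rewrite in_itv.
Qed.

Lemma isd_within f df a b : (forall x, a <= x <= b -> isd f x (df x)) ->
  {within `[a, b], continuous f}.
Proof.
move=> H; apply: continuous_in_subspaceT => x; rewrite inE /= in_itv /= => xab.
exact: isd_cont (H x xab).
Qed.

Lemma mvt_exc f df a b : a <= b ->
  (forall x, a <= x <= b -> isd f x (df x)) ->
  exists2 c, a <= c <= b & f b - f a = df c * (b - a).
Proof.
move=> ab H; apply: mvt_ex => //; last exact: isd_within H.
by move=> x /andP[? ?]; apply: H; rewrite !ltW.
Qed.

Lemma mvt f df a b : (forall x, isd f x (df x)) ->
  exists2 c, `|c - a| <= `|b - a| & f b - f a = df c * (b - a).
Proof.
move=> H; have [ab|ba] := leP a b.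
- have [c /andP[ac cb] E] : exists2 c, a <= c <= b & f b - f a = df c * (b - a).
    exact: mvt_exc.
  by exists c => //; rewrite !ger0_norm ?subr_ge0 // lerD2r.
- have [c /andP[ac cb] E] : exists2 c, b <= c <= a & f a - f b = df c * (a - b).
    by apply: mvt_exc => //; exact: ltW.
  exists c; first by rewrite !ler0_norm ?subr_le0 ?(ltW ba)// lerN2 lerD2r.
  by rewrite -[LHS]opprB E -mulrN opprB.
Qed.

Lemma mvt_abs f df a b C :
  (forall x, isd f x (df x)) -> (forall x, `|df x| <= C) ->
  `|f b - f a| <= C * `|b - a|.
Proof.
by move=> H HC; have [c _ ->] := mvt a b H; rewrite normrM ler_wpM2r.
Qed.

Lemma isd0_cst f a b : (forall x, isd f x 0) -> f a = f b.
Proof. by move=> /(mvt b a)[c _]; rewrite mul0r => /subr0_eq. Qed.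

Lemma nondecr_on f df a b : a <= b ->
  (forall x, a <= x <= b -> isd f x (df x)) ->
  (forall x, a < x < b -> 0 <= df x) -> f a <= f b.
Proof.
rewrite le_eqVlt => /predU1P[->//|ab] H Hd; rewrite -subr_ge0.
have cf := isd_within H.
have [c cab ->] : exists2 c, c \in `]a, b[%R & f b - f a = df c * (b - a).
  apply: MVT => // x; rewrite in_itv /= => /andP[ax xb].
  by apply: H; rewrite !ltW.
by move: cab; rewrite in_itv /= => cab; rewrite mulr_ge0 ?Hd // subr_ge0 ltW.
Qed.

(** Both B - A and B + A are nondecreasing. Duhamel integrals and Picard increments are bounded this
    way, by exhibiting a majorant B instead of estimating an integral. *)
Lemma comparison A dA B dB t0 t1 : t0 <= t1 ->
  (forall t, t0 <= t <= t1 -> isd A t (dA t)) ->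
  (forall t, t0 <= t <= t1 -> isd B t (dB t)) ->
  (forall t, t0 < t < t1 -> `|dA t| <= dB t) -> `|A t0| <= B t0 ->
  `|A t1| <= B t1.
Proof.
move=> t01 HA HB ab.
have E1 : (B - A) t0 <= (B - A) t1.
  apply: (@nondecr_on (B - A) (fun t => dB t - dA t)) => // t tt.
    by apply: is_deriveB; [apply: HB|apply: HA].
  by move: (ab t tt); rewrite ler_norml subr_ge0 => /andP[].
have E2 : (B + A) t0 <= (B + A) t1.
  apply: (@nondecr_on (B + A) (fun t => dB t + dA t)) => // t tt.
    by apply: is_deriveD; [apply: HB|apply: HA].
  by move: (ab t tt); rewrite ler_norml -subr_ge0 opprK addrC => /andP[].
move: E1 E2; rewrite /GRing.add /GRing.opp /= => E1 E2.
rewrite !ler_norml => /andP[h1 h2].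
apply/andP; split; lra.
Qed.

Lemma contP (T : pseudoMetricNormedZmodType R) (f : T -> R) (a : T) :
  {for a, continuous f} <-> forall e : R, 0 < e -> exists2 r : R, 0 < r & forall y : T,
    `|y - a| < r -> `|f y - f a| < e.
Proof.
split=> [cf e e0|H].
  have /cvgrPdist_lt/(_ e e0) := cf; move=> /nbhs_ballP[r /= r0 Hr].
  exists r => // y ya; rewrite distrC; apply: Hr; rewrite -ball_normE /= distrC //.
apply/cvgrPdist_lt => e e0; have [r r0 Hr] := H e e0.
apply/nbhs_ballP; exists r => //= y; rewrite -ball_normE /= => ya.
by rewrite distrC Hr // distrC.
Qed.

Lemma continuous_uniform_limit (T : pseudoMetricNormedZmodType R)
  (f_ : nat -> T -> R) (f : T -> R) (e : nat -> R) :
  (forall n, continuous (f_ n)) -> (forall n p, `|f_ n p - f p| <= e n) ->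
  e @ \oo --> 0 -> continuous f.
Proof.
move=> cf H /cvgrPdist_lt e0 a; apply/contP => h h0.
have [|n _ /(_ n (leqnn _))] := e0 (h / 3); first by rewrite divr_gt0.
rewrite sub0r normrN => /(le_lt_trans (ler_norm _)) en.
have [|r r0 Hr] := (contP (f_ n) a).1 (cf n a) (h / 3); first by rewrite divr_gt0.
exists r => // y /Hr ya.
have := H n y; have := H n a; rewrite !ler_norml => /andP[h1 h2] /andP[h3 h4].
move: ya; rewrite !ltr_norml => /andP[h5 h6]; apply/andP; split; lra.
Qed.

Lemma near_oo_isd f g a b x d : (forall y, a < y < b -> f y = g y) ->
  a < x < b -> isd f x d -> isd g x d.
Proof.
move=> fg xab; apply: isd_near.
have : x \in `]a, b[%R by rewrite in_itv.
by move=> /near_in_itvoo; apply: filterS => y; rewrite in_itv /= => /fg.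
Qed.

(** The mean value theorem for f_n - f_n0 makes the increments Cauchy with an error proportional to
    |y - x|; the differentiability of the single function f_n0 then passes to the limit. *)
Lemma isd_uniform_limit (f_ df_ : nat -> R -> R) f df (e : nat -> R) a b :
  (forall n x, a < x < b -> isd (f_ n) x (df_ n x)) ->
  (forall x, a < x < b -> f_ ^~ x @ \oo --> f x) ->
  (forall n x, a < x < b -> `|df_ n x - df x| <= e n) -> e @ \oo --> 0 ->
  forall x, a < x < b -> isd f x (df x).
Proof.
move=> Hd Hf He e0 x xab; apply/isdP => h h0.
have h4 : 0 < h / 4 by rewrite divr_gt0.
have [n0 _ Hn0] : \forall n \near \oo, `|0 - e n| < h / 4.
  by move/cvgrPdist_lt : e0; exact.
have en n : (n0 <= n)%N -> e n < h / 4.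
  by move=> /Hn0 /=; rewrite sub0r normrN => /(le_lt_trans (ler_norm _)).
have [r r0 Hr] := (isdP (f_ n0) x (df_ n0 x)).1 (Hd n0 x xab) _ h4.
have [axx xbb] := andP xab.
exists (Num.min r (Num.min (x - a) (b - x))).
  by rewrite !lt_min r0 !subr_gt0 axx.
move=> y; rewrite !lt_min => /and3P[yr ya yb].
have yab : a < y < b.
  by move: ya yb; rewrite !ltr_norml => /andP[? ?] /andP[? ?]; apply/andP; split; lra.
have key n : (n0 <= n)%N ->
   `|(f_ n y - f_ n x) - (f_ n0 y - f_ n0 x)| <= (h / 4 + h / 4) * `|y - x|.
  move=> nn; pose g z := f_ n z - f_ n0 z.
  have Dg z : a < z < b -> isd g z (df_ n z - df_ n0 z).
    by move=> zab; apply: is_deriveB; apply: Hd.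
  have bnd z : a < z < b -> `|df_ n z - df_ n0 z| <= h / 4 + h / 4.
    move=> zab; have := He n _ zab; have := He n0 _ zab.
    have := en n nn; have := en n0 (leqnn _).
    rewrite !ler_norml => ? ? /andP[? ?] /andP[? ?]; apply/andP; split; lra.
  have -> : f_ n y - f_ n x - (f_ n0 y - f_ n0 x) = g y - g x by rewrite /g; ring.
  have sub z u v : a < u < b -> a < v < b -> u <= z <= v -> a < z < b.
    by move=> /andP[? ?] /andP[? ?] /andP[? ?]; apply/andP; split; lra.
  have [xy|yx] := leP x y.
    have [z zz ->] : exists2 z, x <= z <= y & g y - g x = (df_ n z - df_ n0 z) * (y - x).
      by apply: (mvt_exc (df := fun z => df_ n z - df_ n0 z)) => // z /sub zz; apply: Dg; apply: zz.
    by rewrite normrM ler_wpM2r // bnd // (sub _ x y).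
  have [z zz E] : exists2 z, y <= z <= x & g x - g y = (df_ n z - df_ n0 z) * (x - y).
    by apply: (mvt_exc (df := fun z => df_ n z - df_ n0 z)) => //; [exact: ltW|move=> z /sub zz; apply: Dg; apply: zz].
  by rewrite distrC E normrM [`|x - y|]distrC ler_wpM2r // bnd // (sub _ y x).
have key2 : `|(f y - f x) - (f_ n0 y - f_ n0 x)| <= (h / 4 + h / 4) * `|y - x|.
  have C : (fun n => `|(f_ n y - f_ n x) - (f_ n0 y - f_ n0 x)|) @ \oo -->
      `|(f y - f x) - (f_ n0 y - f_ n0 x)|.
    apply: cvg_norm; apply: cvgB; last exact: cvg_cst.
    by apply: cvgB; apply: Hf.
  rewrite -(cvg_lim _ C) //; apply: limr_le; first by apply/cvg_ex; eexists; exact: C.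
  by near=> n; apply: key; near: n; exists n0.
have k3 := Hr y yr.
have k5 : `|(df_ n0 x - df x) * (y - x)| <= h / 4 * `|y - x|.
  by rewrite normrM ler_wpM2r // (le_trans (He n0 x xab)) // ltW // en.
have -> : f y - f x - df x * (y - x) = ((f y - f x) - (f_ n0 y - f_ n0 x)) +
   (f_ n0 y - f_ n0 x - df_ n0 x * (y - x)) + (df_ n0 x - df x) * (y - x) by ring.
apply: le_trans (ler_normD _ _) _.
apply: le_trans (lerD (ler_normD _ _) (lexx _)) _.
apply: le_trans (lerD (lerD key2 k3) k5) _.
by rewrite -!mulrDl ler_wpM2r //; lra.
Unshelve. all: by end_near. Qed.

(* Only one of the two mixed derivatives is assumed to exist. *)
Lemma mixed_derivative (h G hx Gx : R -> R -> R) t x r : 0 < r ->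
  (forall s y, `|s - t| < r -> `|y - x| < r -> isd (h ^~ y) s (G s y)) ->
  (forall s, `|s - t| < r -> isd (h s) x (hx s x)) ->
  (forall s y, `|s - t| < r -> `|y - x| < r -> isd (G s) y (Gx s y)) ->
  {for (t, x), continuous (fun p : R * R => Gx p.1 p.2)} ->
  isd (hx ^~ x) t (Gx t x).
Proof.
move=> r0 Ht Hx HGx /contP cG; apply/isdP => e e0.
have [r1 r10 Hr1] := cG e e0.
exists (Num.min r r1); first by rewrite lt_min r0.
move=> s; rewrite lt_min => /andP[sr sr1].
pose A y := h s y - h t y.
have dA : isd A x (hx s x - hx t x).
  by apply: is_deriveB; apply: Hx => //; rewrite subrr normr0.
have bet (u v w z : R) : `|v - u| < w -> u <= z <= v \/ v <= z <= u -> `|z - u| < w.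
  by rewrite !ltr_norml => /andP[? ?] [] /andP[? ?]; apply/andP; split; lra.
(* By the mean value theorem in s, then in y, the second difference of h over the rectangle with
   corners (t, x) and (s, y) is [Gx] at an intermediate point times the area. *)
have key y : `|y - x| < r -> `|y - x| < r1 ->
   `|A y - A x - Gx t x * (s - t) * (y - x)| <= e * `|s - t| * `|y - x|.
  move=> yr yr1.
  have [u Hu [v Hv E]] : exists2 u, `|u - t| < r /\ `|u - t| < r1 & exists2 v,
    `|v - x| < r1 & A y - A x = Gx u v * (y - x) * (s - t).
    have [u [u1 u2] E1] : exists2 u, `|u - t| < r /\ `|u - t| < r1 &
         A y - A x = (G u y - G u x) * (s - t).
      have dd u : `|u - t| < r -> isd (fun u => h u y - h u x) u (G u y - G u x).
        by move=> ur; apply: is_deriveB; apply: Ht => //; rewrite subrr normr0.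
      have E0 : A y - A x = (h s y - h s x) - (h t y - h t x) by rewrite /A; ring.
      have [st|st] := leP t s.
        have [u Hu E] := @mvt_exc (fun u => h u y - h u x) (fun u => G u y - G u x) t s st
            (fun u Hu => dd u (bet _ _ _ _ sr (or_introl Hu))).
        by exists u; [split; [exact: bet sr (or_introl Hu)|exact: bet sr1 (or_introl Hu)]|rewrite E0].
      have [u Hu E] := @mvt_exc (fun u => h u y - h u x) (fun u => G u y - G u x) s t (ltW st)
            (fun u Hu => dd u (bet _ _ _ _ sr (or_intror Hu))).
      exists u; first by split; [exact: bet sr (or_intror Hu)|exact: bet sr1 (or_intror Hu)].
      by rewrite E0 -[LHS]opprB E -mulrN opprB.
    exists u => //.
    have dd v : `|v - x| < r -> isd (G u) v (Gx u v) by exact: HGx.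
    have [st|st] := leP x y.
      have [v Hv E] := @mvt_exc (G u) (Gx u) x y st
            (fun v Hv => dd v (bet _ _ _ _ yr (or_introl Hv))).
      by exists v; [exact: bet yr1 (or_introl Hv)|rewrite E1 E].
    have [v Hv E] := @mvt_exc (G u) (Gx u) y x (ltW st)
            (fun v Hv => dd v (bet _ _ _ _ yr (or_intror Hv))).
    exists v; first exact: bet yr1 (or_intror Hv).
    by rewrite E1 -[G u y - G u x]opprB E -mulrN opprB.
  have -> : A y - A x - Gx t x * (s - t) * (y - x) =
     (Gx u v - Gx t x) * ((s - t) * (y - x)) by rewrite E; ring.
  rewrite normrM [X in _ * X]normrM -[leRHS]mulrA ler_wpM2r ?mulr_ge0 //.
  apply/ltW; apply: (Hr1 (u, v)).
  by rewrite /Num.norm /= gt_max Hu.2 Hv.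
(* For fixed s, [key] divided by y - x becomes the claim as y tends to x; one y close enough to x,
   at the price of h0, suffices. *)
apply/ler_addgt0Pr => h0 h00.
have [r2 r20 Hr2] := (isdP _ _ _).1 dA h0 h00.
have [y [yx [y1 [y2 y3]]]] : exists y, y != x /\ `|y - x| < r /\ `|y - x| < r1 /\ `|y - x| < r2.
  exists (x + Num.min r (Num.min r1 r2) / 2).
  have m0 : 0 < Num.min r (Num.min r1 r2) by rewrite !lt_min r0 r10.
  have m1 : Num.min r (Num.min r1 r2) / 2 < Num.min r (Num.min r1 r2) by lra.
  rewrite addrC addrK gtr0_norm ?divr_gt0 //; split.
    by rewrite -subr_eq0 addrK gt_eqF // divr_gt0.
  by move: m1; rewrite {2 4 6}/Num.min !lt_min => /and3P[-> -> ->].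
have := key y y1 y2; have := Hr2 y y3.
have yx0 : 0 < `|y - x| by rewrite normr_gt0 subr_eq0.
move=> k1 k2; rewrite -(ler_pM2r yx0) mulrDl -normrM.
have -> : (hx s x - hx t x - Gx t x * (s - t)) * (y - x) =
   (A y - A x - Gx t x * (s - t) * (y - x)) - (A y - A x - (hx s x - hx t x) * (y - x)) by ring.
by apply: le_trans (ler_normB _ _) _; apply: lerD.
Qed.

(** The mean value theorem needs the derivative only strictly between t0 and t. It carries the flow
    equation across the time at which two solutions are joined. *)
Lemma isd_extend f df t0 r : 0 < r -> {for t0, continuous df} ->
  (forall t, `|t - t0| < r -> {for t, continuous f}) ->
  (forall t, `|t - t0| < r -> t != t0 -> isd f t (df t)) -> isd f t0 (df t0).
Proof.
move=> r0 /contP cdf cf Hd; apply/isdP => e e0; have [r1 r10 Hr1] := cdf e e0.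
exists (Num.min r r1); first by rewrite lt_min r0.
move=> t; rewrite lt_min => /andP[tr tr1].
have wc a b : (forall x, a <= x <= b -> `|x - t0| < r) -> {within `[a, b], continuous f}.
  move=> H; apply: continuous_in_subspaceT => x; rewrite inE /= in_itv /= => xab.
  by apply: cf; apply: H.
have sub a b c w : `|b - a| < w -> a <= c <= b \/ b <= c <= a -> `|c - a| < w.
  by rewrite !ltr_norml => /andP[? ?] [] /andP[? ?]; apply/andP; split; lra.
have [c [c1 ->]] : exists c, `|c - t0| < r1 /\ f t - f t0 = df c * (t - t0).
  have [tt|tt] := leP t0 t.
    have [c cc E] : exists2 c, t0 <= c <= t & f t - f t0 = df c * (t - t0).
      apply: mvt_ex => // [x /andP[x1 x2]|].
        by apply: Hd; [apply: sub tr _; left; rewrite !ltW|rewrite gt_eqF].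
      by apply: wc => x xx; apply: sub tr _; left.
    by exists c; split=> //; apply: sub tr1 _; left.
  have [c cc E] : exists2 c, t <= c <= t0 & f t0 - f t = df c * (t0 - t).
    apply: mvt_ex => // [|x /andP[x1 x2]|]; first exact: ltW.
      by apply: Hd; [apply: sub tr _; right; rewrite !ltW|rewrite lt_eqF].
    by apply: wc => x xx; apply: sub tr _; right.
  exists c; split; first by apply: sub tr1 _; right.
  by rewrite -[LHS]opprB E -mulrN opprB.
by rewrite -mulrBl normrM ler_wpM2r // ltW // Hr1.
Qed.

(** The integral over [a, x] is differentiated only to the right of its lower end a, so that a has
    to move with x. By [Pa] increments do not depend on a, whence the pieces agree. *)
Lemma isd_primitive f : continuous f ->
  exists F : R -> R, (forall x, isd F x (f x)) /\ F 0 = 0.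
Proof.
move=> cf.
pose P a x : R := \int[lebesgue_measure]_(t in `[a, x]) f t.
have ci a b : lebesgue_measure.-integrable `[a, b] (EFin \o f).
  apply: continuous_compact_integrable; first exact: segment_compact.
  exact: continuous_subspaceT.
have dP a x : a < x -> isd (P a) x (f x).
  move=> ax; have x1 : x < x + 1 by rewrite ltrDl.
  have [dPx Px] := continuous_FTC1 x1 (ci a (x + 1)) ax (cf x).
  by apply: DeriveDef; [exact: dPx|rewrite -derive1E; exact: Px].
have Pa a b x y : a <= b -> b < x -> b < y -> P a x - P a y = P b x - P b y.
  move=> ab bx byy.
  have E z : b < z -> P a z - P b z = P a (b + 1) - P b (b + 1).
    have dd w : b < w -> isd (P a \- P b) w 0.
      move=> bw; apply: isd_eq (subrr (f w)).
      by apply: is_deriveB; apply: dP => //; apply: le_lt_trans bw.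
    move=> bz; have [z1|z1] := leP z (b + 1).
      have [c _] := @mvt_exc (P a \- P b) (fun=> 0) z (b + 1) z1
        (fun w (hw : z <= w <= b + 1) => dd w (lt_le_trans bz (andP hw).1)).
      by rewrite mul0r => /subr0_eq.
    have [|c _] := @mvt_exc (P a \- P b) (fun=> 0) (b + 1) z (ltW z1).
      by move=> w /andP[w1 _]; apply: dd; apply: lt_le_trans w1; rewrite ltrDl.
    by rewrite mul0r => /subr0_eq.
  have := E x bx; rewrite -(E y byy) => /eqP; rewrite -subr_eq0 => /eqP h.
  by apply/eqP; rewrite -subr_eq0 -[X in _ == X]h; apply/eqP; ring.
(* A lower end to the left of both x and 0. *)
pose m x := Num.min x 0 - 1.
have m1 x : m x < x by rewrite /m ltrBlDr (le_lt_trans (y := x)) ?ge_min ?lexx // ltrDl.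
have m2 x : m x < 0 by rewrite /m ltrBlDr (le_lt_trans (y := 0)) ?ge_min ?lexx ?orbT // add0r.
exists (fun x => P (m x) x - P (m x) 0); split; last by rewrite subrr.
move=> x.
suff : isd (fun y => P (m x - 1) y - P (m x - 1) 0) x (f x).
  have mx z : m x < z -> m x - 1 < z by move=> h; rewrite ltrBlDr (lt_trans h) // ltrDl ltr01.
  apply: (near_oo_isd (a := m x) (b := x + 1)) => [y /andP[y1 _]|]; last by rewrite m1 ltrDl ltr01.
  have [h|h] := leP (m x - 1) (m y); first exact: Pa.
  by rewrite -(Pa (m y) (m x - 1)) //; [exact: ltW|exact: mx|exact: mx].
apply: isd_eq (subr0 _); apply: is_deriveB.
  by apply: dP; rewrite ltrBlDr (lt_trans (m1 x)) // ltrDl.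
Qed.

Lemma second_derivative_test f df d2 x : (forall y, isd f y (df y)) ->
  isd df x d2 -> (forall y, f y <= f x) -> df x = 0 /\ d2 <= 0.
Proof.
move=> Hf Hd Hm; have df0 : df x = 0.
  apply/eqP; rewrite -normr_le0; apply/ler_addgt0Pr => e e0.
  rewrite add0r.
  have [r r0 Hr] := (isdP _ _ _).1 (Hf x) e e0.
  have p0 : 0 < r / 2 by rewrite divr_gt0.
  have pr : `|r / 2| < r by rewrite gtr0_norm //; lra.
  have := Hr (x + r / 2); have := Hr (x - r / 2).
  rewrite ![x + _ - x]addrC !addKr normrN => /(_ pr) h1 /(_ pr) h2.
  move: h1 h2; rewrite (gtr0_norm p0) !ler_norml => /andP[h1 _] /andP[h2 _].
  have := Hm (x + r / 2); have := Hm (x - r / 2) => h3 h4.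
  by apply/andP; split; rewrite -(ler_pM2r p0); nra.
split=> //; rewrite leNgt; apply/negP => d20.
have [|r r0 Hr] := (isdP _ _ _).1 Hd (d2 / 2); first by rewrite divr_gt0.
have p0 : 0 < r / 2 by rewrite divr_gt0.
have [c /andP[c1 c2] E] : exists2 c, x + r / 4 <= c <= x + r / 2 &
    f (x + r / 2) - f (x + r / 4) = df c * (x + r / 2 - (x + r / 4)).
  by apply: mvt_exc => //; lra.
have h1 : 0 < df c.
  have := Hr c; rewrite df0 subr0 gtr0_norm; last by lra.
  move=> /(_ ltac:(lra)); rewrite ler_norml => /andP[h _]; nra.
have [c' /andP[c1' c2'] E'] : exists2 c, x <= c <= x + r / 4 &
    f (x + r / 4) - f x = df c * (x + r / 4 - x).
  by apply: mvt_exc => //; lra.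
have h2 : 0 <= df c'.
  have := Hr c'; rewrite df0 subr0 ger0_norm; last by lra.
  move=> /(_ ltac:(lra)); rewrite ler_norml => /andP[h _]; nra.
have := Hm (x + r / 2); nra.
Qed.

End Calculus.

(** * Functions of time and space *)

Section TwoVariables.
Context {R : realType}.
Implicit Types (f g h : R -> R -> R) (t x : R).

Definition jcont f := continuous (fun p : R * R => f p.1 p.2).

Lemma jcP f t x : {for (t, x), continuous (fun p : R * R => f p.1 p.2)} <->
  forall e : R, 0 < e -> exists2 r : R, 0 < r & forall s y, `|s - t| < r ->
    `|y - x| < r -> `|f s y - f t x| < e.
Proof.
split=> [/contP H e e0|H].
  have [r r0 Hr] := H e e0; exists r => // s y sr yr; apply: (Hr (s, y)).
  by rewrite /Num.norm /= gt_max sr.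
apply/contP => e e0; have [r r0 Hr] := H e e0; exists r => // -[s y].
by rewrite /Num.norm /= gt_max => /andP[sr yr]; apply: Hr.
Qed.

Lemma jcontP f : jcont f <->
  forall t x (e : R), 0 < e -> exists2 r : R, 0 < r & forall s y, `|s - t| < r ->
    `|y - x| < r -> `|f s y - f t x| < e.
Proof. by split=> [H t x|H [t x]]; apply/(jcP f t x); [exact: (H (t, x))|exact: H]. Qed.

Lemma jc_x f t : jcont f -> continuous (f t).
Proof.
move=> cf x; apply/contP => e e0; have [r r0 Hr] := (jcP f t x).1 (cf (t, x)) e e0.
by exists r => // y yr; apply: Hr => //; rewrite subrr normr0.
Qed.

Lemma jc_t f x : jcont f -> continuous (f ^~ x).
Proof.
move=> cf t; apply/contP => e e0; have [r r0 Hr] := (jcP f t x).1 (cf (t, x)) e e0.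
by exists r => // y yr; apply: Hr => //; rewrite subrr normr0.
Qed.

Lemma jc_comp f g h : jcont f -> jcont g -> jcont h -> jcont (fun t x => f (g t x) (h t x)).
Proof.
move=> cf cg ch; apply/jcontP => t x e e0.
have [r r0 Hr] := (jcP f (g t x) (h t x)).1 (cf (_, _)) e e0.
have [r1 r10 Hr1] := (jcP g t x).1 (cg (_, _)) r r0.
have [r2 r20 Hr2] := (jcP h t x).1 (ch (_, _)) r r0.
exists (Num.min r1 r2); first by rewrite lt_min r10.
move=> s y; rewrite !lt_min => /andP[s1 s2] /andP[y1 y2].
by apply: Hr; [apply: Hr1|apply: Hr2].
Qed.

Lemma jc_fst (k : R -> R) : continuous k -> jcont (fun t _ : R => k t).
Proof.
move=> ck; apply/jcontP => t x e e0; have [r r0 Hr] := (contP _ _).1 (ck t) e e0.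
by exists r => // s y /Hr.
Qed.

Lemma jc_snd (k : R -> R) : continuous k -> jcont (fun _ x : R => k x).
Proof.
move=> ck; apply/jcontP => t x e e0; have [r r0 Hr] := (contP _ _).1 (ck x) e e0.
by exists r => // s y _ /Hr.
Qed.

(** Compactness of [a, b] makes the modulus of continuity in x uniform in t; this is what allows
    differentiation under a time integral. *)
Lemma jc_tube f x a b (e : R) : jcont f -> 0 < e ->
  exists2 r : R, 0 < r & forall t y, a <= t <= b -> `|y - x| < r ->
    `|f t y - f t x| < e.
Proof.
move=> cf e0.
have /compact_near_coveringP/near_covering_withinP := @segment_compact R a b.
move=> /(_ _ (nbhs x) (fun y t => `|f t y - f t x| < e) _) [].
  move=> t _; have [|r r0 Hr] := (jcP f t x).1 (cf (t, x)) (e / 2); first by rewrite divr_gt0.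
  exists (ball t r, ball x r); first by split; exact: nbhsx_ballx.
  move=> [s y] /= [sr yr]; move: sr yr; rewrite -!ball_normE /= => sr yr _.
  have h1 : `|f s y - f t x| < e / 2 by apply: Hr; rewrite distrC.
  have h2 : `|f s x - f t x| < e / 2 by apply: Hr; rewrite ?subrr ?normr0 // distrC.
  move: h1 h2; rewrite !ltr_norml => /andP[? ?] /andP[? ?]; apply/andP; split; lra.
move=> r /= r0 Hr; exists r => // t y tab yx.
by apply: (Hr y); rewrite /= ?in_itv /= ?tab // distrC.
Qed.

(** Integrals are values of this normalized primitive, so that measure theory enters through
    [isd_primitive] only. For a discontinuous f the value is arbitrary. *)
Definition prim (f : R -> R) : R -> R :=
  get [set F | (forall x, isd F x (f x)) /\ F 0 = 0].

Lemma primP (f : R -> R) : continuous f -> (forall x, isd (prim f) x (f x)) /\ prim f 0 = 0.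
Proof.
by move=> /isd_primitive [F HF]; apply: (@getPex _ [set F | (forall x, isd F x (f x)) /\ F 0 = 0]); exists F.
Qed.

Definition tint f t x := prim (f ^~ x) t.

Lemma isd_tint f t x : jcont f -> isd (tint f ^~ x) t (f t x).
Proof. by move=> cf; have [] := primP (@jc_t f x cf). Qed.

Lemma tint0 f x : jcont f -> tint f 0 x = 0.
Proof. by move=> cf; have [] := primP (@jc_t f x cf). Qed.

Lemma prim_le (f g : R -> R) (T C : R) : (forall t, isd f t (g t)) -> f 0 = 0 ->
  (forall t, `|t| <= T -> `|g t| <= C) -> forall t, `|t| <= T -> `|f t| <= C * `|t|.
Proof.
move=> df f0 H t tT; have [c ct] := mvt 0 t df; rewrite f0 !subr0 => ->.
by rewrite normrM ler_wpM2r // H // (le_trans _ tT) // -[c]subr0 -[t]subr0.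
Qed.

Lemma tint_tube f x T (e : R) : jcont f -> 0 <= T -> 0 < e ->
  exists2 r : R, 0 < r & forall t y, `|t| <= T -> `|y - x| < r ->
    `|tint f t y - tint f t x| <= e * `|t|.
Proof.
move=> cf T0 e0; have [r r0 Hr] := jc_tube x (- T) T cf e0.
exists r => // t y tT yr.
apply: (@prim_le (fun t => tint f t y - tint f t x) (fun t => f t y - f t x) T) => //.
- by move=> s; apply: is_deriveB; apply: isd_tint.
- by rewrite !tint0 // subrr.
- by move=> s sT; apply/ltW/Hr => //; rewrite -ler_norml.
Qed.

Lemma jc_tint f : jcont f -> jcont (tint f).
Proof.
move=> cf; apply/jcontP => t x e e0.
have T0 : 0 <= `|t| + 1 by rewrite addr_ge0.
have T1 : 0 < `|t| + 1 by rewrite ltr_pwDr.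
have [|r r0 Hr] := @tint_tube f x (`|t| + 1) (e / 2 / (`|t| + 1)) cf T0.
  by rewrite !divr_gt0.
have [|r1 r10 Hr1] := (contP _ _).1 (isd_cont (isd_tint t x cf)) (e / 2).
  by rewrite divr_gt0.
exists (Num.min r (Num.min r1 1)); first by rewrite !lt_min r0 r10 ltr01.
move=> s y; rewrite !lt_min => /and3P[s1 s2 s3] /and3P[y1 y2 y3].
have sT : `|s| <= `|t| + 1.
  rewrite -(subrK t s) (le_trans (ler_normD _ _)) // addrC lerD2l ltW //.
have := Hr1 s s2; have := Hr s y sT y1 => h1 h2.
have h3 : `|tint f s y - tint f s x| <= e / 2.
  apply: le_trans h1 _; rewrite -mulrA ler_piMr ?divr_ge0 ?(ltW e0) //.
  by rewrite ler_pdivrMl // mulr1.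
move: h2 h3; rewrite ltr_norml ler_norml ltr_norml => /andP[? ?] /andP[? ?].
apply/andP; split; lra.
Qed.

(** The mean value theorem in x turns the error of the integrand into a variation of g, which
    [jc_tube] makes small uniformly over the time interval; [prim_le] integrates it. *)
Lemma isd_tint_x f g : jcont f -> jcont g -> (forall t x, isd (f t) x (g t x)) ->
  forall t x, isd (tint f t) x (tint g t x).
Proof.
move=> cf cg Hd t x; apply/isdP => e e0.
have T1 : 0 < `|t| + 1 by rewrite ltr_pwDr.
have [|r r0 Hr] := @jc_tube g x (- `|t|) `|t| (e / (`|t| + 1)) cg.
  by rewrite !divr_gt0.
exists r => // y yr.
have dE (s : R) : isd (fun s : R => tint f s y - tint f s x - tint g s x * (y - x)) s
   (f s y - f s x - g s x * (y - x)).
  apply: is_deriveB; first by apply: is_deriveB; apply: isd_tint.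
  have h := isd_tint s x cg.
  apply: isd_eq (is_deriveM h (is_derive_cst (y - x) s 1)) _.
  by rewrite scaler0 add0r [_ *: _]mulrC.
apply: le_trans (@prim_le _ _ `|t| (e / (`|t| + 1) * `|y - x|) dE _ _ t (lexx _)) _.
- by rewrite !tint0 // mul0r !subrr.
- move=> s sT; have [c cx ->] := mvt x y (Hd s).
  rewrite -mulrBl normrM ler_wpM2r // ltW // Hr //; first by rewrite -ler_norml.
  exact: le_lt_trans yr.
rewrite mulrAC ler_wpM2r // -mulrA ler_piMr ?(ltW e0) //.
by rewrite ler_pdivrMl // mulr1 lerDl.
Qed.

End TwoVariables.

(** * Joint continuity of spatial derivatives *)

Section SpatialSmoothness.
Context {R : realType}.
Implicit Types (f g h : R -> R -> R) (t x : R).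

(** Only spatial derivatives are counted; in time mere continuity is asked. The class thus survives
    the clamping of time and the concatenation of flows, both of which destroy time derivatives. *)
Fixpoint csm N f : Prop := jcont f /\
  if N is N'.+1 then exists2 g, (forall t x, isd (f t) x (g t x)) & csm N' g else True.

Definition xsmooth f := forall N, csm N f.

Lemma csmS N f : csm N.+1 f -> csm N f.
Proof. by elim: N f => [|N IH] f; [case|move=> [c [g Hg /IH h]]; split=> //; exists g]. Qed.

Lemma csm_jc N f : csm N f -> jcont f.
Proof. by case: N => [|N] []. Qed.

Lemma csm_cst N (c : R) : csm N (fun _ _ => c).
Proof.
elim: N c => [|N IH] c /=; first by split=> // p; apply: cst_continuous.
split; first by move=> p; apply: cst_continuous.
by exists (fun _ _ => 0); [move=> t x; exact: is_derive_cst|exact: IH].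
Qed.

Lemma csmD N f g : csm N f -> csm N g -> csm N (fun t x => f t x + g t x).
Proof.
elim: N f g => [|N IH] f g /= [cf Hf] [cg Hg]; (split; first by move=> p; apply: cvgD; [apply: cf|apply: cg]) => //.
move: Hf Hg => [f1 df Hf] [g1 dg Hg]; exists (fun t x => f1 t x + g1 t x); last exact: IH.
by move=> t x; apply: is_deriveD.
Qed.

Lemma csmM N f g : csm N f -> csm N g -> csm N (fun t x => f t x * g t x).
Proof.
elim: N f g => [|N IH] f g Hf0 Hg0; have [cf Hf] := Hf0; have [cg Hg] := Hg0;
   (split; first by move=> p; apply: cvgM; [apply: cf|apply: cg]) => //.
move: Hf Hg => [f1 df Hf] [g1 dg Hg].
exists (fun t x => f t x * g1 t x + f1 t x * g t x).
  move=> t x; apply: isd_eq (is_deriveM (df t x) (dg t x)) _.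
  by rewrite /GRing.scale /= [g t x * _]mulrC.
by apply: csmD; apply: IH => //; apply: csmS.
Qed.

Lemma csm_ext N f g : (forall t x, f t x = g t x) -> csm N f -> csm N g.
Proof. by move=> H; suff -> : f = g by []; apply/funext => t; apply/funext => x. Qed.

Lemma csmN N f : csm N f -> csm N (fun t x => - f t x).
Proof.
move=> Hf; apply: (csm_ext (f := fun t x => -1 * f t x)) => [t x|]; first by rewrite mulN1r.
by apply: csmM => //; apply: csm_cst.
Qed.

Lemma csmV N f : (forall t x, f t x != 0) -> csm N f -> csm N (fun t x => (f t x)^-1).
Proof.
move=> f0; elim: N => [|N IH] Hf0; have [cf Hf] := Hf0;
   (split; first by move=> p; apply: cvgV => //; apply: cf) => //.
move: Hf => [f1 df Hf]; exists (fun t x => - (f1 t x * ((f t x)^-1 * (f t x)^-1))).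
  move=> t x; apply: isd_eq (is_deriveV (f0 t x) (df t x)) _.
  by rewrite /GRing.scale /= expr2 invfM mulNr mulrC.
by apply: csmN; apply: csmM => //; apply: csmM; apply: IH; apply: csmS.
Qed.

Lemma csm_exp N f : csm N f -> csm N (fun t x => expR (f t x)).
Proof.
elim: N => [|N IH] Hf0; have [cf Hf] := Hf0;
   (split; first by move=> p; apply: (@continuous_comp _ _ _ (fun p => f p.1 p.2) expR); [exact: cf|exact: continuous_expR]) => //.
move: Hf => [f1 df Hf]; exists (fun t x => expR (f t x) * f1 t x).
  by move=> t x; apply: isd_chain (df t x); apply: is_derive_expR.
by apply: csmM => //; apply: IH; apply: csmS.
Qed.

Lemma csm_comp N f h : csm N f -> csm N h -> csm N (fun t x => f t (h t x)).
Proof.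
elim: N f h => [|N IH] f h Hf0 Hh0; have [cf Hf] := Hf0; have [ch Hh] := Hh0;
  (split; first by apply: (jc_comp cf (g := fun t _ => t)) => //; apply: (jc_fst (k := id)) => ?; exact: cvg_id) => //.
move: Hf Hh => [f1 df Hf] [h1 dh Hh].
exists (fun t x => f1 t (h t x) * h1 t x).
  by move=> t x; apply: isd_chain (df t (h t x)) (dh t x).
by apply: csmM => //; apply: IH => //; apply: csmS.
Qed.

(** Here k need not be differentiable: it will be a clamp. *)
Lemma csm_time N f (k : R -> R) : continuous k -> csm N f -> csm N (fun t x => f (k t) x).
Proof.
move=> ck; elim: N f => [|N IH] f [cf Hf]; (split; first by
  apply: (jc_comp cf (g := fun t _ => k t) (h := fun _ x => x)); [exact: jc_fst|apply: (jc_snd (k := id)) => ?; exact: cvg_id]) => //.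
by move: Hf => [f1 df Hf]; exists (fun t x => f1 (k t) x); [move=> t x; apply: df|apply: IH].
Qed.

Lemma csm_tint N f : csm N f -> csm N (tint f).
Proof.
elim: N f => [|N IH] f [cf Hf]; split=> //; try exact: jc_tint.
move: Hf => [f1 df Hf]; exists (tint f1); last exact: IH.
by apply: isd_tint_x => //; apply: csm_jc Hf.
Qed.

Definition dx f t x := (f t)^`()%classic x.

Lemma isd_dx f t x d : isd (f t) x d -> dx f t x = d.
Proof. by move=> [_ <-]; rewrite /dx derive1E. Qed.

Lemma dx_isd f t x d : isd (f t) x d -> isd (f t) x (dx f t x).
Proof. by move=> H; rewrite (isd_dx H). Qed.

Lemma xsmooth_dx f : xsmooth f -> (forall t x, isd (f t) x (dx f t x)) /\ xsmooth (dx f).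
Proof.
move=> H; split=> [t x|N]; first by have [_ [g dg _]] := H 1; apply: dx_isd (dg t x).
have [_ [g dg Hg]] := H N.+1.
by apply: (csm_ext (f := g)) => // t x; rewrite (isd_dx (dg t x)).
Qed.

Lemma xsmooth_csm f g N : (forall t x, isd (f t) x (g t x)) -> jcont f -> csm N g -> csm N.+1 f.
Proof. by move=> H1 H2 H3; split=> //; exists g. Qed.

End SpatialSmoothness.

(** * Maximum principle *)

Section MaximumPrinciple.
Context {R : realType}.
Implicit Types (f g h Q : R -> R -> R) (t x : R).

Lemma periodic_int (T : Type) (f : R -> T) (L : R) (k : int) x :
  (forall x, f (x + L) = f x) -> f (x + k%:~R * L) = f x.
Proof.
move=> H; have Hn (n : nat) y : f (y + n%:R * L) = f y.
  by elim: n => [|n IH]; rewrite ?mul0r ?addr0 // -addn1 natrD mulrDl mul1r addrA H.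
case: (intP k) => [|n|n]; first by rewrite mul0r addr0.
  exact: Hn.
by rewrite -[in RHS](subrK (n.+1%:R * L) x) Hn mulrNz mulNr.
Qed.

Lemma periodic_reduce (L x : R) : 0 < L -> exists k : int, 0 <= x + k%:~R * L <= L.
Proof.
move=> L0; exists (- Num.floor (x / L)).
have E : x + (- Num.floor (x / L))%:~R * L = (x / L - (Num.floor (x / L))%:~R) * L.
  by rewrite mulrBl divfK ?gt_eqF // mulrNz mulNr.
have h1 : (Num.floor (x / L))%:~R <= x / L by exact: floor_le.
have h2 : x / L < (Num.floor (x / L) + 1)%:~R by exact: floorD1_gt.
rewrite E mulr_ge0 ?(ltW L0) ?subr_ge0 //= -[leRHS]mul1r ler_wpM2r ?(ltW L0) //.
by rewrite lerBlDl ltW // (lt_le_trans h2) // intrD.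
Qed.

(** First touching time: the compact set where Q >= 0 over one period has a point of least time (t0,
    x0). There Q = 0 is a spatial maximum, and a negative time derivative would make Q positive
    slightly earlier. *)
Lemma parabolic_barrier (T L : R) Q : 0 < L ->
  (forall t x, 0 <= t < T -> {for (t, x), continuous (fun p : R * R => Q p.1 p.2)}) ->
  (forall t x, 0 <= t < T -> Q t (x + L) = Q t x) ->
  (forall x, Q 0 x < 0) ->
  (forall t x, 0 < t < T -> Q t x = 0 -> (forall y, Q t y <= 0) ->
     exists2 d : R, d < 0 & isd (Q ^~ x) t d) ->
  forall t x, 0 <= t < T -> Q t x < 0.
Proof.
move=> L0 cQ pQ Q0 touch t1 x1 /andP[t10 t1T]; rewrite ltNge; apply/negP => Q1.
(* Q is known on [0, T) only; clamping time to [0, t1] yields a function continuous on the whole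
   plane. *)
pose k (t : R) := Num.max 0 (Num.min t t1).
have kb t : 0 <= k t < T.
  rewrite /k le_max lexx /= gt_max gt_min t1T orbT andbT.
  exact: le_lt_trans t1T.
have kid t : 0 <= t <= t1 -> k t = t.
  by move=> /andP[h1 h2]; rewrite /k min_l // max_r.
have ck : continuous k.
  move=> t; apply: (@continuous_max _ _ (fun=> 0) (fun t => Num.min t t1)); first exact: cvg_cst.
  by apply: (@continuous_min _ _ id (fun=> t1)); [exact: cvg_id|exact: cvg_cst].
pose P p := Q (k p.1) p.2 : R.
have cP : continuous P.
  move=> [t x]; apply/(jcP (fun t x => Q (k t) x)) => e e0.
  have [r r0 Hr] := (jcP _ _ _).1 (cQ (k t) x (kb t)) e e0.
  have [r1 r10 Hr1] := (contP _ _).1 (ck t) r r0.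
  exists (Num.min r r1); first by rewrite lt_min r0.
  move=> s y; rewrite !lt_min => /andP[s1 s2] /andP[y1 y2].
  by apply: Hr => //; apply: Hr1.
pose A : set (R * R) := (`[0, t1] `*` `[0, L]) `&` P @^-1` [set y | 0 <= y].
have cA : compact A.
  apply: compact_closedI; first by apply: compact_setX; exact: segment_compact.
  apply: closed_comp; last exact: closed_ge.
  by move=> p _; apply: cP.
have A0 : A !=set0.
  have [m /andP[m1 m2]] := periodic_reduce x1 L0.
  exists (t1, x1 + m%:~R * L); split; first by split; rewrite /= in_itv /= ?lexx ?t10 ?m1.
  rewrite /= /P /= kid ?lexx ?t10 //.
  by rewrite (@periodic_int _ (Q t1)) // => x; apply: pQ; rewrite t10.
have [[t0 x0] t0A tmin] : exists2 c, c \in A & forall p, p \in A -> c.1 <= p.1.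
  apply: compact_EVT_min => //; apply: continuous_subspaceT => p; exact: cvg_fst.
have t0A' := set_mem t0A; case: t0A' => -[/=].
rewrite !in_itv /= => /andP[t00 t01] /andP[x00 x0L] Q00.
move: Q00; rewrite /P /= kid ?t00 // => Q00.
have t0T : 0 <= t0 < T by rewrite t00 (le_lt_trans t01).
have t0_gt0 : 0 < t0.
  by rewrite lt_neqAle t00 andbT; apply: contraTneq Q00 => <-; rewrite -ltNge.
have before t y : 0 <= t < t0 -> Q t y < 0.
  move=> /andP[tt0 tt1]; rewrite ltNge; apply/negP => Qt.
  have tT : 0 <= t < T by rewrite tt0 (lt_trans tt1) //; case/andP: t0T.
  have [m ym] := periodic_reduce y L0.
  have := tmin (t, y + m%:~R * L); rewrite leNgt /= tt1 => H.
  suff : false by []. apply: H; apply/mem_set; split.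
    by split; rewrite /= in_itv //= tt0 (le_trans (ltW tt1)).
  rewrite /= /P /= kid; last by rewrite tt0 (le_trans (ltW tt1)).
  by rewrite (@periodic_int _ (Q t)) // => x; apply: pQ.
(* A positive value at time t0 would, by continuity, persist at slightly earlier times, against
   [before]. *)
have at0 y : Q t0 y <= 0.
  rewrite leNgt; apply/negP => Qy.
  have [r r0 Hr] := (jcP _ _ _).1 (cQ t0 y t0T) _ Qy.
  pose s := Num.max 0 (t0 - r / 2).
  have s1 : 0 <= s < t0 by rewrite /s le_max lexx gt_max t0_gt0 ltrBlDr ltrDl divr_gt0.
  have s2 : `|s - t0| < r.
    rewrite ltr0_norm ?subr_lt0; last by case/andP: s1.
    rewrite opprB ltrBlDr -ltrBlDl (lt_le_trans (y := t0 - r / 2)) //; last by rewrite le_max lexx orbT.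
    by lra.
  have := Hr s y s2; rewrite subrr normr0 => /(_ r0).
  have := before s y s1; rewrite ltr_norml => h1 /andP[h2 _]; lra.
have Qx0 : Q t0 x0 = 0 by apply/eqP; rewrite eq_le at0.
have [|d d0 dQ] := touch t0 x0 _ Qx0 at0; first by rewrite t0_gt0; case/andP: t0T.
have [|r r0 Hr] := (isdP _ _ _).1 dQ (- d / 2); first by rewrite divr_gt0 ?oppr_gt0.
pose s := Num.max (t0 / 2) (t0 - r / 2).
have s0 : 0 <= s < t0 by rewrite /s le_max divr_ge0 //= gt_max; apply/andP; split; lra.
have s1 : s < t0 by case/andP: s0.
have s2 : t0 - r / 2 <= s by rewrite /s le_max lexx orbT.
have := Hr s; rewrite ltr0_norm ?subr_lt0 // => /(_ ltac:(lra)).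
rewrite Qx0 ler_norml => /andP[h _].
have := before s x0 s0; nra.
Qed.

End MaximumPrinciple.

(** * Smooth functions on open sets *)

Section SmoothOpen.
Context {R : realType}.

Lemma continuous_near (V W : normedModType R) (f g : V -> W) a :
  (\near a, f a = g a) -> {for a, continuous f} -> {for a, continuous g}.
Proof.
move=> fg cf A nA.
have nA' : nbhs (f a) A by rewrite (nbhs_singleton fg).
have := cf A nA'; rewrite /nbhs /= => cfA.
by apply: filterS2 fg cfA => x E; rewrite /preimage /= -E.
Qed.

(** Every iterated derivative of a member agrees on U with a member, hence is continuous and
    differentiable there. Agreement on U is enough because U is open and derivatives are local; the
    direction 0 is treated apart. *)
Lemma smooth_open_class (V W : normedModType R) (U : set V) (E : set (V -> W)) :
  open U -> (forall f, E f -> forall a, U a -> {for a, continuous f}) ->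
  (forall f v, E f -> exists2 g, E g & forall a, U a -> is_derive a v f (g a)) ->
  forall f, E f -> smooth_open U f.
Proof.
move=> oU cE dE f Ef.
have loc (g h : V -> W) : (forall a, U a -> g a = h a) ->
    forall a, U a -> \near a, g a = h a.
  by move=> gh a Ua; have := open_nbhs_nbhs (conj oU Ua); apply: filterS.
have key s : exists2 g, E g & forall a, U a -> iter_derive f s a = g a.
  elim: s => [|v s [g Eg IH]] /=; first by exists f.
  have [g' Eg' Hg'] := dE g v Eg; exists g' => // a Ua.
  have [_ <-] := Hg' a Ua.
  have [->|v0] := eqVneq v 0; first by rewrite !derive0.
  by apply: near_eq_derive => //; apply: loc.
move=> s a Ua; have [g Eg Hg] := key s; split.
  apply: continuous_near (cE g Eg a Ua).
  by apply: loc => // b Ub; rewrite Hg.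
move=> v; have [->|v0] := eqVneq v 0; first exact: derivable0.
have [g' _ Hg'] := dE g v Eg; have [dg _] := Hg' a Ua.
by apply: near_eq_derivable dg => //; apply: loc => // b Ub; rewrite Hg.
Qed.

Lemma smooth_derive (V W : normedModType R) (U : set V) (f : V -> W) v :
  smooth_open U f -> smooth_open U ('D_v f).
Proof.
move=> H s a Ua; have := H (rcons s v) a Ua.
by rewrite /iter_derive foldr_rcons.
Qed.

Lemma smooth_cont (V W : normedModType R) (U : set V) (f : V -> W) a :
  smooth_open U f -> U a -> {for a, continuous f}.
Proof. by move=> H /(H [::])[]. Qed.

Lemma smooth_isd (V W : normedModType R) (U : set V) (f : V -> W) a v :
  smooth_open U f -> U a -> is_derive a v f ('D_v f a).
Proof. by move=> H /(H [::])[_ /(_ v)]; apply: derivableP. Qed.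

Lemma smooth_eq (V W : normedModType R) (U : set V) (f g : V -> W) : open U ->
  (forall a, U a -> f a = g a) -> smooth_open U f -> smooth_open U g.
Proof.
move=> oU fg sf.
pose E : set (V -> W) := [set h | exists2 f, smooth_open U f & forall a, U a -> f a = h a].
have loc (k h : V -> W) : (forall a, U a -> k a = h a) ->
    forall a, U a -> \near a, k a = h a.
  by move=> gh a Ua; have := open_nbhs_nbhs (conj oU Ua); apply: filterS.
apply: (@smooth_open_class _ _ U E) => //; last by exists f.
- move=> h [k sk kh] a Ua; by apply: continuous_near (smooth_cont sk Ua); apply: loc.
- move=> h v [k sk kh]; exists ('D_v k).
    by exists ('D_v k) => //; apply: smooth_derive.
  move=> a Ua; have D := smooth_isd v sk Ua.
  have [v0|v0] := eqVneq v 0; last by apply: near_eq_is_derive D => //; apply: loc.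
  by rewrite v0 derive0; apply: is_derive0.
Qed.

Lemma smooth_sub (V W : normedModType R) (U U' : set V) (f : V -> W) :
  U' `<=` U -> smooth_open U f -> smooth_open U' f.
Proof. by move=> UU sf s a /UU; apply: sf. Qed.

Lemma is_derive_line (V W : normedModType R) (f : V -> W) a v (d : W) :
  isd (fun h : R => f (h *: v + a)) (0 : R) d <-> is_derive a v f d.
Proof.
have E : 'D_1 (fun h : R => f (h *: v + a)) 0 = 'D_v f a.
  rewrite /derive; suff -> : (fun h : R => h^-1 *:
      (((fun h : R => f (h *: v + a)) \o shift 0) (h *: 1) - f (0 *: v + a)))
    = (fun h : R => h^-1 *: ((f \o shift a) (h *: v) - f a)) by [].
  by apply/funext => h /=; rewrite addr0 scale0r add0r [h *: 1]mulr1.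
split=> -[h1 h2]; split.
- exact: (derivable1P f a v).2.
- by rewrite -E.
- exact: (derivable1P f a v).1.
- by rewrite E.
Qed.

Lemma is_derive_outer (V : normedModType R) (F : R -> R) (f : V -> R) a v (c d : R) :
  isd F (f a) c -> is_derive a v f d -> is_derive a v (F \o f) (c * d).
Proof.
move=> HF /is_derive_line Hf; apply/is_derive_line.
by apply: (@isd_chain _ F _ 0 c d) => //; rewrite scale0r add0r.
Qed.

Lemma isd_shift (f : R -> R) (x d : R) : isd (fun h : R => f (h + x)) (0 : R) d <-> isd f x d.
Proof.
split=> /isdP H; apply/isdP => e e0; have [r r0 Hr] := H e e0; exists r => // y yr.
  by have := Hr (y - x); rewrite add0r subr0 subrK; apply.
by have := Hr (y + x); rewrite addrK !subr0 add0r in yr *; apply.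
Qed.

Lemma is_derive_fst (f : R * R -> R) t x (d : R) :
  is_derive (t, x) ((1, 0) : R * R) f d <-> isd (fun s : R => f (s, x)) t d.
Proof.
rewrite -is_derive_line -(isd_shift (fun s => f (s, x))).
suff -> : (fun h : R => f (h *: ((1, 0) : R * R) + (t, x))) = (fun h => f (h + t, x)) by [].
by apply/funext => h; congr f; congr pair; rewrite /= ?[h *: 1]mulr1 // [h *: 0]mulr0 add0r.
Qed.

Lemma is_derive_snd (f : R * R -> R) t x (d : R) :
  is_derive (t, x) ((0, 1) : R * R) f d <-> isd (fun y : R => f (t, y)) x d.
Proof.
rewrite -is_derive_line -(isd_shift (fun s => f (t, s))).
suff -> : (fun h : R => f (h *: ((0, 1) : R * R) + (t, x))) = (fun h => f (t, h + x)) by [].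
by apply/funext => h; congr f; congr pair; rewrite /= ?[h *: 1]mulr1 // [h *: 0]mulr0 add0r.
Qed.

Lemma is_derive_total (F Ft Fx : R -> R -> R) (t x r : R) : 0 < r ->
  (forall s y : R, `|s - t| < r -> `|y - x| < r -> isd (F ^~ y) s (Ft s y)) ->
  (forall s y : R, `|s - t| < r -> `|y - x| < r -> isd (F s) y (Fx s y)) ->
  {for (t, x), continuous (fun p : R * R => Ft p.1 p.2)} ->
  {for (t, x), continuous (fun p : R * R => Fx p.1 p.2)} ->
  forall v : R * R, is_derive (t, x) v (fun p => F p.1 p.2) (v.1 * Ft t x + v.2 * Fx t x).
Proof.
move=> r0 HFt HFx /jcP cFt /jcP cFx v; apply/is_derive_line.
suff : isd (fun h : R => F (h * v.1 + t) (h * v.2 + x)) (0 : R) (v.1 * Ft t x + v.2 * Fx t x) by [].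
apply/isdP => e e0.
pose N := `|v.1| + `|v.2| + 1.
have N0 : 0 < N by rewrite /N; have := normr_ge0 v.1; have := normr_ge0 v.2; lra.
have [|r1 r10 Hr1] := cFt (e / N); first exact: divr_gt0.
have [|r2 r20 Hr2] := cFx (e / N); first exact: divr_gt0.
pose rm := Num.min r (Num.min r1 r2).
have rm0 : 0 < rm by rewrite !lt_min r0 r10.
exists (rm / N); first exact: divr_gt0.
move=> h; rewrite !subr0 !mul0r !add0r => hr.
have h1 : `|h * v.1| < rm.
  rewrite normrM; move: hr; rewrite ltr_pdivlMr // => hr; apply: le_lt_trans hr.
  by rewrite ler_wpM2l // /N; have := normr_ge0 v.2; lra.
have h2 : `|h * v.2| < rm.
  rewrite normrM; move: hr; rewrite ltr_pdivlMr // => hr; apply: le_lt_trans hr.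
  by rewrite ler_wpM2l // /N; have := normr_ge0 v.1; lra.
have mid (u z w : R) : `|z - u| < w -> forall c, u <= c <= z \/ z <= c <= u -> `|c - u| < w.
  move=> zw c; move: zw; rewrite !ltr_norml => /andP[? ?] [] /andP[? ?]; apply/andP; split; lra.
have mv (f df : R -> R) (u z w : R) : `|z - u| < w -> (forall c, `|c - u| < w -> isd f c (df c)) ->
   exists2 c, `|c - u| < w & f z - f u = df c * (z - u).
  move=> zw Hd; have [uz|zu] := leP u z.
    have [c cc E] := mvt_exc uz (fun c hc => Hd c (mid _ _ _ zw c (or_introl hc))).
    by exists c => //; apply: mid zw _ (or_introl cc).
  have [c cc E] := mvt_exc (ltW zu) (fun c hc => Hd c (mid _ _ _ zw c (or_intror hc))).
  exists c; first by apply: mid zw _ (or_intror cc).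
  by rewrite -[LHS]opprB E -mulrN opprB.
have rr (w : R) : `|w| < rm -> [/\ `|w| < r, `|w| < r1 & `|w| < r2].
  by rewrite /rm !lt_min => /and3P[].
have H1 : `|h * v.1 + t - t| < rm by rewrite addrK.
have H2 : `|h * v.2 + x - x| < rm by rewrite addrK.
have [c c1 E1] := mv (F ^~ (h * v.2 + x)) (Ft ^~ (h * v.2 + x)) _ _ _ H1
  (fun c hc => HFt c _ (let: And3 a _ _ := rr _ hc in a) (let: And3 a _ _ := rr _ H2 in a)).
have t0 : `|t - t| < r by rewrite subrr normr0.
have [c' c2 E2] := mv (F t) (Fx t) _ _ _ H2
  (fun c hc => HFx t c t0 (let: And3 a _ _ := rr _ hc in a)).
have [_ a1 _] := rr _ c1; have [_ a2 _] := rr _ H2; have [_ _ a3] := rr _ c2.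
have b1 := Hr1 c (h * v.2 + x) a1 a2.
have b2 := Hr2 t c' _ a3; rewrite subrr normr0 in b2; have {}b2 := b2 r20.
have -> : F (h * v.1 + t) (h * v.2 + x) - F t x - (v.1 * Ft t x + v.2 * Fx t x) * h =
  (F (h * v.1 + t) (h * v.2 + x) - F t (h * v.2 + x)) + (F t (h * v.2 + x) - F t x)
   - (v.1 * Ft t x + v.2 * Fx t x) * h by ring.
rewrite E1 E2 !addrK.
have -> : Ft c (h * v.2 + x) * (h * v.1) + Fx t c' * (h * v.2) - (v.1 * Ft t x + v.2 * Fx t x) * h
 = ((Ft c (h * v.2 + x) - Ft t x) * v.1 + (Fx t c' - Fx t x) * v.2) * h by ring.
rewrite normrM ler_wpM2r // (le_trans (ler_normD _ _)) // !normrM.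
apply: (@le_trans _ _ (e / N * `|v.1| + e / N * `|v.2|)).
  by apply: lerD; rewrite ler_wpM2r // ltW.
by rewrite -mulrDr -mulrA ler_piMr ?(ltW e0) // ler_pdivrMl // mulr1 /N lerDl.
Qed.

(* This class is closed under differentiation, so that [smooth_open_class] applies to it. *)
Inductive smooth_gen (U : set (R * R)) : (R * R -> R) -> Prop :=
| sg_base f : smooth_open U f -> smooth_gen U f
| sg_cst c : smooth_gen U (fun=> c)
| sg_add f g : smooth_gen U f -> smooth_gen U g -> smooth_gen U (fun p => f p + g p)
| sg_mul f g : smooth_gen U f -> smooth_gen U g -> smooth_gen U (fun p => f p * g p)
| sg_inv f : (forall p, U p -> f p != 0) -> smooth_gen U f -> smooth_gen U (fun p => (f p)^-1)
| sg_sqrt f : (forall p, U p -> 0 < f p) -> smooth_gen U f ->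
    smooth_gen U (fun p => Num.sqrt (f p)).

Lemma smooth_gen_smooth U f : open U -> smooth_gen U f -> smooth_open U f.
Proof.
move=> oU; apply: (smooth_open_class (E := smooth_gen U)) => // {}f.
  move=> Hf a Ua; elim: Hf => {f}.
  - by move=> f /smooth_cont; apply.
  - by move=> c; apply: cst_continuous.
  - by move=> f g _ cf _ cg; apply: cvgD.
  - by move=> f g _ cf _ cg; apply: cvgM.
  - by move=> f f0 _ cf; apply: cvgV; [exact: f0|].
  - by move=> f f0 _ cf; apply: (continuous_comp cf); apply: sqrt_continuous.
move=> v; elim => {f}.
- move=> f sf; exists ('D_v f); first by constructor; apply: smooth_derive.
  by move=> a; apply: smooth_isd.
- by move=> c; exists (fun=> 0); [exact: sg_cst|move=> a _; exact: is_derive_cst].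
- move=> f g _ [f' Ef' Hf'] _ [g' Eg' Hg']; exists (fun p => f' p + g' p); first exact: sg_add.
  by move=> a Ua; apply: is_deriveD; [apply: Hf'|apply: Hg'].
- move=> f g Ef [f' Ef' Hf'] Eg [g' Eg' Hg']; exists (fun p => f p * g' p + f' p * g p).
    by apply: sg_add; apply: sg_mul.
  move=> a Ua; apply: is_derive_eq (is_deriveM (Hf' a Ua) (Hg' a Ua)) _.
  by rewrite /GRing.scale /= [g a * _]mulrC.
- move=> f f0 Ef [f' Ef' Hf']; exists (fun p => -1 * ((f p)^-1 * (f p)^-1) * f' p).
    by apply: sg_mul => //; apply: sg_mul; [exact: sg_cst|apply: sg_mul; apply: sg_inv].
  move=> a Ua; apply: (is_derive_outer (F := GRing.inv)) (Hf' a Ua).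
  apply: isd_eq (is_deriveV (f := id) (f0 a Ua) (is_derive_id _ _)) _.
  by rewrite [LHS]mulr1 expr2 invfM mulN1r.
- move=> f f0 Ef [f' Ef' Hf']; exists (fun p => (2 * Num.sqrt (f p))^-1 * f' p).
    apply: sg_mul => //; apply: sg_inv; last by apply: sg_mul; [exact: sg_cst|exact: sg_sqrt].
    by move=> p Up; rewrite mulf_neq0 // ?pnatr_eq0 // gt_eqF // sqrtr_gt0 f0.
  by move=> a Ua; apply: is_derive_outer (Hf' a Ua); apply: is_derive1_sqrt; apply: f0.
Qed.

Implicit Types (U : set (R * R)) (f g : R * R -> R).

Lemma smooth_cst U (c : R) : open U -> smooth_open U (fun=> c).
Proof. by move=> oU; apply: smooth_gen_smooth => //; apply: sg_cst. Qed.

Lemma smoothD U f g : open U -> smooth_open U f -> smooth_open U g ->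
  smooth_open U (fun p => f p + g p).
Proof. by move=> oU sf sg; apply: smooth_gen_smooth => //; apply: sg_add; apply: sg_base. Qed.

Lemma smoothM U f g : open U -> smooth_open U f -> smooth_open U g ->
  smooth_open U (fun p => f p * g p).
Proof. by move=> oU sf sg; apply: smooth_gen_smooth => //; apply: sg_mul; apply: sg_base. Qed.

Lemma smoothV U f : open U -> (forall p, U p -> f p != 0) -> smooth_open U f ->
  smooth_open U (fun p => (f p)^-1).
Proof. by move=> oU f0 sf; apply: smooth_gen_smooth => //; apply: sg_inv => //; apply: sg_base. Qed.

Lemma smooth_sqrt U f : open U -> (forall p, U p -> 0 < f p) -> smooth_open U f ->
  smooth_open U (fun p => Num.sqrt (f p)).
Proof. by move=> oU f0 sf; apply: smooth_gen_smooth => //; apply: sg_sqrt => //; apply: sg_base. Qed.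

Lemma is_derive_pair (V W1 W2 : normedModType R) (f : V -> W1) (g : V -> W2) a v c d :
  is_derive a v f c -> is_derive a v g d -> is_derive a v (fun p => (f p, g p)) (c, d).
Proof.
move=> [df <-] [dg <-].
have C : (fun h => h^-1 *: (((fun p => (f p, g p)) \o shift a) (h *: v) - (f a, g a))) @ 0^'
   --> ('D_v f a, 'D_v g a).
  exact: (cvg_pair df dg).
by apply: DeriveDef; [apply/cvg_ex; eexists; exact: C|apply/cvg_lim].
Qed.

Lemma is_derive_fstv (V : normedModType R) (f : V -> R * R) a v d :
  is_derive a v f d -> is_derive a v (fun p => (f p).1) d.1.
Proof.
move=> [df <-].
have C : (fun h => h^-1 *: (((fun p => (f p).1) \o shift a) (h *: v) - (f a).1)) @ 0^'
   --> ('D_v f a).1.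
  exact: (cvg_comp _ fst df (@cvg_fst _ _ _ _ _)).
by apply: DeriveDef; [apply/cvg_ex; eexists; exact: C|apply/cvg_lim].
Qed.

Lemma is_derive_sndv (V : normedModType R) (f : V -> R * R) a v d :
  is_derive a v f d -> is_derive a v (fun p => (f p).2) d.2.
Proof.
move=> [df <-].
have C : (fun h => h^-1 *: (((fun p => (f p).2) \o shift a) (h *: v) - (f a).2)) @ 0^'
   --> ('D_v f a).2.
  exact: (cvg_comp _ snd df (@cvg_snd _ _ _ _ _)).
by apply: DeriveDef; [apply/cvg_ex; eexists; exact: C|apply/cvg_lim].
Qed.

Lemma smooth_pair (U : set (R * R)) (f : R * R -> R * R) : open U ->
  smooth_open U f <-> smooth_open U (fun p => (f p).1) /\ smooth_open U (fun p => (f p).2).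
Proof.
move=> oU; split=> [sf|[sf1 sf2]].
  split.
    pose E1 : set (R * R -> R) := [set g | exists2 f : R * R -> R * R, smooth_open U f & g = fun p => (f p).1].
    apply: (smooth_open_class (E := E1)) => //; last by exists f.
      by move=> _ [g sg ->] a Ua; apply: (continuous_comp (smooth_cont sg Ua)); exact: cvg_fst.
    move=> _ v [g sg ->]; exists (fun p => ('D_v g p).1).
      by exists ('D_v g); [exact: smooth_derive sg|].
    by move=> a Ua; apply: is_derive_fstv; apply: smooth_isd sg Ua.
  pose E2 : set (R * R -> R) := [set g | exists2 f : R * R -> R * R, smooth_open U f & g = fun p => (f p).2].
    apply: (smooth_open_class (E := E2)) => //; last by exists f.
    by move=> _ [g sg ->] a Ua; apply: (continuous_comp (smooth_cont sg Ua)); exact: cvg_snd.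
  move=> _ v [g sg ->]; exists (fun p => ('D_v g p).2).
    by exists ('D_v g); [exact: smooth_derive sg|].
  by move=> a Ua; apply: is_derive_sndv; apply: smooth_isd sg Ua.
pose V2 : normedModType R := (R * R)%type; pose E : set (V2 -> V2) :=
  [set g | smooth_open U (fun p => (g p).1) /\ smooth_open U (fun p => (g p).2)].
have key := @smooth_open_class V2 V2 U E oU; apply: (key _ _ f (conj sf1 sf2)).
  move=> g [sg1 sg2] a Ua; rewrite [g](_ : _ = fun p => ((g p).1, (g p).2)); last by apply/funext => p; case: (g p).
  exact: (cvg_pair (smooth_cont sg1 Ua) (smooth_cont sg2 Ua)).
move=> g v [sg1 sg2]; exists (fun p => ('D_v (fun p => (g p).1) p, 'D_v (fun p => (g p).2) p)).
  by split; [exact: smooth_derive sg1|exact: smooth_derive sg2].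
move=> a Ua; rewrite [X in is_derive _ _ X](_ : _ = fun p => ((g p).1, (g p).2)); last by apply/funext => p; case: (g p).
by apply: is_derive_pair; [exact: smooth_isd sg1 Ua|exact: smooth_isd sg2 Ua].
Qed.

End SmoothOpen.

(* A solution of an evolution equation whose right-hand side is built from the
   spatial derivatives is smooth as soon as these are jointly continuous: each
   time derivative can be traded for spatial ones. *)
Section Bootstrap.
Context {R : realType}.
Implicit Types (f g : R -> R -> R) (t x : R).
Context (u v : R -> R -> R).
Context (xu : xsmooth u) (xv : xsmooth v).
Let n1 t x := u t x * u t x + v t x * v t x.
Let n2 t x := dx u t x * dx u t x + dx v t x * dx v t x.
Context (n10 : forall t x, n1 t x != 0) (n20 : forall t x, n2 t x != 0).

Inductive diff_rat : (R -> R -> R) -> Prop :=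
| dr_u k : diff_rat (iter k dx u)
| dr_v k : diff_rat (iter k dx v)
| dr_cst c : diff_rat (fun _ _ => c)
| dr_add f g : diff_rat f -> diff_rat g -> diff_rat (fun t x => f t x + g t x)
| dr_mul f g : diff_rat f -> diff_rat g -> diff_rat (fun t x => f t x * g t x)
| dr_inv1 : diff_rat (fun t x => (n1 t x)^-1)
| dr_inv2 : diff_rat (fun t x => (n2 t x)^-1).

Lemma xsmooth_iter f k : xsmooth f -> xsmooth (iter k dx f).
Proof. by move=> xf; elim: k => //= k /xsmooth_dx[]. Qed.

Lemma xsmooth_rat f : diff_rat f -> xsmooth f.
Proof.
have xu' := (xsmooth_dx xu).2; have xv' := (xsmooth_dx xv).2.
elim=> {f} => [k|k|c|f g _ xf _ xg|f g _ xf _ xg||] N.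
- exact: xsmooth_iter.
- exact: xsmooth_iter.
- exact: csm_cst.
- exact: csmD.
- exact: csmM.
- by apply: csmV => //; apply: csmD; apply: csmM.
- by apply: csmV => //; apply: csmD; apply: csmM.
Qed.

Lemma dr_ext f g : (forall t x, f t x = g t x) -> diff_rat f -> diff_rat g.
Proof. by move=> H; suff -> : f = g by []; apply/funext => t; apply/funext => x. Qed.

Let dr_u0 : diff_rat u := dr_u 0.
Let dr_v0 : diff_rat v := dr_v 0.
Let dr_u1 : diff_rat (dx u) := dr_u 1.
Let dr_v1 : diff_rat (dx v) := dr_v 1.

Let isd_sq_inv (f g f' g' : R -> R) (x : R) : f x * f x + g x * g x != 0 ->
  isd f x (f' x) -> isd g x (g' x) -> isd (fun y => (f y * f y + g y * g y)^-1) x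
  (- 2 * (((f x * f x + g x * g x)^-1 * (f x * f x + g x * g x)^-1) * (f x * f' x + g x * g' x))).
Proof.
move=> h0 df dg.
have D : isd (fun y => f y * f y + g y * g y) x (2 * (f x * f' x + g x * g' x)).
  apply: isd_eq (is_deriveD (is_deriveM df df) (is_deriveM dg dg)) _.
  by rewrite /GRing.scale /=; ring.
apply: isd_eq (is_deriveV (f := fun y => f y * f y + g y * g y) h0 D) _.
by rewrite /GRing.scale /= expr2 invfM; ring.
Qed.

Lemma dr_dx f : diff_rat f ->
  exists2 g, diff_rat g & forall t x, isd (f t) x (g t x).
Proof.
have E h : xsmooth h -> forall t x, isd (h t) x (dx h t x) by move=> /xsmooth_dx[].
elim=> {f} => [k|k|c|f g Rf [f' Rf' Hf] Rg [g' Rg' Hg]|f g Rf [f' Rf' Hf] Rg [g' Rg' Hg]||].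
- exists (iter k.+1 dx u); first exact: (dr_u k.+1).
  by move=> t x; apply: E; apply: xsmooth_iter.
- exists (iter k.+1 dx v); first exact: (dr_v k.+1).
  by move=> t x; apply: E; apply: xsmooth_iter.
- by exists (fun _ _ => 0); [exact: dr_cst|move=> t x; exact: is_derive_cst].
- exists (fun t x => f' t x + g' t x); first exact: dr_add.
  by move=> t x; apply: is_deriveD.
- exists (fun t x => f t x * g' t x + f' t x * g t x).
    by apply: dr_add; apply: dr_mul.
  move=> t x; apply: isd_eq (is_deriveM (Hf t x) (Hg t x)) _.
  by rewrite /GRing.scale /= [g t x * _]mulrC.
- exists (fun t x => - 2 * (((n1 t x)^-1 * (n1 t x)^-1) * (u t x * dx u t x + v t x * dx v t x))).
    apply: dr_mul; first exact: dr_cst.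
    by apply: dr_mul; [apply: dr_mul; exact: dr_inv1|apply: dr_add; apply: dr_mul].
  move=> t x; apply: (@isd_sq_inv (u t) (v t) (dx u t) (dx v t)); [exact: n10|exact: E|exact: E].
- exists (fun t x => - 2 * (((n2 t x)^-1 * (n2 t x)^-1) *
    (dx u t x * iter 2 dx u t x + dx v t x * iter 2 dx v t x))).
    apply: dr_mul; first exact: dr_cst.
    apply: dr_mul; first by apply: dr_mul; exact: dr_inv2.
    by apply: dr_add; apply: dr_mul => //; [exact: (dr_u 2)|exact: (dr_v 2)].
  move=> t x; apply: (@isd_sq_inv (dx u t) (dx v t) (dx (dx u) t) (dx (dx v) t)).
  + exact: n20.
  + by apply: E; exact: (xsmooth_iter 1 xu).
  + by apply: E; exact: (xsmooth_iter 1 xv).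
Qed.

Context (a b : R) (ru rv : R -> R -> R).
Context (Eu : diff_rat ru) (Ev : diff_rat rv).
Context (Du : forall t x, a < t < b -> isd (u ^~ x) t (ru t x)).
Context (Dv : forall t x, a < t < b -> isd (v ^~ x) t (rv t x)).

(** One space derivative at a time through [mixed_derivative], whose asymmetry matters: the time
    derivative of the next spatial derivative is not known to exist beforehand. *)
Let dr_dt_iter w rw k : xsmooth w -> diff_rat rw ->
  (forall t x, a < t < b -> isd (w ^~ x) t (rw t x)) ->
  exists2 g, diff_rat g & forall t x, a < t < b -> isd (iter k dx w ^~ x) t (g t x).
Proof.
move=> xw Ew Dw; elim: k => [|k [g Eg Hg]] /=; first by exists rw.
have [g' Eg' Hg'] := dr_dx Eg; exists g' => // t x /andP[ta tb].
pose r := Num.min (t - a) (b - t).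
have r0 : 0 < r by rewrite lt_min !subr_gt0 ta.
have sr s : `|s - t| < r -> a < s < b.
  by rewrite lt_min !ltr_norml => /andP[/andP[? ?] /andP[? ?]]; apply/andP; split; lra.
apply: (@mixed_derivative _ (iter k dx w) g (iter k.+1 dx w) g' t x r r0).
- by move=> s y /sr sab _; apply: Hg.
- by move=> s _; apply: (xsmooth_dx (xsmooth_iter k xw)).1.
- exact: (csm_jc (xsmooth_rat Eg' 0)).
Qed.

Lemma dr_dt f : diff_rat f ->
  exists2 g, diff_rat g & forall t x, a < t < b -> isd (f ^~ x) t (g t x).
Proof.
elim=> {f} => [k|k|c|f g Rf [f' Rf' Hf] Rg [g' Rg' Hg]|f g Rf [f' Rf' Hf] Rg [g' Rg' Hg]||].
- exact: dr_dt_iter xu Eu Du.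
- exact: dr_dt_iter xv Ev Dv.
- by exists (fun _ _ => 0); [exact: dr_cst|move=> t x _; exact: is_derive_cst].
- exists (fun t x => f' t x + g' t x); first exact: dr_add.
  by move=> t x tab; apply: is_deriveD; [exact: Hf|exact: Hg].
- exists (fun t x => f t x * g' t x + f' t x * g t x).
    by apply: dr_add; apply: dr_mul.
  move=> t x tab; apply: isd_eq (is_deriveM (Hf t x tab) (Hg t x tab)) _.
  by rewrite /GRing.scale /= [g t x * _]mulrC.
- exists (fun t x => - 2 * (((n1 t x)^-1 * (n1 t x)^-1) * (u t x * ru t x + v t x * rv t x))).
    apply: dr_mul; first exact: dr_cst.
    by apply: dr_mul; [apply: dr_mul; exact: dr_inv1|apply: dr_add; apply: dr_mul].
  move=> t x tab; apply: (@isd_sq_inv (u ^~ x) (v ^~ x) (ru ^~ x) (rv ^~ x)).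
  + exact: n10.
  + exact: Du.
  + exact: Dv.
- have [gu Egu Hgu] := @dr_dt_iter u ru 1 xu Eu Du.
  have [gv Egv Hgv] := @dr_dt_iter v rv 1 xv Ev Dv.
  exists (fun t x => - 2 * (((n2 t x)^-1 * (n2 t x)^-1) *
    (dx u t x * gu t x + dx v t x * gv t x))).
    apply: dr_mul; first exact: dr_cst.
    apply: dr_mul; first by apply: dr_mul; exact: dr_inv2.
    by apply: dr_add; apply: dr_mul.
  move=> t x tab; exact: (@isd_sq_inv (fun s => dx u s x) (fun s => dx v s x)
    (fun s => gu s x) (fun s => gv s x) t (n20 t x) (Hgu t x tab) (Hgv t x tab)).
Qed.

Lemma smooth_rat f : diff_rat f ->
  smooth_open [set p : R * R | a < p.1 < b] (fun p => f p.1 p.2).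
Proof.
move=> Ef; pose E : set (R * R -> R) := [set g | exists2 f, diff_rat f & g = fun p => f p.1 p.2].
apply: (smooth_open_class (E := E)); last by exists f.
- rewrite (_ : [set p : R * R | _] = fst @^-1` `]a, b[%classic).
    by apply: open_comp => [p _|]; [exact: cvg_fst|exact: interval_open].
  by apply/funext => p; rewrite /preimage /= in_itv.
- by move=> _ [g Eg ->] p _; apply: (csm_jc (xsmooth_rat Eg 0)).
- move=> _ w [g Eg ->]; have [gt Egt Hgt] := dr_dt Eg; have [gx Egx Hgx] := dr_dx Eg.
  exists (fun p => w.1 * gt p.1 p.2 + w.2 * gx p.1 p.2).
    exists (fun t x => w.1 * gt t x + w.2 * gx t x) => //.
    by apply: dr_add; apply: dr_mul => //; exact: dr_cst.
  move=> [t x] /= /andP[ta tb].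
  pose r := Num.min (t - a) (b - t).
  have r0 : 0 < r by rewrite lt_min !subr_gt0 ta.
  have sr s : `|s - t| < r -> a < s < b.
    by rewrite lt_min !ltr_norml => /andP[/andP[? ?] /andP[? ?]]; apply/andP; split; lra.
  apply: (@is_derive_total _ g gt gx t x r r0).
  + by move=> s y /sr sab _; apply: Hgt.
  + exact: (csm_jc (xsmooth_rat Egt 0)).
  + exact: (csm_jc (xsmooth_rat Egx 0)).
Qed.

End Bootstrap.

(* Functions of (t, x) given by absolutely convergent series of modes
   c(t) cos(k x + b) with k in kap Z. The bound in [rep d M] holds for all the
   submultiplicative weights (1+|k|)^d (1+eta_s|k|)^s simultaneously: as eta_s can
   be chosen after the data, all of them can be given the same norm. *)
(** * The Wiener algebra and the heat equation *)

Section Wiener.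
Context {R : realType} (kap : R) (eta : nat -> R) (eta_gt0 : forall s, 0 < eta s).
Implicit Types (f g h : R -> R -> R) (t x k M : R) (d s n : nat).

(** A phase replaces separate sines, so that d/dx maps a mode to a mode and a product of two modes
    is a sum of two. The bound [mm] is uniform in time; [mk_int] makes every mode periodic with the
    same period. *)
Record mode := Mode {
  mk : R; mb : R; mc : R -> R; mm : R;
  mc_cont : continuous mc;
  mc_le : forall t, `|mc t| <= mm;
  mk_int : exists j : int, mk = j%:~R * kap }.

Definition wgt d s k := (1 + `|k|) ^+ d * (1 + eta s * `|k|) ^+ s.
Definition evl (P : seq mode) t x : R := \sum_(m <- P) mc m t * cos (mk m * x + mb m).
Definition nrm d s (P : seq mode) : R := \sum_(m <- P) mm m * wgt d s (mk m).

(** The terms are finite blocks of modes rather than single modes, because products and double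
    series are summed by square shells. *)
Definition rep d M f := exists P : nat -> seq mode,
  (forall s n, \sum_(j < n) nrm d s (P j) <= M) /\
  (forall t x, (fun n => \sum_(j < n) evl (P j) t x) @ \oo --> f t x).

Lemma mm_ge0 m : 0 <= mm m.
Proof. exact: le_trans (normr_ge0 _) (mc_le m 0). Qed.

Lemma base1 s k : 1 <= 1 + eta s * `|k|.
Proof. by rewrite lerDl mulr_ge0 // ltW. Qed.

Lemma base0 s k : 0 <= 1 + eta s * `|k|.
Proof. exact: le_trans ler01 (base1 s k). Qed.

Lemma wgt_ge1 d s k : 1 <= wgt d s k.
Proof. by rewrite /wgt mulr_ege1 // exprn_ege1 ?base1 ?lerDl. Qed.

Lemma wgt_ge0 d s k : 0 <= wgt d s k.
Proof. exact: le_trans ler01 (wgt_ge1 d s k). Qed.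

(** Each factor 1 + e |k| is submultiplicative in k. This makes the series of bounded norm an
    algebra. *)
Lemma wgt_sub d s k l : wgt d s (k + l) <= wgt d s k * wgt d s l.
Proof.
have N := ler_normD k l.
have H (e : R) : 0 <= e -> 1 + e * `|k + l| <= (1 + e * `|k|) * (1 + e * `|l|).
  move=> e0; have h : e * `|k + l| <= e * `|k| + e * `|l| by rewrite -mulrDr ler_wpM2l.
  have : 0 <= (e * `|k|) * (e * `|l|) by rewrite !mulr_ge0.
  by move: h; set a := e * `|k|; set b := e * `|l|; set c := e * _ => ? ?; rewrite mulrDl mul1r mulrDr mulr1; lra.
have H1 := H 1 ler01; rewrite !mul1r in H1.
rewrite /wgt mulrACA -!exprMn; apply: ler_pM; rewrite ?exprn_ge0 ?base0 ?addr_ge0 //.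
  by rewrite lerXn2r // nnegrE ?mulr_ge0 ?addr_ge0.
by rewrite lerXn2r // ?nnegrE ?mulr_ge0 ?base0 // H // ltW.
Qed.

Lemma wgt_sub' d s k l : wgt d s (k - l) <= wgt d s k * wgt d s l.
Proof. by have := wgt_sub d s k (- l); rewrite {3}/wgt normrN. Qed.

Lemma wgt_le d d' s k : (d' <= d)%N -> wgt d' s k <= wgt d s k.
Proof.
move=> dd; rewrite /wgt ler_wpM2r ?exprn_ge0 ?base0 //.
by rewrite ler_weXn2l // lerDl.
Qed.

Lemma nrm_ge0 d s P : 0 <= nrm d s P.
Proof. by apply: sumr_ge0 => m _; rewrite mulr_ge0 ?mm_ge0 ?wgt_ge0. Qed.

Lemma nrm_cat d s P Q : nrm d s (P ++ Q) = nrm d s P + nrm d s Q.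
Proof. exact: big_cat. Qed.

Lemma evl_cat P Q t x : evl (P ++ Q) t x = evl P t x + evl Q t x.
Proof. exact: big_cat. Qed.

Lemma nrm_flatten d s (PP : seq (seq mode)) :
  nrm d s (flatten PP) = \sum_(P <- PP) nrm d s P.
Proof. by elim: PP => [|P PP IH] /=; rewrite ?big_nil ?big_cons -?IH ?nrm_cat // /nrm big_nil. Qed.

Lemma evl_flatten (PP : seq (seq mode)) t x :
  evl (flatten PP) t x = \sum_(P <- PP) evl P t x.
Proof. by elim: PP => [|P PP IH] /=; rewrite ?big_nil ?big_cons -?IH ?evl_cat // /evl big_nil. Qed.

Lemma abs_cos_le1 (y : R) : `|cos y| <= 1.
Proof. by rewrite ler_norml cos_geN1 cos_le1. Qed.

Lemma evl_le d s P t x : `|evl P t x| <= nrm d s P.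
Proof.
apply: le_trans (ler_norm_sum _ _ _) _; apply: ler_sum => m _.
rewrite normrM ler_pM //; first exact: mc_le.
exact: le_trans (abs_cos_le1 _) (wgt_ge1 _ _ _).
Qed.

Lemma continuous_cosl k b : continuous (fun x => cos (k * x + b)).
Proof.
move=> x; apply: (@continuous_comp _ _ _ (fun x => k * x + b) cos); last exact: continuous_cos.
by apply: cvgD; [apply: cvgM; [exact: cvg_cst|exact: cvg_id]|exact: cvg_cst].
Qed.

Lemma jcM f g : jcont f -> jcont g -> jcont (fun t x => f t x * g t x).
Proof. by move=> cf cg p; apply: cvgM; [exact: cf|exact: cg]. Qed.

Lemma jcD f g : jcont f -> jcont g -> jcont (fun t x => f t x + g t x).
Proof. by move=> cf cg p; apply: cvgD; [exact: cf|exact: cg]. Qed.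

Lemma jc_ext f g : (forall t x, f t x = g t x) -> jcont f -> jcont g.
Proof. by move=> H; suff -> : f = g by []; apply/funext => t; apply/funext => x. Qed.

Lemma evl_jc P : jcont (evl P).
Proof.
elim: P => [|m P IH].
  by apply: (jc_ext (f := fun _ _ => 0)) => [t x|p]; [rewrite /evl big_nil|exact: cst_continuous].
apply: (jc_ext (f := fun t x => mc m t * cos (mk m * x + mb m) + evl P t x)).
  by move=> t x; rewrite /evl big_cons.
apply: jcD => //; apply: jcM; first by apply: jc_fst; exact: mc_cont.
by apply: jc_snd; exact: continuous_cosl.
Qed.

Lemma rep_tail (P : nat -> seq mode) M d : (forall s n, \sum_(j < n) nrm d s (P j) <= M) ->
  exists e : nat -> R, [/\ e @ \oo --> 0, forall n, 0 <= e n &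
   forall n q, (n <= q)%N -> \sum_(n <= j < q) nrm d 0 (P j) <= e n].
Proof.
move=> HM; pose a n := \sum_(j < n) nrm d 0 (P j).
have am : nondecreasing_seq a.
  by apply/nondecreasing_seqP => n; rewrite /a big_ord_recr /= lerDl nrm_ge0.
have au : has_ubound (range a) by exists M => _ [n _ <-]; exact: HM.
have ca := nondecreasing_cvgn am au.
set A := sup _ in ca.
have aA n : a n <= A by apply: ub_le_sup => //; exists n.
exists (fun n => A - a n); split.
- by rewrite -[X in _ --> X](subrr A); apply: cvgB => //; exact: cvg_cst.
- by move=> n; rewrite subr_ge0.
- move=> n q nq; rewrite lerBrDl; apply: le_trans (aA q).
  by rewrite /a -!(big_mkord xpredT (fun j => nrm d 0 (P j))) -big_cat_nat.
Qed.

Lemma partial_tail (u : nat -> R) n q : (n <= q)%N ->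
  \sum_(j < q) u j - \sum_(j < n) u j = \sum_(n <= j < q) u j.
Proof.
move=> nq; rewrite -!(big_mkord xpredT u) (big_cat_nat _ nq) //=.
by rewrite addrAC subrr add0r.
Qed.

Lemma cvg_dist_le (u : nat -> R) (l a e : R) n0 : u @ \oo --> l ->
  (forall n, (n0 <= n)%N -> `|u n - a| <= e) -> `|l - a| <= e.
Proof.
move=> ul H; have C : (fun n => `|u n - a|) @ \oo --> `|l - a|.
  by apply: cvg_norm; apply: cvgB => //; exact: cvg_cst.
rewrite -(cvg_lim _ C) //; apply: limr_le; first by apply/cvg_ex; eexists; exact: C.
by near=> n; apply: H; near: n; exists n0.
Unshelve. all: by end_near. Qed.

Lemma rep_rate (P : nat -> seq mode) M d f :
  (forall s n, \sum_(j < n) nrm d s (P j) <= M) ->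
  (forall t x, (fun n => \sum_(j < n) evl (P j) t x) @ \oo --> f t x) ->
  exists2 e : nat -> R, e @ \oo --> 0 &
    forall n t x, `|\sum_(j < n) evl (P j) t x - f t x| <= e n.
Proof.
move=> HM Hf; have [e [e0 _ He]] := rep_tail HM; exists e => // n t x.
rewrite distrC; apply: (cvg_dist_le (n0 := n) (Hf t x)) => q nq.
rewrite (partial_tail (fun j => evl (P j) t x) nq); apply: le_trans (ler_norm_sum _ _ _) _.
apply: le_trans (He n q nq); apply: ler_sum => j _; exact: evl_le.
Qed.

Lemma rep_bound d M f t x : rep d M f -> `|f t x| <= M.
Proof.
move=> [P [HM Hf]]; rewrite -[f t x]subr0.
apply: (cvg_dist_le (n0 := 0) (Hf t x)) => n _; rewrite subr0.
apply: le_trans (ler_norm_sum _ _ _) _; apply: le_trans (HM 0 n).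
by apply: ler_sum => j _; exact: evl_le.
Qed.

Lemma rep_jc d M f : rep d M f -> jcont f.
Proof.
move=> [P [HM Hf]]; have [e e0 He] := rep_rate HM Hf.
apply: (@continuous_uniform_limit _ _ (fun n p => \sum_(j < n) evl (P j) p.1 p.2) _ e) => //.
  move=> n; elim: n => [|n IH].
    rewrite (_ : (fun p : R * R => _) = (fun=> 0)); first by move=> p; exact: cst_continuous.
    by apply/funext => p; rewrite big_ord0.
  rewrite (_ : (fun p : R * R => _) = (fun p => \sum_(j < n) evl (P j) p.1 p.2 + evl (P n) p.1 p.2)).
    by move=> p; apply: cvgD; [exact: IH|exact: evl_jc].
  by apply/funext => p; rewrite big_ord_recr.
Qed.

Lemma rep_ext d M f g : (forall t x, f t x = g t x) -> rep d M f -> rep d M g.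
Proof. by move=> H; suff -> : f = g by []; apply/funext => t; apply/funext => x. Qed.

Lemma rep_le d d' M M' f : (d' <= d)%N -> M <= M' -> rep d M f -> rep d' M' f.
Proof.
move=> dd MM [P [HM Hf]]; exists P; split=> // s n.
apply: le_trans MM; apply: le_trans (HM s n); apply: ler_sum => j _; apply: ler_sum => m _.
by rewrite ler_wpM2l ?mm_ge0 // wgt_le.
Qed.

Lemma repD d M M' f g : rep d M f -> rep d M' g -> rep d (M + M') (fun t x => f t x + g t x).
Proof.
move=> [P [HM Hf]] [Q [HM' Hg]]; exists (fun n => P n ++ Q n); split.
  move=> s n; rewrite (eq_bigr (fun j : 'I_n => nrm d s (P j) + nrm d s (Q j))).
    by rewrite big_split /=; apply: lerD; [exact: HM|exact: HM'].
  by move=> j _; exact: nrm_cat.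
move=> t x; rewrite (_ : (fun n => _) = (fun n => \sum_(j < n) evl (P j) t x + \sum_(j < n) evl (Q j) t x)).
  exact: cvgD.
by apply/funext => n; rewrite -big_split; apply: eq_bigr => j _; exact: evl_cat.
Qed.

Lemma rep_cst d (c : R) : rep d `|c| (fun _ _ => c).
Proof.
have cc : continuous (fun _ : R => c) by move=> ?; exact: cst_continuous.
have k0 : exists j : int, 0 = j%:~R * kap by exists 0; rewrite mul0r.
pose m := @Mode 0 0 _ _ cc (fun _ => lexx `|c|) k0.
exists (fun n => if n is 0 then [:: m] else [::]).
have E (T : seq mode -> R) n : T [::] = 0 ->
   \sum_(j < n) T (if j : nat is 0 then [:: m] else [::]) = if n is 0 then 0 else T [:: m].
  move=> T0; case: n => [|n]; first by rewrite big_ord0.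
  by rewrite big_ord_recl /= big1 ?addr0 // => i _ /=.
split=> [s n|t x].
  rewrite (E (nrm d s)); last by rewrite /nrm big_nil.
  case: n => [//|_]; rewrite /nrm big_seq1 /= /wgt normr0 mulr0 !addr0 !expr1n !mulr1 //.
apply: cvg_near_cst; exists 1%N => // n /= n1.
rewrite (E (fun P => evl P t x)); last by rewrite /evl big_nil.
by case: n n1 => // n _; rewrite /evl big_seq1 /= mul0r addr0 cos0 mulr1.
Qed.

Lemma cos_mul (a b : R) : cos a * cos b = (cos (a + b) + cos (a - b)) / 2.
Proof. by rewrite cosD cosB; field. Qed.

Definition mode_mulD (m p : mode) : mode.
Proof.
refine (@Mode (mk m + mk p) (mb m + mb p) (fun t => mc m t * mc p t / 2) (mm m * mm p / 2) _ _ _).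
- move=> t; apply: cvgM; last exact: cvg_cst.
  by apply: cvgM; exact: mc_cont.
- move=> t; rewrite normrM [`|2^-1|]ger0_norm ?invr_ge0 // ler_wpM2r ?invr_ge0 //.
  by rewrite normrM; apply: ler_pM => //; exact: mc_le.
- have [i Ei] := mk_int m; have [j Ej] := mk_int p; exists (i + j).
  by rewrite intrD mulrDl -Ei -Ej.
Defined.

Definition mode_mulB (m p : mode) : mode.
Proof.
refine (@Mode (mk m - mk p) (mb m - mb p) (fun t => mc m t * mc p t / 2) (mm m * mm p / 2) _ _ _).
- move=> t; apply: cvgM; last exact: cvg_cst.
  by apply: cvgM; exact: mc_cont.
- move=> t; rewrite normrM [`|2^-1|]ger0_norm ?invr_ge0 // ler_wpM2r ?invr_ge0 //.
  by rewrite normrM; apply: ler_pM => //; exact: mc_le.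
- have [i Ei] := mk_int m; have [j Ej] := mk_int p; exists (i - j).
  by rewrite intrB mulrBl -Ei -Ej.
Defined.

Definition mulp (P Q : seq mode) : seq mode :=
  flatten [seq flatten [seq [:: mode_mulD m p; mode_mulB m p] | p <- Q] | m <- P].

Lemma evl_mul P Q t x : evl (mulp P Q) t x = evl P t x * evl Q t x.
Proof.
rewrite /mulp evl_flatten big_map {2}/evl mulr_suml; apply: eq_bigr => m _.
rewrite evl_flatten big_map /evl mulr_sumr; apply: eq_bigr => p _.
rewrite !big_cons big_nil addr0 /= mulrACA cos_mul.
have -> : (mk m + mk p) * x + (mb m + mb p) = mk m * x + mb m + (mk p * x + mb p) by ring.
have -> : (mk m - mk p) * x + (mb m - mb p) = mk m * x + mb m - (mk p * x + mb p) by ring.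
by field.
Qed.

Lemma nrm_mul d s P Q : nrm d s (mulp P Q) <= nrm d s P * nrm d s Q.
Proof.
rewrite /mulp nrm_flatten big_map {2}/nrm mulr_suml; apply: ler_sum => m _.
rewrite nrm_flatten big_map /nrm mulr_sumr; apply: ler_sum => p _.
rewrite !big_cons big_nil addr0 /= -mulrDr mulrACA -mulrA.
rewrite ler_wpM2l ?mulr_ge0 ?mm_ge0 //.
have h1 := wgt_sub d s (mk m) (mk p); have h2 := wgt_sub' d s (mk m) (mk p).
rewrite mulrC ler_pdivrMr //; lra.
Qed.

Lemma repM d M M' f g : rep d M f -> rep d M' g -> rep d (M * M') (fun t x => f t x * g t x).
Proof.
move=> [P [HM Hf]] [Q [HM' Hg]].
pose cP (P : nat -> seq mode) n := flatten [seq P i | i <- iota 0 n].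
have ecP P' n t x : evl (cP P' n) t x = \sum_(j < n) evl (P' j) t x.
  by rewrite /cP evl_flatten big_map -(big_mkord xpredT (fun j => evl (P' j) t x)) /index_iota subn0.
have ncP P' n s : nrm d s (cP P' n) = \sum_(j < n) nrm d s (P' j).
  by rewrite /cP nrm_flatten big_map -(big_mkord xpredT (fun j => nrm d s (P' j))) /index_iota subn0.
(* The n-th block is the n-th square shell, so that partial sums of the product are exactly products
   of partial sums. *)
exists (fun n => mulp (P n) (cP Q n.+1) ++ mulp (cP P n) (Q n)); split.
  move=> s n; apply: (@le_trans _ _ ((\sum_(j < n) nrm d s (P j)) * (\sum_(j < n) nrm d s (Q j)))).
    elim: n => [|n IH]; first by rewrite !big_ord0 mul0r.
    rewrite big_ord_recr /= [X in _ <= X * _]big_ord_recr [X in _ <= _ * X]big_ord_recr /=.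
    rewrite nrm_cat; apply: le_trans (lerD IH (lerD (nrm_mul _ _ _ _) (nrm_mul _ _ _ _))) _.
    rewrite !ncP big_ord_recr /=; set a := \sum_(j < n) _; set b := \sum_(j < n) _.
    rewrite le_eqVlt; apply/orP; left; apply/eqP; ring.
  by apply: ler_pM => //; apply: sumr_ge0 => j _; exact: nrm_ge0.
move=> t x; rewrite (_ : (fun n => _) = (fun n => (\sum_(j < n) evl (P j) t x) * (\sum_(j < n) evl (Q j) t x))).
  exact: cvgM.
apply/funext; elim => [|n IH]; first by rewrite !big_ord0 mul0r.
rewrite big_ord_recr /= IH evl_cat !evl_mul !ecP !big_ord_recr /=; ring.
Qed.

Lemma repZ d M (c : R) f : rep d M f -> rep d (`|c| * M) (fun t x => c * f t x).
Proof. by move=> /(repM (rep_cst d c)). Qed.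

Lemma repN d M f : rep d M f -> rep d M (fun t x => - f t x).
Proof.
move=> /(repZ (-1)); rewrite normrN1 mul1r; apply: rep_ext => t x; exact: mulN1r.
Qed.

Lemma repB d M M' f g : rep d M f -> rep d M' g -> rep d (M + M') (fun t x => f t x - g t x).
Proof. by move=> Hf /repN Hg; apply: repD. Qed.

Definition mode_dx (m : mode) : mode.
Proof.
refine (@Mode (mk m) (mb m + pi / 2) (fun t => mk m * mc m t) (`|mk m| * mm m) _ _ (mk_int m)).
- by move=> t; apply: cvgM; [exact: cvg_cst|exact: mc_cont].
- by move=> t; rewrite normrM ler_wpM2l // mc_le.
Defined.

Lemma cosDpi2 (y : R) : cos (y + pi / 2) = - sin y.
Proof. by rewrite cosD cos_pihalf sin_pihalf; ring. Qed.

Lemma isd_cosl k b x : isd (fun x => cos (k * x + b)) x (k * cos (k * x + (b + pi / 2))).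
Proof.
have D : isd (fun x => k * x + b) x k.
  apply: isd_eq (is_deriveD (is_deriveM (is_derive_cst k x 1) (is_derive_id x 1)) (is_derive_cst b x 1)) _.
  by rewrite /GRing.scale /=; ring.
apply: isd_eq (isd_chain (is_derive_cos _) D) _.
by rewrite addrA cosDpi2 mulrC.
Qed.

Lemma evl_dx P t x : isd (evl P t) x (evl (map mode_dx P) t x).
Proof.
elim: P => [|m P IH].
  apply: (@isd_ext _ (fun=> 0)) => [y|]; first by rewrite /evl big_nil.
  by rewrite /evl big_nil; exact: is_derive_cst.
apply: (@isd_ext _ (fun x => mc m t * cos (mk m * x + mb m) + evl P t x)) => [y|].
  by rewrite /evl big_cons.
have -> : evl (map mode_dx (m :: P)) t x =
    mk m * mc m t * cos (mk m * x + (mb m + pi / 2)) + evl (map mode_dx P) t x.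
  by rewrite /evl /= big_cons.
apply: is_deriveD.
apply: isd_eq (is_deriveM (is_derive_cst (mc m t) x 1) (isd_cosl (mk m) (mb m) x)) _.
by rewrite /GRing.scale /=; ring.
Qed.

Lemma nrm_dx d s P : nrm d s (map mode_dx P) <= nrm d.+1 s P.
Proof.
rewrite /nrm big_map; apply: ler_sum => m _ /=.
rewrite [`|_| * mm m]mulrC -mulrA ler_wpM2l ?mm_ge0 //.
rewrite /wgt exprS -mulrA ler_wpM2r ?lerDr // mulr_ge0 ?exprn_ge0 ?base0 //.
Qed.

Lemma isd_sum (F G : nat -> R -> R) x n : (forall j, isd (F j) x (G j x)) ->
  isd (fun x => \sum_(j < n) F j x) x (\sum_(j < n) G j x).
Proof.
move=> H; elim: n => [|n IH].
  by rewrite big_ord0; apply: (@isd_ext _ (fun=> 0)) => y; rewrite big_ord0.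
rewrite big_ord_recr; apply: (@isd_ext _ (fun x => \sum_(j < n) F j x + F n x)) => y.
by rewrite big_ord_recr.
Qed.

(** The moments give the qualitative counterpart [lrep] of [rep]: all moments of the frequencies are
    finite, without a common norm, so that d/dx loses nothing. *)
Definition kmom i (P : seq mode) : R := \sum_(m <- P) mm m * `|mk m| ^+ i.
Definition lsum (P : nat -> seq mode) := forall i, exists C, forall n, \sum_(j < n) kmom i (P j) <= C.
Definition lrep f := exists2 P, lsum P &
  forall t x, (fun n => \sum_(j < n) evl (P j) t x) @ \oo --> f t x.

Lemma kmom_ge0 i P : 0 <= kmom i P.
Proof. by apply: sumr_ge0 => m _; rewrite mulr_ge0 ?mm_ge0 ?exprn_ge0. Qed.

Lemma kmom_dx i P : kmom i (map mode_dx P) = kmom i.+1 P.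
Proof. by rewrite /kmom big_map; apply: eq_bigr => m _ /=; rewrite exprS; ring. Qed.

Lemma evl_le_kmom P t x : `|evl P t x| <= kmom 0 P.
Proof.
apply: le_trans (ler_norm_sum _ _ _) _; apply: ler_sum => m _.
by rewrite normrM ler_pM // ?mc_le // expr0 abs_cos_le1.
Qed.

Lemma lsum_dx P : lsum P -> lsum (fun j => map mode_dx (P j)).
Proof.
move=> HP i; have [C HC] := HP i.+1; exists C => n.
by under eq_bigr do rewrite kmom_dx; exact: HC.
Qed.

Lemma lsum_rate P : lsum P -> exists e : nat -> R, [/\ e @ \oo --> 0, forall n, 0 <= e n &
   forall n q, (n <= q)%N -> \sum_(n <= j < q) kmom 0 (P j) <= e n].
Proof.
move=> HP; have [M HM] := HP 0; pose a n := \sum_(j < n) kmom 0 (P j).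
have am : nondecreasing_seq a.
  by apply/nondecreasing_seqP => n; rewrite /a big_ord_recr /= lerDl kmom_ge0.
have au : has_ubound (range a) by exists M => _ [n _ <-]; exact: HM.
have ca := nondecreasing_cvgn am au.
set A := sup _ in ca.
have aA n : a n <= A by apply: ub_le_sup => //; exists n.
exists (fun n => A - a n); split.
- by rewrite -[X in _ --> X](subrr A); apply: cvgB => //; exact: cvg_cst.
- by move=> n; rewrite subr_ge0.
- move=> n q nq; rewrite lerBrDl; apply: le_trans (aA q).
  by rewrite /a -!(big_mkord xpredT (fun j => kmom 0 (P j))) -big_cat_nat.
Qed.

Lemma lsum_tail P (e : nat -> R) n q t x : (n <= q)%N ->
  (forall n q, (n <= q)%N -> \sum_(n <= j < q) kmom 0 (P j) <= e n) ->
  `|\sum_(j < q) evl (P j) t x - \sum_(j < n) evl (P j) t x| <= e n.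
Proof.
move=> nq He; rewrite (partial_tail (fun j => evl (P j) t x) nq).
apply: le_trans (ler_norm_sum _ _ _) _.
by apply: le_trans (He n q nq); apply: ler_sum => j _; exact: evl_le_kmom.
Qed.

Lemma lsum_cvg P : lsum P -> exists f, forall t x,
  (fun n => \sum_(j < n) evl (P j) t x) @ \oo --> f t x.
Proof.
move=> HP; have [e [e0 _ He]] := lsum_rate HP.
exists (fun t x => lim ((fun n => \sum_(j < n) evl (P j) t x) @ \oo)) => t x.
have [n0 e0'] : exists n0, forall r, 0 < r -> exists n0, e n0 < r.
  exists 0 => r r0; have [n0 _ Hn] : \forall n \near \oo, `|0 - e n| < r.
    by move/cvgrPdist_lt : e0; apply.
  exists n0; have := Hn n0 (leqnn _).
  by rewrite /= sub0r normrN => /(le_lt_trans (ler_norm _)).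
apply: cauchy_cvg; apply: cauchy_exP => r r0; have [n1 en] := e0' r r0.
exists (\sum_(j < n1) evl (P j) t x); exists n1 => // n /= nn.
by rewrite -ball_normE /= distrC; apply: le_lt_trans en; apply: lsum_tail He.
Qed.

Lemma lsum_unif P f : lsum P ->
  (forall t x, (fun n => \sum_(j < n) evl (P j) t x) @ \oo --> f t x) ->
  exists2 e : nat -> R, e @ \oo --> 0 &
    forall n t x, `|\sum_(j < n) evl (P j) t x - f t x| <= e n.
Proof.
move=> HP Hf; have [e [e0 _ He]] := lsum_rate HP; exists e => // n t x.
rewrite distrC; apply: (cvg_dist_le (n0 := n) (Hf t x)) => q nq.
exact: lsum_tail He.
Qed.

Lemma sum_evl_jc (P : nat -> seq mode) n : jcont (fun t x => \sum_(j < n) evl (P j) t x).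
Proof.
elim: n => [|n IH].
  by apply: (jc_ext (f := fun _ _ => 0)) => [t x|p]; [rewrite big_ord0|exact: cst_continuous].
apply: (jc_ext (f := fun t x => \sum_(j < n) evl (P j) t x + evl (P n) t x)).
  by move=> t x; rewrite big_ord_recr.
by apply: jcD => //; exact: evl_jc.
Qed.

Lemma lrep_jc f : lrep f -> jcont f.
Proof.
move=> [P HP Hf]; have [e e0 He] := lsum_unif HP Hf.
apply: (@continuous_uniform_limit _ _ (fun n p => \sum_(j < n) evl (P j) p.1 p.2) _ e) => // n.
exact: sum_evl_jc.
Qed.

Lemma lrep_bnd f : lrep f -> exists B, forall t x, `|f t x| <= B.
Proof.
move=> [P HP Hf]; have [B HB] := HP 0; exists B => t x.
rewrite -[f t x]subr0; apply: (cvg_dist_le (n0 := 0) (Hf t x)) => n _; rewrite subr0.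
apply: le_trans (ler_norm_sum _ _ _) _; apply: le_trans (HB n).
by apply: ler_sum => j _; exact: evl_le_kmom.
Qed.

Lemma evl_series_dx P f g : lsum P ->
  (forall t x, (fun n => \sum_(j < n) evl (P j) t x) @ \oo --> f t x) ->
  (forall t x, (fun n => \sum_(j < n) evl (map mode_dx (P j)) t x) @ \oo --> g t x) ->
  forall t x, isd (f t) x (g t x).
Proof.
move=> HP Hf Hg t x; have [e e0 He] := lsum_unif (lsum_dx HP) Hg.
apply: (@isd_uniform_limit _ (fun n y => \sum_(j < n) evl (P j) t y)
  (fun n y => \sum_(j < n) evl (map mode_dx (P j)) t y) (f t) (g t) e (x - 1) (x + 1)) => //.
- by move=> n y _; apply: (isd_sum (F := fun j => evl (P j) t) (G := fun j => evl (map mode_dx (P j)) t)) => j; exact: evl_dx.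
- by rewrite ltrBlDr ltrDl ltr01.
Qed.

Lemma lrep_dx f : lrep f -> (forall t x, isd (f t) x (dx f t x)) /\ lrep (dx f).
Proof.
move=> [P HP Hf]; have [g Hg] := lsum_cvg (lsum_dx HP).
have D := evl_series_dx HP Hf Hg; split=> [t x|]; first exact: dx_isd (D t x).
exists (fun j => map mode_dx (P j)); first exact: lsum_dx.
by move=> t x; rewrite (isd_dx (D t x)).
Qed.

Lemma lrep_xsmooth f : lrep f -> xsmooth f.
Proof.
move=> Lf N; elim: N f Lf => [|N IH] f Lf /=; split=> //; try exact: lrep_jc.
by have [D Ld] := lrep_dx Lf; exists (dx f) => //; exact: IH.
Qed.

(** The weight dominates (eta_i |k|)^i, so that the i-th moment is at most M / eta_i^i: positive
    scales, however small, ensure smoothness. *)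
Lemma rep_lsum d M (P : nat -> seq mode) : (forall s n, \sum_(j < n) nrm d s (P j) <= M) -> lsum P.
Proof.
move=> HM i; exists (M / eta i ^+ i) => n.
rewrite ler_pdivlMr ?exprn_gt0 // mulr_suml; apply: le_trans (HM i n).
apply: ler_sum => j _; rewrite mulr_suml; apply: ler_sum => m _.
rewrite -mulrA ler_wpM2l ?mm_ge0 // -exprMn mulrC /wgt -[leLHS]mul1r.
apply: ler_pM => //; first by rewrite exprn_ge0 // mulr_ge0 // ltW.
  by rewrite exprn_ege1 // lerDl.
by rewrite lerXn2r // ?nnegrE ?base0 ?mulr_ge0 ?(ltW (eta_gt0 i)) // lerDr.
Qed.

Lemma rep_lrep d M f : rep d M f -> lrep f.
Proof. by move=> [P [HM Hf]]; exists P => //; exact: rep_lsum HM. Qed.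

Lemma rep_dx d M f : rep d.+1 M f -> rep d M (dx f).
Proof.
move=> [P [HM Hf]]; have HP := rep_lsum HM; have [g Hg] := lsum_cvg (lsum_dx HP).
have D := evl_series_dx HP Hf Hg.
exists (fun j => map mode_dx (P j)); split.
  by move=> s n; apply: le_trans (HM s n); apply: ler_sum => j _; exact: nrm_dx.
by move=> t x; rewrite (isd_dx (D t x)).
Qed.

Lemma rep_periodic d M f t x : kap != 0 -> rep d M f -> f t (x + 2 * pi / kap) = f t x.
Proof.
move=> k0 [P [_ Hf]].
have cosP (j : int) (y : R) : cos (y + j%:~R * (2 * pi)) = cos y.
  apply: periodic_int => z; rewrite cosD.
  have -> : cos (2 * pi) = 1 :> R by rewrite mulr_natl cos2pi.
  have -> : sin (2 * pi) = 0 :> R by rewrite mulr_natl sin2pi.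
  by rewrite mulr1 mulr0 subr0.
have E j : evl (P j) t (x + 2 * pi / kap) = evl (P j) t x.
  apply: eq_bigr => m _; have [i Ei] := mk_int m; congr (_ * _).
  rewrite -[RHS](cosP i); congr cos; rewrite Ei; field => //.
have H1 := Hf t (x + 2 * pi / kap); have H2 := Hf t x.
move: H1; under eq_fun do under eq_bigr do rewrite E.
by move=> H1; exact: (cvg_unique _ H1 H2).
Qed.

(** Completeness of the algebra: a series of functions with summable norms is again represented. The
    double family of blocks is rearranged by square shells, and its sum is identified by cutting off
    the rows beyond some I, whose total norm is small. *)
Lemma rep_series d (mu : nat -> R) M (F : nat -> R -> R -> R) f :
  (forall i, rep d (mu i) (F i)) -> (forall n, \sum_(i < n) mu i <= M) ->
  (forall t x, (fun n => \sum_(i < n) F i t x) @ \oo --> f t x) -> rep d M f.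
Proof.
move=> HF Hmu Hf.
have [P HP] : exists P : nat -> nat -> seq mode, forall i,
   (forall s n, \sum_(j < n) nrm d s (P i j) <= mu i) /\
   (forall t x, (fun n => \sum_(j < n) evl (P i j) t x) @ \oo --> F i t x).
  by have /choice[P HP] := HF; exists P.
have mu0 i : 0 <= mu i by have := (HP i).1 0 0; rewrite big_ord0.
pose row (n : nat) i := flatten [seq P i j | j <- iota 0 n].
have erow n i t x : evl (row n i) t x = \sum_(j < n) evl (P i j) t x.
  by rewrite /row evl_flatten big_map -(big_mkord xpredT (fun j => evl (P i j) t x)) /index_iota subn0.
have nrow n i s : nrm d s (row n i) = \sum_(j < n) nrm d s (P i j).
  by rewrite /row nrm_flatten big_map -(big_mkord xpredT (fun j => nrm d s (P i j))) /index_iota subn0.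
(* Column n of the rows before n, followed by row n up to its diagonal entry: together the first n
   blocks fill the square of side n. *)
exists (fun n => flatten [seq P i n | i <- iota 0 n] ++ row n.+1 n).
have S (T : seq mode -> R) : (forall P Q, T (P ++ Q) = T P + T Q) -> T [::] = 0 ->
    forall n, \sum_(k < n) T (flatten [seq P i k | i <- iota 0 k] ++ row k.+1 k) =
      \sum_(i < n) \sum_(j < n) T (P i j).
  move=> TD T0; have Tf (PP : seq (seq mode)) : T (flatten PP) = \sum_(P <- PP) T P.
    by elim: PP => [|Q PP IH] /=; rewrite ?big_nil ?big_cons -?IH ?TD.
  have Tr n i : T (row n i) = \sum_(j < n) T (P i j).
    by rewrite /row Tf big_map -(big_mkord xpredT (fun j => T (P i j))) /index_iota subn0.
  elim=> [|n IH]; first by rewrite !big_ord0.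
  rewrite big_ord_recr /= IH [RHS]big_ord_recr /=.
  under [X in _ = X + _]eq_bigr do rewrite big_ord_recr /=.
  rewrite big_split /= TD Tf big_map Tr -addrA; congr (_ + (_ + _)).
  by rewrite -(big_mkord xpredT (fun i => T (P i n))) /index_iota subn0.
split.
  move=> s n; rewrite (S (nrm d s)); last by rewrite /nrm big_nil.
    by apply: le_trans (Hmu n); apply: ler_sum => i _; exact: (HP i).1.
  by move=> *; exact: nrm_cat.
move=> t x; apply/cvgrPdist_le => e e0.
have e3 : 0 < e / 3 by rewrite divr_gt0.
have [I HI] : exists I, forall n, (I <= n)%N -> \sum_(I <= i < n) mu i <= e / 3.
  pose a n := \sum_(i < n) mu i.
  have am : nondecreasing_seq a.
    by apply/nondecreasing_seqP => n; rewrite /a big_ord_recr /= lerDl.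
  have au : has_ubound (range a) by exists M => _ [n _ <-]; exact: Hmu.
  have ca := nondecreasing_cvgn am au; set A := sup _ in ca.
  have aA n : a n <= A by apply: ub_le_sup => //; exists n.
  have [n0 _ /(_ n0 (leqnn _))] : \forall n \near \oo, `|A - a n| < e / 3.
    by move/cvgrPdist_lt : ca; exact.
  move=> /= /(le_lt_trans (ler_norm _)) h; exists n0 => n nn.
  rewrite -partial_tail // lerBlDl; apply: le_trans (aA n) _.
  by rewrite -lerBlDl ltW.
have h1 : `|f t x - \sum_(i < I) F i t x| <= e / 3.
  apply: (cvg_dist_le (n0 := I) (Hf t x)) => n In.
  rewrite (partial_tail (fun i => F i t x) In); apply: le_trans (ler_norm_sum _ _ _) _.
  by apply: le_trans (HI n In); apply: ler_sum => i _; exact: rep_bound (HF i).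
have C : (fun n => \sum_(i < I) \sum_(j < n) evl (P i j) t x) @ \oo --> \sum_(i < I) F i t x.
  elim: I {HI h1} => [|I IH].
    rewrite big_ord0; apply: cvg_near_cst; near=> n; exact: big_ord0.
  rewrite big_ord_recr /=; rewrite (_ : (fun n => _) =
    (fun n => \sum_(i < I) \sum_(j < n) evl (P i j) t x + \sum_(j < n) evl (P I j) t x)).
    by apply: cvgD => //; exact: (HP I).2.
  by apply/funext => n; rewrite big_ord_recr.
have [n0 _ Hn0] : \forall n \near \oo, `|\sum_(i < I) F i t x - \sum_(i < I) \sum_(j < n) evl (P i j) t x| < e / 3.
  by move/cvgrPdist_lt : C; exact.
near=> n.
have In : (I <= n)%N by near: n; exists I.
have h2 : `|\sum_(i < I) F i t x - \sum_(i < I) \sum_(j < n) evl (P i j) t x| < e / 3.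
  by apply: Hn0; near: n; exists n0.
have h3 : `|\sum_(I <= i < n) \sum_(j < n) evl (P i j) t x| <= e / 3.
  apply: le_trans (ler_norm_sum _ _ _) _; apply: le_trans (HI n In); apply: ler_sum => i _.
  apply: le_trans (ler_norm_sum _ _ _) _; apply: le_trans ((HP i).1 0 n).
  by apply: ler_sum => j _; exact: evl_le.
rewrite (S (fun P => evl P t x)); [|by move=> *; exact: evl_cat|by rewrite /evl big_nil].
have := partial_tail (fun i => \sum_(j < n) evl (P i j) t x) In.
move: h1 h2 h3; set X1 := \sum_(i < I) F i t x; set X2 := \sum_(i < I) _; set X3 := \sum_(I <= _ < _) _.
set X4 := \sum_(_ < n) _.
rewrite !ler_norml ltr_norml => /andP[? ?] /andP[? ?] /andP[? ?] ?; apply/andP; split; lra.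
Unshelve. all: by end_near. Qed.

(* Duhamel: the solution of g_t = g_xx + f, g(0) = 0 gains two derivatives, and
   one derivative together with a small factor. *)
Context (sig : R) (sig_gt0 : 0 < sig) (sig_le1 : sig <= 1).
Let eps := sig ^+ 2.
Definition clamp t := Num.max 0 (Num.min t eps).

Let eps_gt0 : 0 < eps. Proof. exact: exprn_gt0. Qed.
Let eps_le1 : eps <= 1. Proof. by rewrite /eps exprn_ile1 // ltW. Qed.

Lemma clamp_itv t : 0 <= clamp t <= eps.
Proof. by rewrite /clamp le_max lexx /= ge_max (ltW eps_gt0) ge_min lexx orbT. Qed.

Lemma clamp_id t : 0 <= t <= eps -> clamp t = t.
Proof. by move=> /andP[h1 h2]; rewrite /clamp min_l // max_r. Qed.

Lemma continuous_clamp : continuous clamp.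
Proof.
move=> t; apply: (@continuous_max _ _ (fun=> 0) (fun t => Num.min t eps)); first exact: cvg_cst.
by apply: (@continuous_min _ _ id (fun=> eps)); [exact: cvg_id|exact: cvg_cst].
Qed.

(** A bound for the integral of exp(- k^2 (t - s)) over s in [0, t] when t <= eps. The frequency 0
    is separate because 0^-1 = 0 would make the minimum vanish. *)
Definition theta k := if k == 0 then eps else Num.min eps (k ^+ 2)^-1.

Lemma theta_ge0 k : 0 <= theta k.
Proof.
by rewrite /theta; case: ifP => _; rewrite ?le_min ltW //= invr_ge0 sqr_ge0.
Qed.

Lemma theta_le_eps k : theta k <= eps.
Proof. by rewrite /theta; case: ifP => _ //; rewrite ge_min lexx. Qed.

Lemma theta_le1 k : k ^+ 2 * theta k <= 1.
Proof.
rewrite /theta; case: ifPn => [/eqP ->|k0]; first by rewrite expr0n mul0r ler01.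
have k20 : 0 < k ^+ 2 by rewrite exprn_even_gt0.
by rewrite mulrC -ler_pdivlMr // mul1r ge_min lexx orbT.
Qed.

Lemma theta2 k : (1 + `|k|) ^+ 2 * theta k <= 4.
Proof.
have h1 := theta_le_eps k; have h2 := theta_le1 k; have h3 := theta_ge0 k.
rewrite -real_normK ?num_real // in h2; move: h2; set a := `|k| => h2.
have a0 : 0 <= a by exact: normr_ge0.
have h4 : theta k <= 1 by apply: le_trans h1 eps_le1.
have : 0 <= (1 - a) ^+ 2 * theta k by rewrite mulr_ge0 // sqr_ge0.
rewrite !expr2 in h2 *; nra.
Qed.

(** Since k^2 theta <= 1 and theta <= eps, the geometric mean gives |k| theta <= sqrt eps = sig;
    this is why the time span is the square of [sig]. *)
Lemma theta1 k : (1 + `|k|) * theta k <= 2 * sig.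
Proof.
have h1 := theta_le_eps k; have h2 := theta_le1 k; have h3 := theta_ge0 k.
rewrite -real_normK ?num_real // in h2; move: h2; set a := `|k| => h2.
have a0 : 0 <= a by exact: normr_ge0.
rewrite /eps expr2 in h1.
have h5 : theta k <= sig by apply: le_trans h1 _; rewrite ger_pMl.
have h6 : a * theta k <= sig.
  rewrite -(@ler_pXn2r _ 2) ?nnegrE ?mulr_ge0 ?(ltW sig_gt0) // exprMn [theta k ^+ 2]expr2 mulrA.
  apply: (@le_trans _ _ (1 * theta k)); first by rewrite ler_wpM2r.
  by rewrite mul1r expr2.
lra.
Qed.

Let expk (k : R) (s : R) := expR (k ^+ 2 * s).

Let isd_expk (k t : R) : isd (expk k) t (k ^+ 2 * expk k t).
Proof.
have D : isd (fun t => k ^+ 2 * t) t (k ^+ 2).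
  apply: isd_eq (is_deriveM (is_derive_cst (k ^+ 2) t 1) (is_derive_id t 1)) _.
  by rewrite /GRing.scale /=; ring.
by apply: isd_eq (isd_chain (is_derive_expR _) D) _; rewrite mulrC.
Qed.

Let forcing (m : mode) t := expk (mk m) t * mc m t.

Let forcing_cont m : continuous (forcing m).
Proof. by move=> t; apply: cvgM; [exact: isd_cont (isd_expk _ _)|exact: mc_cont]. Qed.

Let forcing_le m t : `|forcing m t| <= mm m * expk (mk m) t.
Proof.
rewrite normrM mulrC (ger0_norm (expR_ge0 _)) ler_wpM2r ?expR_ge0 //.
exact: mc_le.
Qed.

(** The Duhamel coefficient: exp(- k^2 t) times the integral of exp(k^2 s) c(s) over [0, t]. *)
Let duhc (m : mode) t := (expk (mk m) t)^-1 * prim (forcing m) t.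

Let duhc_le m t : 0 <= t <= eps -> `|duhc m t| <= mm m * theta (mk m).
Proof.
move=> /andP[t0 te]; have [dP P0] := primP (@forcing_cont m).
have E0 : 0 < expk (mk m) t by exact: expR_gt0.
rewrite normrM normfV (gtr0_norm E0) ler_pdivrMl //.
have B1 : `|prim (forcing m) t| <= mm m * (t * expk (mk m) t).
  apply: (@comparison _ _ (forcing m) (fun s : R => mm m * (s * expk (mk m) t)) (fun=> mm m * expk (mk m) t) 0 t) => //.
  - move=> s _; apply: isd_eq (is_deriveM (is_derive_cst (mm m) s 1) (is_deriveM (is_derive_id s 1) (is_derive_cst (expk (mk m) t) s 1))) _.
    by rewrite /GRing.scale /=; ring.
  - move=> s /andP[_ st]; apply: le_trans (forcing_le m s) _.
    rewrite ler_wpM2l ?mm_ge0 // ler_expR ler_wpM2l ?sqr_ge0 //; exact: ltW.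
  - by rewrite P0 normr0 mul0r mulr0.
rewrite /theta; case: ifPn => [_|k0].
  apply: le_trans B1 _; rewrite [leRHS]mulrCA ler_wpM2l ?mm_ge0 //.
  by rewrite mulrC ler_wpM2l ?(ltW E0).
have k20 : 0 < mk m ^+ 2 by rewrite exprn_even_gt0.
have B2 : `|prim (forcing m) t| <= mm m * ((mk m ^+ 2)^-1 * expk (mk m) t).
  apply: (@comparison _ _ (forcing m) (fun s : R => mm m * ((mk m ^+ 2)^-1 * expk (mk m) s))
    (fun s : R => mm m * expk (mk m) s) 0 t) => //.
  - move=> s _; apply: isd_eq (is_deriveM (is_derive_cst (mm m) s 1) (is_deriveM (is_derive_cst (mk m ^+ 2)^-1 s 1) (isd_expk (mk m) s))) _.
    by rewrite /GRing.scale /=; field; rewrite k0.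
  - by rewrite P0 normr0 mulr_ge0 ?mm_ge0 // mulr_ge0 ?invr_ge0 ?sqr_ge0 // expR_ge0.
rewrite minEle; case: ifP => _.
  apply: le_trans B1 _; rewrite [leRHS]mulrCA ler_wpM2l ?mm_ge0 //.
  by rewrite mulrC ler_wpM2l ?(ltW E0).
by apply: le_trans B2 _; rewrite [leRHS]mulrCA [expk _ _ * _]mulrC.
Qed.

Let isd_duhc m t : isd (duhc m) t (- mk m ^+ 2 * duhc m t + mc m t).
Proof.
have [dP P0] := primP (@forcing_cont m).
have E0 : expk (mk m) t != 0 by rewrite gt_eqF // expR_gt0.
apply: isd_eq (is_deriveM (is_deriveV (f := expk (mk m)) E0 (isd_expk (mk m) t)) (dP t)) _.
by rewrite /GRing.scale /= /duhc /forcing; field.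
Qed.

(** Time is clamped to [0, eps], since a mode must be bounded at all times while [duhc_le] holds on
    that interval. *)
Definition mode_duh (m : mode) : mode.
Proof.
refine (@Mode (mk m) (mb m) (fun t => duhc m (clamp t)) (mm m * theta (mk m)) _ _ (mk_int m)).
- move=> t; apply: (@continuous_comp _ _ _ clamp (duhc m)); first exact: continuous_clamp.
  exact: isd_cont (isd_duhc m _).
- by move=> t; apply: duhc_le; exact: clamp_itv.
Defined.

Lemma isd_mode_duh m t x : 0 < t < eps ->
  isd (fun t => mc (mode_duh m) t * cos (mk m * x + mb m)) t
    (evl (map mode_dx (map mode_dx [:: mode_duh m])) t x + evl [:: m] t x).
Proof.
move=> te; rewrite /evl /= !big_seq1 /=.
have D : isd (fun t => duhc m (clamp t)) t (- mk m ^+ 2 * duhc m t + mc m t).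
  apply: near_oo_isd te (isd_duhc m t) => s /andP[s0 s1].
  by rewrite clamp_id // !ltW.
have [t0 t1] := andP te.
apply: isd_eq (is_deriveM D (is_derive_cst (cos (mk m * x + mb m)) t 1)) _.
rewrite /GRing.scale /= clamp_id ?ltW // !addrA cosDpi2.
have -> : mk m * x + mb m + pi / 2 = (mk m * x + mb m) + pi / 2 by [].
by rewrite sinD cos_pihalf sin_pihalf; ring.
Qed.

Lemma isd_evl_duh P t x : 0 < t < eps ->
  isd (fun t => evl (map mode_duh P) t x) t
    (evl (map mode_dx (map mode_dx (map mode_duh P))) t x + evl P t x).
Proof.
move=> te; elim: P => [|m P IH].
  by rewrite /evl !big_nil addr0; apply: (@isd_ext _ (fun=> 0)) => s; rewrite big_nil.
have D := isd_mode_duh m x te.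
apply: (@isd_ext _ (fun t => mc (mode_duh m) t * cos (mk m * x + mb m) + evl (map mode_duh P) t x)).
  by move=> s; rewrite /evl /= big_cons.
apply: isd_eq (is_deriveD D IH) _; rewrite /evl /= !big_cons !big_nil /=; ring.
Qed.

Lemma nrm_duh2 d s P : nrm d.+2 s (map mode_duh P) <= 4 * nrm d s P.
Proof.
rewrite /nrm big_map mulr_sumr; apply: ler_sum => m _ /=.
have h := theta2 (mk m).
rewrite -mulrA [leRHS]mulrCA ler_wpM2l ?mm_ge0 // /wgt -[d.+2]addn2 exprD.
rewrite mulrCA -!mulrA; rewrite ![in leRHS]mulrA [4 * _]mulrC -![in leRHS]mulrA ler_wpM2l ?exprn_ge0 ?addr_ge0 //.
by rewrite !mulrA ler_wpM2r ?exprn_ge0 ?base0 // mulrC.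
Qed.

Lemma nrm_duh1 d s P : nrm d.+1 s (map mode_duh P) <= 2 * sig * nrm d s P.
Proof.
rewrite /nrm big_map mulr_sumr; apply: ler_sum => m _ /=.
have h := theta1 (mk m).
rewrite -mulrA [leRHS]mulrCA ler_wpM2l ?mm_ge0 // /wgt exprSr.
rewrite mulrCA -!mulrA; rewrite ![in leRHS]mulrA [2 * sig * _]mulrC -![in leRHS]mulrA ler_wpM2l ?exprn_ge0 ?addr_ge0 //.
by rewrite !mulrA ler_wpM2r ?exprn_ge0 ?base0 // mulrC.
Qed.

Lemma nrm_duh0 d s P : nrm d s (map mode_duh P) <= nrm d s P.
Proof.
rewrite /nrm big_map; apply: ler_sum => m _ /=.
rewrite ler_wpM2r ?wgt_ge0 // ler_piMr ?mm_ge0 //.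
exact: le_trans (theta_le_eps _) eps_le1.
Qed.

Lemma evl_duh_neg P t x : t <= 0 -> evl (map mode_duh P) t x = 0.
Proof.
move=> t0; rewrite /evl big_map big1 // => m _ /=.
have -> : clamp t = 0 by rewrite /clamp max_l // ge_min t0.
by rewrite /duhc (primP (@forcing_cont m)).2 mulr0 mul0r.
Qed.

Lemma rep_duhamel d M f : rep d M f -> exists g, [/\ rep d.+2 (4 * M) g,
  rep d.+1 (2 * sig * M) g, (forall t x, t <= 0 -> g t x = 0) &
  forall t x, 0 < t < eps -> isd (g ^~ x) t (dx (dx g) t x + f t x)].
Proof.
move=> [P [HM Hf]]; pose Q j := map mode_duh (P j).
have HQ (s n : nat) : \sum_(j < n) nrm d s (Q j) <= M.
  by apply: le_trans (HM s n); apply: ler_sum => j _; exact: nrm_duh0.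
have LQ := rep_lsum HQ; have [g Hg] := lsum_cvg LQ; exists g.
have R2 : rep d.+2 (4 * M) g.
  exists Q; split=> // s n; apply: (@le_trans _ _ (4 * \sum_(j < n) nrm d s (P j))).
    by rewrite mulr_sumr; apply: ler_sum => j _; exact: nrm_duh2.
  by rewrite ler_wpM2l.
have R1 : rep d.+1 (2 * sig * M) g.
  exists Q; split=> // s n; apply: (@le_trans _ _ (2 * sig * \sum_(j < n) nrm d s (P j))).
    by rewrite mulr_sumr; apply: ler_sum => j _; exact: nrm_duh1.
  by rewrite ler_wpM2l // mulr_ge0 // ltW.
split=> // [t x t0|t x te].
  have := Hg t x; under eq_fun do under eq_bigr do rewrite evl_duh_neg //.
  under eq_fun do rewrite big1 //.
  by move=> /cvg_lim <- //; rewrite lim_cst.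
have [g1 Hg1] := lsum_cvg (lsum_dx LQ).
have [g2 Hg2] := lsum_cvg (lsum_dx (lsum_dx LQ)).
have D1 := evl_series_dx LQ Hg Hg1.
have D2 := evl_series_dx (lsum_dx LQ) Hg1 Hg2.
have E1 : dx g = g1 by apply/funext => t'; apply/funext => x'; exact: isd_dx (D1 t' x').
have E2 : dx (dx g) = g2 by rewrite E1; apply/funext => t'; apply/funext => x'; exact: isd_dx (D2 t' x').
rewrite E2; have [e e0 He] := lsum_unif (lsum_dx (lsum_dx LQ)) Hg2.
have [e' e0' He'] := rep_rate HM Hf.
have K := @isd_uniform_limit _ (fun n (s : R) => \sum_(j < n) evl (Q j) s x)
  (fun n (s : R) => \sum_(j < n) evl (map mode_dx (map mode_dx (Q j))) s x + \sum_(j < n) evl (P j) s x)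
  (g ^~ x) (fun s : R => g2 s x + f s x) (fun n => e n + e' n) 0 eps.
apply: (K _ _ _ _ t te) => //.
- move=> n s se; rewrite -big_split /=.
  apply: (isd_sum (F := fun j (s : R) => evl (Q j) s x)
    (G := fun j (s : R) => evl (map mode_dx (map mode_dx (Q j))) s x + evl (P j) s x)) => j.
  exact: isd_evl_duh.
- move=> n s se; have := He n s x; have := He' n s x.
  rewrite !ler_norml => /andP[? ?] /andP[? ?]; apply/andP; split; lra.
- by rewrite -[X in _ --> X](addr0 0); exact: cvgD.
Qed.

End Wiener.

(** * Fixed-point iteration for the flow in arclength parameter *)

Section FixedPoint.
Context {R : realType} (M N : R) (M1 : 1 <= M) (N0 : 0 <= N) (NM : N <= M).
Context (kap : R) (eta : nat -> R) (eta_gt0 : forall s, 0 < eta s).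
Implicit Types (f g u D H W : R -> R -> R) (t x p : R).

Local Notation rep := (rep kap eta).

Context (A1 A0 sig : R) (A1_gt0 : 0 < A1) (A1_le1 : A1 <= 1) (A0_gt0 : 0 < A0) (A01 : A0 <= A1).
Context (sig_gt0 : 0 < sig) (sig_le1 : sig <= 1).
(** Origin of the constants. [rhs_diff] has the factor 11 M^2 A1, which the two-derivative gain
    multiplies by 4; the first equation makes the product 1/2. [prod_diff] has 52 M^2 A0 and
    [Wmap_diff] one more M; the second equation makes this A1 / 2. With the third, [sig] is small
    enough both for 2 sig (11 M^2 A1) <= A0 / 2 in the one-derivative gain and for the first
    iterate. *)
Context (AE : [/\ 88 * M ^+ 2 * A1 = 1, 104 * M ^+ 3 * A0 = A1 & 88 * 104 * 44 * M ^+ 8 * sig = 1]).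
Context (u0 v0 w0 : R -> R -> R).
Context (ru0 : rep 3 M u0) (rv0 : rep 3 M v0) (rw0 : rep 1 M w0).

(** The unknowns are deviations: u + D for a component of the curve, 1 + H for 1 / |z_x|^2 and w0 +
    W for 1 / |z|^2. Taking D_xx out of (1 + H) (u + D)_xx - N (w0 + W) (u + D) leaves this
    forcing. *)
Definition rhs u D H W t x := H t x * dx (dx D) t x + (1 + H t x) * dx (dx u) t x
  - N * ((w0 t x + W t x) * (u t x + D t x)).
(** [qd] and [qr] are the changes of |z_x|^2 (initially 1) and of |z|^2. [Hmap] and [Wmap] rewrite
    (1 + qd) (1 + H) = 1 and (|z_0|^2 + qr) (w0 + W) = 1 as fixed-point equations without division,
    using |z_0|^2 w0 = 1. *)
Definition qd D1 D2 t x := 2 * (dx u0 t x * dx D1 t x + dx v0 t x * dx D2 t x)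
  + (dx D1 t x * dx D1 t x + dx D2 t x * dx D2 t x).
Definition qr D1 D2 t x := 2 * (u0 t x * D1 t x + v0 t x * D2 t x)
  + (D1 t x * D1 t x + D2 t x * D2 t x).
Definition Hmap D1 D2 H t x := - (qd D1 D2 t x * (1 + H t x)).
Definition Wmap D1 D2 W t x := - (w0 t x * (qr D1 D2 t x * (w0 t x + W t x))).

Let M_gt0 : 0 < M. Proof. exact: lt_le_trans ltr01 M1. Qed.
Let Mn1 n : 1 <= M ^+ n. Proof. exact: exprn_ege1. Qed.

Local Ltac consts := have ? := M1; have ? := A01; have ? := A1_le1; have ? := A0_gt0;
  have ? := A1_gt0; have ? := M_gt0.

Lemma dxB f g : lrep kap f -> lrep kap g ->
  dx (fun t x => f t x - g t x) = fun t x => dx f t x - dx g t x.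
Proof.
move=> /(@lrep_dx R kap)[df _] /(@lrep_dx R kap)[dg _].
by apply/funext => t; apply/funext => x; apply: isd_dx; apply: is_deriveB.
Qed.

Lemma dxD f g : lrep kap f -> lrep kap g ->
  dx (fun t x => f t x + g t x) = fun t x => dx f t x + dx g t x.
Proof.
move=> /(@lrep_dx R kap)[df _] /(@lrep_dx R kap)[dg _].
by apply/funext => t; apply/funext => x; apply: isd_dx; apply: is_deriveD.
Qed.

Lemma rep_ddx d K f : rep d.+2 K f -> rep d K (dx (dx f)).
Proof. by move=> Hf; apply: rep_dx => //; apply: rep_dx. Qed.

(** Two norms: with weight 2 the deviation is merely bounded, with weight 1 it is small. The second
    controls D and D_x, hence H and W, and these are the factors multiplying second derivatives. *)
Definition sizeD D := rep 2 2 D /\ rep 1 (2 * A0) D.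
Definition distD p D E := rep 2 p (fun t x => E t x - D t x) /\
   rep 1 (A0 * p) (fun t x => E t x - D t x).
Definition distH p H K := rep 0 (A1 * p) (fun t x => K t x - H t x).
Definition sizeH H := rep 0 (2 * A1) H.

(** The critical term is H D_xx: the difference of its factors H carries A1 by [distH], and the
    difference of the second derivatives, of size p only, is multiplied by the small H. All
    remaining terms are of lower order. *)
Lemma rhs_diff p u D E H K W V : 0 <= p -> rep 3 M u ->
  sizeD D -> sizeD E -> sizeH H -> sizeH K -> sizeH W -> sizeH V ->
  distD p D E -> distH p H K -> distH p W V ->
  rep 0 (11 * M ^+ 2 * A1 * p) (fun t x => rhs u E K V t x - rhs u D H W t x).
Proof.
move=> p0 ru [D2 D1] [E2 E1] sH sK sW sV [dD2 dD1] dH dW.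
have ru2 : rep 0 M (dx (dx u)) by apply: rep_le (rep_ddx ru).
have E2' := rep_ddx E2.
have E0 : dx (dx (fun t x => E t x - D t x)) = fun t x => dx (dx E) t x - dx (dx D) t x.
  have LE := rep_lrep eta_gt0 E2; have LD := rep_lrep eta_gt0 D2.
  rewrite dxB // dxB //; [exact: (lrep_dx LE).2|exact: (lrep_dx LD).2].
have dD2' : rep 0 p (fun t x => dx (dx E) t x - dx (dx D) t x) by rewrite -E0; apply: rep_ddx dD2.
have ru' : rep 0 M u by apply: rep_le ru.
have E1' : rep 0 (2 * A0) E by apply: rep_le E1.
have dD1' : rep 0 (A0 * p) (fun t x => E t x - D t x) by apply: rep_le dD1.
have rw' : rep 0 M w0 by apply: rep_le rw0.
have X := repB eta_gt0 (repD (repD (repM eta_gt0 dH E2') (repM eta_gt0 sH dD2')) (repM eta_gt0 dH ru2))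
  (repZ eta_gt0 N (repD (repM eta_gt0 dW (repD ru' E1')) (repM eta_gt0 (repD rw' sW) dD1'))).
apply: rep_le (rep_ext _ X) => //; last first.
  move=> t x; rewrite /rhs; move: (dx (dx E) t x) (dx (dx D) t x) (dx (dx u) t x) (K t x) (H t x).
  by move: (V t x) (W t x) (w0 t x) (u t x) (E t x) (D t x) => *; ring.
rewrite (ger0_norm N0).
have x0 : 0 <= A1 * p by rewrite mulr_ge0 // ltW.
have y0 : 0 <= A0 * p <= A1 * p by rewrite mulr_ge0 ?(ltW A0_gt0) //= ler_wpM2r.
set z := A1 * p in x0 y0 *; set y := A0 * p in y0 *; have /andP[y1 y2] := y0.
have h1 : A1 * p * (M + 2 * A0) + (M + 2 * A1) * y <= z * (M + 2) + (M + 2) * z.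
  apply: lerD; first by rewrite ler_wpM2l //; consts; lra.
  by apply: ler_pM => //; consts; lra.
have h2 : N * (A1 * p * (M + 2 * A0) + (M + 2 * A1) * y) <= M * (z * (M + 2) + (M + 2) * z).
  apply: ler_pM => //; apply: addr_ge0; apply: mulr_ge0 => //; consts; lra.
have h3 : z <= M * z by rewrite ler_peMl.
have h4 : M * z <= M * (M * z) by rewrite ler_wpM2l // ltW.
have -> : 11 * M ^+ 2 * A1 * p = 11 * (M * (M * z)) by rewrite /z; ring.
move: h2; rewrite -/z.
have -> : M * (z * (M + 2) + (M + 2) * z) = 2 * (M * (M * z)) + 4 * (M * z) by ring.
have : 2 * A1 * p = 2 * z by rewrite /z mulrA.
lra.
Qed.

Lemma q_diff p a b D1 D2 E1 E2 (F := fun a b D1 D2 t x => 2 * (a t x * D1 t x + b t x * D2 t x)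
  + (D1 t x * D1 t x + D2 t x * D2 t x)) : 0 <= p -> rep 0 M a -> rep 0 M b ->
  rep 0 (2 * A0) D1 -> rep 0 (2 * A0) D2 -> rep 0 (2 * A0) E1 -> rep 0 (2 * A0) E2 ->
  rep 0 (A0 * p) (fun t x => E1 t x - D1 t x) ->  rep 0 (A0 * p) (fun t x => E2 t x - D2 t x) ->
  rep 0 (16 * M * A0) (F a b D1 D2) /\
  rep 0 (12 * M * A0 * p) (fun t x => F a b E1 E2 t x - F a b D1 D2 t x).
Proof.
move=> p0 ra rb rD1 rD2 rE1 rE2 d1 d2; split.
  have X := repD (repZ eta_gt0 2 (repD (repM eta_gt0 ra rD1) (repM eta_gt0 rb rD2)))
    (repD (repM eta_gt0 rD1 rD1) (repM eta_gt0 rD2 rD2)).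
  apply: rep_le X => //; rewrite ger0_norm //.
  have h1 : A0 * A0 <= 1 * A0 by rewrite ler_wpM2r ?(ltW A0_gt0) //; consts; lra.
  have h2 : 1 * A0 <= M * A0 by rewrite ler_wpM2r ?(ltW A0_gt0).
  have -> : 2 * (M * (2 * A0) + M * (2 * A0)) + (2 * A0 * (2 * A0) + 2 * A0 * (2 * A0))
     = 8 * (M * A0) + 8 * (A0 * A0) by ring.
  have -> : 16 * M * A0 = 16 * (M * A0) by ring.
  lra.
have X := repD (repZ eta_gt0 2 (repD (repM eta_gt0 ra d1) (repM eta_gt0 rb d2)))
    (repD (repM eta_gt0 (repD rE1 rD1) d1) (repM eta_gt0 (repD rE2 rD2) d2)).
apply: rep_le (rep_ext _ X) => //; last by move=> t x; rewrite /F; ring.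
rewrite ger0_norm //.
set y := A0 * p; have y0 : 0 <= y by rewrite mulr_ge0 // ltW.
have h1 : A0 * y <= 1 * y by rewrite ler_wpM2r //; consts; lra.
have h2 : 1 * y <= M * y by rewrite ler_wpM2r.
have -> : 2 * (M * y + M * y) + ((2 * A0 + 2 * A0) * y + (2 * A0 + 2 * A0) * y)
     = 4 * (M * y) + 8 * (A0 * y) by ring.
have -> : 12 * M * A0 * p = 12 * (M * y) by rewrite /y; ring.
lra.
Qed.

Lemma prod_diff p (Q Q' : R -> R -> R) w H K : 0 <= p -> rep 0 M w -> sizeH K ->
  rep 0 (16 * M * A0) Q -> rep 0 (12 * M * A0 * p) (fun t x => Q' t x - Q t x) ->
  distH p H K ->
  rep 0 (52 * M ^+ 2 * A0 * p) (fun t x => Q' t x * (w t x + K t x) - Q t x * (w t x + H t x)).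
Proof.
move=> p0 rw sK rQ dQ dH.
have X := repD (repM eta_gt0 dQ (repD rw sK)) (repM eta_gt0 rQ dH).
apply: rep_le (rep_ext _ X) => //; last by move=> t x; ring.
set y := A0 * p; have y0 : 0 <= y by rewrite mulr_ge0 // ltW.
have -> : 12 * M * A0 * p * (M + 2 * A1) + 16 * M * A0 * (A1 * p) =
  (M * y) * (12 * M + 40 * A1) by rewrite /y; ring.
have -> : 52 * M ^+ 2 * A0 * p = (M * y) * (52 * M) by rewrite /y; ring.
by rewrite ler_wpM2l ?mulr_ge0 ?(ltW M_gt0) //; consts; lra.
Qed.

Lemma qd_diff p D1 D2 E1 E2 : 0 <= p -> sizeD D1 -> sizeD D2 -> sizeD E1 -> sizeD E2 ->
  distD p D1 E1 -> distD p D2 E2 -> rep 0 (16 * M * A0) (qd D1 D2) /\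
  rep 0 (12 * M * A0 * p) (fun t x => qd E1 E2 t x - qd D1 D2 t x).
Proof.
move=> p0 sD1 sD2 sE1 sE2 d1 d2.
have dd D E : sizeD D -> sizeD E -> distD p D E ->
    rep 0 (A0 * p) (fun t x => dx E t x - dx D t x).
  move=> [_ D'] [_ E'] [_ d]; have LE := rep_lrep eta_gt0 E'; have LD := rep_lrep eta_gt0 D'.
  by have := rep_dx eta_gt0 d; rewrite dxB.
apply: (@q_diff p (dx u0) (dx v0) (dx D1) (dx D2) (dx E1) (dx E2)) => //.
- by apply: rep_le (rep_dx eta_gt0 ru0).
- by apply: rep_le (rep_dx eta_gt0 rv0).
- exact: rep_dx eta_gt0 _ _ _ sD1.2.
- exact: rep_dx eta_gt0 _ _ _ sD2.2.
- exact: rep_dx eta_gt0 _ _ _ sE1.2.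
- exact: rep_dx eta_gt0 _ _ _ sE2.2.
- exact: dd.
- exact: dd.
Qed.

Lemma qr_diff p D1 D2 E1 E2 : 0 <= p -> sizeD D1 -> sizeD D2 -> sizeD E1 -> sizeD E2 ->
  distD p D1 E1 -> distD p D2 E2 -> rep 0 (16 * M * A0) (qr D1 D2) /\
  rep 0 (12 * M * A0 * p) (fun t x => qr E1 E2 t x - qr D1 D2 t x).
Proof.
move=> p0 [_ sD1] [_ sD2] [_ sE1] [_ sE2] [_ d1] [_ d2].
have L d K f : rep d K f -> rep 0 K f by apply: rep_le.
apply: (@q_diff p u0 v0 D1 D2 E1 E2) => //; [exact: L ru0|exact: L rv0|exact: L sD1|
  exact: L sD2|exact: L sE1|exact: L sE2|exact: L d1|exact: L d2].
Qed.

Lemma Hmap_diff p D1 D2 E1 E2 H K : 0 <= p -> sizeD D1 -> sizeD D2 -> sizeD E1 -> sizeD E2 ->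
  distD p D1 E1 -> distD p D2 E2 -> sizeH K -> distH p H K ->
  distH (p / 2) (Hmap D1 D2 H) (Hmap E1 E2 K).
Proof.
move=> p0 sD1 sD2 sE1 sE2 d1 d2 sK dH.
have [q1 q2] := qd_diff p0 sD1 sD2 sE1 sE2 d1 d2.
have r1 : rep 0 M (fun _ _ : R => 1) by apply: rep_le (rep_cst kap eta 0 1) => //; rewrite normr1.
have X := repN eta_gt0 (prod_diff p0 r1 sK q1 q2 dH).
apply: rep_le (rep_ext _ X) => //; last by move=> t x; rewrite /Hmap; ring.
have [_ <- _] := AE.
have -> : 104 * M ^+ 3 * A0 * (p / 2) = 52 * M ^+ 2 * A0 * p * M by field.
by rewrite ler_peMr // !mulr_ge0 ?exprn_ge0 // ltW.
Qed.

Lemma Wmap_diff p D1 D2 E1 E2 H K : 0 <= p -> sizeD D1 -> sizeD D2 -> sizeD E1 -> sizeD E2 ->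
  distD p D1 E1 -> distD p D2 E2 -> sizeH K -> distH p H K ->
  distH (p / 2) (Wmap D1 D2 H) (Wmap E1 E2 K).
Proof.
move=> p0 sD1 sD2 sE1 sE2 d1 d2 sK dH.
have [q1 q2] := qr_diff p0 sD1 sD2 sE1 sE2 d1 d2.
have r1 : rep 0 M w0 by apply: rep_le rw0.
have X := repN eta_gt0 (repM eta_gt0 r1 (prod_diff p0 r1 sK q1 q2 dH)).
apply: rep_le (rep_ext _ X) => //; last by move=> t x; rewrite /Wmap; ring.
have [_ <- _] := AE.
suff -> : 104 * M ^+ 3 * A0 * (p / 2) = M * (52 * M ^+ 2 * A0 * p) by [].
by field.
Qed.

Record state := State { s1 : R -> R -> R; s2 : R -> R -> R; sH : R -> R -> R; sW : R -> R -> R }.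

Definition sized c (S : state) := [/\ rep 2 c (s1 S) /\ rep 1 (A0 * c) (s1 S),
  rep 2 c (s2 S) /\ rep 1 (A0 * c) (s2 S), rep 0 (A1 * c) (sH S) & rep 0 (A1 * c) (sW S)].
Definition close p (S T : state) := [/\ distD p (s1 S) (s1 T), distD p (s2 S) (s2 T),
  distH p (sH S) (sH T) & distH p (sW S) (sW T)].
Definition linear_step (S T : state) := [/\
  forall t x, 0 < t < sig ^+ 2 ->
    isd (s1 T ^~ x) t (dx (dx (s1 T)) t x + rhs u0 (s1 S) (sH S) (sW S) t x),
  forall t x, 0 < t < sig ^+ 2 ->
    isd (s2 T ^~ x) t (dx (dx (s2 T)) t x + rhs v0 (s2 S) (sH S) (sW S) t x),
  sH T = Hmap (s1 S) (s2 S) (sH S), sW T = Wmap (s1 S) (s2 S) (sW S) &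
  forall t x, t <= 0 -> s1 T t x = 0 /\ s2 T t x = 0].
(** Here p bounds the last increment and c the size reached before it. Each step halves p and adds
    it to c, so that c = 2 - 2 p throughout and no size exceeds 2. *)
Definition inv p c S T := [/\ sized c S, sized (c + p) T, close p S T & linear_step S T].

Lemma sized_le c S : c <= 2 -> sized c S -> [/\ sizeD (s1 S), sizeD (s2 S), sizeH (sH S) & sizeH (sW S)].
Proof.
move=> c2 [[a1 a2] [b1 b2] a3 a4].
have h1 : A1 * c <= 2 * A1 by rewrite mulrC ler_wpM2r // ltW.
have h0 : A0 * c <= 2 * A0 by rewrite mulrC ler_wpM2r // ltW.
split; rewrite /sizeD /sizeH; first split; last first.
- exact: rep_le a4.
- exact: rep_le a3.
- by split; [exact: rep_le b1|exact: rep_le b2].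
- exact: rep_le a2.
- exact: rep_le a1.
Qed.

(** Only the increment is solved for, with the difference of two successive forcings on the right;
    adding it to the previous iterate gives the next one, and the contraction is the bound of this
    difference. *)
Lemma duhamel_increment p u D E H K W V : 0 <= p -> rep 3 M u ->
  sizeD D -> sizeD E -> sizeH H -> sizeH K -> sizeH W -> sizeH V ->
  distD p D E -> distH p H K -> distH p W V ->
  (forall t x, 0 < t < sig ^+ 2 -> isd (E ^~ x) t (dx (dx E) t x + rhs u D H W t x)) ->
  (forall t x, t <= 0 -> E t x = 0) ->
  exists G, [/\ distD (p / 2) E G,
    forall t x, 0 < t < sig ^+ 2 -> isd (G ^~ x) t (dx (dx G) t x + rhs u E K V t x) &
    forall t x, t <= 0 -> G t x = 0].
Proof.
move=> p0 ru sD sE sH' sK sW' sV dD dH dW EqE E0.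
have X := rhs_diff p0 ru sD sE sH' sK sW' sV dD dH dW.
have [g [g2 g1 g0 dg]] := rep_duhamel eta_gt0 sig_gt0 sig_le1 X.
have [AE1 AE2 AE3] := AE.
have e1 : M ^+ 2 * A1 = 88^-1.
  by apply: (@mulfI _ 88) => //; rewrite mulrA AE1 mulfV.
have L2 : rep 2 (p / 2) g.
  apply: rep_le g2 => //.
  by rewrite -[11 * M ^+ 2 * A1]mulrA e1; lra.
have L1 : rep 1 (A0 * (p / 2)) g.
  apply: rep_le g1 => //.
  have -> : 2 * sig * (11 * M ^+ 2 * A1 * p) = (44 * M ^+ 2 * A1 * sig) * (p / 2) by field.
  rewrite ler_wpM2r ?divr_ge0 // -(@ler_pM2l _ (104 * M ^+ 3)) ?mulr_gt0 ?exprn_gt0 // AE2.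
  have -> : 104 * M ^+ 3 * (44 * M ^+ 2 * A1 * sig) = (A1 * sig) * (104 * 44 * M ^+ 5) by ring.
  rewrite -mulrA ger_pMr //.
  have h1 : sig * (104 * 44 * M ^+ 5) * (88 * M ^+ 3) = 1 by rewrite -[RHS]AE3; ring.
  rewrite -[leRHS]h1 ler_peMr ?mulr_ge0 ?exprn_ge0 ?(ltW M_gt0) ?(ltW sig_gt0) //.
  by have := Mn1 3; lra.
exists (fun t x => E t x + g t x); split.
- by split; apply: rep_ext (_ : forall t x, g t x = _) _; try (by move=> t x; rewrite addrAC subrr add0r).
- move=> t x te; have LE := rep_lrep eta_gt0 sE.2; have Lg := rep_lrep eta_gt0 g2.
  rewrite dxD // dxD //; [|exact: (lrep_dx LE).2|exact: (lrep_dx Lg).2].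
  apply: isd_eq (is_deriveD (EqE t x te) (dg t x te)) _.
  by move: (dx (dx E) t x) (rhs u D H W t x) (dx (dx g) t x) (rhs u E K V t x) => *; ring.
- by move=> t x t0; rewrite E0 // g0 // addr0.
Qed.

Lemma repT d a b f g : rep d a f -> rep d b (fun t x => g t x - f t x) -> rep d (a + b) g.
Proof. by move=> rf rg; apply: rep_ext (repD rf rg) => t x; rewrite addrC subrK. Qed.

Lemma next_step p c S T : 0 <= p -> 0 <= c -> c + p <= 2 -> inv p c S T ->
  exists U, inv (p / 2) (c + p) T U.
Proof.
move=> p0 c0 cp [sS sT [d1 d2 dH dW] [E1 E2 EH EW E0]].
have c2 : c <= 2 by apply: le_trans cp; rewrite lerDl.
have [S1 S2 SH SW] := sized_le c2 sS; have [T1 T2 TH TW] := sized_le cp sT.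
have [G1 [dG1 EG1 G10]] := duhamel_increment p0 ru0 S1 T1 SH TH SW TW d1 dH dW E1 (fun t x h => (E0 t x h).1).
have [G2 [dG2 EG2 G20]] := duhamel_increment p0 rv0 S2 T2 SH TH SW TW d2 dH dW E2 (fun t x h => (E0 t x h).2).
have hH := Hmap_diff p0 S1 S2 T1 T2 d1 d2 TH dH; rewrite -EH in hH.
have hW := Wmap_diff p0 S1 S2 T1 T2 d1 d2 TW dW; rewrite -EW in hW.
exists (State G1 G2 (Hmap (s1 T) (s2 T) (sH T)) (Wmap (s1 T) (s2 T) (sW T))).
split => //.
have [[a1 a2] [b1 b2] a3 a4] := sT.
rewrite /sized !(mulrDr _ (c + p)); split=> /=.
- by split; [exact: repT a1 dG1.1|exact: repT a2 dG1.2].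
- by split; [exact: repT b1 dG2.1|exact: repT b2 dG2.2].
- exact: repT a3 hH.
- exact: repT a4 hW.
- by split=> //= t x t0; rewrite G10 // G20.
Qed.

(** The data have weight 3, so that the first forcing u_xx - N w0 u has weight 1. The one-derivative
    gain, with its small factor, then already reaches weight 2. *)
Lemma first_step : exists T, inv 1 0 (State (fun _ _ => 0) (fun _ _ => 0) (fun _ _ => 0) (fun _ _ => 0)) T.
Proof.
have r0 d a : 0 <= a -> rep d a (fun _ _ : R => 0).
  by move=> a0; apply: rep_le (rep_cst kap eta d 0) => //; rewrite normr0.
pose Z := fun _ _ : R => 0 : R.
have dZ : dx Z = Z by apply/funext => t; apply/funext => x; apply: isd_dx; exact: is_derive_cst.
have [AE1 AE2 AE3] := AE.
have base u : rep 3 M u -> exists g, [/\ rep 2 1 g /\ rep 1 A0 g,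
    forall t x, 0 < t < sig ^+ 2 -> isd (g ^~ x) t (dx (dx g) t x + rhs u Z Z Z t x) &
    forall t x, t <= 0 -> g t x = 0].
  move=> ru; have ru2 := rep_ddx ru.
  have X := repB eta_gt0 ru2 (repZ eta_gt0 N (repM eta_gt0 rw0 (rep_le eta_gt0 (isT : (1 <= 3)%N) (lexx M) ru))).
  have {}X : rep 1 (2 * M ^+ 3) (rhs u Z Z Z).
    apply: rep_le (rep_ext _ X) => //; last first.
      by move=> t x; rewrite /rhs dZ dZ /Z; move: (dx (dx u) t x) => *; ring.
    rewrite (ger0_norm N0).
    have h1 : N * (M * M) <= M * (M * M) by rewrite ler_wpM2r ?mulr_ge0 ?(ltW M_gt0).
    have h2 : M * 1 <= M * (M * M) by rewrite ler_wpM2l ?mulr_ege1 ?(ltW M_gt0).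
    by rewrite !exprS expr0; lra.
  have [g [g2 g1 g0 dg]] := rep_duhamel eta_gt0 sig_gt0 sig_le1 X.
  have hA : 2 * sig * (2 * M ^+ 3) <= A0.
    rewrite -(@ler_pM2l _ (104 * M ^+ 3)) ?mulr_gt0 ?exprn_gt0 // AE2.
    rewrite -(@ler_pM2l _ (88 * M ^+ 2)) ?mulr_gt0 ?exprn_gt0 // AE1 -[leRHS]AE3.
    have -> : 88 * M ^+ 2 * (104 * M ^+ 3 * (2 * sig * (2 * M ^+ 3))) = 88 * 104 * 4 * M ^+ 8 * sig by ring.
    by rewrite ler_wpM2r ?(ltW sig_gt0) // ler_wpM2r ?exprn_ge0 ?(ltW M_gt0) //; lra.
  exists g; split=> //; split; apply: rep_le g1 => //.
  by apply: le_trans hA _; consts; lra.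
have [g1 [[a1 a2] a3 a4]] := base _ ru0; have [g2 [[b1 b2] b3 b4]] := base _ rv0.
exists (State g1 g2 Z Z); split.
- by rewrite /sized !mulr0; split=> /=; (try split); exact: r0.
- rewrite /sized add0r !mulr1; split=> //=; apply: r0; exact: ltW.
- split; rewrite /distD /distH /= ?mulr1.
  + by split; [apply: rep_ext a1|apply: rep_ext a2] => t x; rewrite subr0.
  + by split; [apply: rep_ext b1|apply: rep_ext b2] => t x; rewrite subr0.
  + by apply: rep_ext (r0 0 A1 (ltW A1_gt0)) => t x; rewrite subr0.
  + by apply: rep_ext (r0 0 A1 (ltW A1_gt0)) => t x; rewrite subr0.
- split=> //=; last by move=> t x t0; rewrite a4 // b4.
  + apply/funext => t; apply/funext => x; rewrite /Hmap /qd -/Z dZ /Z; ring.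
  + apply/funext => t; apply/funext => x; rewrite /Wmap /qr /= /Z; ring.
Qed.

Let hp n : R := 2^-1 ^+ n.

Let hp_ge0 n : 0 <= hp n. Proof. by rewrite exprn_ge0 // invr_ge0. Qed.
Let hpS n : hp n.+1 = hp n / 2. Proof. exact: exprSr. Qed.
Let hp_le1 n : hp n <= 1. Proof. by rewrite exprn_ile1 ?invr_ge0 // invf_le1 //; lra. Qed.

Lemma iterates : exists S : nat -> state,
  S 0 = State (fun _ _ => 0) (fun _ _ => 0) (fun _ _ => 0) (fun _ _ => 0) /\
  forall n, inv (hp n) (2 - 2 * hp n) (S n) (S n.+1).
Proof.
pose Q n (X : state * state) := inv (hp n) (2 - 2 * hp n) X.1 X.2.
(* Pairs of consecutive states, since a step needs both; off [Q] the successor is arbitrary, which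
   makes the relation total for [choice]. *)
have nxt n X : exists Y, Q n X -> Q n.+1 Y /\ Y.1 = X.2.
  have [HQ|HQ] := pselect (Q n X); last by exists X.
  have := hp_ge0 n; have := hp_le1 n => h1 h2.
  have [||U HU] := @next_step _ _ _ _ (hp_ge0 n) _ _ HQ; [lra|lra|].
  exists (X.2, U) => _; split=> //; rewrite /Q /= hpS.
  by have -> : 2 - 2 * (hp n / 2) = 2 - 2 * hp n + hp n by field.
have [T HT] := first_step.
have /choice[F HF] : forall nX : nat * (state * state), exists Y, Q nX.1 nX.2 -> Q nX.1.+1 Y /\ Y.1 = nX.2.2.
  by move=> [n X]; exact: nxt.
pose S0 := State (fun _ _ => 0) (fun _ _ => 0) (fun _ _ => 0) (fun _ _ => 0).
pose P := fix P n := if n is n'.+1 then F (n', P n') else (S0, T).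
have HP n : Q n (P n).
  elim: n => [|n IH]; last exact: (HF (n, P n) IH).1.
  by rewrite /Q /hp expr0 mulr1 subrr.
exists (fun n => (P n).1); split=> // n.
by rewrite (HF (n, P n) (HP n)).2; exact: HP.
Qed.

Lemma hp_cvg : hp @ \oo --> 0.
Proof. by apply: cvg_expr; rewrite ger0_norm ?invr_ge0 // invf_lt1 //; lra. Qed.

Lemma sum_hp n : \sum_(i < n) hp i <= 2.
Proof.
suff -> : \sum_(i < n) hp i = 2 - 2 * hp n by have := hp_ge0 n; lra.
elim: n => [|n IH]; first by rewrite big_ord0 /hp expr0; ring.
by rewrite big_ord_recr /= IH hpS; field.
Qed.

Lemma geometric_limit (f : nat -> R -> R -> R) d K :
  (forall n, rep d (K * hp n) (fun t x => f n.+1 t x - f n t x)) ->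
  exists g, forall t x, (fun n => f n t x) @ \oo --> g t x.
Proof.
move=> Hf; exists (fun t x => lim ((fun n => f n t x) @ \oo)) => t x.
have K0 : 0 <= K.
  have := rep_bound eta_gt0 0 0 (Hf 0); rewrite /hp expr0 mulr1.
  exact: le_trans.
have T n q : (n <= q)%N -> `|f q t x - f n t x| <= 2 * K * hp n.
  suff : (n <= q)%N -> `|f q t x - f n t x| <= 2 * K * (hp n - hp q).
    move=> H nq; apply: le_trans (H nq) _.
    by rewrite ler_wpM2l ?mulr_ge0 //; have := hp_ge0 q; lra.
  elim: q => [|q IH] nq; first by move: nq; rewrite leqn0 => /eqP ->; rewrite !subrr normr0 mulr0.
  move: nq; rewrite leq_eqVlt => /predU1P[->|nq]; first by rewrite !subrr normr0 mulr0.
  have h1 := IH nq; have h2 := rep_bound eta_gt0 t x (Hf q).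
  have -> : f q.+1 t x - f n t x = (f q.+1 t x - f q t x) + (f q t x - f n t x) by rewrite addrA subrK.
  apply: le_trans (ler_normD _ _) _; apply: le_trans (lerD h2 h1) _.
  by rewrite hpS le_eqVlt; apply/orP; left; apply/eqP; field.
apply: cauchy_cvg; apply: cauchy_exP => r r0.
have [n0 Hn0] : exists n0, 2 * K * hp n0 < r.
  have C : (fun n => 2 * K * hp n) @ \oo --> 2 * K * 0 by apply: cvgM; [exact: cvg_cst|exact: hp_cvg].
  rewrite mulr0 in C.
  have [n0 _ /(_ n0 (leqnn _))] : \forall n \near \oo, `|0 - 2 * K * hp n| < r.
    by move/cvgrPdist_lt : C; apply.
  by rewrite /= sub0r normrN => /(le_lt_trans (ler_norm _)); exists n0.
exists (f n0 t x); exists n0 => // n /= nn.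
by rewrite -ball_normE /= distrC; apply: le_lt_trans Hn0; exact: T.
Qed.

Lemma geometric_rate (f : nat -> R -> R -> R) g d K :
  (forall n, rep d (K * hp n) (fun t x => f n.+1 t x - f n t x)) ->
  (forall t x, (fun n => f n t x) @ \oo --> g t x) ->
  forall n, rep d (K * (2 * hp n)) (fun t x => g t x - f n t x).
Proof.
move=> Hf Hg n.
have K0 : 0 <= K.
  have := rep_bound eta_gt0 0 0 (Hf 0); rewrite /hp expr0 mulr1.
  exact: le_trans.
apply: (rep_series eta_gt0 (fun i => Hf (n + i)%N)).
  move=> m; rewrite (eq_bigr (fun i : 'I_m => K * hp n * hp i)).
    rewrite -mulr_sumr mulrCA [K * _ * _]mulrC ler_wpM2r ?mulr_ge0 //; exact: sum_hp.
  by move=> i _; rewrite /hp exprD mulrA.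
move=> t x; rewrite (_ : (fun m => _) = (fun m => f (m + n)%N t x - f n t x)).
  by apply: cvgB; [rewrite (@cvg_shiftn n R (fun m => f m t x))|exact: cvg_cst].
apply/funext; elim => [|m IH]; first by rewrite big_ord0 add0n subrr.
rewrite big_ord_recr /= IH [(n + m)%N]addnC -addSn; ring.
Qed.

Lemma limit_eq (a b : R) (C : R) : (forall n, `|a - b| <= C * hp n) -> a = b.
Proof.
move=> H; apply/eqP; rewrite -subr_eq0 -normr_le0.
have L : (fun n => C * hp n) @ \oo --> C * 0 by apply: cvgM; [exact: cvg_cst|exact: hp_cvg].
rewrite mulr0 in L; rewrite -(cvg_lim _ L) //; apply: limr_ge; first by apply/cvg_ex; exists 0.
by near=> n; exact: H.
Unshelve. all: by end_near. Qed.

Lemma fixed_point : exists S, [/\ [/\ sizeD (s1 S), sizeD (s2 S), sizeH (sH S) & sizeH (sW S)],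
  forall t x, t <= 0 -> s1 S t x = 0 /\ s2 S t x = 0,
  (forall t x, sH S t x = Hmap (s1 S) (s2 S) (sH S) t x) /\
  (forall t x, sW S t x = Wmap (s1 S) (s2 S) (sW S) t x) &
  (forall t x, 0 < t < sig ^+ 2 ->
    isd (s1 S ^~ x) t (dx (dx (s1 S)) t x + rhs u0 (s1 S) (sH S) (sW S) t x)) /\
  (forall t x, 0 < t < sig ^+ 2 ->
    isd (s2 S ^~ x) t (dx (dx (s2 S)) t x + rhs v0 (s2 S) (sH S) (sW S) t x))].
Proof.
have [S [S0 HS]] := iterates.
have c1 n : rep 2 (1 * hp n) (fun t x => s1 (S n.+1) t x - s1 (S n) t x).
  by have [_ _ [[h _] _ _ _] _] := HS n; rewrite mul1r.
have c1' n : rep 1 (A0 * hp n) (fun t x => s1 (S n.+1) t x - s1 (S n) t x).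
  by have [_ _ [[_ h] _ _ _] _] := HS n.
have c2 n : rep 2 (1 * hp n) (fun t x => s2 (S n.+1) t x - s2 (S n) t x).
  by have [_ _ [_ [h _] _ _] _] := HS n; rewrite mul1r.
have c2' n : rep 1 (A0 * hp n) (fun t x => s2 (S n.+1) t x - s2 (S n) t x).
  by have [_ _ [_ [_ h] _ _] _] := HS n.
have c3 n : rep 0 (A1 * hp n) (fun t x => sH (S n.+1) t x - sH (S n) t x).
  by have [_ _ [_ _ h _] _] := HS n.
have c4 n : rep 0 (A1 * hp n) (fun t x => sW (S n.+1) t x - sW (S n) t x).
  by have [_ _ [_ _ _ h] _] := HS n.
have [f1 L1] := geometric_limit (f := fun n => s1 (S n)) c1.
have [f2 L2] := geometric_limit (f := fun n => s2 (S n)) c2.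
have [fH L3] := geometric_limit (f := fun n => sH (S n)) c3.
have [fW L4] := geometric_limit (f := fun n => sW (S n)) c4.
have e1 := geometric_rate c1 L1; have e1' := geometric_rate c1' L1.
have e2 := geometric_rate c2 L2; have e2' := geometric_rate c2' L2.
have e3 := geometric_rate c3 L3; have e4 := geometric_rate c4 L4.
pose T := State f1 f2 fH fW.
have p2 n : 0 <= 2 * hp n by rewrite mulr_ge0.
have cl n : close (2 * hp n) (S n) T.
  split=> /=; [split|split|exact: e3|exact: e4] => //.
    by rewrite -[2 * hp n]mul1r.
  by rewrite -[2 * hp n]mul1r.
have sT : [/\ sizeD f1, sizeD f2, sizeH fH & sizeH fW].
  have h0 : 2 * hp 0 = 2 :> R by rewrite /hp expr0 mulr1.
  have := e1 0; have := e1' 0; have := e2 0; have := e2' 0; have := e3 0; have := e4 0.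
  rewrite S0 h0 /= mul1r ![_ * 2]mulrC => a4 a3 a2' a2 a1' a1.
  split; rewrite /sizeD /sizeH; try split.
  - by apply: rep_ext a1 => t x; rewrite subr0.
  - by apply: rep_ext a1' => t x; rewrite subr0.
  - by apply: rep_ext a2 => t x; rewrite subr0.
  - by apply: rep_ext a2' => t x; rewrite subr0.
  - by apply: rep_ext a3 => t x; rewrite subr0.
  - by apply: rep_ext a4 => t x; rewrite subr0.
have sn n : [/\ sizeD (s1 (S n)), sizeD (s2 (S n)), sizeH (sH (S n)) & sizeH (sW (S n))].
  by have [h _ _ _] := HS n; apply: sized_le h; have := hp_ge0 n; lra.
have [t1 t2 t3 t4] := sT.
have st n : linear_step (S n) (S n.+1) by have [] := HS n.
exists T; split=> //=.
- move=> t x t0; split.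
    apply: (limit_eq (C := 2)) => n; have [_ _ _ _ h] := st n.
    have := rep_bound eta_gt0 t x (e1 n.+1); rewrite (h t x t0).1 => /le_trans; apply.
    by rewrite mul1r hpS; have := hp_ge0 n; lra.
  apply: (limit_eq (C := 2)) => n; have [_ _ _ _ h] := st n.
  have := rep_bound eta_gt0 t x (e2 n.+1); rewrite (h t x t0).2 => /le_trans; apply.
  by rewrite mul1r hpS; have := hp_ge0 n; lra.
- split=> t x; apply: (limit_eq (C := 2 * A1)) => n; have [_ _ EH EW _] := st n;
    have [s1' s2' s3' s4'] := sn n; have [d1 d2 d3 d4] := cl n.
    have X := Hmap_diff (p2 n) s1' s2' t1 t2 d1 d2 t3 d3.
    have X1 := rep_bound eta_gt0 t x X; have X2 := rep_bound eta_gt0 t x (e3 n.+1).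
    rewrite -EH in X1; move: X1 X2; rewrite hpS !ler_norml => /andP[? ?] /andP[? ?].
    by apply/andP; split; lra.
  have X := Wmap_diff (p2 n) s1' s2' t1 t2 d1 d2 t4 d4.
  have X1 := rep_bound eta_gt0 t x X; have X2 := rep_bound eta_gt0 t x (e4 n.+1).
  rewrite -EW in X1; move: X1 X2; rewrite hpS !ler_norml => /andP[? ?] /andP[? ?].
  by apply/andP; split; lra.
pose C := 2 + 11 * M ^+ 2 * A1 * 2.
have Ce : (fun n => C * hp n) @ \oo --> 0.
  by rewrite -[X in _ --> X](mulr0 C); apply: cvgM; [exact: cvg_cst|exact: hp_cvg].
(* The time derivatives of the iterates converge uniformly, at the rate C 2^-n, to the right-hand
   side formed with the limit. *)
have lim_pde u (g : nat -> R -> R -> R) f : rep 3 M u -> (forall n, sizeD (g n)) -> sizeD f ->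
   (forall n, distD (2 * hp n) (g n) f) -> (forall t x, (fun n => g n t x) @ \oo --> f t x) ->
   (forall n t x, 0 < t < sig ^+ 2 -> isd (g n.+1 ^~ x) t (dx (dx (g n.+1)) t x + rhs u (g n) (sH (S n)) (sW (S n)) t x)) ->
   forall t x, 0 < t < sig ^+ 2 -> isd (f ^~ x) t (dx (dx f) t x + rhs u f fH fW t x).
  move=> ru sg sf dg Lg Eg t x te.
  have K := @isd_uniform_limit _ (fun n (s : R) => g n.+1 s x)
    (fun n (s : R) => dx (dx (g n.+1)) s x + rhs u (g n) (sH (S n)) (sW (S n)) s x)
    (f ^~ x) (fun s : R => dx (dx f) s x + rhs u f fH fW s x) (fun n => C * hp n) 0 (sig ^+ 2).
  apply: (K _ _ _ _ t te) => // [s se|n s se].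
  - by have := Lg s x; rewrite -(@cvg_shiftS R (fun n => g n s x)).
  have [s1' s2' s3' s4'] := sn n; have [_ _ d3 d4] := cl n.
  have X := rep_bound eta_gt0 s x (rhs_diff (p2 n) ru (sg n) sf s3' t3 s4' t4 (dg n) d3 d4).
  have LE := rep_lrep eta_gt0 sf.2; have LD := rep_lrep eta_gt0 (sg n.+1).2.
  have := rep_bound eta_gt0 s x (rep_ddx (dg n.+1).1).
  rewrite dxB // dxB //; [|exact: (lrep_dx LE).2|exact: (lrep_dx LD).2].
  move: X; rewrite /C hpS !ler_norml.
  move: (dx (dx f) s x) (dx (dx (g n.+1)) s x) (rhs _ _ _ _ _ _) (rhs _ _ _ _ _ _) (hp n) => a b c d p.
  move: (11 * M ^+ 2 * A1) => K' /andP[? ?] /andP[? ?].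
  by apply/andP; split; rewrite mulrDl; lra.
have q1 n : sizeD (s1 (S n)) /\ sizeD (s2 (S n)) by have [] := sn n.
have q2 n : distD (2 * hp n) (s1 (S n)) f1 /\ distD (2 * hp n) (s2 (S n)) f2 by have [] := cl n.
split.
  have K1 := lim_pde u0 (fun n => s1 (S n)) f1 ru0 (fun n => (q1 n).1) t1 (fun n => (q2 n).1) L1.
  have K2 n t x (te : 0 < t < sig ^+ 2) : isd (s1 (S n.+1) ^~ x) t (dx (dx (s1 (S n.+1))) t x + rhs u0 (s1 (S n)) (sH (S n)) (sW (S n)) t x).
    by case: (st n) => h _ _ _ _; exact: (h t x te).
  exact (K1 K2).
have K1 := lim_pde v0 (fun n => s2 (S n)) f2 rv0 (fun n => (q1 n).2) t2 (fun n => (q2 n).2) L2.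
have K2 n t x (te : 0 < t < sig ^+ 2) : isd (s2 (S n.+1) ^~ x) t (dx (dx (s2 (S n.+1))) t x + rhs v0 (s2 (S n)) (sH (S n)) (sW (S n)) t x).
  by case: (st n) => _ h _ _ _; exact: (h t x te).
exact (K1 K2).
Qed.

End FixedPoint.

(** The value of [sig] forced by the third equation of [AE]; the solution is obtained up to its
    square. *)
Definition step_time {R : realType} (M : R) := (88 * 104 * 44 * M ^+ 8)^-1.

(* [N] is n - 1; the time span only depends on the bound [M] and not on the weights [eta]. *)
Lemma flow_fixed_point {R : realType} (M N kap : R) (eta : nat -> R) (u0 v0 w0 : R -> R) :
  1 <= M -> 0 <= N -> N <= M -> (forall s, 0 < eta s) ->
  rep kap eta 3 M (fun _ => u0) -> rep kap eta 3 M (fun _ => v0) -> rep kap eta 1 M (fun _ => w0) ->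
  (forall x, (derive1 u0 x) ^+ 2 + (derive1 v0 x) ^+ 2 = 1) ->
  (forall x, w0 x * (u0 x ^+ 2 + v0 x ^+ 2) = 1) ->
  exists u v h w, [/\ [/\ rep kap eta 2 (M + 2) u, rep kap eta 2 (M + 2) v,
      rep kap eta 0 (M + 2) h & rep kap eta 0 (M + 2) w],
    forall t x, t <= 0 -> u t x = u0 x /\ v t x = v0 x,
    forall t x, (dx u t x ^+ 2 + dx v t x ^+ 2) * h t x = 1 /\
      (u t x ^+ 2 + v t x ^+ 2) * w t x = 1 &
    forall t x, 0 < t < step_time M ^+ 2 ->
      isd (u ^~ x) t (h t x * dx (dx u) t x - N * (w t x * u t x)) /\
      isd (v ^~ x) t (h t x * dx (dx v) t x - N * (w t x * v t x))].
Proof.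
move=> M1 N0 NM eta_gt0 ru rv rw U1 W1.
have M0 : 0 < M by apply: lt_le_trans ltr01 M1.
have Mn n : 1 <= M ^+ n by exact: exprn_ege1.
pose A1 := (88 * M ^+ 2)^-1; pose A0 := A1 / (104 * M ^+ 3); pose sig := step_time M.
have A1_gt0 : 0 < A1 by rewrite invr_gt0 mulr_gt0 // exprn_gt0.
have A1_le1 : A1 <= 1 by rewrite invf_le1 ?mulr_gt0 ?exprn_gt0 //; have := Mn 2; lra.
have A0_gt0 : 0 < A0 by rewrite divr_gt0 // mulr_gt0 // exprn_gt0.
have A01 : A0 <= A1.
  by rewrite ler_pdivrMr ?mulr_gt0 ?exprn_gt0 // ler_peMr ?(ltW A1_gt0) //; have := Mn 3; lra.
have sig_gt0 : 0 < sig by rewrite invr_gt0 !mulr_gt0 // exprn_gt0.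
have sig_le1 : sig <= 1 by rewrite invf_le1 ?mulr_gt0 ?exprn_gt0 //; have := Mn 8; lra.
have AE : [/\ 88 * M ^+ 2 * A1 = 1, 104 * M ^+ 3 * A0 = A1 & 88 * 104 * 44 * M ^+ 8 * sig = 1].
  split.
  - by rewrite mulfV // gt_eqF // mulr_gt0 // exprn_gt0.
  - by rewrite /A0 mulrC divfK // gt_eqF // mulr_gt0 // exprn_gt0.
  - by rewrite mulfV // gt_eqF // !mulr_gt0 // exprn_gt0.
have [[D1 D2 H W] /= [[sD1 sD2 sH sW] D0 [EH EW] [E1 E2]]] :=
  fixed_point M1 N0 NM eta_gt0 A1_gt0 A1_le1 A0_gt0 A01 sig_gt0 sig_le1 AE ru rv rw.
have B u D : rep kap eta 3 M (fun _ => u) -> sizeD kap eta A0 D ->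
    (forall t x, dx (fun t x => u x + D t x) t x = derive1 u x + dx D t x) /\
    (forall t x, dx (dx (fun t x => u x + D t x)) t x = dx (dx (fun _ => u)) t x + dx (dx D) t x).
  move=> r3 [r2 _]; have L1 := rep_lrep eta_gt0 r3; have L2 := rep_lrep eta_gt0 r2.
  rewrite (dxD L1 L2) (dxD (lrep_dx L1).2 (lrep_dx L2).2).
  by split.
have [B1 B1'] := B _ _ ru sD1; have [B2 B2'] := B _ _ rv sD2.
exists (fun t x => u0 x + D1 t x), (fun t x => v0 x + D2 t x), (fun t x => 1 + H t x), (fun t x => w0 x + W t x).
split; [split|..].
- by apply: repD (sD1.1); apply: rep_le ru.
- by apply: repD (sD2.1); apply: rep_le rv.
- apply: rep_le (repD (rep_cst kap eta 0 1) sH) => //; rewrite normr1; lra.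
- have r0 : rep kap eta 0 M (fun _ => w0) by apply: rep_le rw.
  by apply: rep_le (repD r0 sW) => //; lra.
- by move=> t x /(D0 t x)[-> ->]; rewrite !addr0.
- move=> t x; split.
    have := EH t x; rewrite B1 B2 /Hmap /qd.
    have := U1 x; rewrite -/(dx (fun _ => u0) t x) -/(dx (fun _ => v0) t x).
    move: (dx _ _ _) (dx _ _ _) (dx _ _ _) (dx _ _ _) (H t x) => a b c d e Hu He.
    have : 1 + e - (1 + e - e) = - ((2 * (d * b + c * a) + (b * b + a * a)) * (1 + e)) by rewrite -He; ring.
    have : (d ^+ 2 + c ^+ 2 - 1) * (1 + e) = 0 by rewrite Hu subrr mul0r.
    by nra.
  have := EW t x; rewrite /Wmap /qr.
  have := W1 x; move: (u0 x) (v0 x) (w0 x) (D1 t x) (D2 t x) (W t x) => a b c d e w Hu He.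
  have h1 : (a ^+ 2 + b ^+ 2) * (w + c * ((2 * (a * d + b * e) + (d * d + e * e)) * (c + w))) = 0.
    by rewrite {1}He addNr mulr0.
  have h2 : (c * (a ^+ 2 + b ^+ 2) - 1) * ((2 * (a * d + b * e) + (d * d + e * e)) * (c + w)) = 0.
    by rewrite Hu subrr mul0r.
  by nra.
- move=> t x te; split.
    apply: isd_eq (is_deriveD (is_derive_cst (u0 x) t 1) (E1 t x te)) _.
    by rewrite B1' /rhs; move: (dx (dx _) _ _) (dx (dx _) _ _) => a b; ring.
  apply: isd_eq (is_deriveD (is_derive_cst (v0 x) t 1) (E2 t x te)) _.
  by rewrite B2' /rhs; move: (dx (dx _) _ _) (dx (dx _) _ _) => a b; ring.
Qed.

(** * Fourier series of smooth periodic functions *)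

Lemma continuous_sum {R : realType} (F : nat -> R -> R) n : (forall i, continuous (F i)) ->
  continuous (fun x => \sum_(i < n) F i x).
Proof.
move=> cF; elim: n => [|n IH].
  rewrite (_ : (fun x => _) = fun=> 0); first by move=> x; exact: cst_continuous.
  by apply/funext => x; rewrite big_ord0.
rewrite (_ : (fun x => _) = fun x => \sum_(i < n) F i x + F n x).
  by move=> x; apply: cvgD; [exact: IH|exact: cF].
by apply/funext => x; rewrite big_ord_recr.
Qed.

Section Integral.
Context {R : realType} (L : R) (L_ge0 : 0 <= L).
Implicit Types (f g : R -> R) (x y c : R).

Definition itg f := prim f L.

Lemma itg_isd f F : continuous f -> (forall x, isd F x (f x)) -> itg f = F L - F 0.
Proof.
move=> cf dF; have [dP P0] := primP cf.
have : prim f L - F L = prim f 0 - F 0.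
  by apply: (@isd0_cst R (fun x => prim f x - F x)) => x; rewrite -(subrr (f x)); apply: is_deriveB.
by rewrite P0 /itg; lra.
Qed.

Lemma itgD f g : continuous f -> continuous g -> itg (fun x => f x + g x) = itg f + itg g.
Proof.
move=> cf cg; have [dP P0] := primP cf; have [dQ Q0] := primP cg.
have dS x : isd (fun x => prim f x + prim g x) x (f x + g x) by apply: is_deriveD.
rewrite (itg_isd _ dS) ?P0 ?Q0 ?addr0 ?subr0 //.
by move=> x; apply: cvgD; [exact: cf|exact: cg].
Qed.

Lemma itgZ f c : continuous f -> itg (fun x => c * f x) = c * itg f.
Proof.
move=> cf; have [dP P0] := primP cf.
have dS x : isd (fun x => c * prim f x) x (c * f x).
  apply: isd_eq (is_deriveM (is_derive_cst c x 1) (dP x)) _.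
  by rewrite /GRing.scale /=; ring.
rewrite (itg_isd _ dS) ?P0 ?mulr0 ?subr0 //.
by move=> x; apply: cvgM; [exact: cvg_cst|exact: cf].
Qed.

Lemma itg_ext f g : f =1 g -> itg f = itg g.
Proof. by move=> fg; congr itg; apply/funext. Qed.

Lemma itg_cst c : itg (fun=> c) = c * L.
Proof.
have dS x : isd (fun x => c * x) x c.
  apply: isd_eq (is_deriveM (is_derive_cst c x 1) (is_derive_id x 1)) _.
  by rewrite /GRing.scale /=; ring.
rewrite (itg_isd _ dS) ?mulr0 ?subr0 // => x; exact: cst_continuous.
Qed.

Lemma itg_sum (F : nat -> R -> R) n : (forall i, continuous (F i)) ->
  itg (fun x => \sum_(i < n) F i x) = \sum_(i < n) itg (F i).
Proof.
move=> cF; elim: n => [|n IH].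
  rewrite big_ord0 -[RHS](mul0r L) -itg_cst; apply: itg_ext => x; exact: big_ord0.
have cS : continuous (fun x => \sum_(i < n) F i x).
  exact: continuous_sum.
rewrite big_ord_recr /= -IH -itgD //; apply: itg_ext => x; exact: big_ord_recr.
Qed.

Lemma itg_le f g : continuous f -> continuous g -> (forall x, f x <= g x) -> itg f <= itg g.
Proof.
move=> cf cg fg; have [dP P0] := primP cf; have [dQ Q0] := primP cg.
have dS x : isd (fun x => prim g x - prim f x) x (g x - f x) by apply: is_deriveB.
have := @nondecr_on R _ _ 0 L L_ge0 (fun x _ => dS x) (fun x _ => _).
rewrite P0 Q0 subrr subr_ge0; apply => x; by rewrite subr_ge0.
Qed.

Lemma itg_abs f g : continuous f -> continuous g -> (forall x, `|f x| <= g x) -> `|itg f| <= itg g.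
Proof.
move=> cf cg fg; rewrite ler_norml; apply/andP; split.
  rewrite -[itg f]opprK lerN2 -mulN1r -itgZ //; apply: itg_le => // [x|x].
    by apply: cvgM; [exact: cvg_cst|exact: cf].
  by rewrite mulN1r; apply: le_trans (fg x); rewrite -normrN ler_norm.
by apply: itg_le => // x; apply: le_trans (fg x); exact: ler_norm.
Qed.

End Integral.

Section FejerKernel.
Context {R : realType}.
Implicit Types (X : R) (n : nat).

Definition dirichlet n X : R := 1 + 2 * \sum_(k < n) cos (k.+1%:R * X).

Lemma dirichletE n X : (1 - cos X) * dirichlet n X = cos (n%:R * X) - cos (n.+1%:R * X).
Proof.
elim: n => [|n IH]; first by rewrite /dirichlet big_ord0 mul0r cos0 mul1r mulr0 addr0 mulr1.
have -> : dirichlet n.+1 X = dirichlet n X + 2 * cos (n.+1%:R * X).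
  by rewrite /dirichlet big_ord_recr /=; ring.
have -> : n.+2%:R * X = n.+1%:R * X + X by rewrite -[n.+2]addn1 natrD mulrDl mul1r.
have E : n%:R * X = n.+1%:R * X - X by rewrite -[n.+1]addn1 natrD mulrDl mul1r addrK.
rewrite mulrDr IH E cosB cosD; ring.
Qed.

Lemma fejerE n X : (1 - cos X) * \sum_(i < n) dirichlet i X = 1 - cos (n%:R * X).
Proof.
elim: n => [|n IH]; first by rewrite big_ord0 mulr0 mul0r cos0 subrr.
by rewrite big_ord_recr /= mulrDr IH dirichletE; ring.
Qed.

(** Read off from [fejerE] after dividing by 1 - cos X. Where cos X = 1 every cosine in the sum is
    1. *)
Lemma fejer_ge0 n X : 0 <= \sum_(i < n) dirichlet i X.
Proof.
have [c1|c1] := eqVneq (cos X) 1; last first.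
  have c0 : 0 < 1 - cos X by rewrite subr_gt0 lt_neqAle c1 cos_le1.
  by rewrite -(pmulr_rge0 _ c0) fejerE subr_ge0 cos_le1.
have s0 : sin X = 0.
  by have := cos2Dsin2 X; rewrite c1 expr1n => /eqP; rewrite -subr_eq0 addrAC subrr add0r sqrf_eq0 => /eqP.
have ck (k : nat) : cos (k%:R * X) = 1 /\ sin (k%:R * X) = 0.
  elim: k => [|k [IH1 IH2]]; first by rewrite mul0r cos0 sin0.
  by rewrite -addn1 natrD mulrDl mul1r cosD sinD IH1 IH2 c1 s0; split; ring.
apply: sumr_ge0 => i _; rewrite /dirichlet addr_ge0 // mulr_ge0 // sumr_ge0 // => k _.
by rewrite (ck k.+1).1.
Qed.

End FejerKernel.

Lemma periodic_bounded {R : realType} (f : R -> R) (L : R) : 0 < L -> continuous f ->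
  (forall x, f (x + L) = f x) -> exists C, forall x, `|f x| <= C.
Proof.
move=> L0 cf pf; have cW : {within `[0, L], continuous (fun x => `|f x|)}.
  by apply: continuous_subspaceT => x; apply: cvg_norm; exact: cf.
have [c _ Hc] := EVT_max (ltW L0) cW; exists `|f c| => x.
have [k Hk] := periodic_reduce x L0; rewrite -(periodic_int k x pf).
by apply: Hc; rewrite in_itv.
Qed.

Section FourierInversion.
Context {R : realType} (kap : R) (kap_gt0 : 0 < kap).
Local Notation L := (2 * pi / kap).
Implicit Types (F G : R -> R) (b k x y : R).

Let L_gt0 : 0 < L. Proof. by rewrite divr_gt0 // mulr_gt0 ?pi_gt0. Qed.

Definition fcoef F k b := itg L (fun y => F y * cos (k * y + b)).

Let cFc F k b : continuous F -> continuous (fun y => F y * cos (k * y + b)).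
Proof. by move=> cF y; apply: cvgM; [exact: cF|exact: continuous_cosl]. Qed.

Lemma cos_period (j : nat) b y : cos (j%:R * kap * (y + L) + b) = cos (j%:R * kap * y + b).
Proof.
have -> : j%:R * kap * (y + L) + b = (j%:R * kap * y + b) + (j : int)%:~R * (2 * pi).
  by rewrite pmulrn; field; rewrite gt_eqF.
apply: (periodic_int (f := cos)) => z; have := cosD2pi z.
by rewrite mulr_natl.
Qed.

Lemma fcoef_parts F G (j : nat) b : (forall x, isd F x (G x)) -> continuous G ->
  (forall x, F (x + L) = F x) ->
  (j%:R * kap) * fcoef F (j%:R * kap) b = - fcoef G (j%:R * kap) (b - pi / 2).
Proof.
move=> dF cG pF; have cF : continuous F by move=> x; exact: isd_cont (dF x).
set k := j%:R * kap; rewrite /fcoef -itgZ; last exact: cFc.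
apply/eqP; rewrite -addr_eq0 -itgD; [|by move=> x; apply: cvgM; [exact: cvg_cst|exact: cFc]|exact: cFc].
have dS x : isd (fun y => F y * cos (k * y + (b - pi / 2))) x
    (k * (F x * cos (k * x + b)) + G x * cos (k * x + (b - pi / 2))).
  apply: isd_eq (is_deriveM (dF x) (isd_cosl k (b - pi / 2) x)) _.
  by rewrite subrK /GRing.scale /=; ring.
rewrite (itg_isd L _ dS).
- by rewrite -[in X in X - _](add0r L) pF cos_period subrr.
- by move=> x; apply: cvgD; [apply: cvgM; [exact: cvg_cst|exact: cFc]|exact: cFc].
Qed.

Lemma fcoef_bound F k b C : continuous F -> (forall x, `|F x| <= C) -> `|fcoef F k b| <= C * L.
Proof.
move=> cF FC; rewrite -(itg_cst L C) /fcoef.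
refine (itg_abs (ltW L_gt0) _ _ _).
- exact: cFc.
- by move=> x; exact: cst_continuous.
- move=> x; rewrite normrM -[leRHS]mulr1 ler_pM //; exact: abs_cos_le1.
Qed.

Lemma fcoef_expand F k x : continuous F ->
  fcoef F k (- (k * x)) = fcoef F k 0 * cos (k * x) + fcoef F k (- (pi / 2)) * cos (k * x - pi / 2).
Proof.
move=> cF; rewrite [_ * cos (k * x)]mulrC [_ * cos (k * x - _)]mulrC /fcoef -!itgZ; try exact: cFc.
rewrite -itgD; try by move=> y; apply: cvgM; [exact: cvg_cst|exact: cFc].
by apply: itg_ext => y; rewrite addr0 cosB !cosBpihalf; ring.
Qed.

Lemma fcoef_dirichlet F n x : continuous F ->
  fcoef F 0 0 + 2 * \sum_(k < n) fcoef F (k.+1%:R * kap) (- (k.+1%:R * kap * x))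
   = itg L (fun y => F y * dirichlet n (kap * (y - x))).
Proof.
move=> cF; rewrite /fcoef -(itg_sum L n (F := fun (k : nat) y => F y * cos (k.+1%:R * kap * y - k.+1%:R * kap * x))); last first.
  by move=> i; exact: cFc.
have cS : continuous (fun y => \sum_(k < n) F y * cos (k.+1%:R * kap * y - k.+1%:R * kap * x)).
  refine (@continuous_sum R (fun (k : nat) y => F y * cos (k.+1%:R * kap * y - k.+1%:R * kap * x)) n (fun i => _)).
  exact: cFc.
rewrite -itgZ // -itgD; [|exact: cFc|by move=> y; apply: cvgM; [exact: cvg_cst|exact: cS]].
apply: itg_ext => y; rewrite mul0r addr0 cos0 mulr1 /dirichlet mulrDr mulr1 mulrCA; congr (_ + 2 * _).
rewrite big_distrr /=; apply: eq_bigr => k _; congr (_ * cos _); ring.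
Qed.

Lemma continuous_dirichlet n x : continuous (fun y => dirichlet n (kap * (y - x))).
Proof.
have cS : continuous (fun y => \sum_(k < n) cos (k.+1%:R * (kap * (y - x)))); last first.
  by move=> y; apply: cvgD; [exact: cvg_cst|apply: cvgM; [exact: cvg_cst|exact: cS]].
refine (@continuous_sum R (fun (k : nat) y => cos (k.+1%:R * (kap * (y - x)))) n (fun i => _)).
have := @continuous_cosl R (i.+1%:R * kap) (- (i.+1%:R * kap * x)).
suff -> : (fun y => cos (i.+1%:R * (kap * (y - x)))) = fun y => cos (i.+1%:R * kap * y - i.+1%:R * kap * x) by [].
by apply/funext => w; congr cos; ring.
Qed.

Lemma itg_dirichlet n x : itg L (fun y => dirichlet n (kap * (y - x))) = L.
Proof.
have c1 : continuous (fun _ : R => 1 : R) by move=> y; exact: cst_continuous.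
rewrite (_ : itg _ _ = itg L (fun y => 1 * dirichlet n (kap * (y - x)))); last first.
  by apply: itg_ext => y; rewrite mul1r.
rewrite -fcoef_dirichlet // big1 => [|k _].
  rewrite mulr0 addr0 -[RHS]mul1r -itg_cst; apply: itg_ext => y.
  by rewrite mul0r addr0 cos0 mulr1.
apply/eqP; rewrite -(@mulrI_eq0 _ (k.+1%:R * kap)); last by apply/lregP; rewrite mulf_neq0 // gt_eqF.
rewrite (@fcoef_parts _ (fun=> 0)) //; last by move=> y; exact: cst_continuous.
rewrite oppr_eq0 -[X in _ == X](mul0r L) -(itg_cst L 0) /fcoef; apply/eqP; apply: itg_ext => y.
by rewrite mul0r.
Qed.

(** Close to x modulo the period continuity gives e; elsewhere 1 - cos is bounded below and F is
    bounded. The form is adapted to Fejer sums: their product with 1 - cos is at most 2, so that the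
    second term contributes an amount independent of the number of summands. *)
Lemma localization F x e : continuous F -> (forall x, F (x + L) = F x) -> 0 < e ->
  exists2 C, 0 <= C & forall y, `|F y - F x| <= e + C * (1 - cos (kap * (y - x))).
Proof.
move=> cF pF e0; have [B HB] := periodic_bounded L_gt0 cF pF.
have B0 : 0 <= B by exact: le_trans (normr_ge0 _) (HB 0).
have /contP/(_ e e0)[r r0 Hr] := cF x.
(* With d <= L / 2 the angle kap d stays in [0, pi], where cos decreases. *)
pose d := Num.min (r / 2) (L / 2).
have d0 : 0 < d by rewrite lt_min; apply/andP; split; have := L_gt0; lra.
have dr : d < r by rewrite gt_min; apply/orP; left; lra.
have dL : d <= L / 2 by rewrite ge_min lexx orbT.
have kL : kap * L = 2 * pi by field; rewrite gt_eqF.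
have kd : 0 < kap * d <= pi.
  rewrite mulr_gt0 //=; have : kap * d <= kap * (L / 2) by rewrite ler_pM2l.
  by rewrite mulrA kL; lra.
have cd : 0 < 1 - cos (kap * d).
  rewrite subr_gt0 -[ltRHS]cos0 ltr_cos ?in_itv /= ?lexx ?pi_ge0 //; lra.
exists (2 * B / (1 - cos (kap * d))); first by rewrite divr_ge0 ?mulr_ge0 // ltW.
move=> y; have cE z : kap * z = 1%:R * kap * z + 0 by rewrite mul1r addr0.
have [k Hk] := periodic_reduce (y - x) L_gt0.
rewrite -(periodic_int k y pF).
have -> : cos (kap * (y - x)) = cos (kap * (y - x + k%:~R * L)).
  by rewrite (periodic_int (f := fun z => cos (kap * z))) // => z; rewrite !cE cos_period.
have -> : y + k%:~R * L = x + (y - x + k%:~R * L) by rewrite addrA addrCA subrr addr0.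
move: (y - x + _) Hk => w /andP[w0 wL].
have cw : 0 <= 1 - cos (kap * w) by rewrite subr_ge0 cos_le1.
have far : cos (kap * w) <= cos (kap * d) ->
    `|F (x + w) - F x| <= e + 2 * B / (1 - cos (kap * d)) * (1 - cos (kap * w)).
  move=> cc; have : `|F (x + w) - F x| <= 2 * B.
    by apply: le_trans (ler_normB _ _) _; have := HB (x + w); have := HB x; lra.
  move=> /le_trans; apply; rewrite mulrAC -[leLHS]add0r lerD ?(ltW e0) //.
  by rewrite ler_pdivlMr // ler_wpM2l ?mulr_ge0 //; lra.
have near z : `|z - x| < r -> F z = F (x + w) -> 
    `|F (x + w) - F x| <= e + 2 * B / (1 - cos (kap * d)) * (1 - cos (kap * w)).
  move=> zr <-; apply: le_trans (ltW (Hr _ zr)) _; rewrite lerDl !mulr_ge0 // ?invr_ge0 //; lra.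
have [wd|wd] := leP w d.
  by apply: (near (x + w)) => //; rewrite addrAC subrr add0r ger0_norm // (le_lt_trans wd).
have [wd'|wd'] := leP (L - w) d.
  apply: (near (x + w - L)); last by rewrite -[RHS]pF /= -[in RHS](subrK L (x + w)) !pF.
  have -> : x + w - L - x = - (L - w) by ring.
  by rewrite normrN ger0_norm ?subr_ge0 // (le_lt_trans wd').
apply: far; have [wp|wp] := leP (kap * w) pi.
  rewrite ltW // ltr_cos ?in_itv /= ?wp ?andbT; first by rewrite ltr_pM2l.
  - by case/andP : kd => /ltW ->.
  - by rewrite mulr_ge0 // ltW.
have -> : cos (kap * w) = cos (kap * (L - w)).
  by rewrite -cosN -[LHS](periodic_int (f := cos) (L := 2 * pi) 1) => [|z]; [congr cos; rewrite mulrBr kL; ring|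
    rewrite mulr_natl cosD2pi].
have h1 : kap * d < kap * (L - w) by rewrite ltr_pM2l.
have h2 : kap * (L - w) = 2 * pi - kap * w by rewrite mulrBr kL.
rewrite ltW // ltr_cos ?in_itv /=; [by []|by case/andP : kd => /ltW ->|by rewrite h2; have := mulr_gt0 kap_gt0 (lt_trans d0 wd); lra].
Qed.

(** Convergence being assumed, only the value of the limit has to be found. The Cesaro means of the
    partial sums tend to l, and by positivity of the Fejer kernel they come arbitrarily close to L
    F(x). *)
Lemma fourier_inversion F x l : continuous F -> (forall x, F (x + L) = F x) ->
  (fun n => fcoef F 0 0 + 2 * \sum_(k < n) fcoef F (k.+1%:R * kap) (- (k.+1%:R * kap * x))) @ \oo --> l ->
  L * F x = l.
Proof.
move=> cF pF Hl; set S := (fun n => _) in Hl.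
have HS n : S n = itg L (fun y => F y * dirichlet n (kap * (y - x))) by exact: fcoef_dirichlet.
have cD := continuous_dirichlet.
have cFD n : continuous (fun y => F y * dirichlet n (kap * (y - x))).
  by move=> y; apply: cvgM; [exact: cF|exact: cD].
suff H e : 0 < e -> `|l - L * F x| <= e * L + e.
  apply/eqP; rewrite eq_sym -subr_eq0 -normr_le0; apply/ler_addgt0Pr => e e0; rewrite add0r.
  have L1 : 0 < L + 1 by rewrite addr_gt0.
  have := H (e / (L + 1)) (divr_gt0 e0 L1).
  have EE a : 0 < a + 1 -> e / (a + 1) * a + e / (a + 1) = e by move=> a0; field; rewrite gt_eqF.
  by rewrite EE.
move=> e0; have [C C0 HC] := localization x cF pF e0.
(* The term e N L comes from the total mass of the kernel, the term 2 C L from [fejerE]; division by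
   N removes the latter in the limit. *)
have E N : `|\sum_(i < N) S i - N%:R * (L * F x)| <= N%:R * (e * L) + 2 * C * L.
  have cK : continuous (fun y => \sum_(i < N) dirichlet i (kap * (y - x))).
    exact (@continuous_sum R (fun (k : nat) y => dirichlet k (kap * (y - x))) N (fun i => cD i x)).
  have iK : itg L (fun y => \sum_(i < N) dirichlet i (kap * (y - x))) = N%:R * L.
    rewrite (itg_sum L N (F := fun i y => dirichlet i (kap * (y - x)))) => [|i]; last exact: cD.
    rewrite (eq_bigr (fun=> L)) => [|i _]; last exact: itg_dirichlet.
    by rewrite sumr_const card_ord [RHS]mulr_natl.
  have -> : \sum_(i < N) S i - N%:R * (L * F x) =
      itg L (fun y => (F y - F x) * \sum_(i < N) dirichlet i (kap * (y - x))).
    have -> : N%:R * (L * F x) = F x * itg L (fun y => \sum_(i < N) dirichlet i (kap * (y - x))).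
      by rewrite iK; ring.
    rewrite -mulNr -itgZ // (eq_bigr (fun i : 'I_N => itg L (fun y => F y * dirichlet i (kap * (y - x))))) //.
    rewrite -(itg_sum L N (F := fun i y => F y * dirichlet i (kap * (y - x)))) // -itgD.
    - by apply: itg_ext => y; rewrite -big_distrr /= -mulrDl.
    - exact (@continuous_sum R (fun (k : nat) y => F y * dirichlet k (kap * (y - x))) N cFD).
    - by move=> y; apply: cvgM; [exact: cvg_cst|exact: cK].
  have -> : N%:R * (e * L) + 2 * C * L =
     itg L (fun y => e * \sum_(i < N) dirichlet i (kap * (y - x)) + 2 * C).
    rewrite itgD; [rewrite itgZ // iK itg_cst; ring| |by move=> y; exact: cst_continuous].
    by move=> y; apply: cvgM; [exact: cvg_cst|exact: cK].
  refine (itg_abs (ltW L_gt0) _ _ _).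
  - by move=> y; apply: cvgM; [apply: cvgB; [exact: cF|exact: cvg_cst]|exact: cK].
  - by move=> y; apply: cvgD; [apply: cvgM; [exact: cvg_cst|exact: cK]|exact: cvg_cst].
  - move=> y; rewrite normrM (ger0_norm (fejer_ge0 _ _)).
    apply: le_trans (ler_wpM2r (fejer_ge0 _ _) (HC y)) _.
    rewrite mulrDl -mulrA fejerE lerD2l [2 * C]mulrC ler_wpM2l //.
    by have := cos_geN1 (N%:R * (kap * (y - x))); lra.
have M := cesaro Hl.
have [n0 Hn] : exists n0 : nat, forall n, (n0 <= n)%N -> `|arithmetic_mean S n - L * F x| <= e * L + e.
  have [n0 Hn0] : exists n0 : nat, 2 * C * L / e < n0%:R.
    by exists (Num.truncn (2 * C * L / e)).+1; exact: truncnS_gt.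
  exists n0 => n nn; rewrite /arithmetic_mean /series /= big_mkord.
  have n1 : 0 < n.+1%:R :> R by [].
  have -> : n.+1%:R^-1 * \sum_(i < n.+1) S i - L * F x = n.+1%:R^-1 * (\sum_(i < n.+1) S i - n.+1%:R * (L * F x)).
    by rewrite mulrBr mulKf.
  rewrite normrM ger0_norm ?invr_ge0 // mulrC ler_pdivrMr //; apply: le_trans (E n.+1) _.
  have : 2 * C * L / e < n.+1%:R by apply: lt_le_trans Hn0 _; rewrite ler_nat; apply: leq_trans nn _.
  rewrite ltr_pdivrMr // => /ltW h.
  by move: h; move: (2 * C * L) (e * L) n.+1%:R => *; nra.
exact (cvg_dist_le M Hn).
Qed.

End FourierInversion.

Section FourierSeries.
Context {R : realType} (kap : R) (eta : nat -> R) (kap_gt0 : 0 < kap).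
Local Notation L := (2 * pi / kap).
Context (Fd : nat -> R -> R) (C : nat -> R).
Context (dF : forall j (x : R), isd (Fd j) x (Fd j.+1 x)) (pF : forall x, Fd 0 (x + L) = Fd 0 x).
Context (FC : forall j x, `|Fd j x| <= C j).

Let L_gt0 : 0 < L. Proof. by rewrite divr_gt0 // mulr_gt0 ?pi_gt0. Qed.

Let pFj j x : Fd j (x + L) = Fd j x.
Proof.
elim: j x => [//|j IH] x.
have D : isd (fun y : R => y + L) x 1.
  by apply: isd_eq (is_deriveD (is_derive_id x 1) (is_derive_cst L x 1)) _; rewrite addr0.
apply: (@isd_uniq _ (Fd j) x) => //.
apply: (@isd_ext _ (Fd j \o (fun y => y + L))) => [y|]; first exact: IH.
by rewrite -[Fd j.+1 _]mulr1; apply: isd_chain D.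
Qed.

Let cF j : continuous (Fd j). Proof. by move=> x; exact: isd_cont (dF j x). Qed.

(** Integration by parts i times. Each one passes to the next derivative of F and shifts the phase
    by - pi / 2, so the induction is over all derivatives and phases at once. *)
Lemma fcoef_decay i (k : nat) b : `|fcoef kap (Fd 0) (k%:R * kap) b| * (k%:R * kap) ^+ i <= C i * L.
Proof.
suff H j b' : `|fcoef kap (Fd j) (k%:R * kap) b'| * (k%:R * kap) ^+ i <= C (i + j)%N * L.
  by have := H 0 b; rewrite addn0.
have k0 : 0 <= k%:R * kap by rewrite mulr_ge0 // ltW.
elim: i j b' => [|i IH] j b'; first by rewrite mulr1; apply: fcoef_bound.
have -> (y : R) : `|y| * (k%:R * kap) ^+ i.+1 = `|k%:R * kap * y| * (k%:R * kap) ^+ i.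
  by rewrite exprS normrM (ger0_norm k0); ring.
rewrite (fcoef_parts kap_gt0 _ _ (dF j)) // normrN; apply: le_trans (IH _ _) _.
by rewrite addnS.
Qed.

Let k_int (k : nat) : exists j : int, k%:R * kap = j%:~R * kap.
Proof. by exists (k : int); rewrite pmulrn. Qed.

Let cmode (c : R) (k : nat) (b : R) : mode kap :=
  Mode b (fun t => @cst_continuous _ _ c t) (fun _ => lexx `|c|) (k_int k).

Let amp k b := 2 / L * fcoef kap (Fd 0) (k%:R * kap) b.

(** The phases 0 and - pi / 2 give the cosine and the sine of each frequency. *)
Definition fourier_modes (j : nat) : seq (mode kap) := if j is 0 then
  [:: cmode (L^-1 * fcoef kap (Fd 0) 0 0) 0 0] else
  [:: cmode (amp j 0) j 0; cmode (amp j (- (pi / 2))) j (- (pi / 2))].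

Lemma fourier_modes0 t x : evl (fourier_modes 0) t x = L^-1 * fcoef kap (Fd 0) 0 0.
Proof. by rewrite /evl big_seq1 /= mul0r mul0r addr0 cos0 mulr1. Qed.

Lemma fourier_modesS j t x : evl (fourier_modes j.+1) t x =
  L^-1 * (2 * fcoef kap (Fd 0) (j.+1%:R * kap) (- (j.+1%:R * kap * x))).
Proof.
rewrite fcoef_expand // /evl /fourier_modes big_cons big_seq1 /= /amp addr0.
by move: (cos _) (cos _) (fcoef _ _ _ _) (fcoef _ _ _ _) (L^-1) => *; ring.
Qed.

(** Two derivatives beyond the weight e provide the factor 1 / j^2, whose sum is at most 2;
    [fourier_mode_le] contributes the factor 4. The mean value accounts for C 0. Only the entries 0
    and e + 2 of C occur. *)
Definition fourier_bound e : R := C 0 + 8 * (C (e + 2)%N * (1 + kap^-1) ^+ (e + 2)).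

Lemma sum_inv_sqr n : \sum_(j < n) (j.+1%:R ^+ 2)^-1 <= 2 :> R.
Proof.
case: n => [|n]; first by rewrite big_ord0.
suff : \sum_(j < n.+1) (j.+1%:R ^+ 2)^-1 <= 2 - n.+1%:R^-1 :> R.
  by move=> /le_trans; apply; rewrite lerBlDr lerDl invr_ge0.
elim: n => [|n IH]; first by rewrite big_ord_recl big_ord0 /= expr1n invr1; lra.
rewrite big_ord_recr /=; apply: le_trans (lerD IH (lexx _)) _.
have n0 : 0 < n.+1%:R :> R by [].
have n1 : n.+2%:R = n.+1%:R + 1 :> R by rewrite -natr1.
rewrite n1; move: n.+1%:R n0 => y y0.
have y1 : 0 < y + 1 by lra.
have h : y^-1 - (y + 1)^-1 - ((y + 1) ^+ 2)^-1 = (y * (y + 1) ^+ 2)^-1 by field; rewrite !gt_eqF.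
have : 0 < (y * (y + 1) ^+ 2)^-1 by rewrite invr_gt0 mulr_gt0 ?exprn_gt0.
lra.
Qed.

Lemma fourier_mode_le e j : \sum_(m <- fourier_modes j.+1) mm m * (1 + `|mk m|) ^+ e <=
  4 * (C (e + 2)%N * (1 + kap^-1) ^+ (e + 2)) * (j.+1%:R ^+ 2)^-1.
Proof.
rewrite big_cons big_seq1 /=; set k := j.+1%:R * kap.
have k0 : 0 < k by rewrite mulr_gt0.
rewrite (ger0_norm (ltW k0)).
have key b : `|amp j.+1 b| * (1 + k) ^+ e <= 2 * (C (e + 2)%N * (1 + kap^-1) ^+ (e + 2)) * (j.+1%:R ^+ 2)^-1.
  rewrite /amp normrM ger0_norm; last by rewrite divr_ge0 // ltW.
  set w := fcoef _ _ _ _; set B := C _ * _.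
  have -> : 2 / L * `|w| * (1 + k) ^+ e = 2 * (`|w| * (1 + k) ^+ e / L).
    by move: (L^-1) => y; ring.
  rewrite -[leRHS]mulrA ler_pM2l // ler_pdivrMr // {}/B.
  have h := fcoef_decay (e + 2) j.+1 b; rewrite -/k -/w in h.
  have q0 : 0 < (1 + kap^-1) ^+ (e + 2) * (j.+1%:R ^+ 2)^-1.
    by rewrite mulr_gt0 ?exprn_gt0 ?invr_gt0 ?exprn_gt0 // addr_gt0 // invr_gt0.
  rewrite -[C _ * _ * _]mulrA mulrAC.
  apply: le_trans (ler_wpM2r (ltW q0) h); rewrite -mulrA ler_wpM2l //.
  have kk : (1 + k) <= k * (1 + kap^-1).
    rewrite mulrDr mulr1 addrC lerD2l /k mulfK ?gt_eqF // ler1n //.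
  have kk0 : 0 <= (k * (1 + kap^-1)) ^+ e by rewrite exprn_ge0 // mulr_ge0 ?addr_ge0 ?invr_ge0 ?(ltW k0) ?(ltW kap_gt0).
  have -> : k ^+ (e + 2) * ((1 + kap^-1) ^+ (e + 2) * (j.+1%:R ^+ 2)^-1) =
      (k * (1 + kap^-1)) ^+ e * ((k / j.+1%:R) * (1 + kap^-1)) ^+ 2.
    by rewrite !exprD !exprMn exprVn; move: (k ^+ e) (_ ^+ e) => *; ring.
  have -> : k / j.+1%:R * (1 + kap^-1) = kap + 1.
    by rewrite /k [_ * kap]mulrC mulfK ?pnatr_eq0 // mulrDr mulr1 mulfV // gt_eqF.
  have h1 : 1 <= (kap + 1) ^+ 2 by rewrite exprn_ege1 // lerDr ltW.
  apply: le_trans (_ : (k * (1 + kap^-1)) ^+ e <= _); last by rewrite ler_peMr.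
  by rewrite lerXn2r // nnegrE ?addr_ge0 ?mulr_ge0 ?addr_ge0 ?invr_ge0 ?(ltW k0) ?(ltW kap_gt0).
have -> : 4 * (C (e + 2)%N * (1 + kap^-1) ^+ (e + 2)) / j.+1%:R ^+ 2 =
  2 * (C (e + 2)%N * (1 + kap^-1) ^+ (e + 2)) / j.+1%:R ^+ 2 + 2 * (C (e + 2)%N * (1 + kap^-1) ^+ (e + 2)) / j.+1%:R ^+ 2.
  by rewrite -mulrDl -mulrDl -natrD.
exact: lerD.
Qed.

Lemma fourier_sum_le e n : \sum_(j < n) \sum_(m <- fourier_modes j) mm m * (1 + `|mk m|) ^+ e <= fourier_bound e.
Proof.
have B0 : 0 <= C (e + 2)%N * (1 + kap^-1) ^+ (e + 2).
  rewrite mulr_ge0 ?exprn_ge0 ?addr_ge0 ?invr_ge0 ?(ltW kap_gt0) //.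
  exact: le_trans (normr_ge0 _) (FC _ 0).
have h0 : \sum_(m <- fourier_modes 0) mm m * (1 + `|mk m|) ^+ e <= C 0.
  rewrite big_seq1 /= mul0r normr0 addr0 expr1n mulr1 normrM ger0_norm ?invr_ge0 ?(ltW L_gt0) //.
  by rewrite ler_pdivrMl // mulrC; apply: fcoef_bound.
case: n => [|n].
  have C0 : 0 <= C 0 by apply: le_trans (normr_ge0 _) (FC 0 0).
  by rewrite big_ord0 /fourier_bound addr_ge0 // mulr_ge0.
rewrite big_ord_recl; apply: lerD => //.
apply: le_trans (ler_sum _ (fun (i : 'I_n) _ => fourier_mode_le e i)) _.
rewrite -mulr_sumr; apply: le_trans (ler_wpM2l _ (sum_inv_sqr n)) _; first by rewrite mulr_ge0.
lra.
Qed.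

(** Convexity of the power along the segment from 1 to 1 + q. Hence the weight with scale eta_s
    exceeds the one with s = 0 by at most eta_s times a weight free of scales, and a small eta_s
    adds no more than 1 to the norm. *)
Lemma weight_expand (a q : R) s : 0 <= a <= 1 -> 0 <= q -> (1 + a * q) ^+ s <= 1 + a * (1 + q) ^+ s.
Proof.
move=> /andP[a0 a1] q0; suff : (1 + a * q) ^+ s <= 1 + a * ((1 + q) ^+ s - 1) by lra.
elim: s => [|s IH]; first by rewrite !expr0; lra.
rewrite !exprSr; apply: le_trans (ler_wpM2r _ IH) _; first by rewrite addr_ge0 ?mulr_ge0.
have Y1 : 1 <= (1 + q) ^+ s by rewrite exprn_ege1 // lerDl.
move: (_ ^+ _) Y1 => Y Y1.
have h : a * (a * (q * (Y - 1))) <= 1 * (a * (q * (Y - 1))).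
  by rewrite ler_wpM2r // !mulr_ge0 // subr_ge0.
nra.
Qed.

Lemma fourier_rep d : (forall s, 0 < eta s <= 1) -> (forall s, eta s * fourier_bound (d + s)%N <= 1) ->
  rep kap eta d (fourier_bound d + 1) (fun _ => Fd 0).
Proof.
move=> e01 eB.
have nn s n : \sum_(j < n) nrm eta d s (fourier_modes j) <= fourier_bound d + 1.
  apply: le_trans (lerD (fourier_sum_le d n) (eB s)).
  apply: le_trans (lerD (lexx _) (ler_wpM2l _ (fourier_sum_le (d + s) n))); last first.
    by have /andP[/ltW] := e01 s.
  rewrite mulr_sumr -big_split /=; apply: ler_sum => j _.
  rewrite mulr_sumr -big_split /=; apply: ler_sum => m _.
  rewrite [eta s * _]mulrCA -mulrDr ler_wpM2l ?mm_ge0 // /wgt.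
  have /andP[e0 e1] := e01 s.
  have h := weight_expand s (a := eta s) (q := `|mk m|) _ _.
  apply: le_trans (ler_wpM2l _ (h _ _)) _; rewrite ?exprn_ge0 ?addr_ge0 ?(ltW e0) //.
  by rewrite mulrDr mulr1 exprD mulrCA.
exists fourier_modes; split=> // t x.
have lP : lsum fourier_modes by apply: rep_lsum nn => s; have /andP[] := e01 s.
have [G HG] := lsum_cvg lP.
suff -> : Fd 0 x = G t x by exact: HG.
apply: (@mulfI _ L); first by rewrite gt_eqF.
refine (fourier_inversion kap_gt0 (@cF 0) pF _).
have := HG t x; rewrite -(@cvg_shiftS R) => H.
rewrite (_ : (fun n => _) = fun n => L * \sum_(j < n.+1) evl (fourier_modes j) t x).
  by apply: cvgM; [exact: cvg_cst|exact: H].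
apply/funext => n; rewrite big_ord_recl fourier_modes0 mulrDr mulrA mulfV ?gt_eqF // mul1r; congr (_ + _).
rewrite [in RHS](eq_bigr (fun j : 'I_n => L^-1 * (2 * fcoef kap (Fd 0) (j.+1%:R * kap) (- (j.+1%:R * kap * x))))); last first.
  by move=> j _; exact: fourier_modesS.
by rewrite -!mulr_sumr mulVKf // gt_eqF.
Qed.

End FourierSeries.

Lemma isd_translate {R : realType} (f : R -> R) (P x d : R) : isd f (x + P) d ->
  isd (fun y : R => f (y + P)) x d.
Proof.
move=> df; rewrite -[d]mulr1; apply: (@isd_chain R f (fun y => y + P)) => //.
by apply: isd_eq (is_deriveD (is_derive_id x 1) (is_derive_cst P x 1)) _; rewrite addr0.
Qed.

Lemma inverse_isd {R : realType} (f f' : R -> R) (c : R) : 0 < c ->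
  (forall x : R, isd f x (f' x)) -> (forall x, c <= f' x) ->
  exists2 g, (forall y, f (g y) = y) /\ (forall x, g (f x) = x) &
    forall y : R, isd g y (f' (g y))^-1.
Proof.
move=> c0 df fc.
have up a b : a <= b -> c * (b - a) <= f b - f a.
  move=> ab; have [d _ ->] := mvt_exc ab (fun x _ => df x).
  by rewrite ler_wpM2r ?subr_ge0.
have cf : continuous f by move=> x; exact: isd_cont (df x).
have inj : injective f.
  move=> a b; wlog ab : a b / a <= b.
    by move=> W; have [/W|/ltW/W h] := leP a b => // /esym/h.
  by move=> E; have := up _ _ ab; rewrite E subrr pmulr_rle0 // => ba; lra.
have surj y : exists x, f x = y.
  (* Since f grows at least at the rate c, f(- r) <= y <= f(r). *)
  pose r := `|y - f 0| / c.
  have r0 : 0 <= r by rewrite divr_ge0 // ltW.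
  have cr : c * r = `|y - f 0| by rewrite mulrC divfK // gt_eqF.
  have h1 := up 0 r r0; have h2 := up (- r) 0 _.
  have mr : - r <= r by lra.
  have [|x _ <-] := @IVT R f (- r) r y mr (continuous_subspaceT cf); last by exists x.
  have {}h2 := h2 ltac:(lra).
  rewrite subr0 cr in h1; rewrite opprK add0r cr in h2.
  have := ler_norm (y - f 0); have := ler_norm (- (y - f 0)); rewrite normrN => n1 n2.
  by rewrite ge_min le_max; apply/andP; split; apply/orP; [left|right]; lra.
have [g Hg] := choice surj.
have gf x : g (f x) = x by apply: inj; rewrite Hg.
exists g; first by [].
move=> y; rewrite -{1}[y]Hg; apply: is_derive_inverse.
- by near=> z; exact: gf.
- by near=> z; exact: cf.
- by rewrite gt_eqF // (lt_le_trans c0).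
Unshelve. all: by end_near. Qed.

(** * Arclength parametrization *)

Section Arclength.
Context {R : realType}.
Implicit Types (f e ua va wa : R -> R).

Definition Ds e f := fun x => e x * derive1 f x.

Lemma xsmooth_derive1 f : xsmooth (fun _ : R => f) ->
  (forall x : R, isd f x (derive1 f x)) /\ xsmooth (fun _ : R => derive1 f).
Proof. by move=> /xsmooth_dx[d s]; split=> // x; exact: (d 0 x). Qed.

Lemma xsmooth_Ds e f : xsmooth (fun _ : R => e) -> xsmooth (fun _ : R => f) ->
  xsmooth (fun _ : R => Ds e f).
Proof. by move=> xe /xsmooth_derive1[_ xf] N; exact: csmM. Qed.

(** The sequence takes the given value B at 0 and J, the only entries that influence the existence
    time. Its other entries are finite by periodicity, without control; they serve to choose the
    scales [eta]. *)
Lemma iter_Ds_bounds e f P J B : 0 < P -> xsmooth (fun _ : R => e) -> xsmooth (fun _ : R => f) ->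
  (forall x, e (x + P) = e x) -> (forall x, f (x + P) = f x) ->
  (forall x, `|f x| <= B) -> (forall x, `|iter J (Ds e) f x| <= B) ->
  exists C : nat -> R, [/\ C 0%N = B, C J = B & forall j x, `|iter j (Ds e) f x| <= C j].
Proof.
move=> P0 xe xf pe pf f0 fJ.
have xi j : xsmooth (fun _ : R => iter j (Ds e) f) by elim: j => // j IH; exact: xsmooth_Ds.
have pi' j x : iter j (Ds e) f (x + P) = iter j (Ds e) f x.
  elim: j x => [//|j IH] x; rewrite !iterS /Ds pe; congr (_ * _).
  have [d _] := xsmooth_derive1 (xi j).
  apply: isd_uniq (isd_ext IH _) (d x); exact: isd_translate.
have bd j : exists C, forall x, `|iter j (Ds e) f x| <= C.
  apply: (periodic_bounded P0) => [x|x]; last exact: pi'.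
  by have [d _] := xsmooth_derive1 (xi j); exact: isd_cont (d x).
have [C HC] := choice bd.
exists (fun j => if (j == 0%N) || (j == J) then B else C j); split; rewrite ?eqxx ?orbT //.
move=> j x; case: eqP => [->|_] /=; first exact: f0.
by case: eqP => [->|_]; [exact: fJ|exact: HC].
Qed.

(** It dominates N and [fourier_bound] + 1 for weight 3, hence the exponent 5 = 3 + 2, with 1 / kap
    replaced by its bound B. *)
Definition data_bound (N B : R) := N + 2 + B + 8 * (B * (1 + B) ^+ 5).

(* [e] is the inverse of the speed, so that [Ds e] is the arclength derivative. *)
Lemma arclength_flow (N B : R) ua va wa e : 0 <= N -> 1 <= B ->
  xsmooth (fun _ : R => ua) -> xsmooth (fun _ : R => va) -> xsmooth (fun _ : R => wa) ->
  xsmooth (fun _ : R => e) ->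
  (forall x, [/\ ua (x + 2 * pi) = ua x, va (x + 2 * pi) = va x, wa (x + 2 * pi) = wa x &
     e (x + 2 * pi) = e x]) ->
  (forall x, 0 < e x) -> (forall x, e x ^+ 2 * (derive1 ua x ^+ 2 + derive1 va x ^+ 2) = 1) ->
  (forall x, wa x * (ua x ^+ 2 + va x ^+ 2) = 1) ->
  (forall x, [/\ `|ua x| <= B, `|va x| <= B, `|wa x| <= B & (e x)^-1 <= B]) ->
  (forall x, [/\ `|iter 5 (Ds e) ua x| <= B, `|iter 5 (Ds e) va x| <= B & `|iter 3 (Ds e) wa x| <= B]) ->
  exists kap X0 u v h w, [/\ [/\ 0 < kap, (forall x : R, isd X0 x (e x)^-1) &
      forall x, X0 (x + 2 * pi) = X0 x + 2 * pi / kap],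
    exists eta, [/\ forall s : nat, 0 < eta s, exists Q, rep kap eta 2 Q u /\ rep kap eta 2 Q v & 
      exists Q, rep kap eta 0 Q h /\ rep kap eta 0 Q w],
    forall x, u 0 (X0 x) = ua x /\ v 0 (X0 x) = va x,
    forall t x, (dx u t x ^+ 2 + dx v t x ^+ 2) * h t x = 1 /\
      (u t x ^+ 2 + v t x ^+ 2) * w t x = 1 &
    forall t x, 0 < t < step_time (data_bound N B) ^+ 2 ->
      isd (u ^~ x) t (h t x * dx (dx u) t x - N * (w t x * u t x)) /\
      isd (v ^~ x) t (h t x * dx (dx v) t x - N * (w t x * v t x))].
Proof.
move=> N0 B1 xu xv xw xe per e0 e1 w1 Bd Bd5.
have B0 : 0 < B by apply: lt_le_trans ltr01 B1.
have P0 : 0 < 2 * pi :> R by rewrite mulr_gt0 ?pi_gt0.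
have ne x : e x != 0 by rewrite gt_eqF.
have ce : continuous e by move=> x; exact: (jc_x (t := 0) (csm_jc (xe 0))).
have clam : continuous (fun x => (e x)^-1) by move=> x; apply: cvgV; [exact: ne|exact: ce].
(* [X0] is the arclength, [g] its inverse and L the length of the curve; kap = 2 pi / L makes kap Z
   the frequencies of L-periodic functions, and 1 / kap <= B because the speed is at most B. *)
have [dX X00] := primP clam; set X0 := prim _ in dX X00.
have [Be HBe] := periodic_bounded P0 ce (fun x => let: And4 _ _ _ h := per x in h).
have Be0 : 0 < Be by apply: lt_le_trans (e0 0) _; apply: le_trans (HBe 0); exact: ler_norm.
have lamc x : Be^-1 <= (e x)^-1.
  by rewrite lef_pV2 ?posrE //; apply: le_trans (HBe x); exact: ler_norm.
have [g [Xg gX] dg] := inverse_isd (c := Be^-1) ltac:(by rewrite invr_gt0) dX lamc.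
pose L := X0 (2 * pi).
have L0 : 0 < L.
  have [c _] := mvt_exc (ltW P0) (fun x _ => dX x).
  by rewrite X00 subr0 /L => ->; rewrite subr0 mulr_gt0 // invr_gt0.
have LB : L <= B * (2 * pi).
  have [c _] := mvt_exc (ltW P0) (fun x _ => dX x).
  by rewrite X00 subr0 /L => ->; rewrite subr0 ler_pM2r //; have [] := Bd c.
have XL x : X0 (x + 2 * pi) = X0 x + L.
  have : X0 (x + 2 * pi) - X0 x = X0 (0 + 2 * pi) - X0 0.
    apply: (@isd0_cst R (fun x => X0 (x + 2 * pi) - X0 x)) => y.
    apply: isd_eq (is_deriveB (isd_translate (dX (y + 2 * pi))) (dX y)) _.
    by have [_ _ _ ->] := per y; rewrite subrr.
  by rewrite add0r X00 subr0 => E; rewrite -[LHS](subrK (X0 x)) E addrC.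
have gL y : g (y + L) = g y + 2 * pi by rewrite -{1}[y]Xg -XL gX.
pose kap := 2 * pi / L.
have k0 : 0 < kap by rewrite divr_gt0.
have kL : 2 * pi / kap = L by rewrite /kap invf_div mulrC divfK // gt_eqF.
have kB : kap^-1 <= B by rewrite /kap invf_div ler_pdivrMr.
have XD f : xsmooth (fun _ : R => f) -> forall y : R, isd (f \o g) y (Ds e f (g y)).
  move=> /xsmooth_derive1[df _] y; have := isd_chain (df (g y)) (dg y).
  by rewrite invrK mulrC.
have FD f : xsmooth (fun _ : R => f) -> forall j (y : R), isd (iter j (Ds e) f \o g) y (iter j.+1 (Ds e) f (g y)).
  move=> xf j; apply: XD; elim: j => // j IH; exact: xsmooth_Ds.
have [Cu [Cu0 Cu5 HCu]] := iter_Ds_bounds P0 xe xu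
  (fun x => let: And4 _ _ _ h := per x in h) (fun x => let: And4 h _ _ _ := per x in h)
  (fun x => let: And4 h _ _ _ := Bd x in h) (fun x => let: And3 h _ _ := Bd5 x in h).
have [Cv [Cv0 Cv5 HCv]] := iter_Ds_bounds P0 xe xv
  (fun x => let: And4 _ _ _ h := per x in h) (fun x => let: And4 _ h _ _ := per x in h)
  (fun x => let: And4 _ h _ _ := Bd x in h) (fun x => let: And3 _ h _ := Bd5 x in h).
have [Cw [Cw0 Cw3 HCw]] := iter_Ds_bounds P0 xe xw
  (fun x => let: And4 _ _ _ h := per x in h) (fun x => let: And4 _ _ h _ := per x in h)
  (fun x => let: And4 _ _ h _ := Bd x in h) (fun x => let: And3 _ _ h := Bd5 x in h).
have fb0 C f i : (forall j x, `|iter j (Ds e) f x| <= C j) -> 0 <= fourier_bound kap C i.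
  move=> HC; have C0 j : 0 <= C j by apply: le_trans (HC j 0).
  by rewrite addr_ge0 // !mulr_ge0 // exprn_ge0 // addr_ge0 // invr_ge0 ltW.
(* One sequence of scales has to serve both coordinates (weight 3) and the reciprocal of |z|^2
   (weight 1). *)
pose S s := fourier_bound kap Cu (3 + s) + fourier_bound kap Cv (3 + s) + fourier_bound kap Cw (1 + s).
pose eta s := (1 + S s)^-1.
have Su s := fb0 _ _ (3 + s)%N HCu; have Sv s := fb0 _ _ (3 + s)%N HCv; have Sw s := fb0 _ _ (1 + s)%N HCw.
have S1 s : 0 < 1 + S s by rewrite /S; have := Su s; have := Sv s; have := Sw s; lra.
have eta01 s : 0 < eta s <= 1.
  rewrite invr_gt0 S1 /= invf_le1 //.
  by rewrite /S; have := Su s; have := Sv s; have := Sw s; lra.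
have eta0 s : 0 < eta s by have /andP[] := eta01 s.
set M := data_bound N B.
have Bpow : 1 <= (1 + B) ^+ 5 by rewrite exprn_ege1 // lerDl ltW.
have Bp : 1 <= B * (1 + B) ^+ 5 by rewrite mulr_ege1.
have kp i : (1 + kap^-1) ^+ i <= (1 + B) ^+ i.
  by rewrite lerXn2r ?nnegrE ?addr_ge0 ?invr_ge0 ?(ltW k0) ?(ltW B0) // lerD2l.
have MU C : C 0%N = B -> C 5 = B -> fourier_bound kap C 3 + 1 <= M.
  move=> C0 C5; rewrite /fourier_bound C0 C5 /M /data_bound.
  have := ler_wpM2l (ltW B0) (kp 5).
  by rewrite -[in X in X -> _]/(3 + 2)%N; move: (B * _) (B * _) => *; lra.
have MW C : C 0%N = B -> C 3 = B -> fourier_bound kap C 1 + 1 <= M.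
  move=> C0 C5; rewrite /fourier_bound C0 C5 /M /data_bound.
  have : B * (1 + kap^-1) ^+ (1 + 2) <= B * (1 + B) ^+ 5; last by lra.
  apply: ler_wpM2l (ltW B0) _ _ _; refine (le_trans (kp 3) _).
  by rewrite ler_weXn2l // lerDl ltW.
have etaS s x : 0 <= x -> x <= 1 + S s -> eta s * x <= 1.
  by move=> x0 xS; rewrite /eta ler_pdivrMl // mulr1.
have mkrep f C d : xsmooth (fun _ : R => f) -> (forall x, f (x + 2 * pi) = f x) ->
    (forall j x, `|iter j (Ds e) f x| <= C j) -> 
    (forall s, eta s * fourier_bound kap C (d + s) <= 1) -> fourier_bound kap C d + 1 <= M ->
    rep kap eta d M (fun _ => f \o g).
  move=> xf pf HC eB CM; apply: (rep_le eta0 (leqnn d) CM).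
  apply: (fourier_rep k0 (Fd := fun j => iter j (Ds e) f \o g)) => //.
  - by move=> j x; exact: FD.
  - by move=> x; rewrite kL /= gL pf.
  - by move=> j x; exact: HC.
have ru : rep kap eta 3 M (fun _ => ua \o g).
  apply: (mkrep _ Cu) => //; first by move=> x; have [] := per x.
  - by move=> s; apply: etaS => //; rewrite /S; have := Su s; have := Sv s; have := Sw s; lra.
  - exact: MU.
have rv : rep kap eta 3 M (fun _ => va \o g).
  apply: (mkrep _ Cv) => //; first by move=> x; have [] := per x.
  - by move=> s; apply: etaS => //; rewrite /S; have := Su s; have := Sv s; have := Sw s; lra.
  - exact: MU.
have rw : rep kap eta 1 M (fun _ => wa \o g).
  apply: (mkrep _ Cw) => //; first by move=> x; have [] := per x.
  - by move=> s; apply: etaS => //; rewrite /S; have := Su s; have := Sv s; have := Sw s; lra.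
  - exact: MW.
have M1 : 1 <= M by rewrite /M /data_bound; lra.
have NM : N <= M by rewrite /M /data_bound; lra.
have D1 f y : xsmooth (fun _ : R => f) -> derive1 (f \o g) y = e (g y) * derive1 f (g y).
  by move=> xf; exact: (@isd_dx R (fun _ => f \o g) 0 y _ (XD f xf y)).
have [||u [v [h [w [[r1 r2 r3 r4] E0 E1 E2]]]]] := flow_fixed_point M1 N0 NM eta0 ru rv rw.
- move=> y; rewrite !D1 //; rewrite !exprMn -mulrDr; exact: e1.
- by move=> y /=; exact: w1.
exists kap, X0, u, v, h, w; split=> //.
- by split=> // x; rewrite kL.
- exists eta; split=> //; first by exists (M + 2).
  by exists (M + 2).
- by move=> x; have [-> ->] := E0 0 (X0 x) (lexx 0); rewrite /= gX.
Qed.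

End Arclength.

(** * Flows of time-dependent vector fields on the line *)

Section Flow.
Context {R : realType}.
Implicit Types (F G X : R -> R -> R) (s t x y : R).

Lemma tint_diff F t x y : jcont F -> isd (fun t => tint F t y - tint F t x) t (F t y - F t x).
Proof. by move=> cF; apply: is_deriveB; exact: isd_tint. Qed.

(* Two Picard iterates approach each other in the norm weighted by exp (2 La t). *)
Lemma tint_contract F G La C : 0 <= C -> jcont F -> jcont G -> 0 < La -> forall x,
  (forall t, 0 <= t <= 1 -> `|F t x - G t x| <= La * (C * expR (2 * La * t))) ->
  forall t, 0 <= t <= 1 -> `|tint F t x - tint G t x| <= C / 2 * expR (2 * La * t).
Proof.
move=> C0 cF cG La0 x H t /andP[t0 t1].
have dE s : isd (fun s => C / 2 * expR (2 * La * s)) s (La * (C * expR (2 * La * s))).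
  have D : isd (fun s => 2 * La * s) s (2 * La).
    by apply: isd_eq (is_deriveM (is_derive_cst (2 * La) s 1) (is_derive_id s 1)) _; rewrite /GRing.scale /=; ring.
  apply: isd_eq (is_deriveM (is_derive_cst (C / 2) s 1) (isd_chain (is_derive_expR _) D)) _.
  by rewrite /GRing.scale /=; field.
refine (@comparison R (fun s => tint F s x - tint G s x) (fun s => F s x - G s x)
  (fun s => C / 2 * expR (2 * La * s)) (fun s => La * (C * expR (2 * La * s))) 0 t t0 _ _ _ _).
- by move=> s _; apply: is_deriveB; exact: isd_tint.
- by move=> s /andP[s0 st]; apply: H; lra.
- by rewrite !tint0 // subrr normr0 mulr_ge0 ?divr_ge0 ?expR_ge0.
Qed.

Lemma clamp1 t : 0 <= clamp (1 : R) t <= 1.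
Proof. by have := @clamp_itv R 1 ltr01 t; rewrite expr1n. Qed.

Lemma clamp1_id t : 0 <= t <= 1 -> clamp (1 : R) t = t.
Proof. by move=> h; apply: clamp_id; rewrite expr1n. Qed.

(** Iteration in the norm weighted by exp(- 2 La t), which halves distances on all of [0, 1], so
    that no smallness of time is needed. Clamping time makes the iterates converge uniformly on the
    plane; the equivariance x + P -> X + L passes through every iterate. *)
Lemma picard G (X0 : R -> R) (La C0 P L : R) : jcont G -> 0 < La ->
  (forall t x, `|G t x| <= C0) -> (forall t x y, `|G t x - G t y| <= La * `|x - y|) ->
  continuous X0 -> (forall x, X0 (x + P) = X0 x + L) -> (forall t x, G t (x + L) = G t x) ->
  exists X, [/\ jcont X,
    forall t x, X t x = X0 x + tint (fun s y => G s (X s y)) (clamp 1 t) x &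
    forall t x, X t (x + P) = X t x + L].
Proof.
move=> cG La0 GC GL cX0 pX0 pG.
pose K n t x := nat_rect (fun _ => R -> R -> R) (fun _ x => X0 x)
  (fun _ Y t x => X0 x + tint (fun s y => G s (Y s y)) (clamp 1 t) x) n t x.
have KS n t x : K n.+1 t x = X0 x + tint (fun s y => G s (K n s y)) (clamp 1 t) x by [].
have cfst : jcont (fun t _ : R => t) by apply: jc_fst => t; exact: cvg_id.
have jK n : jcont (K n).
  elim: n => [|n IH]; first exact: jc_snd.
  apply: jcD; first exact: jc_snd.
  apply: (jc_comp (f := tint (fun s y => G s (K n s y))) (g := fun t _ => clamp 1 t) (h := fun _ x => x)).
  - by apply: jc_tint; apply: (jc_comp cG cfst IH).
  - by apply: jc_fst; exact: continuous_clamp.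
  - by apply: jc_snd => x; exact: cvg_id.
have jG Y : jcont Y -> jcont (fun s y => G s (Y s y)) by move=> cY; exact: (jc_comp cG cfst cY).
pose E t := expR (2 * La * t).
have C00 : 0 <= C0 by exact: le_trans (normr_ge0 _) (GC 0 0).
(* Chosen so that [tint_contract] applies to the first increment with the constant 2 A: its
   right-hand side is then at least 4 C0, beyond the bound C0 of G. *)
pose A := 2 * C0 / La.
have A0 : 0 <= A by rewrite divr_ge0 ?mulr_ge0 // ltW.
have step n t x : 0 <= t <= 1 -> `|K n.+1 t x - K n t x| <= A / 2 ^+ n * E t.
  elim: n t => [|n IH] t tt.
    rewrite KS /= clamp1_id // addrAC subrr add0r expr0 divr1.
    have h := @tint_contract (fun s y => G s (X0 y)) (fun _ _ => 0) La (2 * A) _ _ _ _ x _ t tt.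
    have z0 : tint (fun _ _ : R => 0 : R) t x = 0.
      have j0 : jcont (fun _ _ : R => 0 : R) by exact: (csm_jc (csm_cst 0 0)).
      apply: etrans (tint0 x j0); apply: (@isd0_cst R (fun s => tint (fun _ _ : R => 0 : R) s x)) => s.
      exact: (@isd_tint R (fun _ _ : R => 0 : R)).
    rewrite z0 subr0 in h; apply: le_trans (h _ _ _ _ _) _.
    - by rewrite mulr_ge0.
    - by apply: jG; exact: jc_snd.
    - exact: (csm_jc (csm_cst 0 0)).
    - by [].
    - move=> s /andP[s0 s1]; rewrite subr0; apply: le_trans (GC _ _) _.
      have -> : La * (2 * A * expR (2 * La * s)) = 4 * C0 * expR (2 * La * s).
        by rewrite /A; field; rewrite gt_eqF.
      have E1 : 1 <= expR (2 * La * s) by rewrite -expR0 ler_expR !mulr_ge0 // ltW.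
      by rewrite -[leLHS]mulr1; apply: ler_pM => //; lra.
    - by have -> : 2 * A / 2 = A by field.
  rewrite !KS clamp1_id // opprD addrACA subrr add0r.
  have -> : A / 2 ^+ n.+1 = A / 2 ^+ n / 2 by rewrite exprSr invfM mulrA.
  apply: tint_contract => //; [by rewrite divr_ge0 ?exprn_ge0|exact: jG|exact: jG|].
  by move=> s /IH h; apply: le_trans (GL _ _ _) _; rewrite ler_pM2l.
have Kcl n t x : K n t x = K n (clamp 1 t) x.
  by case: n => [//|n]; rewrite !KS (@clamp1_id (clamp 1 t)) // clamp1.
pose B := A * E 1.
have B0 : 0 <= B by rewrite mulr_ge0 ?expR_ge0.
have unif n t x : `|K n.+1 t x - K n t x| <= B / 2 ^+ n.
  rewrite (Kcl n) (Kcl n.+1); have /andP[c0 c1] := clamp1 t.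
  apply: le_trans (step n _ _ _) _; first by rewrite c0.
  rewrite /B mulrAC ler_pM2r ?invr_gt0 ?exprn_gt0 //.
  by rewrite ler_wpM2l // ler_expR ler_pM2l // mulr_gt0.
have dist n q t x : (n <= q)%N -> `|K q t x - K n t x| <= 2 * B / 2 ^+ n.
  move=> nq; suff : `|K q t x - K n t x| <= 2 * B / 2 ^+ n - 2 * B / 2 ^+ q.
    have hq : 0 <= 2 * B / 2 ^+ q by apply: divr_ge0; [exact: mulr_ge0|exact: exprn_ge0].
    by move/le_trans; apply; rewrite gerBl.
  elim: q nq => [|q IH]; first by rewrite leqn0 => /eqP ->; rewrite !subrr normr0.
  rewrite leq_eqVlt => /predU1P[->|/IH h]; first by rewrite !subrr normr0.
  have -> : K q.+1 t x - K n t x = (K q.+1 t x - K q t x) + (K q t x - K n t x) by rewrite addrA subrK.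
  apply: le_trans (ler_normD _ _) _; apply: le_trans (lerD (unif q t x) h) _.
  by rewrite exprSr invfM; move: ((2 ^+ q)^-1) ((2 ^+ n)^-1) => a b; lra.
have e0 : (fun n => 2 * B / 2 ^+ n) @ \oo --> (0 : R).
  have H : (fun n => 2 * B * 2^-1 ^+ n) @ \oo --> 2 * B * 0.
    apply: cvgM; first exact: cvg_cst.
    by apply: cvg_expr; rewrite ger0_norm ?invr_ge0 // invf_lt1 // ltr1n.
  rewrite mulr0 in H; suff -> : (fun n => 2 * B / 2 ^+ n) = (fun n => 2 * B * 2^-1 ^+ n) by [].
  by apply/funext => n; rewrite exprVn.
have [X HX] : exists X, forall t x, (fun n => K n t x) @ \oo --> X t x.
  exists (fun t x => lim ((fun n => K n t x) @ \oo)) => t x.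
  apply: cauchy_cvg; apply: cauchy_exP => r r0.
  have /cvgrPdist_lt/(_ r r0)[n0 _ Hn0] := e0.
  exists (K n0 t x); exists n0 => // n /= nn; rewrite -ball_normE /= distrC.
  apply: le_lt_trans (dist _ _ _ _ nn) _; have := Hn0 n0 (leqnn _) => /=.
  by rewrite sub0r normrN => /(le_lt_trans (ler_norm _)).
have rate n t x : `|K n t x - X t x| <= 2 * B / 2 ^+ n.
  by rewrite distrC; apply: (cvg_dist_le (HX t x)) => q; exact: dist.
have jX : jcont X.
  apply: (@continuous_uniform_limit R _ (fun n p => K n p.1 p.2) _ (fun n => 2 * B / 2 ^+ n)) => //.
exists X; split=> // [t x|t x]; last first.
  have pK n s y : K n s (y + P) = K n s y + L.
    elim: n s y => [//|n IH] s y; rewrite !KS pX0 addrAC; congr (_ + _ + _).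
    rewrite /tint; congr (prim _ _); apply/funext => r; by rewrite IH pG.
  have H1 := HX t (x + P); have H2 : (fun n => K n t x + L) @ \oo --> X t x + L.
    by apply: cvgD; [exact: HX|exact: cvg_cst].
  rewrite (_ : (fun n => K n t (x + P)) = fun n => K n t x + L) in H1; last by apply/funext => n.
  exact: (cvg_unique _ H1 H2).
set c := clamp 1 t; have /andP[c0 c1] : 0 <= c <= 1 by exact: clamp1.
have H2 : (fun n => K n.+1 t x) @ \oo --> X t x by have := HX t x; rewrite -(@cvg_shiftS R).
suff H1 : (fun n => K n.+1 t x) @ \oo --> X0 x + tint (fun s y => G s (X s y)) c x.
  exact: (cvg_unique _ H2 H1).
apply: cvgD; first exact: cvg_cst.
have H0 : (fun n => La * (2 * B / 2 ^+ n)) @ \oo --> La * 0 by apply: cvgM; [exact: cvg_cst|exact: e0].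
rewrite mulr0 in H0; apply/cvgrPdist_lt => r r0.
have /cvgrPdist_lt/(_ r r0) := H0; apply: filterS => n /=; rewrite sub0r normrN => h.
apply: le_lt_trans h; apply: le_trans (ler_norm _).
have D s : isd (fun s => tint (fun s y => G s (X s y)) s x - tint (fun s y => G s (K n s y)) s x) s
    (G s (X s x) - G s (K n s x)).
  by apply: is_deriveB; apply: (isd_tint (f := fun s y => G s (_ s y))); apply: jG.
have := prim_le (T := 1) D _ (C := La * (2 * B / 2 ^+ n)) _ (t := c) _.
rewrite !tint0 ?subrr; try exact: jG.
move=> /(_ erefl) W; apply: le_trans (W _ _) _.
- move=> s _; apply: le_trans (GL _ _ _) _; rewrite ler_pM2l // distrC; exact: rate.
- by rewrite ger0_norm.
- rewrite ger0_norm //; apply: ler_piMr => //; apply: mulr_ge0 (ltW La0) _.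
  by apply: divr_ge0; [exact: mulr_ge0|exact: exprn_ge0].
Qed.

(* Uniqueness of ODE solutions in disguise: with D = X t y - X t x the quotient of D by
   exp (int G_x) has derivative (G_x (xi) - G_x (X)) D exp(- int G_x), which is o(y - x). *)
Lemma isd_flow G Gx X (X0 X0' : R -> R) La : jcont G -> jcont Gx ->
  (forall t x, isd (G t) x (Gx t x)) -> 0 < La -> (forall t x, `|Gx t x| <= La) -> jcont X ->
  (forall x, isd X0 x (X0' x)) ->
  (forall t x, X t x = X0 x + tint (fun s y => G s (X s y)) (clamp 1 t) x) ->
  forall t x, isd (X t) x (X0' x * expR (tint (fun s y => Gx s (X s y)) (clamp 1 t) x)).
Proof.
move=> cG cGx dG La0 GxL jX dX0 EX t0 x.
have cfst : jcont (fun t _ : R => t) by apply: jc_fst => t; exact: cvg_id.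
have jF : jcont (fun s y => G s (X s y)) by exact: (jc_comp cG cfst jX).
have jFx : jcont (fun s y => Gx s (X s y)) by exact: (jc_comp cGx cfst jX).
have cl := clamp1 t0; set c := clamp 1 t0 in cl *.
pose Y s := tint (fun s y => Gx s (X s y)) s x.
have dY s : isd Y s (Gx s (X s x)) by exact: (isd_tint (f := fun s y => Gx s (X s y))).
pose D y s := (X0 y + tint (fun s y => G s (X s y)) s y) - (X0 x + tint (fun s y => G s (X s y)) s x).
have dD y s : isd (D y) s (G s (X s y) - G s (X s x)).
  apply: (@isd_ext _ (fun s => (X0 y - X0 x) + (tint (fun s y => G s (X s y)) s y - tint (fun s y => G s (X s y)) s x))).
    by move=> r; rewrite /D opprD addrACA.
  apply: isd_eq (is_deriveD (is_derive_cst (X0 y - X0 x) s 1) (tint_diff s x y jF)) _.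
  by rewrite add0r.
have DX y s : 0 <= s <= 1 -> D y s = X s y - X s x.
  by move=> s01; rewrite /D !EX clamp1_id.
have D0 y : D y 0 = X0 y - X0 x by rewrite /D !tint0 // !addr0.
have [xi Hxi] : exists xi : R -> R -> R, forall y s, `|xi y s - X s x| <= `|X s y - X s x| /\ G s (X s y) - G s (X s x) = Gx s (xi y s) * (X s y - X s x).
  suff /choice[xi Hxi] : forall ys : R * R, exists z, `|z - X ys.2 x| <= `|X ys.2 ys.1 - X ys.2 x| /\ G ys.2 (X ys.2 ys.1) - G ys.2 (X ys.2 x) = Gx ys.2 z * (X ys.2 ys.1 - X ys.2 x).
    by exists (fun y s => xi (y, s)) => y s; exact: (Hxi (y, s)).
  by move=> [y s] /=; have [z h1 h2] := mvt (X s x) (X s y) (dG s); exists z.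
(* The difference of two solutions divided by its expected growth factor; constant up to o(y -
   x). *)
pose ed y s := expR (- Y s) * D y s.
have ded y s : 0 <= s <= 1 -> isd (ed y) s (expR (- Y s) * ((Gx s (xi y s) - Gx s (X s x)) * D y s)).
  move=> s01; apply: isd_eq (is_deriveM (isd_chain (is_derive_expR _) (is_deriveN (dY s))) (dD y s)) _.
  by rewrite (Hxi y s).2 DX // /GRing.scale /=; move: (expR _) => *; ring.
have YL s : 0 <= s <= 1 -> `|Y s| <= La.
  move=> /andP[s0 s1]; have Y0 : Y 0 = 0 by exact: tint0.
  have := prim_le (T := 1) dY Y0 (C := La) (fun s _ => GxL s (X s x)) (t := s).
  by rewrite ger0_norm // => /(_ s1)/le_trans; apply; rewrite ler_piMr // ltW.
have eY s : 0 <= s <= 1 -> expR (- Y s) <= expR La /\ expR (Y s) <= expR La.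
  by move=> /YL; rewrite !ler_expR ler_norml => /andP[? ?]; split; lra.
(* Gronwall's inequality: exp(- 2 La s) D^2 is nonincreasing because |Gx| <= La. *)
have Dlip y s : 0 <= s <= 1 -> `|D y s| <= `|X0 y - X0 x| * expR La.
  move=> s01; have /andP[s0 s1] := s01; pose Q s := - (expR (- (2 * La * s)) * (D y s * D y s)).
  have dQ r : 0 <= r <= s -> isd Q r (2 * expR (- (2 * La * r)) * ((La - Gx r (xi y r)) * (D y r * D y r))).
    move=> /andP[r0 rs]; have r01 : 0 <= r <= 1 by rewrite r0 (le_trans rs).
    have D1 : isd (fun s : R => - (2 * La * s)) r (- (2 * La)).
      apply: isd_eq (is_deriveN (is_deriveM (is_derive_cst (2 * La) r 1) (is_derive_id r 1))) _.
      by rewrite /GRing.scale /=; ring.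
    apply: isd_eq (is_deriveN (is_deriveM (isd_chain (is_derive_expR _) D1) (is_deriveM (dD y r) (dD y r)))) _.
    rewrite -[(D y * D y) r]/(D y r * D y r) (Hxi y r).2 -DX // /GRing.scale /=.
    by move: (expR _) (Gx _ _) (D y r) => *; ring.
  have : Q 0 <= Q s.
    apply: (nondecr_on s0 dQ) => r _; apply: mulr_ge0; first by rewrite mulr_ge0 ?expR_ge0.
    rewrite mulr_ge0 //; last by rewrite -expr2 sqr_ge0.
    by have := GxL r (xi y r); rewrite ler_norml => /andP[_]; lra.
  rewrite /Q mulr0 oppr0 expR0 mul1r lerN2 D0 => h.
  rewrite -ler_sqr ?nnegrE ?mulr_ge0 ?expR_ge0 // -normrX ger0_norm ?sqr_ge0 // exprMn -normrX (ger0_norm (sqr_ge0 _)).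
  have h2 : expR (- (2 * La * s)) * (expR (2 * La * s)) = 1 by rewrite -expRD addNr expR0.
  have h3 : expR (2 * La * s) <= expR La ^+ 2 by rewrite expr2 -expRD ler_expR; nra.
  have h4 : D y s ^+ 2 <= (X0 y - X0 x) ^+ 2 * expR (2 * La * s).
    have -> : D y s ^+ 2 = expR (- (2 * La * s)) * (D y s * D y s) * expR (2 * La * s).
      by rewrite mulrAC h2 mul1r expr2.
    by rewrite ler_pM2r ?expR_gt0 // [leRHS]expr2.
  by apply: le_trans h4 _; rewrite ler_wpM2l ?sqr_ge0.
apply/isdP => e e0.
pose K := `|X0' x| + 1.
have K0 : 0 < K by rewrite ltr_wpDl.
have /isdP/(_ 1 ltr01)[r1 r10 Hr1] := dX0 x.
have XK y : `|y - x| < r1 -> `|X0 y - X0 x| <= K * `|y - x|.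
  move=> yr; have h := Hr1 y yr; rewrite mul1r in h.
  rewrite -[X0 y - X0 x](subrK (X0' x * (y - x))); apply: le_trans (ler_normD _ _) _.
  by rewrite normrM /K mulrDl mul1r addrC lerD2l.
pose W := expR La ^+ 3 * K.
have W0 : 0 < W by rewrite mulr_gt0 // exprn_gt0 // expR_gt0.
(* Half of e for the variation of Gx, whose error is multiplied by W in total; the other half is for
   the derivative of X0. *)
pose e1 := e / (2 * W).
have e10 : 0 < e1 by rewrite divr_gt0 // mulr_gt0.
have jGs : jcont (fun s y => Gx s (X s x + y)).
  have h1 : jcont (fun s _ : R => X s x) by apply: jc_fst; exact: jc_t jX.
  have h2 : jcont (fun _ y : R => y) by apply: jc_snd => z; exact: cvg_id.
  exact: (jc_comp cGx cfst (jcD h1 h2)).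
have [r2 r20 Hr2] := jc_tube 0 0 1 jGs e10.
have /isdP/(_ (e / (2 * expR La)) _)[|r3 r30 Hr3] := dX0 x; first by rewrite divr_gt0 // mulr_gt0 // expR_gt0.
exists (Num.min r1 (Num.min r3 (r2 / (K * expR La)))).
  by rewrite !lt_min r10 r30 divr_gt0 // mulr_gt0 // expR_gt0.
move=> y; rewrite !lt_min => /and3P[y1 y3 y2].
have D1 s : 0 <= s <= 1 -> `|D y s| <= K * expR La * `|y - x|.
  move=> s01; apply: le_trans (Dlip y s s01) _; rewrite mulrAC ler_pM2r ?expR_gt0 //; exact: XK.
have yr2 : K * expR La * `|y - x| < r2 by rewrite mulrC -ltr_pdivlMr // mulr_gt0 // expR_gt0.
have gx s : 0 <= s <= 1 -> `|Gx s (xi y s) - Gx s (X s x)| <= e1.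
  move=> s01; have := Hr2 s (xi y s - X s x) s01; rewrite subr0 [X s x + _]addrC subrK addr0 => h; apply/ltW/h.
  apply: le_lt_trans (Hxi y s).1 _; rewrite -DX //; apply: le_lt_trans yr2; exact: D1.
have edc : `|ed y c - ed y 0| <= expR La * (e1 * (K * expR La * `|y - x|)).
  have /andP[c0 c1] := cl.
  have [z /andP[z0 zc] ->] := mvt_exc c0 (fun s (h : 0 <= s <= c) => ded y s ltac:(by case/andP: h => -> /le_trans; apply)).
  have z01 : 0 <= z <= 1 by rewrite z0 (le_trans zc).
  rewrite subr0 normrM (ger0_norm c0) -[leRHS]mulr1; apply: ler_pM => //.
  rewrite normrM (ger0_norm (expR_ge0 _)) normrM; apply: ler_pM; rewrite ?expR_ge0 ?mulr_ge0 //.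
    exact: (eY z z01).1.
  by apply: ler_pM => //; [exact: gx|exact: D1].
have -> : X t0 y - X t0 x = expR (Y c) * ed y c.
  by rewrite /ed mulrA -expRD subrr expR0 mul1r /D !EX.
have E0 : ed y 0 = X0 y - X0 x by rewrite /ed D0 /Y tint0 // oppr0 expR0 mul1r.
rewrite -/(Y c).
have -> : expR (Y c) * ed y c - X0' x * expR (Y c) * (y - x) =
  expR (Y c) * ((ed y c - ed y 0) + (X0 y - X0 x - X0' x * (y - x))) by rewrite E0; ring.
rewrite normrM (ger0_norm (expR_ge0 _)).
have h3 := Hr3 y y3; have eYc := (eY c cl).2.
apply: le_trans (ler_pM (expR_ge0 _) (normr_ge0 _) eYc (le_trans (ler_normD _ _) (lerD edc h3))) _.
rewrite le_eqVlt; apply/orP; left; apply/eqP; rewrite /e1 /W.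
have EL : expR La != 0 by rewrite gt_eqF // expR_gt0.
by move: (expR La) `|y - x| EL => p q p0; field; rewrite p0 gt_eqF.
Qed.

(** The formula X_x = X0' exp(int G_x(X)) expresses the derivative through X itself, so that each
    order of spatial smoothness yields the next. *)
Lemma flow_xsmooth G (X0 X0' : R -> R) La C0 P L : xsmooth G -> 0 < La ->
  (forall t x, `|G t x| <= C0) -> (forall t x, `|dx G t x| <= La) ->
  (forall x, isd X0 x (X0' x)) -> xsmooth (fun _ : R => X0') -> (forall x, 0 < X0' x) ->
  (forall x, X0 (x + P) = X0 x + L) -> (forall t x, G t (x + L) = G t x) ->
  exists X Xx, [/\ xsmooth X, (forall t x, isd (X t) x (Xx t x)) /\ (forall t x, 0 < Xx t x),
    forall x, X 0 x = X0 x,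
    forall t x, X t (x + P) = X t x + L &
    forall t x, 0 < t < 1 -> isd (X ^~ x) t (G t (X t x))].
Proof.
move=> xG La0 GC GL dX0 xX0 X0p pX0 pG.
have [dG xGx] := xsmooth_dx xG; have jG := csm_jc (xG 0); have jGx := csm_jc (xGx 0).
have lip t x y : `|G t x - G t y| <= La * `|x - y| by exact: mvt_abs (dG t) (GL t).
have cX0 : continuous X0 by move=> x; exact: isd_cont (dX0 x).
have [X [jX EX pX]] := picard jG La0 GC lip cX0 pX0 pG.
have dX := isd_flow jG jGx dG La0 GL jX dX0 EX.
set Xx := fun t x => X0' x * expR (tint (fun s y => dx G s (X s y)) (clamp 1 t) x).
have cfst : jcont (fun t _ : R => t) by apply: jc_fst => t; exact: cvg_id.
have jF : jcont (fun s y => G s (X s y)) by exact: (jc_comp jG cfst jX).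
exists X, Xx; split=> //.
- move=> N; elim: N => [//|N IH]; apply: (xsmooth_csm dX) => //.
  apply: csmM; first exact: xX0.
  apply: csm_exp; apply: (csm_time (k := clamp 1) (f := tint (fun s y => dx G s (X s y)))).
    exact: continuous_clamp.
  by apply: csm_tint; apply: csm_comp.
- by split=> // t x; rewrite mulr_gt0 ?expR_gt0.
- by move=> x; rewrite EX clamp1_id ?lexx ?ler01 // tint0 // addr0.
- move=> t x t01; apply: (@near_oo_isd _ (fun t => X0 x + tint (fun s y => G s (X s y)) t x) _ 0 1) => //.
    by move=> s /andP[s0 s1]; rewrite [RHS]EX clamp1_id // !ltW.
  apply: isd_eq (is_deriveD (is_derive_cst (X0 x) t 1) (isd_tint t x jF)) _.
  by rewrite add0r.
Qed.

End Flow.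

(** The spatial derivative of F is known at one point only; the increment in time is taken at the
    moving point X s, where the joint continuity of [Ft] controls it. *)
Lemma isd_curve {R : realType} (F Ft Fx : R -> R -> R) (X : R -> R) (t d r : R) : 0 < r ->
  (forall s y : R, `|s - t| < r -> isd (F ^~ y) s (Ft s y)) -> jcont Ft ->
  isd (F t) (X t) (Fx t (X t)) -> isd X t d ->
  isd (fun s => F s (X s)) t (Ft t (X t) + Fx t (X t) * d).
Proof.
move=> r0 dt jFt dx dX.
have A : isd (fun s => F t (X s)) t (Fx t (X t) * d) by exact: (isd_chain dx dX).
suff B : isd (fun s => F s (X s) - F t (X s)) t (Ft t (X t)).
  by apply: isd_ext (is_deriveD B A) => s; rewrite /= subrK.
apply/isdP => e e0.
have cX := isd_cont dX.
have /(jcontP Ft)/(_ t (X t) e e0)[r1 r10 H1] := jFt.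
have /contP/(_ r1 r10)[r2 r20 H2] := cX.
exists (Num.min r (Num.min r1 r2)); first by rewrite !lt_min r0 r10.
move=> s; rewrite !lt_min => /and3P[sr s1 s2]; rewrite subrr subr0.
pose P w := F w (X s) - Ft t (X t) * w.
have dP w : `|w - t| < r -> isd P w (Ft w (X s) - Ft t (X t)).
  move=> wr; apply: isd_eq (is_deriveB (dt w (X s) wr) (is_deriveM (is_derive_cst (Ft t (X t)) w 1) (is_derive_id w 1))) _.
  by rewrite /GRing.scale /=; ring.
have E : F s (X s) - F t (X s) - Ft t (X t) * (s - t) = P s - P t by rewrite /P; ring.
rewrite E.
have [st|st] := leP t s.
  have H w : t <= w <= s -> isd P w (Ft w (X s) - Ft t (X t)).
    move=> /andP[tw ws]; apply: dP; apply: le_lt_trans sr.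
    by rewrite !ger0_norm ?subr_ge0 // lerD2r.
  have [c /andP[c1 c2] ->] := mvt_exc st H.
  rewrite normrM ler_wpM2r //; apply/ltW/H1; last exact: H2.
  by apply: le_lt_trans s1; rewrite !ger0_norm ?subr_ge0 // lerD2r.
have H w : s <= w <= t -> isd P w (Ft w (X s) - Ft t (X t)).
  move=> /andP[sw wt]; apply: dP; apply: le_lt_trans sr.
  by rewrite !ler0_norm ?subr_le0 // ?(ltW st) // lerN2 lerD2r.
have [c /andP[c1 c2] Ec] := mvt_exc (ltW st) H.
rewrite distrC Ec normrM [`|t - s|]distrC ler_wpM2r //; apply/ltW/H1; last exact: H2.
apply: le_lt_trans s1; rewrite !ler0_norm ?subr_le0 // ?(ltW st) // lerN2 lerD2r //.
Qed.

(** * Short-time existence for the normal flow *)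

Section NormalFlow.
Context {R : realType}.
Implicit Types (u v U V f g : R -> R -> R) (t x N : R).

(* The flow of profile curves reads u_t = - v_x q, v_t = u_x q with q = nflow (n - 1) u v. *)
Definition nflow N u v t x :=
  ((dx u t x * dx (dx v) t x - dx v t x * dx (dx u) t x) *
     (dx u t x * dx u t x + dx v t x * dx v t x)^-1
   - N * ((dx u t x * v t x - dx v t x * u t x) * (u t x * u t x + v t x * v t x)^-1)) *
  (dx u t x * dx u t x + dx v t x * dx v t x)^-1.

(** The span 1 is that of the flow of parameters in [flow_xsmooth]. *)
Definition existence_time (N B : R) := Num.min 1 (step_time (data_bound N B) ^+ 2).

Lemma existence_time_gt0 N B : 0 <= N -> 1 <= B -> 0 < existence_time N B.
Proof.
move=> N0 B1; have B0 : 0 <= B by apply: le_trans ler01 B1.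
have D0 : 0 < data_bound N B.
  have h : 0 <= B * (1 + B) ^+ 5 by rewrite mulr_ge0 // exprn_ge0 // addr_ge0.
  by rewrite /data_bound; lra.
by rewrite lt_min ltr01 /= exprn_gt0 // invr_gt0 !mulr_gt0 // exprn_gt0.
Qed.

Lemma short_time_existence (N B : R) (ua va wa e : R -> R) : 0 <= N -> 1 <= B ->
  xsmooth (fun _ : R => ua) -> xsmooth (fun _ : R => va) -> xsmooth (fun _ : R => wa) ->
  xsmooth (fun _ : R => e) ->
  (forall x, [/\ ua (x + 2 * pi) = ua x, va (x + 2 * pi) = va x, wa (x + 2 * pi) = wa x &
     e (x + 2 * pi) = e x]) ->
  (forall x, 0 < e x) -> (forall x, e x ^+ 2 * (derive1 ua x ^+ 2 + derive1 va x ^+ 2) = 1) ->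
  (forall x, wa x * (ua x ^+ 2 + va x ^+ 2) = 1) ->
  (forall x, [/\ `|ua x| <= B, `|va x| <= B, `|wa x| <= B & (e x)^-1 <= B]) ->
  (forall x, [/\ `|iter 5 (Ds e) ua x| <= B, `|iter 5 (Ds e) va x| <= B & `|iter 3 (Ds e) wa x| <= B]) ->
  exists U V, [/\ xsmooth U /\ xsmooth V,
    forall t x, U t (x + 2 * pi) = U t x /\ V t (x + 2 * pi) = V t x,
    forall x, U 0 x = ua x /\ V 0 x = va x,
    forall t x, U t x * U t x + V t x * V t x != 0 /\
       dx U t x * dx U t x + dx V t x * dx V t x != 0 &
    forall t x, 0 < t < existence_time N B ->
      isd (U ^~ x) t (- dx V t x * nflow N U V t x) /\
      isd (V ^~ x) t (dx U t x * nflow N U V t x)].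
Proof.
move=> N0 B1 xu xv xw xe per e0 e1 w1 Bd Bd5.
have [kap [X0 [u [v [h [w [[k0 dX0 pX0] [eta [eta0 [Q2 [ru rv]] [Q0 [rh rw]]]] E0 E1 E2]]]]]]] :=
  arclength_flow N0 B1 xu xv xw xe per e0 e1 w1 Bd Bd5.
set L := 2 * pi / kap in pX0.
pose xr f := exists Q, rep kap eta 0 Q f.
have xrM f g : xr f -> xr g -> xr (fun t x => f t x * g t x).
  by move=> [Q H] [Q' H']; exists (Q * Q'); exact: repM.
have xrD f g : xr f -> xr g -> xr (fun t x => f t x + g t x).
  by move=> [Q H] [Q' H']; exists (Q + Q'); exact: repD.
have xrB f g : xr f -> xr g -> xr (fun t x => f t x - g t x).
  by move=> [Q H] [Q' H']; exists (Q + Q'); exact: repB.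
have xrN f : xr f -> xr (fun t x => - f t x).
  by move=> [Q H]; exists Q; exact: repN.
have xrZ c f : xr f -> xr (fun t x => c * f t x).
  by move=> [Q H]; exists (`|c| * Q); exact: repZ.
have xr0 d Q f : rep kap eta d Q f -> xr f by move=> H; exists Q; exact: rep_le H.
have xh : xr h by exists Q0.
have xrw : xr w by exists Q0.
have xru := xr0 _ _ _ ru; have xrv := xr0 _ _ _ rv.
have xu1 := xr0 _ _ _ (rep_dx eta0 ru); have xv1 := xr0 _ _ _ (rep_dx eta0 rv).
have xu2 := xr0 _ _ _ (rep_dx eta0 (rep_dx eta0 ru)); have xv2 := xr0 _ _ _ (rep_dx eta0 (rep_dx eta0 rv)).
pose P t x := h t x * dx (dx u) t x - N * (w t x * u t x).
pose Q t x := h t x * dx (dx v) t x - N * (w t x * v t x).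
have xP : xr P by apply: xrB; [exact: xrM|apply: xrZ; exact: xrM].
have xQ : xr Q by apply: xrB; [exact: xrM|apply: xrZ; exact: xrM].
(* Since h = 1 / |z_x|^2, this is minus the tangential coefficient of the velocity (P, Q). Along X_t
   = G(t, X) the curve acquires the extra velocity G z_x, and only the normal part of (P, Q)
   remains. *)
pose G t x := - (h t x * (P t x * dx u t x + Q t x * dx v t x)).
have [C0 rG] : xr G by exact: (xrN _ (xrM _ _ xh (xrD _ _ (xrM _ _ xP xu1) (xrM _ _ xQ xv1)))).
have lG := rep_lrep eta0 rG; have [_ lG1] := lrep_dx lG.
have [La HLa] := lrep_bnd lG1.
have La0 : 0 <= La by apply: le_trans (HLa 0 0).
have ne x : e x != 0 by rewrite gt_eqF.
have xl : xsmooth (fun _ : R => fun x => (e x)^-1).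
  by move=> M; apply: csmV => // t x; exact: ne.
have La1 : 0 < La + 1 by lra.
have GLa t x : `|dx G t x| <= La + 1 by apply: le_trans (HLa t x) _; rewrite lerDl.
have X0p x : 0 < (e x)^-1 by rewrite invr_gt0.
have pG t x : G t (x + L) = G t x by rewrite (rep_periodic t x _ rG) // gt_eqF.
have [X [Xx [xX [dX Xp] X0E pX ODE]]] := flow_xsmooth (lrep_xsmooth lG) La1
  (fun t x => rep_bound eta0 t x rG) GLa dX0 xl X0p pX0 pG.
have xsu := lrep_xsmooth (rep_lrep eta0 ru); have xsv := lrep_xsmooth (rep_lrep eta0 rv).
have XxE t x : dx X t x = Xx t x by exact: isd_dx.
have xXx : xsmooth Xx.
  have [_ h1] := xsmooth_dx xX.
  by rewrite (_ : Xx = dx X) //; apply/funext => t; apply/funext => x; rewrite XxE.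
have [dXx _] := xsmooth_dx xXx.
have D1 f t x : xsmooth f -> isd (fun y => f t (X t y)) x (dx f t (X t x) * Xx t x).
  move=> /xsmooth_dx[df _]; exact: (isd_chain (df t (X t x)) (dX t x)).
have D2 f t x : xsmooth f -> dx (dx (fun t x => f t (X t x))) t x =
    dx (dx f) t (X t x) * Xx t x ^+ 2 + dx f t (X t x) * dx Xx t x.
  move=> xf; have -> : dx (fun t x => f t (X t x)) = fun t x => dx f t (X t x) * Xx t x.
    by apply/funext => s; apply/funext => y; apply: isd_dx; exact: D1.
  have [_ xf1] := xsmooth_dx xf.
  apply: isd_dx; apply: isd_eq (is_deriveM (D1 _ t x xf1) (dXx t x)) _.
  by rewrite /GRing.scale /=; move: (dx _ _ _) (dx _ _ _) (dx _ _ _) => *; ring.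
pose U t x := u t (X t x); pose V t x := v t (X t x).
have U1 t x : dx U t x = dx u t (X t x) * Xx t x by apply: isd_dx; exact: D1.
have V1 t x : dx V t x = dx v t (X t x) * Xx t x by apply: isd_dx; exact: D1.
have n2E t x : (dx U t x * dx U t x + dx V t x * dx V t x) * (h t (X t x) / Xx t x ^+ 2) = 1.
  rewrite U1 V1; have [E _] := E1 t (X t x); have X1 := Xp t x.
  rewrite -[RHS]E; move: (dx u t _) (dx v t _) (h t _) => a b c.
  by field; rewrite gt_eqF.
have n1E t x : (U t x * U t x + V t x * V t x) * w t (X t x) = 1 by have [_] := E1 t (X t x); rewrite !expr2.
have n2i t x : (dx U t x * dx U t x + dx V t x * dx V t x)^-1 = h t (X t x) / Xx t x ^+ 2.
  by rewrite -[LHS]mulr1 -(n2E t x) mulKf //; apply/eqP => E; have := n2E t x; rewrite E mul0r => /eqP; rewrite eq_sym oner_eq0.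
have n1i t x : (U t x * U t x + V t x * V t x)^-1 = w t (X t x).
  by rewrite -[LHS]mulr1 -(n1E t x) mulKf //; apply/eqP => E; have := n1E t x; rewrite E mul0r => /eqP; rewrite eq_sym oner_eq0.
exists U, V; split.
- by split=> M; apply: csm_comp.
- move=> t x; rewrite /U /V pX.
  by rewrite (rep_periodic _ _ _ ru) ?(rep_periodic _ _ _ rv) ?gt_eqF.
- by move=> x; rewrite /U /V X0E; exact: E0.
- move=> t x; split; apply/eqP => E; [have := n1E t x|have := n2E t x]; rewrite E mul0r => /eqP;
    by rewrite eq_sym oner_eq0.
move=> t x /andP[t0]; rewrite lt_min => /andP[t1 t2].
pose r := Num.min t (step_time (data_bound N B) ^+ 2 - t).
have r0 : 0 < r by rewrite lt_min t0 subr_gt0.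
have rt s : `|s - t| < r -> 0 < s < step_time (data_bound N B) ^+ 2.
  by rewrite lt_min !ltr_norml => /andP[/andP[h1 h2] /andP[h3 h4]]; apply/andP; split; lra.
have t01 : 0 < t < 1 by rewrite t0.
have [du _] := xsmooth_dx xsu; have [dv _] := xsmooth_dx xsv.
have jP : jcont P by have [Q' /(rep_jc eta0)] := xP.
have jQ : jcont Q by have [Q' /(rep_jc eta0)] := xQ.
have du_t := @isd_curve R u P (dx u) (X ^~ x) t _ r r0 (fun s y h => (E2 s y (rt s h)).1) jP (du t _) (ODE t x t01).
have dv_t := @isd_curve R v Q (dx v) (X ^~ x) t _ r r0 (fun s y h => (E2 s y (rt s h)).2) jQ (dv t _) (ODE t x t01).
have [Hh _] := E1 t (X t x); have Hx := Xp t x.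
have qE : nflow N U V t x = h t (X t x) / Xx t x *
  (dx u t (X t x) * Q t (X t x) - dx v t (X t x) * P t (X t x)).
  rewrite /nflow n1i n2i U1 V1 /U /V !D2 // /P /Q.
  move: (dx (dx u) _ _) (dx (dx v) _ _) (dx u _ _) (dx v _ _) (h _ _) (w _ _) (u _ _) (v _ _) (dx Xx _ _) => *.
  by field; rewrite gt_eqF.
split.
  apply: isd_eq du_t _; rewrite qE V1 /G.
  move: (P _ _) (Q _ _) (dx u _ _) (dx v _ _) (h _ _) (Xx t x) Hx Hh => p q a b c y y0 H.
  have -> : - (b * y) * (c / y * (a * q - b * p)) = - (b * (c * (a * q - b * p))) by field; rewrite gt_eqF.
  apply/eqP; rewrite -subr_eq0; apply/eqP; transitivity (p * (1 - (a ^+ 2 + b ^+ 2) * c)); first by ring.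
  by rewrite H subrr mulr0.
apply: isd_eq dv_t _; rewrite qE U1 /G.
move: (P _ _) (Q _ _) (dx u _ _) (dx v _ _) (h _ _) (Xx t x) Hx Hh => p q a b c y y0 H.
have -> : (a * y) * (c / y * (a * q - b * p)) = a * (c * (a * q - b * p)) by field; rewrite gt_eqF.
apply/eqP; rewrite -subr_eq0; apply/eqP; transitivity (q * (1 - (a ^+ 2 + b ^+ 2) * c)); first by ring.
by rewrite H subrr mulr0.
Qed.

End NormalFlow.

(** * Mean curvature of equivariant maps *)

Section ScaledVectors.
Context {R : realType}.

Lemma isd_scale (W : normedModType R) (P : R -> R) (t d : R) (w : W) : isd P t d ->
  is_derive t (1 : R) (fun s => P s *: w) (d *: w).
Proof.
move=> [dP <-].
have C : (fun h : R => h^-1 *: (((fun s => P s *: w) \o shift t) (h *: (1 : R)) - P t *: w)) @ 0^'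
    --> 'D_1 P t *: w.
  rewrite (_ : (fun h => _) = fun h => (h^-1 *: ((P \o shift t) (h *: 1) - P t)) *: w).
    exact: cvgZr_tmp dP.
  by apply/funext => h; rewrite -scalerA scalerBl.
by apply: DeriveDef; [apply/cvg_ex; eexists; exact: C|apply/cvg_lim].
Qed.

End ScaledVectors.

Section EuclideanAlgebra.
Context {R : realType} {n : nat}.
Implicit Types (x y : 'rV[R]_n) (p q w : 'rV[R]_n * 'rV[R]_n) (c d : R * R).

Lemma dotvC x y : dotv x y = dotv y x.
Proof. by apply: eq_bigr => i _; rewrite mulrC. Qed.

Lemma dotvDl x y (w : 'rV[R]_n) : dotv (x + y) w = dotv x w + dotv y w.
Proof. by rewrite -big_split; apply: eq_bigr => i _; rewrite mxE mulrDl. Qed.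

Lemma dotvZl (k : R) x y : dotv (k *: x) y = k * dotv x y.
Proof. by rewrite mulr_sumr; apply: eq_bigr => i _; rewrite mxE mulrA. Qed.

Lemma dotv0l x : dotv 0 x = 0.
Proof. by rewrite -(scale0r x) dotvZl mul0r. Qed.

Lemma dotvDr x y (w : 'rV[R]_n) : dotv w (x + y) = dotv w x + dotv w y.
Proof. by rewrite dotvC dotvDl !(dotvC _ w). Qed.

Lemma dotvZr (k : R) x y : dotv x (k *: y) = k * dotv x y.
Proof. by rewrite dotvC dotvZl dotvC. Qed.

Lemma dotv_sumr (I : finType) (F : I -> 'rV[R]_n) x : dotv x (\sum_i F i) = \sum_i dotv x (F i).
Proof.
elim/big_ind2 : _ => [|u a v b <- <-|//]; last exact: dotvDr.
by rewrite -(scale0r x) dotvZr mul0r.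
Qed.

Lemma dotCDl p q w : dotC (p + q) w = dotC p w + dotC q w.
Proof. by rewrite /dotC /= !dotvDl addrACA. Qed.

Lemma dotCC p q : dotC p q = dotC q p.
Proof. by rewrite /dotC dotvC [dotv p.2 _]dotvC. Qed.

Lemma dotCDr p q w : dotC w (p + q) = dotC w p + dotC w q.
Proof. by rewrite dotCC dotCDl !(dotCC _ w). Qed.

Lemma dotC_suml (I : finType) (F : I -> 'rV[R]_n * 'rV[R]_n) w : dotC (\sum_i F i) w = \sum_i dotC (F i) w.
Proof.
elim/big_ind2 : _ => [|u a v b <- <-|//]; last exact: dotCDl.
by rewrite /dotC /= !dotv0l addr0.
Qed.

(** The elementary tensor of c and x in R^2 (x) R^n = C^n; an equivariant map is (phi, x) ->
    [tens (c phi) x]. *)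
Definition tens c x : 'rV[R]_n * 'rV[R]_n := (c.1 *: x, c.2 *: x).

Lemma dotC_tens c d x y : dotC (tens c x) (tens d y) = dot2 c d * dotv x y.
Proof. by rewrite /dotC /tens /= !(dotvZl, dotvZr) /dot2; ring. Qed.

Lemma tens_sum (I : finType) c (F : I -> 'rV[R]_n) : tens c (\sum_i F i) = \sum_i tens c (F i).
Proof.
elim/big_ind2 : _ => [|u a v b <- <-|//]; first by rewrite /tens !scaler0.
by rewrite /tens !scalerDr.
Qed.

Lemma tensDl c d x : tens (c + d) x = tens c x + tens d x.
Proof. by rewrite /tens /= !scalerDl. Qed.

Lemma tens_suml (I : finType) (F : I -> R * R) x : tens (\sum_i F i) x = \sum_i tens (F i) x.
Proof.
elim/big_ind2 : _ => [|u a v b <- <-|//]; first by rewrite /tens !scale0r.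
exact: tensDl.
Qed.

Lemma tensZ (k : R) c x : k *: tens c x = tens c (k *: x).
Proof. by rewrite /tens; congr (_, _); rewrite /= !scalerA mulrC. Qed.

Lemma tensZl (k : R) c x : k *: tens c x = tens (k *: c) x.
Proof. by rewrite /tens; congr (_, _); rewrite /= scalerA. Qed.

Lemma tens0 c : tens c 0 = 0.
Proof. by rewrite /tens !scaler0. Qed.

(** The n orthonormal rows form a square matrix M with M M^T = 1, hence M^T M = 1. *)
Lemma parseval (E : 'I_n -> 'rV[R]_n) : (forall i j, dotv (E i) (E j) = (i == j)%:R) ->
  forall y, \sum_i dotv (E i) y *: E i = y.
Proof.
move=> HE y; pose M := \matrix_(i < n, j < n) E i 0 j.
have MM : M *m M^T = 1%:M.
  apply/matrixP => i j; rewrite !mxE -HE; apply: eq_bigr => k _; by rewrite !mxE.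
have {}MM := mulmx1C MM.
apply/rowP => k; rewrite summxE.
have -> : y 0 k = (y *m (M^T *m M)) 0 k by rewrite MM mulmx1.
rewrite mulmxA mxE; apply: eq_bigr => i _; rewrite !mxE; congr (_ * _).
by apply: eq_bigr => j _; rewrite !mxE mulrC.
Qed.

End EuclideanAlgebra.

Section EquivariantMeanCurvature.
Context {R : realType} {n : nat} (c c1 c2 : R -> R * R).
Context (dc1 : forall t : R, isd (fun t => (c t).1) t (c1 t).1) (dc2 : forall t : R, isd (fun t => (c t).2) t (c1 t).2).
Context (dd1 : forall t : R, isd (fun t => (c1 t).1) t (c2 t).1) (dd2 : forall t : R, isd (fun t => (c1 t).2) t (c2 t).2).
Implicit Types (x xi : 'rV[R]_n) (t phi al m h : R).

Local Notation Phi := (equivariant_map (n := n) c).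

(** The factor 1 / |x + t xi| for a unit vector x and a tangent vector xi with |xi|^2 = m. *)
Definition radial m t : R := (Num.sqrt (1 + t * t * m))^-1.

Lemma radial_arg m t : 0 <= m -> 0 < 1 + t * t * m.
Proof. by move=> m0; rewrite ltr_pwDl // mulr_ge0 // -expr2 sqr_ge0. Qed.

Lemma isd_radial m t : 0 <= m -> isd (radial m) t (- (m * t * radial m t ^+ 3)).
Proof.
move=> m0; have p := radial_arg t m0.
have D : isd (fun t => 1 + t * t * m) t (2 * t * m).
  apply: isd_eq (is_deriveD (is_derive_cst (1 : R) t 1) (is_deriveM (is_deriveM (is_derive_id t 1) (is_derive_id t 1)) (is_derive_cst m t 1))) _.
  by rewrite /GRing.scale /=; ring.
have S : isd (fun t => Num.sqrt (1 + t * t * m)) t ((2 * Num.sqrt (1 + t * t * m))^-1 * (2 * t * m)).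
  by apply: isd_chain D; exact: is_derive1_sqrt.
have s0 : Num.sqrt (1 + t * t * m) != 0 by rewrite gt_eqF // sqrtr_gt0.
rewrite /radial; apply: isd_eq (is_deriveV (f := fun t => Num.sqrt (1 + t * t * m)) s0 S) _.
by rewrite /GRing.scale /=; field.
Qed.

Lemma hom_ext_line phi x al xi h : dotv x x = 1 -> dotv x xi = 0 ->
  hom_ext Phi (h *: (al, xi) + (phi, x)) =
  tens (radial (dotv xi xi) h *: c (phi + al * h)) (x + h *: xi).
Proof.
move=> x1 x0; rewrite /hom_ext /equivariant_map /= /normalize.
have -> : dotv (h *: xi + x) (h *: xi + x) = 1 + h * h * dotv xi xi.
  by rewrite !(dotvDl, dotvDr, dotvZl, dotvZr) x1 (dotvC xi x) x0; ring.
rewrite /tens /radial /= addrC [h *: xi + x]addrC; congr (_, _); rewrite scalerA mulrC;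
  by rewrite /GRing.scale /= [h * al]mulrC.
Qed.

Definition line_coef m (g : R -> R) phi al h := radial m h * g (phi + al * h).

Lemma isd_line_coef m (g g' : R -> R) phi al h : 0 <= m -> (forall t : R, isd g t (g' t)) ->
  isd (line_coef m g phi al) h
    (radial m h * (al * g' (phi + al * h)) - m * h * radial m h ^+ 3 * g (phi + al * h)).
Proof.
move=> m0 dg; have D : isd (fun h => phi + al * h) h al.
  apply: isd_eq (is_deriveD (is_derive_cst phi h 1) (is_deriveM (is_derive_cst al h 1) (is_derive_id h 1))) _.
  by rewrite /GRing.scale /=; ring.
apply: isd_eq (is_deriveM (isd_radial h m0) (isd_chain (dg _) D)) _.
by rewrite /GRing.scale /=; ring.
Qed.

Definition line_coef' m (g g' : R -> R) phi al h :=
  radial m h * (al * g' (phi + al * h)) - m * h * radial m h ^+ 3 * g (phi + al * h).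

Lemma radial0 m : radial m 0 = 1.
Proof. by rewrite /radial !mul0r addr0 sqrtr1 invr1. Qed.

(** The term - m g is the second derivative of the radial factor, i.e. the curvature of the unit
    sphere in the direction xi. *)
Lemma isd_line_coef' m (g g' g2 : R -> R) phi al : 0 <= m -> (forall t : R, isd g t (g' t)) ->
  (forall t : R, isd g' t (g2 t)) ->
  isd (line_coef' m g g' phi al) (0 : R) (al ^+ 2 * g2 phi - m * g phi).
Proof.
move=> m0 dg dg'; have D1 := isd_line_coef phi al 0 m0 dg'.
have D2 := isd_line_coef phi al 0 m0 dg.
have D3 : isd (fun h : R => m * h * (radial m h * radial m h)) (0 : R) m.
  apply: isd_eq (is_deriveM (is_deriveM (is_derive_cst m (0 : R) 1) (is_derive_id (0 : R) 1)) (is_deriveM (isd_radial 0 m0) (isd_radial 0 m0))) _.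
  rewrite -[(radial m * radial m) 0]/(radial m 0 * radial m 0) -[(cst m * id) 0]/(m * 0) /GRing.scale /= radial0; ring.
have D4 := is_deriveB (is_deriveM (is_derive_cst al (0 : R) 1) D1) (is_deriveM D3 D2).
apply: isd_ext (isd_eq D4 _).
  move=> h; rewrite /line_coef'.
  transitivity (al * line_coef m g' phi al h - m * h * (radial m h * radial m h) * line_coef m g phi al h) => //.
  by rewrite /line_coef; ring.
by rewrite /GRing.scale /= !radial0 /line_coef !radial0 !mulr0 !addr0; ring.
Qed.

Lemma tens_line (g : R -> R * R) x xi h :
  tens (g h) (x + h *: xi) = ((g h).1 *: x + (h * (g h).1) *: xi, (g h).2 *: x + (h * (g h).2) *: xi).
Proof. by rewrite /tens !scalerDr !scalerA ![_ * h]mulrC. Qed.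

Lemma is_derive_tens_line (g : R -> R * R) (t : R) (d : R * R) x xi :
  isd (fun h => (g h).1) t d.1 -> isd (fun h => (g h).2) t d.2 ->
  is_derive t (1 : R) (fun h => tens (g h) (x + h *: xi)) (tens d (x + t *: xi) + tens (g t) xi).
Proof.
move=> D1 D2; rewrite (_ : (fun h => _) = fun h =>
  ((g h).1 *: x + (h * (g h).1) *: xi, (g h).2 *: x + (h * (g h).2) *: xi)); last first.
  by apply/funext => h; rewrite tens_line.
have Dh k (p : R -> R) : isd p t k -> isd (fun h => h * p h) t (p t + t * k).
  move=> Dp; apply: isd_eq (is_deriveM (is_derive_id t 1) Dp) _.
  by rewrite /GRing.scale /=; ring.
have -> : tens d (x + t *: xi) + tens (g t) xi =
  (d.1 *: x + ((g t).1 + t * d.1) *: xi, d.2 *: x + ((g t).2 + t * d.2) *: xi).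
  rewrite tens_line /tens /=; congr (_, _); rewrite /= -addrA -scalerDl [_ + _ * _]addrC //.
apply: is_derive_pair; apply: is_deriveD; try exact: isd_scale; apply: isd_scale; exact: Dh.
Qed.

Lemma dotv_ge0 x : 0 <= dotv x x.
Proof. by apply: sumr_ge0 => i _; rewrite -expr2 sqr_ge0. Qed.

Let gl phi al xi h : R * R := radial (dotv xi xi) h *: c (phi + al * h).
Let gl' phi al xi h : R * R :=
  (line_coef' (dotv xi xi) (fun t => (c t).1) (fun t => (c1 t).1) phi al h,
   line_coef' (dotv xi xi) (fun t => (c t).2) (fun t => (c1 t).2) phi al h).

Lemma derive_hom_ext phi x al xi h : dotv x x = 1 -> dotv x xi = 0 ->
  'D_(al, xi) (hom_ext Phi) (h *: (al, xi) + (phi, x)) =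
  tens (gl' phi al xi h) (x + h *: xi) + tens (gl phi al xi h) xi.
Proof.
move=> x1 x0.
suff H : is_derive (h *: (al, xi) + (phi, x)) (al, xi) (hom_ext Phi)
    (tens (gl' phi al xi h) (x + h *: xi) + tens (gl phi al xi h) xi).
  exact: derive_val.
apply/is_derive_line.
rewrite (_ : (fun k => _) = (fun k => tens (gl phi al xi (k + h)) (x + (k + h) *: xi))); last first.
  by apply/funext => k; rewrite addrA -scalerDl hom_ext_line.
have D := @is_derive_tens_line (gl phi al xi) h (gl' phi al xi h) x xi
  (isd_line_coef phi al h (dotv_ge0 xi) dc1) (isd_line_coef phi al h (dotv_ge0 xi) dc2).
have := D; rewrite -[h in is_derive h _ _ _](add0r h) => D0.
have E : (0 : R) + h = h by rewrite add0r.
have /is_derive_line := D.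
rewrite (_ : (fun k : R => tens (gl phi al xi (k *: (1 : R) + h)) _) =
   (fun k : R => tens (gl phi al xi (k + h)) (x + (k + h) *: xi))) //.
by apply/funext => k; rewrite [k *: 1]mulr1.
Qed.

Lemma differential_equivariant phi x al xi : dotv x x = 1 -> dotv x xi = 0 ->
  differential Phi phi x (al, xi) = tens (al *: c1 phi) x + tens (c phi) xi.
Proof.
move=> x1 x0; rewrite /differential -[(phi, x)]add0r -(scale0r ((al, xi) : R * 'rV[R]_n)).
rewrite derive_hom_ext // scale0r addr0 /gl /gl' /line_coef' radial0 !mulr0 !addr0 !mul0r !subr0 !mul1r scale1r.
by congr (tens _ _ + _).
Qed.

Lemma second_derivative_equivariant phi x al xi : dotv x x = 1 -> dotv x xi = 0 ->
  'D_(al, xi) (fun p => 'D_(al, xi) (hom_ext Phi) p) (phi, x) =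
  tens (al ^+ 2 *: c2 phi - dotv xi xi *: c phi) x + tens (c1 phi) ((2 * al) *: xi).
Proof.
move=> x1 x0.
suff H : is_derive (phi, x) (al, xi) (fun p => 'D_(al, xi) (hom_ext Phi) p)
    (tens (al ^+ 2 *: c2 phi - dotv xi xi *: c phi) x + tens (c1 phi) ((2 * al) *: xi)).
  exact: derive_val.
apply/is_derive_line.
rewrite (_ : (fun h => _) = (fun h => tens (gl' phi al xi h) (x + h *: xi) + tens (gl phi al xi h) xi)); last first.
  by apply/funext => h; exact: derive_hom_ext.
have m0 := dotv_ge0 xi.
have D1 := @is_derive_tens_line (gl' phi al xi) 0 (al ^+ 2 *: c2 phi - dotv xi xi *: c phi) x xi
  (isd_line_coef' phi al m0 dc1 dd1) (isd_line_coef' phi al m0 dc2 dd2).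
have D2 : is_derive (0 : R) (1 : R) (fun h => tens (gl phi al xi h) xi) (tens (al *: c1 phi) xi).
  apply: is_derive_pair; apply: isd_scale.
    apply: isd_eq (isd_line_coef phi al 0 m0 dc1) _.
    by rewrite radial0 !mulr0 !addr0 !mul0r subr0 mul1r.
  apply: isd_eq (isd_line_coef phi al 0 m0 dc2) _.
  by rewrite radial0 !mulr0 !addr0 !mul0r subr0 mul1r.
have -> : tens (al ^+ 2 *: c2 phi - dotv xi xi *: c phi) x + tens (c1 phi) ((2 * al) *: xi) =
  tens (al ^+ 2 *: c2 phi - dotv xi xi *: c phi) (x + 0 *: xi) + tens (gl' phi al xi 0) xi + tens (al *: c1 phi) xi.
  rewrite scale0r addr0 -addrA -tensDl; congr (_ + _).
  have -> : gl' phi al xi 0 = al *: c1 phi.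
    rewrite /gl' /line_coef' radial0 !mulr0 !addr0 !mul0r !subr0 !mul1r.
    by [].
  by rewrite -tensZ tensZl mulr_natl mulr2n scalerDl.
exact: is_deriveD.
Qed.

Section Frame.
Context (phi : R) (x : 'rV[R]_n) (e : 'I_n -> R * 'rV[R]_n).
Context (x1 : dotv x x = 1) (He : orthonormal_frame Phi phi x e).
Context (rr0 : 0 < dot2 (c phi) (c phi)) (ss0 : 0 < dot2 (c1 phi) (c1 phi)).

Let rr := dot2 (c phi) (c phi).
Let ss := dot2 (c1 phi) (c1 phi).
Let al i := (e i).1.
Let xi i := (e i).2.

Let xxi i : dotv x (xi i) = 0. Proof. by have [T _] := He; exact: T. Qed.

Let dE i : differential Phi phi x (e i) = tens (al i *: c1 phi) x + tens (c phi) (xi i).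
Proof. by have := differential_equivariant phi (al i) x1 (xxi i); rewrite -surjective_pairing. Qed.

Let dot2Zl (k : R) (p q : R * R) : dot2 (k *: p) q = k * dot2 p q.
Proof. by rewrite /dot2 /= /GRing.scale /=; ring. Qed.

Let dot2C (p q : R * R) : dot2 p q = dot2 q p.
Proof. by rewrite /dot2 mulrC [p.2 * _]mulrC. Qed.

Let frame_dot i j : al i * al j * ss + rr * dotv (xi i) (xi j) = (i == j)%:R.
Proof.
have [_ /(_ i j) <-] := He; rewrite !dE.
rewrite dotCDl !dotCDr !dotC_tens x1 (dotvC (xi i) x) !xxi.
by rewrite !mulr0 addr0 add0r !dot2Zl [dot2 _ (al j *: _)]dot2C !dot2Zl /rr /ss; ring.
Qed.

(** The induced metric is |c'|^2 in the direction of phi plus |c|^2 times that of the sphere, so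
    that the rescaled frame is an orthonormal basis of R^n = R x + x^perp. Parseval's identity for x
    then gives the traces needed, for every frame at once. *)
Let E i := (Num.sqrt ss * al i) *: x + Num.sqrt rr *: xi i.

Let sss : Num.sqrt ss * Num.sqrt ss = ss. Proof. by rewrite -expr2 sqr_sqrtr // ltW. Qed.
Let rrr : Num.sqrt rr * Num.sqrt rr = rr. Proof. by rewrite -expr2 sqr_sqrtr // ltW. Qed.

Let E_dot i j : dotv (E i) (E j) = (i == j)%:R.
Proof.
rewrite -frame_dot /E !(dotvDl, dotvDr, dotvZl, dotvZr) x1 xxi (dotvC (xi i) x) xxi.
by rewrite -[in RHS]sss -[in RHS]rrr; ring.
Qed.

Let Ex i : dotv (E i) x = Num.sqrt ss * al i.
Proof. by rewrite /E dotvDl !dotvZl x1 (dotvC (xi i)) xxi; ring. Qed.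

Lemma frame_al2 : \sum_i al i ^+ 2 = ss^-1.
Proof.
have := congr1 (dotv x) (parseval E_dot x); rewrite dotv_sumr x1 => H.
apply: (@mulfI _ ss); first by rewrite gt_eqF.
rewrite mulfV ?gt_eqF // -H mulr_sumr; apply: eq_bigr => i _.
by rewrite dotvZr (dotvC x) Ex -[in LHS]sss; ring.
Qed.

Lemma frame_alxi : \sum_i al i *: xi i = 0.
Proof.
have H := parseval E_dot x.
have K : \sum_i dotv (E i) x *: E i = (ss * \sum_i al i ^+ 2) *: x + (Num.sqrt ss * Num.sqrt rr) *: \sum_i al i *: xi i.
  rewrite mulr_sumr scaler_suml scaler_sumr -big_split; apply: eq_bigr => i _.
  rewrite Ex /E scalerDr !scalerA; congr (_ *: _ + _ *: _); last by ring.
  by rewrite -[in RHS]sss; ring.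
move: K; rewrite H frame_al2 mulfV ?gt_eqF // scale1r -{1}[x]addr0 => /addrI/esym/eqP.
rewrite scaler_eq0 mulf_eq0 => /orP[/orP[]|/eqP //];
  by rewrite gt_eqF // sqrtr_gt0.
Qed.

Lemma frame_xi2 : \sum_i dotv (xi i) (xi i) = (n%:R - 1) / rr.
Proof.
have H : \sum_i (al i * al i * ss + rr * dotv (xi i) (xi i)) = n%:R.
  rewrite (eq_bigr (fun=> 1)) => [|i _]; last by rewrite frame_dot eqxx.
  by rewrite sumr_const card_ord.
move: H; rewrite big_split -mulr_sumr -mulr_suml /=.
rewrite (eq_bigr (fun i => al i ^+ 2)) // frame_al2 mulVf ?gt_eqF // => <-.
by rewrite addrAC subrr add0r mulrAC mulfV ?mul1r // gt_eqF.
Qed.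

Let W := ss^-1 *: c2 phi - ((n%:R - 1) / rr) *: c phi.

(** The trace of the second derivative is W (x) x, the mixed terms cancelling by [frame_alxi]. It is
    orthogonal to all c (x) xi, so that the normal projection only removes the component of W along
    c'. *)
Lemma mean_curvature_equivariant :
  mean_curvature_vector Phi phi x e = tens (W - (dot2 W (c1 phi) / ss) *: c1 phi) x.
Proof.
rewrite /mean_curvature_vector /second_fundamental_form /normal_part sumrB.
set A := fun i => 'D_(e i) (fun p => 'D_(e i) (hom_ext Phi) p) (phi, x).
have AE i : A i = tens (al i ^+ 2 *: c2 phi - dotv (xi i) (xi i) *: c phi) x + tens (c1 phi) ((2 * al i) *: xi i).
  by have := second_derivative_equivariant phi (al i) x1 (xxi i); rewrite -surjective_pairing.
have SA : \sum_i A i = tens W x.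
  rewrite (eq_bigr _ (fun i _ => AE i)) big_split /=.
  have -> : \sum_i tens (al i ^+ 2 *: c2 phi - dotv (xi i) (xi i) *: c phi) x = tens W x.
    rewrite /W -frame_al2 -frame_xi2 !scaler_suml -sumrB.
    by rewrite tens_suml.
  rewrite -tens_sum (_ : \sum_i (2 * al i) *: xi i = 0) ?tens0 ?addr0 //.
  under eq_bigr do rewrite -scalerA.
  by rewrite -scaler_sumr frame_alxi scaler0.
rewrite exchange_big /= SA.
have -> : \sum_j \sum_i dotC (A i) (differential Phi phi x (e j)) *: differential Phi phi x (e j) =
    \sum_j (dot2 W (c1 phi) * al j) *: (tens (al j *: c1 phi) x + tens (c phi) (xi j)).
  apply: eq_bigr => j _; rewrite -scaler_suml -dotC_suml SA dE; congr (_ *: _).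
    rewrite dotCC dotCDl !dotC_tens x1 (dotvC (xi j)) xxi mulr0 addr0 mulr1 dot2Zl dot2C mulrC //.
have -> : \sum_j (dot2 W (c1 phi) * al j) *: (tens (al j *: c1 phi) x + tens (c phi) (xi j)) =
   tens ((dot2 W (c1 phi) / ss) *: c1 phi) x.
  under eq_bigr do rewrite -scalerA scalerDr tensZl scalerA -expr2 tensZ scalerDr.
  rewrite big_split /= -!scaler_sumr -tens_sum frame_alxi tens0 scaler0 addr0.
  rewrite -frame_al2 -scalerA scaler_suml -tensZl; congr (_ *: _).
  by rewrite tens_suml.
rewrite /tens /=; congr (_, _); by rewrite -scalerBl.
Qed.

End Frame.

(** The definition of the flow speaks of all orthonormal frames; one is needed to extract the
    velocity from it. *)
Lemma frame_exists phi (i0 : 'I_n) : 0 < dot2 (c phi) (c phi) -> 0 < dot2 (c1 phi) (c1 phi) ->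
  exists e, orthonormal_frame Phi phi (delta_mx 0 i0) e.
Proof.
move=> rr0 ss0; set x : 'rV[R]_n := delta_mx 0 i0.
have dd (i j : 'I_n) : dotv (delta_mx 0 i : 'rV[R]_n) (delta_mx 0 j) = (i == j)%:R.
  rewrite /dotv (bigD1 i) //= big1 ?addr0 => [|k ki]; rewrite !mxE eqxx /= ?eqxx ?mul1r //.
  by rewrite eq_sym in ki; rewrite eq_sym (negbTE ki) mul0r.
have x1 : dotv x x = 1 by rewrite dd eqxx.
pose rr := Num.sqrt (dot2 (c phi) (c phi)); pose ss := Num.sqrt (dot2 (c1 phi) (c1 phi)).
have r0 : rr != 0 by rewrite gt_eqF // sqrtr_gt0.
have s0 : ss != 0 by rewrite gt_eqF // sqrtr_gt0.
have rE : dot2 (c phi) (c phi) = rr ^+ 2 by rewrite sqr_sqrtr // ltW.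
have sE : dot2 (c1 phi) (c1 phi) = ss ^+ 2 by rewrite sqr_sqrtr // ltW.
pose e i : R * 'rV[R]_n := if i == i0 then (ss^-1, 0) else (0, rr^-1 *: delta_mx 0 i).
have T i : dotv x (e i).2 = 0.
  rewrite /e; case: eqP => [_|/eqP ne] /=; first by rewrite dotvC dotv0l.
  by rewrite dotvZr dd eq_sym (negbTE ne) mulr0.
exists e; split=> [i|i j]; first exact: T.
have dE k : differential Phi phi x (e k) = if k == i0 then tens (ss^-1 *: c1 phi) x else tens (rr^-1 *: c phi) (delta_mx 0 k).
  have := differential_equivariant phi (e k).1 x1 (T k); rewrite -surjective_pairing => ->.
  rewrite /e; case: eqP => _ /=; first by rewrite tens0 addr0.
  by rewrite scale0r -tensZl tensZ -tensZ tensZl /tens /= !scale0r !add0r.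
rewrite !dE; case: (eqVneq i i0) => [Ei|ii]; case: (eqVneq j i0) => [Ej|jj]; rewrite ?Ei ?Ej.
- rewrite dotC_tens x1 eqxx mulr1; have : dot2 (ss^-1 *: c1 phi) (ss^-1 *: c1 phi) = ss^-1 ^+ 2 * dot2 (c1 phi) (c1 phi).
    by rewrite /dot2 /= /GRing.scale /=; ring.
  by move=> ->; rewrite sE -exprMn mulVf // expr1n.
- by rewrite dotC_tens dd eq_sym (negbTE jj) mulr0.
- by rewrite dotC_tens dd (negbTE ii) mulr0.
- rewrite dotC_tens dd; have : dot2 (rr^-1 *: c phi) (rr^-1 *: c phi) = rr^-1 ^+ 2 * dot2 (c phi) (c phi).
    by rewrite /dot2 /= /GRing.scale /=; ring.
  by move=> ->; rewrite rE -exprMn mulVf // expr1n mul1r.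
Qed.

End EquivariantMeanCurvature.

(* Sealed, since unification otherwise unfolds [smooth_open] to compare two distinct functions. *)
Variant smoothf {R : realType} (W : set (R * R)) (F : R * R -> R) : Prop :=
  Smoothf of smooth_open W F.

(** * Evolution equations and a priori bounds *)

Section Derivations.
Context {R : realType} (W : set (R * R)) (oW : open W).
Implicit Types (F G : R * R -> R) (p : R * R).

Local Notation sm := (smoothf W).

Lemma sm_cst (c : R) : sm (fun=> c).
Proof. by constructor; exact: smooth_cst. Qed.

Lemma smD F G : sm F -> sm G -> sm (fun p => F p + G p).
Proof. by move=> [sF] [sG]; constructor; exact: smoothD. Qed.

Lemma smM F G : sm F -> sm G -> sm (fun p => F p * G p).
Proof. by move=> [sF] [sG]; constructor; exact: smoothM. Qed.

Lemma smV F : (forall p, W p -> F p != 0) -> sm F -> sm (fun p => (F p)^-1).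
Proof. by move=> F0 [sF]; constructor; exact: smoothV. Qed.

Lemma sm_drv F v : sm F -> sm ('D_v F).
Proof. by move=> [sF]; constructor; exact: smooth_derive. Qed.

Lemma sm_isd F v p : sm F -> W p -> is_derive p v F ('D_v F p).
Proof. by move=> [sF]; exact: smooth_isd. Qed.

Lemma sm_ext F G : (forall p, F p = G p) -> sm F -> sm G.
Proof. by move=> /funext ->. Qed.

Definition Dt F : R * R -> R := 'D_((1, 0) : R * R) F.
Definition Dx F : R * R -> R := 'D_((0, 1) : R * R) F.

(** Common rules for d/dt, d/dx and the arclength derivative. The last clause, locality, allows
    identities valid on an open set to be differentiated. *)
Definition derivation (D : (R * R -> R) -> R * R -> R) :=
  [/\ forall F, sm F -> sm (D F),
      forall F G, sm F -> sm G -> forall p, W p -> D (fun p => F p + G p) p = D F p + D G p,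
      forall F G, sm F -> sm G -> forall p, W p -> D (fun p => F p * G p) p = D F p * G p + F p * D G p,
      forall (c : R) p, W p -> D (fun=> c) p = 0 &
      forall F G (V : set (R * R)), open V -> (forall p, V p -> F p = G p) -> forall p, V p -> D F p = D G p].

Lemma derivation_dir v : derivation (fun F => 'D_v F).
Proof.
split.
- by move=> F; exact: sm_drv.
- move=> F G sF sG p Wp.
  exact: (@derive_val _ _ _ _ _ _ _ (is_deriveD (sm_isd v sF Wp) (sm_isd v sG Wp))).
- move=> F G sF sG p Wp.
  rewrite (@derive_val _ _ _ _ _ _ _ (is_deriveM (sm_isd v sF Wp) (sm_isd v sG Wp))).
  by rewrite /GRing.scale /=; ring.
- by move=> c p _; exact: (@derive_val _ _ _ _ _ _ _ (is_derive_cst c p v)).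
- move=> F G V oV FG p Vp; apply: near_eq_derive.
  by have := open_nbhs_nbhs (conj oV Vp); apply: filterS => y; exact: FG.
Qed.

Lemma derivation_scale (e : R * R -> R) D : sm e -> derivation D -> derivation (fun F p => e p * D F p).
Proof.
move=> se [D1 D2 D3 D4 D5]; split.
- by move=> F sF; apply: smM => //; exact: D1.
- by move=> F G sF sG p Wp; rewrite D2 // mulrDr.
- by move=> F G sF sG p Wp; rewrite D3 //; ring.
- by move=> c p Wp; rewrite D4 // mulr0.
- by move=> F G V oV FG p Vp; rewrite (D5 _ _ _ oV FG).
Qed.

Lemma smN F : sm F -> sm (fun p => - F p).
Proof.
move=> sF; apply: (sm_ext (F := fun p => -1 * F p)) => [p|]; first by rewrite mulN1r.
by apply: smM => //; exact: sm_cst.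
Qed.

Lemma smB F G : sm F -> sm G -> sm (fun p => F p - G p).
Proof. by move=> sF sG; apply: smD => //; exact: smN. Qed.

Lemma smZ (c : R) F : sm F -> sm (fun p => c * F p).
Proof. by move=> sF; apply: smM => //; exact: sm_cst. Qed.

Section Rules.
Context (D : (R * R -> R) -> R * R -> R) (dD : derivation D).

Lemma drv_sm F : sm F -> sm (D F). Proof. by case: dD => h _ _ _ _; exact: h. Qed.

Lemma drvD F G p : sm F -> sm G -> W p -> D (fun p => F p + G p) p = D F p + D G p.
Proof. by case: dD => _ h _ _ _ sF sG Wp; exact: h. Qed.

Lemma drvM F G p : sm F -> sm G -> W p -> D (fun p => F p * G p) p = D F p * G p + F p * D G p.
Proof. by case: dD => _ _ h _ _ sF sG Wp; exact: h. Qed.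

Lemma drv_cst c p : W p -> D (fun=> c) p = 0.
Proof. by case: dD => _ _ _ h _ Wp; exact: h. Qed.

Lemma drv_eq F G (V : set (R * R)) p : open V -> (forall p, V p -> F p = G p) -> V p -> D F p = D G p.
Proof. by case: dD => _ _ _ _ h oV FG Vp; exact: (h _ _ V). Qed.

Lemma drvZ c F p : sm F -> W p -> D (fun p => c * F p) p = c * D F p.
Proof. by move=> sF Wp; rewrite drvM ?drv_cst ?mul0r ?add0r //; exact: sm_cst. Qed.

Lemma drvN F p : sm F -> W p -> D (fun p => - F p) p = - D F p.
Proof.
move=> sF Wp; rewrite (@drv_eq _ (fun p => -1 * F p) W) ?drvZ ?mulN1r // => y _.
by rewrite mulN1r.
Qed.

Lemma drvB F G p : sm F -> sm G -> W p -> D (fun p => F p - G p) p = D F p - D G p.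
Proof. by move=> sF sG Wp; rewrite drvD ?drvN //; exact: smN. Qed.

End Rules.

Lemma schwarz F p : sm F -> W p -> Dt (Dx F) p = Dx (Dt F) p.
Proof.
case: p => t x sF Wp.
have [r r0 Hr] : exists2 r : R, 0 < r & forall s y, `|s - t| < r -> `|y - x| < r -> W (s, y).
  have : nbhs (t, x) W by exact: open_nbhs_nbhs.
  move=> /nbhs_ballP[r r0 H]; exists r => // s y h1 h2; apply: H.
  by split; rewrite /ball /= distrC.
have dF v s y : `|s - t| < r -> `|y - x| < r -> is_derive (s, y) v F ('D_v F (s, y)).
  by move=> h1 h2; apply: sm_isd sF _; exact: Hr.
have x0 : `|x - x| < r by rewrite subrr normr0.
have sT : sm (Dt F) by exact: sm_drv.
have sX : sm (Dx F) by exact: sm_drv.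
have M := @mixed_derivative R (fun s y => F (s, y)) (fun s y => Dt F (s, y)) (fun s y => Dx F (s, y))
  (fun s y => Dx (Dt F) (s, y)) t x r r0 _ _ _ _.
have {}M : isd (fun s : R => Dx F (s, x)) t (Dx (Dt F) (t, x)).
  apply: M.
  - by move=> s y h1 h2; apply/is_derive_fst; exact: dF.
  - by move=> s h; apply/is_derive_snd; exact: dF.
  - by move=> s y h1 h2; apply/is_derive_snd; apply: sm_isd sT _; exact: Hr.
  - rewrite (_ : (fun p : R * R => Dx (Dt F) (p.1, p.2)) = Dx (Dt F)); last first.
      by apply/funext => -[].
    by have [h] := sm_drv ((0, 1) : R * R) sT; exact: smooth_cont h Wp.
by have /is_derive_fst M' := M; rewrite -(@derive_val _ _ _ _ _ _ _ M').
Qed.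

Lemma smooth_exp_time (C : R) : sm (fun p => expR (C * p.1)).
Proof.
constructor; have dE (k : R) a v : is_derive a v (fun p : R * R => k * expR (C * p.1)) (v.1 * C * k * expR (C * a.1)).
  have D1 (t : R) : isd (fun t : R => k * expR (C * t)) t (C * k * expR (C * t)).
    have D0 : isd (fun t : R => C * t) t C.
      by apply: isd_eq (is_deriveM (is_derive_cst C t 1) (is_derive_id t 1)) _; rewrite /GRing.scale /=; ring.
    apply: isd_eq (is_deriveM (is_derive_cst k t 1) (isd_chain (is_derive_expR _) D0)) _.
    by rewrite /GRing.scale /=; ring.
  have D2 : is_derive a v (fun p : R * R => p.1) v.1.
    have := @is_derive_fstv R _ (fun p : R * R => p) a v v (is_derive_id a v); exact.
  by have := is_derive_outer (D1 a.1) D2; rewrite mulrC !mulrA.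
apply: (@smooth_open_class R _ _ W [set f | exists k : R, f = fun p => k * expR (C * p.1)]) => //.
- move=> f [k ->] a _; have D := dE k a.
  have H (t x : R) : {for (t, x), continuous (fun p : R * R => k * expR (C * p.1))}.
    apply: cvgM; first exact: cvg_cst.
    apply: (@continuous_comp _ _ _ (fun p : R * R => C * p.1) expR); last exact: continuous_expR.
    by apply: cvgM; [exact: cvg_cst|exact: cvg_fst].
  by case: a D => t x _; exact: H.
- move=> f v [k ->]; exists (fun p => v.1 * C * k * expR (C * p.1)); first by exists (v.1 * C * k).
  by move=> a _; exact: dE.
- by exists 1; apply/funext => p; rewrite mul1r.
Qed.

Lemma Dt_exp_time (C : R) p : Dt (fun p => expR (C * p.1)) p = C * expR (C * p.1).
Proof.
apply: (@derive_val _ _ _ _ _ _ _ _); case: p => t x; apply/is_derive_fst => /=.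
have D0 : isd (fun t : R => C * t) t C.
  by apply: isd_eq (is_deriveM (is_derive_cst C t 1) (is_derive_id t 1)) _; rewrite /GRing.scale /=; ring.
by apply: isd_eq (isd_chain (is_derive_expR _) D0) _; rewrite mulrC.
Qed.

Lemma Dx_time (g : R -> R) p : Dx (fun p => g p.1) p = 0.
Proof.
apply: (@derive_val _ _ _ _ _ _ _ _); case: p => t x; apply/is_derive_snd => /=.
exact: is_derive_cst.
Qed.

End Derivations.

(* [sp] and [pp] are the components of the position (u, v) along the outward normal (b, -a) and
   the tangent (a, b), [qq] is 1 / |z|^2, and [d/dt, ds] = la ds on [Om]. *)
Section Frenet.
Context {R : realType} (W Om : set (R * R)) (oW : open W) (oOm : open Om) (OmW : Om `<=` W).
Context (N : R) (u v : R * R -> R).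
Local Notation sm := (smoothf W).
Context (su : sm u) (sv : sm v).
Implicit Types (F G : R * R -> R) (p : R * R).

Context (ds Dt : (R * R -> R) -> R * R -> R) (dds : derivation W ds) (ddt : derivation W Dt).
Context (a b k sp pp qq f la : R * R -> R).
Context (aE : a = ds u) (bE : b = ds v) (kE : k = fun p => a p * ds b p - b p * ds a p).
Context (spE : sp = fun p => u p * b p - v p * a p) (ppE : pp = fun p => u p * a p + v p * b p).
Context (qqE : qq = fun p => (u p * u p + v p * v p)^-1) (fE : f = fun p => k p + N * (sp p * qq p)).
Context (ds_swap : forall F p, sm F -> Om p -> Dt (ds F) p = ds (Dt F) p + la p * ds F p).
Let g j := iter j ds f.

Context (ab1 : forall p, W p -> a p * a p + b p * b p = 1).
Context (r0 : forall p, W p -> u p * u p + v p * v p != 0).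
Context (ut : forall p, Om p -> Dt u p = - (b p * f p)) (vt : forall p, Om p -> Dt v p = a p * f p).

Let sa : sm a. Proof. rewrite aE; exact: (drv_sm dds). Qed.
Let sb : sm b. Proof. rewrite bE; exact: (drv_sm dds). Qed.
Let sda : sm (ds a). Proof. exact: (drv_sm dds). Qed.
Let sdb : sm (ds b). Proof. exact: (drv_sm dds). Qed.
Let sk : sm k. Proof. by rewrite kE; apply: smB => //; apply: smM. Qed.
Let ss : sm sp. Proof. by rewrite spE; apply: smB => //; apply: smM. Qed.
Let spp : sm pp. Proof. by rewrite ppE; apply: smD => //; apply: smM. Qed.
Let sn : sm (fun p => u p * u p + v p * v p). Proof. by apply: smD => //; apply: smM. Qed.
Let sq : sm qq. Proof. by rewrite qqE; apply: smV => //. Qed.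
Let sf : sm f. Proof. by rewrite fE; apply: smD => //; apply: smZ => //; apply: smM. Qed.
Let sg j : sm (g j). Proof. by elim: j => [//|j IH]; exact: (drv_sm dds). Qed.

(* Obtained by applying D to a^2 + b^2 = 1. *)
Let drv_ab D p : derivation W D -> W p -> a p * D a p + b p * D b p = 0.
Proof.
move=> dD Wp; have := drv_eq dD oW ab1 Wp.
rewrite (drv_cst dD) // (drvD dD) ?(drvM dD) //; try exact: smM.
by lra.
Qed.

Lemma a_s p : W p -> ds a p = - (k p * b p).
Proof.
move=> Wp; have E := drv_ab dds Wp; have A := ab1 Wp; rewrite kE.
move: (ds a p) (ds b p) (a p) (b p) E A => x y a0 b0 E A.
have : (a0 * a0 + b0 * b0 - 1) * x = 0 by rewrite A subrr mul0r.
have : (a0 * x + b0 * y) * a0 = 0 by rewrite E mul0r.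
by nra.
Qed.

Lemma b_s p : W p -> ds b p = k p * a p.
Proof.
move=> Wp; have E := drv_ab dds Wp; have A := ab1 Wp; rewrite kE.
move: (ds a p) (ds b p) (a p) (b p) E A => x y a0 b0 E A.
have : (a0 * a0 + b0 * b0 - 1) * y = 0 by rewrite A subrr mul0r.
have : (a0 * x + b0 * y) * b0 = 0 by rewrite E mul0r.
by nra.
Qed.

Lemma s_s p : W p -> ds sp p = k p * pp p.
Proof.
move=> Wp; rewrite spE (drvB oW dds) ?(drvM dds) //; try exact: smM.
by rewrite a_s // b_s // -aE -bE ppE; ring.
Qed.

Lemma p_s p : W p -> ds pp p = 1 - k p * sp p.
Proof.
move=> Wp; rewrite -(ab1 Wp) ppE (drvD dds) ?(drvM dds) //; try exact: smM.
by rewrite a_s // b_s // -aE -bE spE; ring.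
Qed.

Lemma drv_q D p : derivation W D -> W p -> D qq p = - (qq p ^+ 2 * (2 * (u p * D u p + v p * D v p))).
Proof.
move=> dD Wp; have E : forall p, W p -> qq p * (u p * u p + v p * v p) = 1.
  by move=> y Wy; rewrite qqE mulVf // r0.
have := drv_eq dD oW E Wp; rewrite (drv_cst dD) // (drvM dD) // (drvD dD) ?(drvM dD) //; try exact: smM.
have A := E p Wp; move: (D qq p) (D u p) (D v p) (qq p) (u p) (v p) A => dq du dv q0 u0 v0 A H.
have : (q0 * (u0 * u0 + v0 * v0) - 1) * dq = 0 by rewrite A subrr mul0r.
have : (dq * (u0 * u0 + v0 * v0) + q0 * (du * u0 + u0 * du + (dv * v0 + v0 * dv))) * q0 = 0 by rewrite H mul0r.
by nra.
Qed.

Lemma q_s p : W p -> ds qq p = - (2 * pp p * qq p ^+ 2).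
Proof. by move=> Wp; rewrite (drv_q dds) // -aE -bE ppE; ring. Qed.

Lemma q_pyth p : W p -> qq p * (sp p ^+ 2 + pp p ^+ 2) = 1.
Proof.
move=> Wp; rewrite -[RHS](mulVf (r0 Wp)) qqE; congr (_ * _).
by rewrite spE ppE -[RHS]mulr1 -(ab1 Wp); ring.
Qed.

(** The commutator is forced by the unit tangent: a a_t + b b_t = 0, where a_t and b_t are the
    arclength derivatives of u_t and v_t plus [la] times a and b. *)
Lemma la_E p : Om p -> la p = k p * f p.
Proof.
move=> Op; have Wp := OmW Op; have E := drv_ab ddt Wp; have A := ab1 Wp.
have at_ : Dt a p = ds (Dt u) p + la p * a p by rewrite aE ds_swap // -aE.
have bt_ : Dt b p = ds (Dt v) p + la p * b p by rewrite bE ds_swap // -bE.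
move: E; rewrite at_ bt_.
have -> : ds (Dt u) p = ds (fun p => - (b p * f p)) p by apply: (drv_eq dds oOm) => // y Oy; exact: ut.
have -> : ds (Dt v) p = ds (fun p => a p * f p) p by apply: (drv_eq dds oOm) => // y Oy; exact: vt.
rewrite (drvN oW dds) ?(drvM dds) ?a_s ?b_s //; last exact: smM.
move: (la p) (ds f p) (k p) (f p) (a p) (b p) A => l fs k0 f0 a0 b0 A E.
have : (a0 * a0 + b0 * b0 - 1) * (l - k0 * f0) = 0 by rewrite A subrr mul0r.
by nra.
Qed.

Lemma swap F p : sm F -> Om p -> Dt (ds F) p = ds (Dt F) p + k p * f p * ds F p.
Proof. by move=> sF Op; rewrite ds_swap // la_E. Qed.

Lemma a_t p : Om p -> Dt a p = - (b p * ds f p).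
Proof.
move=> Op; have Wp := OmW Op; rewrite {1}aE swap //.
have -> : ds (Dt u) p = ds (fun p => - (b p * f p)) p by apply: (drv_eq dds oOm) => // y Oy; exact: ut.
by rewrite (drvN oW dds) ?(drvM dds) ?b_s // ?aE; [ring|exact: smM].
Qed.

Lemma b_t p : Om p -> Dt b p = a p * ds f p.
Proof.
move=> Op; have Wp := OmW Op; rewrite {1}bE swap //.
have -> : ds (Dt v) p = ds (fun p => a p * f p) p by apply: (drv_eq dds oOm) => // y Oy; exact: vt.
by rewrite (drvM dds) ?a_s // ?bE; ring.
Qed.

Lemma k_t p : Om p -> Dt k p = ds (ds f) p + k p ^+ 2 * f p.
Proof.
move=> Op; have Wp := OmW Op; rewrite {1}kE (drvB oW ddt) ?(drvM ddt) //; try exact: smM.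
rewrite !swap //.
have sfs : sm (ds f) by exact: (drv_sm dds).
have -> : ds (Dt a) p = ds (fun p => - (b p * ds f p)) p by apply: (drv_eq dds oOm) => // y Oy; exact: a_t.
have -> : ds (Dt b) p = ds (fun p => a p * ds f p) p by apply: (drv_eq dds oOm) => // y Oy; exact: b_t.
rewrite (drvN oW dds) ?(drvM dds) ?a_t ?b_t ?a_s ?b_s //; last exact: smM.
have A := ab1 Wp; move: (ds (ds f) p) (ds f p) (k p) (f p) (a p) (b p) A => f2 f1 k0 f0 a0 b0 A.
have : (a0 * a0 + b0 * b0 - 1) * (f2 + k0 ^+ 2 * f0) = 0 by rewrite A subrr mul0r.
by nra.
Qed.

Lemma s_t p : Om p -> Dt sp p = - f p + ds f p * pp p.
Proof.
move=> Op; have Wp := OmW Op; rewrite spE (drvB oW ddt) ?(drvM ddt) //; try exact: smM.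
rewrite a_t ?b_t ?ut ?vt // ppE.
have A := ab1 Wp; move: (ds f p) (f p) (a p) (b p) A => f1 f0 a0 b0 A.
have : (a0 * a0 + b0 * b0 - 1) * f0 = 0 by rewrite A subrr mul0r.
by nra.
Qed.

Lemma q_t p : Om p -> Dt qq p = 2 * f p * sp p * qq p ^+ 2.
Proof. by move=> Op; have Wp := OmW Op; rewrite (drv_q ddt) // ut ?vt // spE; ring. Qed.

Lemma r2_t p : Om p -> Dt (fun p => u p * u p + v p * v p) p = - (2 * f p * sp p).
Proof.
move=> Op; have Wp := OmW Op; rewrite (drvD ddt) ?(drvM ddt) //; try exact: smM.
by rewrite ut ?vt // spE; ring.
Qed.

Lemma r2_s p : W p -> ds (fun p => u p * u p + v p * v p) p = 2 * pp p.
Proof.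
move=> Wp; rewrite (drvD dds) ?(drvM dds) //; try exact: smM.
by rewrite -aE -bE ppE; ring.
Qed.

Lemma f_s p : W p -> ds f p = ds k p + N * (k p * pp p * qq p - 2 * sp p * pp p * qq p ^+ 2).
Proof.
move=> Wp; rewrite fE (drvD dds) ?(drvZ oW dds) ?(drvM dds) //; try exact: smM.
  by rewrite s_s // q_s //; congr (_ + _ * _); ring.
by apply: smZ => //; exact: smM.
Qed.

Definition lap F p := ds (ds F) p + N * (pp p * qq p) * ds F p.

Lemma f_evolution p : Om p ->
  Dt f p = lap f p + f p * (k p ^+ 2 + N * ((sp p ^+ 2 - pp p ^+ 2) * qq p ^+ 2)).
Proof.
move=> Op; have Wp := OmW Op; rewrite {1}fE (drvD ddt) ?(drvZ oW ddt) ?(drvM ddt) //; try exact: smM.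
  rewrite k_t // s_t // q_t // /lap.
  have A := q_pyth Wp; move: (ds (ds f) p) (ds f p) (k p) (f p) (sp p) (pp p) (qq p) A => f2 f1 k0 f0 s0 p0 q0 A.
  have : (q0 * (s0 ^+ 2 + p0 ^+ 2) - 1) * (N * f0 * q0) = 0 by rewrite A subrr mul0r.
  by nra.
by apply: smZ => //; exact: smM.
Qed.

Lemma s_evolution p : Om p ->
  Dt sp p = lap sp p + sp p * (k p ^+ 2 - 2 * N * (pp p ^+ 2 * qq p ^+ 2)) - f p - k p.
Proof.
move=> Op; have Wp := OmW Op; rewrite s_t // /lap.
have -> : ds (ds sp) p = ds k p * pp p + k p * (1 - k p * sp p).
  rewrite (drv_eq dds oW s_s Wp) (drvM dds) // p_s //.
by rewrite f_s // s_s // fE; ring.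
Qed.

Lemma r2_evolution p : Om p -> Dt (fun p => u p * u p + v p * v p) p =
  lap (fun p => u p * u p + v p * v p) p - 2 * (N + 1).
Proof.
move=> Op; have Wp := OmW Op; rewrite r2_t // /lap r2_s //.
rewrite (drv_eq dds oW r2_s Wp) (drvZ oW dds) // p_s //.
have A := q_pyth Wp; rewrite fE; move: (k p) (sp p) (pp p) (qq p) A => k0 s0 p0 q0 A.
have : (q0 * (s0 ^+ 2 + p0 ^+ 2) - 1) * N = 0 by rewrite A subrr mul0r.
by nra.
Qed.

(** Differential polynomials of order j in f over the Frenet quantities; the arclength derivative
    raises j by one. The curvature is no generator, since k = f - N s q. *)
Inductive pol (j : nat) : (R * R -> R) -> Prop :=
| pol_a : pol j a | pol_b : pol j b | pol_s : pol j sp | pol_p : pol j pp | pol_q : pol j qq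
| pol_g i : (i <= j)%N -> pol j (g i)
| pol_cst c : pol j (fun=> c)
| pol_add F G : pol j F -> pol j G -> pol j (fun p => F p + G p)
| pol_mul F G : pol j F -> pol j G -> pol j (fun p => F p * G p).

Lemma pol_smooth j F : pol j F -> sm F.
Proof.
by elim=> //; [move=> c; exact: sm_cst|move=> F' G' _ h1 _ h2; exact: smD|move=> F' G' _ h1 _ h2; exact: smM].
Qed.

Lemma pol_le i j F : (i <= j)%N -> pol i F -> pol j F.
Proof.
move=> ij; elim; try by constructor.
- by move=> i' h; constructor; exact: leq_trans ij.
Qed.

Lemma pol_ext j F G : (forall p, F p = G p) -> pol j F -> pol j G.
Proof. by move=> /funext ->. Qed.

Lemma pol_opp j F : pol j F -> pol j (fun p => - F p).
Proof.
move=> pF; apply: (pol_ext (F := fun p => -1 * F p)) => [p|]; first by rewrite mulN1r.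
by apply: pol_mul => //; exact: pol_cst.
Qed.

Lemma pol_sqr j F : pol j F -> pol j (fun p => F p ^+ 2).
Proof. by move=> pF; exact (pol_mul pF pF). Qed.

Lemma pol_k j : pol j k.
Proof.
apply: (pol_ext (F := fun p => f p + - (N * (sp p * qq p)))) => [p|]; first by rewrite fE addrK.
apply: pol_add; first exact: (pol_g (i := 0)).
apply: pol_opp; apply: pol_mul; first exact: pol_cst.
by apply: pol_mul; [exact: pol_s|exact: pol_q].
Qed.

Ltac pol_auto := repeat lazymatch goal with
  | |- pol _ (fun=> ?c) => exact: pol_cst
  | |- pol _ (fun p => @?F p + @?G p) => apply: (@pol_add _ F G)
  | |- pol _ (fun p => @?F p * @?G p) => apply: (@pol_mul _ F G)
  | |- pol _ (fun p => - @?F p) => apply: (@pol_opp _ F)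
  | |- pol _ (fun p => @?F p ^+ 2) => apply: (@pol_sqr _ F)
  | |- _ => first [exact: pol_a|exact: pol_b|exact: pol_s|exact: pol_p|exact: pol_q|exact: pol_k
                  |exact: (pol_g (i := 0))|assumption]
  end.

Lemma pol_ds j F : pol j F -> exists2 G, pol j.+1 G & forall p, W p -> ds F p = G p.
Proof.
elim=> [|||||i ij|c|F1 F2 h1 [G1 p1 e1] h2 [G2 p2 e2]|F1 F2 h1 [G1 p1 e1] h2 [G2 p2 e2]].
- by exists (fun p => - (k p * b p)); [pol_auto|exact: a_s].
- by exists (fun p => k p * a p); [pol_auto|exact: b_s].
- by exists (fun p => k p * pp p); [pol_auto|exact: s_s].
- by exists (fun p => 1 - k p * sp p); [pol_auto|exact: p_s].
- by exists (fun p => - (2 * pp p * qq p ^+ 2)); [pol_auto|exact: q_s].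
- by exists (g i.+1) => //; exact: pol_g.
- by exists (fun=> 0) => [|p Wp]; [exact: pol_cst|exact: (drv_cst dds)].
- exists (fun p => G1 p + G2 p); first exact: pol_add.
  by move=> p Wp; rewrite (drvD dds) ?e1 ?e2 //; [exact: pol_smooth h1|exact: pol_smooth h2].
- exists (fun p => G1 p * F2 p + F1 p * G2 p).
    by apply: pol_add; apply: pol_mul => //; exact: (pol_le (leqnSn j)).
  by move=> p Wp; rewrite (drvM dds) ?e1 ?e2 //; [exact: pol_smooth h1|exact: pol_smooth h2].
Qed.

Lemma lap_ds F p : sm F -> W p ->
  ds (lap F) p = lap (ds F) p + N * ((1 - k p * sp p) * qq p - 2 * pp p ^+ 2 * qq p ^+ 2) * ds F p.
Proof.
move=> sF Wp; have s1 : sm (ds F) by exact: (drv_sm dds).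
have s2 : sm (ds (ds F)) by exact: (drv_sm dds).
have spq : sm (fun p => pp p * qq p) by exact: smM.
have snpq : sm (fun p => N * (pp p * qq p)) by exact: smZ.
rewrite {1}/lap (drvD dds) ?(drvM dds) ?(drv_cst dds) //; try exact: smM; try exact: sm_cst.
by rewrite p_s // q_s // /lap; ring.
Qed.

(* Differentiating the evolution equation of g_j and commuting with d/ds. For j = 0 the zeroth
   order coefficient contains k^2, whose derivative contributes to the coefficient of g_1. *)
Lemma g_evolution j : exists A B, [/\ pol 0 A, pol j B &
  forall p, Om p -> Dt (g j.+1) p = lap (g j.+1) p + A p * g j.+1 p + B p].
Proof.
(* What commuting costs at every order: d/ds with [lap], from the derivative of the drift
   coefficient, and d/dt with d/ds, which adds k f. *)
pose Cm p := N * ((1 - k p * sp p) * qq p - 2 * pp p ^+ 2 * qq p ^+ 2) + k p * f p.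
have pC : pol 0 Cm by rewrite /Cm; pol_auto.
elim: j => [|j [A [B [pA pB EAB]]]].
  pose A p := k p ^+ 2 + N * ((sp p ^+ 2 - pp p ^+ 2) * qq p ^+ 2).
  pose Z p := N * (k p * pp p * qq p - 2 * sp p * pp p * qq p ^+ 2).
  pose B p := f p * (- (2 * k p * Z p) + N * ((2 * sp p * (k p * pp p) - 2 * pp p * (1 - k p * sp p)) * qq p ^+ 2
     - (sp p ^+ 2 - pp p ^+ 2) * (2 * qq p * (2 * pp p * qq p ^+ 2)))).
  have pA : pol 0 A by rewrite /A; pol_auto.
  have pZ : pol 0 Z by rewrite /Z; pol_auto.
  exists (fun p => (Cm p + A p) + 2 * (k p * f p)), B; split.
  - by pol_auto.
  - by rewrite /B; pol_auto.
  - move=> p Op; have Wp := OmW Op; have sA := pol_smooth pA.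
    rewrite {1}/g iterS swap // (drv_eq dds oOm f_evolution Op).
    have sL : sm (lap f).
      have s1 : sm (ds f) by exact: (drv_sm dds).
      apply: smD => //; first exact: (drv_sm dds).
      by apply: smM => //; apply: smZ => //; exact: smM.
    rewrite (drvD dds) ?(drvM dds) //; last exact: smM.
    rewrite lap_ds //.
    have sx F : sm F -> sm (fun p => F p ^+ 2).
      by move=> sF; apply: (sm_ext (F := fun p => F p * F p)) => [y|]; [by rewrite expr2|]; exact: smM.
    have dx2 F : sm F -> ds (fun p => F p ^+ 2) p = 2 * F p * ds F p.
      move=> sF; rewrite (drv_eq dds (V := W) oW (G := fun p => F p * F p)) // (drvM dds) //; ring.
    have EA : ds A p = 2 * k p * (ds f p - Z p) + N * ((2 * sp p * (k p * pp p) - 2 * pp p * (1 - k p * sp p)) * qq p ^+ 2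
     - (sp p ^+ 2 - pp p ^+ 2) * (2 * qq p * (2 * pp p * qq p ^+ 2))).
      have s3 : sm (fun p => sp p ^+ 2 - pp p ^+ 2) by apply: smB => //; exact: sx.
      have s4 : sm (fun p => qq p ^+ 2) by exact: sx.
      have s5 : sm (fun p => (sp p ^+ 2 - pp p ^+ 2) * qq p ^+ 2) by exact: smM.
      rewrite /A (drvD dds) ?(drvZ oW dds) ?(drvM dds) ?(drvB oW dds) ?dx2 ?s_s ?p_s ?q_s //; try exact: sx; last exact: smZ.
      by rewrite f_s // /Z; ring.
    rewrite EA /g /= /Cm /B /A; move: (lap (ds f) p) (ds f p) => *; ring.
have [A1 pA1 EA1] := pol_ds pA; have [B1 pB1 EB1] := pol_ds pB.
exists (fun p => Cm p + A p), (fun p => A1 p * g j.+1 p + B1 p); split.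
- by pol_auto.
- by apply: pol_add => //; apply: pol_mul; [exact: (pol_le _ pA1)|exact: pol_g].
- move=> p Op; have Wp := OmW Op; have sA := pol_smooth pA; have sB := pol_smooth pB; have s1 := sg j.+1.
  rewrite [g j.+2]iterS swap // (drv_eq dds oOm EAB Op).
  have sL : sm (lap (g j.+1)).
    have s2 : sm (ds (g j.+1)) by exact: (drv_sm dds).
    apply: smD => //; first exact: (drv_sm dds).
    by apply: smM => //; apply: smZ => //; exact: smM.
  have sAg : sm (fun p => A p * g j.+1 p) by exact: smM.
  rewrite (drvD dds (smD oW sL sAg) sB) // (drvD dds sL sAg) // (drvM dds sA s1) //.
  rewrite lap_ds // EA1 // EB1 // /Cm -[ds (g j.+1)]/(g j.+2).
  by move: (lap (g j.+2) p) (g j.+2 p) (g j.+1 p) => *; ring.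
Qed.

(** * A priori bounds by the maximum principle *)

Context (T P : R) (N0 : 0 <= N).
Context (OmE : forall t x, 0 < t < T -> Om (t, x)) (WE : forall t x, 0 <= t < T -> W (t, x)).
Definition per F := forall t x, 0 <= t < T -> F (t, x + P) = F (t, x).
(** The derivations being abstract here, the analysis enters through hypotheses. For the actual flow
    [maxp] is [parabolic_barrier] together with the second derivative test at the touching point. *)
Context (maxp : forall F, sm F -> per F -> (forall x, F (0, x) < 0) ->
  (forall t x, 0 < t < T -> F (t, x) = 0 -> ds F (t, x) = 0 -> ds (ds F) (t, x) <= 0 -> Dt F (t, x) < 0) ->
  forall t x, 0 <= t < T -> F (t, x) < 0).
Context (bound0 : forall F, sm F -> per F -> exists C, forall x, `|F (0, x)| <= C).
Context (min0 : forall F, sm F -> per F -> (forall x, 0 < F (0, x)) -> exists2 c : R, 0 < c & forall x, c <= F (0, x)).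
Context (per_ds : forall F, sm F -> per F -> per (ds F)) (per_u : per u) (per_v : per v).
Context (st : sm (fun p => p.1)) (ds_time : forall (h : R -> R) p, ds (fun p => h p.1) p = 0)
  (Dt_time : forall p, Dt (fun p => p.1) p = 1).
Context (sE : forall C, sm (fun p => expR (C * p.1)))
  (Dt_exp : forall (C : R) p, Dt (fun p => expR (C * p.1)) p = C * expR (C * p.1)).

Let r2 p := u p * u p + v p * v p.

Let per_a : per a. Proof. by rewrite aE; exact: per_ds. Qed.
Let per_b : per b. Proof. by rewrite bE; exact: per_ds. Qed.
Let per_s : per sp.
Proof. by move=> t x tT; rewrite spE per_u ?per_v ?per_a ?per_b. Qed.
Let per_q : per qq.
Proof. by move=> t x tT; rewrite qqE per_u ?per_v. Qed.
Let per_f : per f.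
Proof.
move=> t x tT; rewrite fE per_s ?per_q // kE per_a ?per_b //.
by rewrite (per_ds sa per_a) ?(per_ds sb per_b).
Qed.
Let per_g j : per (g j). Proof. by elim: j => [//|j IH]; exact: per_ds. Qed.

(** At a touching point r^2 + t - M has time derivative at most 1 - 2 (N + 1) < 0; the coefficient 1
    of t, smaller than the sharp one, provides the strict inequality. *)
Lemma r2_bound M : (forall x, r2 (0, x) < M) -> forall t x, 0 <= t < T -> r2 (t, x) + t < M.
Proof.
move=> H0 t x tT; rewrite -subr_lt0.
pose F p := r2 p + (p.1 - M).
have s2 : sm (fun p => p.1 - M) by apply: smB => //; exact: sm_cst.
have sF : sm F by exact: smD.
suff /(_ t x tT) : forall t x, 0 <= t < T -> F (t, x) < 0 by rewrite /F /= addrA.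
have dF p : W p -> ds F p = 2 * pp p.
  by move=> Wp; rewrite /F (drvD dds) // r2_s // (ds_time (fun t => t - M)) addr0.
apply: (maxp sF) => [s y sT|y|s y sT _].
- by rewrite /F /r2 /= per_u ?per_v.
- by rewrite /F /= sub0r subr_lt0.
have Op := OmE y sT; have Wp := OmW Op; rewrite dF // (drv_eq dds oW dF Wp) (drvZ oW dds) // => h1 h2.
rewrite /F (drvD ddt) // r2_evolution // /lap (drvB oW ddt) // ?Dt_time ?(drv_cst ddt) //; last exact: sm_cst.
rewrite (drv_eq dds oW r2_s Wp) (drvZ oW dds) // r2_s //.
by rewrite h1 mulr0 addr0; have := N0; lra.
Qed.

Context (T0 : 0 < T) (Q : R) (qQ : forall t x, 0 <= t < T -> qq (t, x) <= Q).

Let D0 : 0 <= (0 : R) < T. Proof. by rewrite lexx. Qed.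

Let q_ge0 p : W p -> 0 < qq p.
Proof.
by move=> Wp; rewrite qqE invr_gt0 lt_neqAle eq_sym r0 //= addr_ge0 // -expr2 sqr_ge0.
Qed.

Let Q0 : 0 < Q. Proof. exact: lt_le_trans (q_ge0 (WE 0 D0)) (qQ 0 D0). Qed.

(* At a spatial minimum of s = <z, nu> either the curvature or the tangential part p of the
   position vanishes; the latter is impossible where s < |z|, i.e. where s^2 q < 1. *)
Lemma s_lower_bound : (forall x, 0 < sp (0, x)) ->
  exists2 be : R, 0 < be & forall t x, 0 <= t < T -> be <= sp (t, x).
Proof.
move=> sp0; have [c1 c10 Hc1] := min0 ss per_s sp0.
(* With c <= 1 / (1 + Q) one has c^2 Q < 1, so that p cannot vanish where s <= c; half of c1 makes
   the initial inequality strict. *)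
pose c := Num.min (c1 / 2) (1 / (1 + Q)).
have Q00 := Q0.
have c0 : 0 < c by rewrite lt_min !divr_gt0 // addr_gt0.
have cc1 : c < c1 by rewrite gt_min; apply/orP; left; lra.
have cQ : c ^+ 2 * Q < 1.
  have h : c <= 1 / (1 + Q) by rewrite ge_min lexx orbT.
  have {}h : c * (1 + Q) <= 1 by rewrite -ler_pdivlMr // addr_gt0.
  have c1' : c <= 1 by nra.
  by nra.
(* Where k = 0 the zeroth order terms of s_t are - 2 N s p^2 q^2 - N s q >= - 3 N Q s; the summand 1
   gives strictness. *)
pose C := 3 * N * Q + 1.
pose E p := expR (- C * p.1).
have C0 : 0 < C by rewrite /C; have := N0; nra.
have sEE : sm (fun p => c * E p) by apply: smZ => //; exact: sE.
exists (c * expR (- C * T)); first by rewrite mulr_gt0 ?expR_gt0.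
move=> t x tT; suff : c * E (t, x) - sp (t, x) < 0.
  rewrite subr_lt0 => /ltW/le_trans h; apply: le_trans (h _ (lexx _)).
  rewrite ler_pM2l // ler_expR /= !mulNr lerN2 ler_pM2l //.
  by case/andP: tT => _ /ltW.
pose F p := c * E p - sp p.
have sF : sm F by exact: smB.
have dF p : W p -> ds F p = - ds sp p.
  by move=> Wp; rewrite /F (drvB oW dds) // (ds_time (fun t => c * expR (- C * t))) sub0r.
apply: (maxp sF) => // [s y sT|y|s y sT /eqP F0].
- by rewrite /F /E /= per_s.
- by rewrite /F /E /= mulr0 expR0 mulr1 subr_lt0; exact: lt_le_trans (Hc1 y).
have Op := OmE y sT; have Wp := OmW Op; have sds : sm (ds sp) by exact: (drv_sm dds).
rewrite dF // (drv_eq dds oW dF Wp) (drvN oW dds) // => h1 h2.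
rewrite /F (drvB oW ddt) // (drvZ oW ddt) ?Dt_exp //; last exact: sE.
move: F0; rewrite subr_eq0 => /eqP Es.
have s1 : sp (s, y) <= c.
  rewrite -Es -[leRHS]mulr1 ler_pM2l // -expR0 ler_expR /= mulNr oppr_le0 mulr_ge0 ?(ltW C0) //.
  by case/andP : sT => /ltW.
have s0 : 0 < sp (s, y) by rewrite -Es mulr_gt0 ?expR_gt0.
have qp := q_pyth Wp; have q0 := q_ge0 Wp.
have qQ' : qq (s, y) <= Q by apply: qQ; case/andP: sT => /ltW -> ->.
have kp : k (s, y) * pp (s, y) = 0 by rewrite -s_s //; lra.
have k0 : k (s, y) = 0.
  move/eqP: kp; rewrite mulf_eq0 => /orP[/eqP //|/eqP p0].
  have : qq (s, y) * sp (s, y) ^+ 2 <= Q * c ^+ 2.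
    by apply: ler_pM; rewrite ?sqr_ge0 ?(ltW q0) // lerXn2r ?nnegrE ?(ltW s0) ?(ltW c0).
  by move: qp; rewrite p0 => h; move: cQ h; rewrite mulrC expr0n /= addr0; lra.
have dsp0 : ds sp (s, y) = 0 by lra.
rewrite -/(E (s, y)) s_evolution // /lap dsp0 fE k0.
have := N0; move: (E (s, y)) (sp (s, y)) (pp (s, y)) (qq (s, y)) (ds (ds sp) (s, y)) Es s0 qp q0 qQ' h2.
rewrite /C => E0 s0' p0 q0' d2 Es s0 qp q0 qQ' h2 N0'.
have Es' : c * (- (3 * N * Q + 1) * E0) = - (3 * N * Q + 1) * s0'.
  by rewrite -Es; ring.
rewrite Es'.
have pq : p0 ^+ 2 * q0' ^+ 2 <= Q.
  have hh : 0 <= q0' * s0' ^+ 2 by rewrite mulr_ge0 ?sqr_ge0 ?(ltW q0).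
  have h3 : q0' * p0 ^+ 2 <= 1 by move: qp; rewrite mulrDr; lra.
  have -> : p0 ^+ 2 * q0' ^+ 2 = (q0' * p0 ^+ 2) * q0' by ring.
  by nra.
have h4 : 0 <= N * s0' by rewrite mulr_ge0 // ltW.
have h5 : N * s0' * (p0 ^+ 2 * q0' ^+ 2) <= N * s0' * Q by rewrite ler_wpM2l.
have h6 : N * s0' * q0' <= N * s0' * Q by rewrite ler_wpM2l.
by nra.
Qed.

Context (S : R) (r2S : forall t x, 0 <= t < T -> r2 (t, x) <= S ^+ 2) (S0 : 0 < S).
Context (be : R) (be0 : 0 < be) (sbe : forall t x, 0 <= t < T -> 2 * be <= sp (t, x)).

Definition bdd F := exists C, forall t x, 0 <= t < T -> `|F (t, x)| <= C.

Let sp2 p : W p -> sp p ^+ 2 + pp p ^+ 2 = r2 p.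
Proof.
move=> Wp; rewrite spE ppE -[RHS]mulr1 -(ab1 Wp) /r2; ring.
Qed.

Let sS t x : 0 <= t < T -> `|sp (t, x)| <= S /\ `|pp (t, x)| <= S.
Proof.
move=> tT; have := r2S x tT; rewrite -sp2; last exact: WE.
have h1 := sqr_ge0 (sp (t, x)); have h2 := sqr_ge0 (pp (t, x)) => h.
by split; rewrite -(@ger0_norm _ S) ?(ltW S0) // -ler_sqr ?nnegrE // !real_normK ?num_real //; lra.
Qed.

(* Tso's trick: f / (s - be) satisfies a maximum principle because the term - be k^2 absorbs the
   linear terms in k. *)
Lemma f_bdd : bdd f.
Proof.
have [Cf HCf] := bound0 sf per_f.
have Cf0 : 0 <= Cf by apply: le_trans (HCf 0).
(* Completing the square, - be k^2 + 2 k <= 1 / be; the terms containing N total at most 4 N S Q,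
   the last 1 is for strictness. Dividing by be is right because s - be >= be. *)
pose C := (be^-1 + 4 * N * S * Q + 1) / be.
pose M := (Cf + 1) / be.
have M0 : 0 < M by rewrite divr_gt0 // ltr_wpDl.
have C0 : 0 < C.
  by rewrite divr_gt0 // ltr_wpDl // addr_ge0 ?invr_ge0 ?(ltW be0) // !mulr_ge0 // ltW // Q0.
pose E p := expR (C * p.1).
have sB : sm (fun p => E p * (sp p - be)) by apply: smM => //; [exact: sE|apply: smB => //; exact: sm_cst].
(* The sign [si] treats f and - f together: the bracket that has to be negative does not contain
   it. *)
have main (si : R) : `|si| = 1 -> forall t x, 0 <= t < T -> si * f (t, x) - M * (E (t, x) * (sp (t, x) - be)) < 0.
  move=> sg1; pose F p := si * f p - M * (E p * (sp p - be)).
  have sF : sm F by apply: smB => //; exact: smZ.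
  have sds : sm (ds sp) by exact: (drv_sm dds).
  have sdf : sm (ds f) by exact: (drv_sm dds).
  have dE p : W p -> ds (fun p => E p * (sp p - be)) p = E p * ds sp p.
    move=> Wp; rewrite (drvM dds) //; [|exact: sE|apply: smB => //; exact: sm_cst].
    by rewrite (ds_time (fun t => expR (C * t))) (drvB oW dds) ?(drv_cst dds) ?mul0r ?add0r ?subr0 //; exact: sm_cst.
  have dF p : W p -> ds F p = si * ds f p - M * (E p * ds sp p).
    by move=> Wp; rewrite /F (drvB oW dds) ?(drvZ oW dds) ?dE //; exact: smZ.
  have sEs : sm (fun p => E p * ds sp p) by apply: smM => //; exact: sE.
  have ddF p : W p -> ds (ds F) p = si * ds (ds f) p - M * (E p * ds (ds sp) p).
    move=> Wp; rewrite (drv_eq dds oW dF Wp) (drvB oW dds) ?(drvZ oW dds) //; try exact: smZ.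
    rewrite (drvM dds) //; last exact: sE.
    by rewrite (ds_time (fun t => expR (C * t))) mul0r add0r.
  apply: (maxp sF) => [s y sT|y|s y sT].
  - by rewrite /F /E /= per_s ?per_f.
  - rewrite /F /E /= mulr0 expR0 mul1r subr_lt0.
    have h1 : si * f (0, y) <= Cf.
      by apply: le_trans (ler_norm _) _; rewrite normrM sg1 mul1r.
    have h2 : Cf + 1 <= M * (sp (0, y) - be).
      rewrite /M mulrAC ler_pdivlMr // ler_wpM2l ?addr_ge0 //.
      by have := sbe y D0; lra.
    by lra.
  have Op := OmE y sT; have Wp := OmW Op; have sT' : 0 <= s < T by case/andP: sT => /ltW -> ->.
  rewrite dF // ddF // /F => /eqP; rewrite subr_eq0 => /eqP F0 h1 h2.
  rewrite (drvB oW ddt) ?(drvZ oW ddt) ?(drvM ddt) //; try exact: smZ; try exact: sE; try (by apply: smB => //; exact: sm_cst).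
  rewrite (drvB oW ddt) ?(drv_cst ddt) //; last exact: sm_cst.
  rewrite Dt_exp subr0 f_evolution // s_evolution // /lap -/(E (s, y)).
  have E0 : 0 < E (s, y) by exact: expR_gt0.
  have qp := q_pyth Wp; have q0 := q_ge0 Wp; have qQ' := qQ y sT'; have [sS' _] := sS y sT'; have sb' := sbe y sT'.
  have X0 : 0 < M * E (s, y) by rewrite mulr_gt0.
  have fk : f (s, y) = k (s, y) + N * (sp (s, y) * qq (s, y)) by rewrite fE.
  have {}sS' : sp (s, y) <= S by apply: le_trans sS'; exact: ler_norm.
  move: (ds (ds f) (s, y)) (ds (ds sp) (s, y)) (ds f (s, y)) (ds sp (s, y)) h1 h2 fk => f2 s2 f1 s1 h1 h2 fk.
  move: (E (s, y)) (f (s, y)) (k (s, y)) (sp (s, y)) (pp (s, y)) (qq (s, y)) X0 E0 F0 h1 h2 fk qp q0 qQ' sS' sb'.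
  move=> E1 f0 k0 s0 p0 q1 X0 E0 F0 h1 h2 fk qp q0 qQ' sS' sb'.
  have Cb : C * be = be^-1 + 4 * N * S * Q + 1 by rewrite /C mulfVK // gt_eqF.
  pose X := M * E1.
  (* The linear operator applied to F, a multiple of F, and a remainder: the first is nonpositive
     and the second vanishes at the touching point, so that the sign is decided by the bracket
     multiplying X. *)
  have -> : si * (f2 + N * (p0 * q1) * f1 + f0 * (k0 ^+ 2 + N * ((s0 ^+ 2 - p0 ^+ 2) * q1 ^+ 2))) -
    M * (C * E1 * (s0 - be) + E1 * (s2 + N * (p0 * q1) * s1 + s0 * (k0 ^+ 2 - 2 * N * (p0 ^+ 2 * q1 ^+ 2)) - f0 - k0)) =
    (si * f2 - M * (E1 * s2)) + N * (p0 * q1) * (si * f1 - M * (E1 * s1)) +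
    (si * f0 - M * (E1 * (s0 - be))) * (k0 ^+ 2 + N * ((s0 ^+ 2 - p0 ^+ 2) * q1 ^+ 2)) +
    X * (- be * k0 ^+ 2 + k0 + f0 + (s0 - be) * (N * ((s0 ^+ 2 - p0 ^+ 2) * q1 ^+ 2)) + 2 * N * s0 * (p0 ^+ 2 * q1 ^+ 2) - C * (s0 - be)).
    by rewrite /X; ring.
  rewrite h1 mulr0 addr0 F0 subrr mul0r addr0.
  suff h3 : - be * k0 ^+ 2 + k0 + f0 + (s0 - be) * (N * ((s0 ^+ 2 - p0 ^+ 2) * q1 ^+ 2)) + 2 * N * s0 * (p0 ^+ 2 * q1 ^+ 2) - C * (s0 - be) < 0.
    have : X * (- be * k0 ^+ 2 + k0 + f0 + (s0 - be) * (N * ((s0 ^+ 2 - p0 ^+ 2) * q1 ^+ 2)) + 2 * N * s0 * (p0 ^+ 2 * q1 ^+ 2) - C * (s0 - be)) < 0.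
      by rewrite nmulr_llt0.
    by lra.
  have b0 := be0; have n0 := N0; have QQ := Q0.
  have s00 : 0 < s0 by lra.
  have h4 : - be * k0 ^+ 2 + 2 * k0 <= be^-1.
    have : 0 <= be^-1 * (be * k0 - 1) ^+ 2 by rewrite mulr_ge0 ?sqr_ge0 ?invr_ge0 ?(ltW b0).
    have -> : be^-1 * (be * k0 - 1) ^+ 2 = be * k0 ^+ 2 - 2 * k0 + be^-1 by field; rewrite gt_eqF.
    by lra.
  have sq1 : 0 <= s0 ^+ 2 * q1 by rewrite mulr_ge0 ?sqr_ge0 ?(ltW q0).
  have pq1 : 0 <= p0 ^+ 2 * q1 by rewrite mulr_ge0 ?sqr_ge0 ?(ltW q0).
  have sq2 : s0 ^+ 2 * q1 ^+ 2 <= Q by rewrite expr2 mulrA; nra.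
  have pq2 : p0 ^+ 2 * q1 ^+ 2 <= Q by rewrite [q1 ^+ 2]expr2 mulrA; nra.
  have pq3 : 0 <= p0 ^+ 2 * q1 ^+ 2 by rewrite mulr_ge0 ?sqr_ge0.
  have SQ : 0 <= S * Q by rewrite mulr_ge0 // ltW.
  have h5 : s0 * q1 <= S * Q by apply: ler_pM => //; exact: ltW.
  have h6 : (s0 - be) * ((s0 ^+ 2 - p0 ^+ 2) * q1 ^+ 2) <= S * Q.
    apply: le_trans (_ : (s0 - be) * Q <= _); last by rewrite ler_wpM2r ?(ltW QQ) //; lra.
    by rewrite ler_wpM2l //; [lra|rewrite mulrBl; lra].
  have h7 : s0 * (p0 ^+ 2 * q1 ^+ 2) <= S * Q by apply: ler_pM => //; exact: ltW.
  have h8 : C * be <= C * (s0 - be) by rewrite ler_wpM2l ?(ltW C0) //; lra.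
  rewrite Cb in h8.
  have w5 := ler_wpM2l n0 h5; have w6 := ler_wpM2l n0 h6; have w7 := ler_wpM2l n0 h7.
  by move: h4 h8 w5 w6 w7; rewrite fk; move: (be^-1) => ib; nra.
exists (M * (expR (C * T) * S)) => t x tT.
have h1 := main 1 (normr1 _) t x tT; have h2 := main (-1) (normrN1 _) t x tT.
have h3 : E (t, x) * (sp (t, x) - be) <= expR (C * T) * S.
  have [sS' _] := sS x tT; have b0 := be0; have sb' := sbe x tT.
  apply: ler_pM; rewrite ?expR_ge0 //; first by lra.
    by rewrite ler_expR ler_pM2l //; case/andP: tT => _ /ltW.
  by have := ler_norm (sp (t, x)); lra.
have h4 : M * (E (t, x) * (sp (t, x) - be)) <= M * (expR (C * T) * S) by rewrite ler_pM2l.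
by rewrite ler_norml; apply/andP; split; lra.
Qed.

Lemma pol_bdd j F : (forall i, (i <= j)%N -> bdd (g i)) -> pol j F -> bdd F.
Proof.
move=> Hg; have ab (x y : R) : x * x + y * y = 1 -> `|x| <= 1.
  move=> h; rewrite -(@normr1 R) -ler_sqr ?nnegrE // !real_normK ?num_real // expr2 expr1n.
  by have := sqr_ge0 y; rewrite expr2; lra.
elim=> [|||||i ij|c|F1 F2 _ [C1 H1] _ [C2 H2]|F1 F2 _ [C1 H1] _ [C2 H2]].
- by exists 1 => t x tT; apply: (ab _ (b (t, x))); apply: ab1; exact: WE.
- by exists 1 => t x tT; apply: (ab _ (a (t, x))); rewrite addrC; apply: ab1; exact: WE.
- by exists S => t x tT; have [] := sS x tT.
- by exists S => t x tT; have [] := sS x tT.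
- by exists Q => t x tT; rewrite ger0_norm ?qQ // ltW // q_ge0 //; exact: WE.
- exact: Hg.
- by exists `|c|.
- exists (C1 + C2) => t x tT; apply: le_trans (ler_normD _ _) _; exact: lerD (H1 t x tT) (H2 t x tT).
- by exists (C1 * C2) => t x tT; rewrite normrM; apply: ler_pM; [| |exact: H1|exact: H2].
Qed.

(** The next derivative satisfies a linear equation whose coefficient A has order 0 and whose
    inhomogeneity B has order j, both bounded by induction; an exponential in time is then a
    barrier. *)
Lemma g_bdd j : bdd (g j).
Proof.
suff H : forall i, (i <= j)%N -> bdd (g i) by exact: H.
elim: j => [|j IH] i; first by rewrite leqn0 => /eqP ->; exact: f_bdd.
rewrite leq_eqVlt => /predU1P[->|]; last exact: IH.
have [A [B [pA pB EG]]] := g_evolution j.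
have [a0 Ha0] : bdd A by apply: pol_bdd pA => i'; rewrite leqn0 => /eqP ->; exact: IH.
have [b0 Hb0] : bdd B by exact: pol_bdd pB.
have a00 : 0 <= a0 by apply: le_trans (Ha0 0 0 D0).
have b00 : 0 <= b0 by apply: le_trans (Hb0 0 0 D0).
have [Cg HCg] := bound0 (sg j.+1) (per_g j.+1).
have Cg0 : 0 <= Cg by apply: le_trans (HCg 0).
(* As M >= 1, the barrier stays above 1, so that b0 absorbs the inhomogeneity as a0 does the linear
   term. *)
pose C := a0 + b0 + 1; pose M := Cg + 1; pose E p := expR (C * p.1).
have C0 : 0 < C by rewrite /C; lra.
have M1 : 1 <= M by rewrite /M; lra.
have sG := sg j.+1; set G := g j.+1 in sG HCg EG *.
have main (si : R) : `|si| = 1 -> forall t x, 0 <= t < T -> si * G (t, x) - M * E (t, x) < 0.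
  move=> sg1; pose F p := si * G p - M * E p.
  have sZ : sm (fun p => si * G p) by exact: smZ.
  have sZ' : sm (fun p => M * E p) by apply: smZ => //; exact: sE.
  have sF : sm F by exact: smB.
  have sdG : sm (ds G) by exact: (drv_sm dds).
  have dF p : W p -> ds F p = si * ds G p.
    by move=> Wp; rewrite /F (drvB oW dds sZ sZ') // (drvZ oW dds) // (ds_time (fun t => M * expR (C * t))) subr0.
  have ddF p : W p -> ds (ds F) p = si * ds (ds G) p.
    by move=> Wp; rewrite (drv_eq dds oW dF Wp) (drvZ oW dds).
  apply: (maxp sF) => [s y sT|y|s y sT].
  - have pG : G (s, y + P) = G (s, y) by exact: (per_g j.+1).
    by rewrite /F /E /= pG.
  - rewrite /F /E /= mulr0 expR0 mulr1 subr_lt0 /M.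
    by apply: le_lt_trans (ler_norm _) _; rewrite normrM sg1 mul1r; apply: le_lt_trans (HCg y) _; lra.
  have Op := OmE y sT; have Wp := OmW Op; have sT' : 0 <= s < T by case/andP: sT => /ltW -> ->.
  rewrite dF // ddF // /F => /eqP; rewrite subr_eq0 => /eqP F0 h1 h2.
  rewrite (drvB oW ddt sZ sZ') // (drvZ oW ddt) // (drvZ oW ddt) ?Dt_exp //; last exact: sE.
  rewrite EG // /lap -/(E (s, y)).
  have E1 : 1 <= E (s, y) by rewrite -expR0 ler_expR mulr_ge0 ?(ltW C0) //; case/andP: sT'.
  have := Ha0 s y sT'; have := Hb0 s y sT'.
  have hB : si * B (s, y) <= `|B (s, y)| by apply: le_trans (ler_norm _) _; rewrite normrM sg1 mul1r.
  have hA : A (s, y) <= `|A (s, y)| by exact: ler_norm.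
  move: (ds (ds G) (s, y)) (ds G (s, y)) h1 h2 F0 => G2 G1 h1 h2 F0 hb ha.
  have ME : 1 <= M * E (s, y) by rewrite mulr_ege1.
  have -> : si * (G2 + N * (pp (s, y) * qq (s, y)) * G1 + A (s, y) * G (s, y) + B (s, y)) - M * (C * E (s, y)) =
    si * G2 + N * (pp (s, y) * qq (s, y)) * (si * G1) + A (s, y) * (si * G (s, y)) + si * B (s, y) - C * (M * E (s, y)) by ring.
  rewrite h1 mulr0 addr0 F0 /C; move: (M * E (s, y)) ME => h ME.
  have w1 : A (s, y) * h <= a0 * h by rewrite ler_wpM2r //; lra.
  have w2 : b0 * 1 <= b0 * h by rewrite ler_wpM2l.
  by nra.
exists (M * expR (C * T)) => t x tT.
have h1 := main 1 (normr1 _) t x tT; have h2 := main (-1) (normrN1 _) t x tT.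
have h3 : M * E (t, x) <= M * expR (C * T).
  by rewrite ler_wpM2l ?ler_expR ?ler_pM2l //; [lra|case/andP: tT => _ /ltW].
by rewrite ler_norml; apply/andP; split; lra.
Qed.

Lemma pol_bounded j F : pol j F -> bdd F.
Proof. by apply: pol_bdd => i _; exact: g_bdd. Qed.

End Frenet.

(** * Time slices of smooth functions *)

Section SmoothSlices.
Context {R : realType}.
Implicit Types (F G : R * R -> R) (U : set (R * R)).

Lemma open_pos U F : open U -> smoothf U F -> open [set p | U p /\ 0 < F p].
Proof.
move=> oU [sF]; rewrite openE => p [Up Fp]; rewrite /interior.
have /contP/(_ _ Fp)[r r0 Hr] := smooth_cont sF Up.
have nU : nbhs p U by exact: open_nbhs_nbhs.
have nB : nbhs p [set y | `|y - p| < r].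
  by apply/nbhs_ballP; exists r => // y; rewrite -ball_normE /= distrC.
apply: filterS (filterI nU nB) => y [Uy yr]; split => //.
have := Hr y yr; rewrite ltr_norml => /andP[h _].
by lra.
Qed.

Lemma smoothf_sub U U' F : U' `<=` U -> smoothf U F -> smoothf U' F.
Proof. by move=> UU' [sF]; constructor; exact: smooth_sub sF. Qed.

Lemma sm_fst U : open U -> smoothf U (fun p : R * R => p.1).
Proof.
move=> oU; constructor.
have dE (k c : R) (a v : R * R) : is_derive a v (fun p : R * R => k * p.1 + c) (k * v.1).
  have D2 : is_derive a v (fun p : R * R => p.1) v.1.
    have := @is_derive_fstv R _ (fun p : R * R => p) a v v (is_derive_id a v); exact.
  apply: is_derive_eq (is_deriveD (is_deriveM (is_derive_cst k a v) D2) (is_derive_cst c a v)) _.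
  by rewrite /GRing.scale /=; ring.
apply: (@smooth_open_class R _ _ U [set f | exists k c : R, f = fun p => k * p.1 + c]) => //.
- move=> f [k [c ->]] a _.
  have H (t x : R) : {for (t, x), continuous (fun p : R * R => k * p.1 + c)}.
    apply: cvgD; last exact: cvg_cst.
    by apply: cvgM; [exact: cvg_cst|exact: cvg_fst].
  by case: a => t x; exact: H.
- move=> f v [k [c ->]]; exists (fun=> k * v.1); first by exists 0, (k * v.1); apply/funext => p; rewrite mul0r add0r.
  by move=> a _; exact: dE.
- by exists 1, 0; apply/funext => p; rewrite mul1r addr0.
Qed.

Lemma isd_sx U F t x : smoothf U F -> U (t, x) -> isd (fun y : R => F (t, y)) x (Dx F (t, x)).
Proof. by move=> sF Ut; apply/is_derive_snd; exact: sm_isd sF Ut. Qed.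

Lemma isd_st U F t x : smoothf U F -> U (t, x) -> isd (fun s : R => F (s, x)) t (Dt F (t, x)).
Proof. by move=> sF Ut; apply/is_derive_fst; exact: sm_isd sF Ut. Qed.

Lemma Dt_fst (p : R * R) : Dt (fun p => p.1) p = 1.
Proof.
by apply: (@derive_val _ _ _ _ _ _ _ _); case: p => t x; apply/is_derive_fst.
Qed.

Lemma xsmooth_slice U F (t : R) : open U -> smoothf U F -> (forall x, U (t, x)) ->
  xsmooth (fun _ : R => fun x => F (t, x)).
Proof.
move=> oU sF Ut n; elim: n F sF => [|n IH] F sF; split; try by [];
  try by apply: jc_snd => x; exact: isd_cont (isd_sx sF (Ut x)).
exists (fun _ x => Dx F (t, x)); first by move=> _ x; exact: isd_sx sF (Ut x).
by apply: IH; exact: sm_drv.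
Qed.

Lemma derive1_slice U F t x : smoothf U F -> U (t, x) ->
  derive1 (fun y => F (t, y)) x = Dx F (t, x).
Proof. by move=> sF Ut; rewrite derive1E; exact: (@derive_val _ _ _ _ _ _ _ (isd_sx sF Ut)). Qed.

End SmoothSlices.

(** * Uniform bounds along the flow and its restart *)

Section EquivariantFlow.
Context {R : realType} (N T : R) (U : set (R * R)) (u v : R * R -> R).
Context (N0 : 0 <= N) (T0 : 0 < T) (oU : open U) (suU : smoothf U u) (svU : smoothf U v).
Let n1 p := u p * u p + v p * v p.
Let n2 p := Dx u p * Dx u p + Dx v p * Dx v p.
Let q p := ((Dx u p * Dx (Dx v) p - Dx v p * Dx (Dx u) p) * (n2 p)^-1
   - N * ((Dx u p * v p - Dx v p * u p) * (n1 p)^-1)) * (n2 p)^-1.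
Context (UD : forall t x, 0 <= t < T -> U (t, x)).
Context (pu : forall t x, 0 <= t < T -> u (t, x + 2 * pi) = u (t, x)).
Context (pv : forall t x, 0 <= t < T -> v (t, x + 2 * pi) = v (t, x)).
Context (n10 : forall t x, 0 <= t < T -> n1 (t, x) != 0).
Context (n20 : forall t x, 0 <= t < T -> n2 (t, x) != 0).
Context (ut : forall t x, 0 < t < T -> Dt u (t, x) = - Dx v (t, x) * q (t, x)).
Context (vt : forall t x, 0 < t < T -> Dt v (t, x) = Dx u (t, x) * q (t, x)).

(** [W] is an open neighbourhood of [0, T) x R, initial time included, on which 1 / |z|^2 and 1 /
    |z_x| are smooth; [Om] is its part over 0 < t < T, where the evolution equation holds. *)
Let W1 := [set p | U p /\ 0 < n1 p].
Let W := [set p | W1 p /\ 0 < n2 p].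
Let Om := [set p : R * R | W p /\ 0 < p.1 < T].

Let sq_gt0 (x y : R) : x * x + y * y != 0 -> 0 < x * x + y * y.
Proof. by rewrite lt_neqAle eq_sym => -> /=; rewrite addr_ge0 // -expr2 sqr_ge0. Qed.

Let oW1 : open W1.
Proof. by apply: open_pos => //; apply: (smD oU); apply: (smM oU). Qed.

Let sX F : smoothf U F -> smoothf U (Dx F).
Proof. by move=> sF; exact: sm_drv. Qed.

Let W1U : W1 `<=` U. Proof. by move=> p []. Qed.
Let WU : W `<=` U. Proof. by move=> p [[]]. Qed.

Let oW : open W.
Proof.
apply: open_pos => //; apply: (smoothf_sub W1U).
by apply: (smD oU); apply: (smM oU) => //; exact: sX.
Qed.

Let oOm : open Om.
Proof.
have sf : smoothf W (fun p : R * R => p.1) by exact: sm_fst.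
have sg : smoothf [set p | W p /\ 0 < p.1] (fun p : R * R => T - p.1).
  have oW' := open_pos oW sf.
  by apply: smB => //; [exact: sm_cst|exact: sm_fst].
rewrite (_ : Om = [set p | [set p | W p /\ 0 < p.1] p /\ 0 < T - p.1]).
  by apply: open_pos sg; exact: open_pos sf.
apply/seteqP; split => p /=; rewrite subr_gt0.
  by move=> [Wp /andP[-> ->]].
by move=> [[Wp p0] pT]; split => //; rewrite p0 pT.
Qed.

Let OmW : Om `<=` W. Proof. by move=> p []. Qed.
Let WE t x : 0 <= t < T -> W (t, x).
Proof. by move=> tT; split; [split; [exact: UD|exact: sq_gt0 (n10 x tT)]|exact: sq_gt0 (n20 x tT)]. Qed.
Let OmE t x : 0 < t < T -> Om (t, x).
Proof. by move=> tT; split => //; apply: WE; case/andP: tT => /ltW -> ->. Qed.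

Let su : smoothf W u := smoothf_sub WU suU.
Let sv : smoothf W v := smoothf_sub WU svU.
Let sn1 : smoothf W n1. Proof. by apply: smD => //; apply: smM. Qed.
Let sn2 : smoothf W n2.
Proof. by apply: smD => //; apply: smM => //; exact: sm_drv. Qed.

Let e p := (Num.sqrt (n2 p))^-1.
Let se : smoothf W e.
Proof.
apply: smV => //; first by move=> p [_ p0]; rewrite gt_eqF // sqrtr_gt0.
by case: sn2 => s; constructor; apply: smooth_sqrt => // p [].
Qed.

Let e0 p : W p -> 0 < e p.
Proof. by move=> [_ p0]; rewrite invr_gt0 sqrtr_gt0. Qed.

Let e2 p : W p -> e p ^+ 2 * n2 p = 1.
Proof. by move=> [_ p0]; rewrite /e exprVn sqr_sqrtr ?(ltW p0) // mulVf // gt_eqF. Qed.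

Let ds F p := e p * Dx F p.
Let dx_der : derivation W Dx := @derivation_dir R W ((0, 1) : R * R).
Let dt_der : derivation W Dt := @derivation_dir R W ((1, 0) : R * R).
Let ds_der : derivation W ds := derivation_scale oW se dx_der.
Let la p := Dt e p / e p.

Let ds_swap F p : smoothf W F -> Om p -> Dt (ds F) p = ds (Dt F) p + la p * ds F p.
Proof.
move=> sF [Wp _]; rewrite /ds (drvM dt_der) //; last exact: sm_drv.
rewrite (schwarz oW) // /la; have := e0 Wp.
by move: (e p) (Dt e p) (Dx F p) => x y z x0; field; rewrite gt_eqF.
Qed.

Let a := ds u.
Let b := ds v.
Let k p := a p * ds b p - b p * ds a p.
Let sp p := u p * b p - v p * a p.
Let pp p := u p * a p + v p * b p.
Let qq p := (u p * u p + v p * v p)^-1.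
Let f p := k p + N * (sp p * qq p).

Let ab1 p : W p -> a p * a p + b p * b p = 1.
Proof. by move=> Wp; rewrite -(e2 Wp) /a /b /ds /n2; ring. Qed.

Let r0 p : W p -> u p * u p + v p * v p != 0.
Proof. by move=> [[_ p0] _]; rewrite gt_eqF. Qed.

Let f_q p : W p -> q p = e p * f p.
Proof.
move=> Wp; have E := e2 Wp; have [_ p2] := Wp.
have ka : k p = e p ^+ 3 * (Dx u p * Dx (Dx v) p - Dx v p * Dx (Dx u) p).
  rewrite /k /a /b /ds (drvM dx_der) ?(drvM dx_der) //; try exact: sm_drv.
  by move: (e p) (Dx e p) (Dx u p) (Dx v p) (Dx (Dx u) p) (Dx (Dx v) p) => *; ring.
rewrite /f ka /q -/(qq p) /sp /a /b /ds -[qq p]/((n1 p)^-1).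
have -> : (n2 p)^-1 = e p ^+ 2.
  by apply: (mulIf (_ : n2 p != 0)); rewrite ?gt_eqF // E mulVf // gt_eqF.
by move: (e p) (qq p) (u p) (v p) (Dx u p) (Dx v p) (Dx (Dx u) p) (Dx (Dx v) p) => *; ring.
Qed.

Let ut' p : Om p -> Dt u p = - (b p * f p).
Proof.
case: p => t x [Wp tT]; rewrite ut // f_q // /b /ds.
by ring.
Qed.

Let vt' p : Om p -> Dt v p = a p * f p.
Proof.
case: p => t x [Wp tT]; rewrite vt // f_q // /a /ds.
by ring.
Qed.

Let P : R := 2 * pi.
Let P0 : 0 < P. Proof. by rewrite mulr_gt0 // pi_gt0. Qed.
Local Notation per := (per T P).

Let per_dx F : smoothf W F -> per F -> per (Dx F).
Proof.
move=> sF pF t x tT.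
have D : isd (fun y : R => F (t, y + P)) x (Dx F (t, x + P)).
  by apply: (isd_translate (f := fun y => F (t, y))); apply: isd_sx sF _; exact: WE.
have D' : isd (fun y : R => F (t, y + P)) x (Dx F (t, x)).
  apply: (isd_ext (f := fun y => F (t, y))); first by move=> y; rewrite /= pF.
  by apply: isd_sx sF _; exact: WE.
exact: isd_uniq D D'.
Qed.

Let per_e : per e.
Proof.
have h1 := @per_dx u su pu; have h2 := @per_dx v sv pv.
by move=> t x tT; rewrite /e /n2 h1 // h2.
Qed.

Let per_ds F : smoothf W F -> per F -> per (ds F).
Proof. by move=> sF pF t x tT; rewrite /ds per_e // per_dx. Qed.

Let maxp F : smoothf W F -> per F -> (forall x, F (0, x) < 0) ->
  (forall t x, 0 < t < T -> F (t, x) = 0 -> ds F (t, x) = 0 -> ds (ds F) (t, x) <= 0 -> Dt F (t, x) < 0) ->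
  forall t x, 0 <= t < T -> F (t, x) < 0.
Proof.
move=> sF pF F0 H; apply: (@parabolic_barrier R T P (fun t x => F (t, x)) P0) => //.
- move=> t x tT; rewrite (_ : (fun p : R * R => F (p.1, p.2)) = F); last by apply/funext => -[].
  by case: sF => h; exact: smooth_cont h (WE x tT).
move=> t x tT Ft Fm; have tT' : 0 <= t < T by case/andP: tT => /ltW -> ->.
have Wt y : W (t, y) := WE y tT'.
have Fm' y : F (t, y) <= F (t, x) by rewrite Ft.
have [d1 d2] := @second_derivative_test R (fun y => F (t, y)) (fun y => Dx F (t, y)) (Dx (Dx F) (t, x)) x
  (fun y => isd_sx sF (Wt y)) (isd_sx (sm_drv _ sF) (Wt x)) Fm'.
exists (Dt F (t, x)); last exact: isd_st sF (Wt x).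
apply: H => //; first by rewrite /ds d1 mulr0.
rewrite /ds (drvM dx_der) //; last exact: sm_drv.
rewrite d1 mulr0 add0r mulrA -expr2.
by rewrite mulr_ge0_le0 // sqr_ge0.
Qed.

Let D0 : 0 <= (0 : R) < T. Proof. by rewrite lexx. Qed.

Let cont0 F : smoothf W F -> continuous (fun x => F (0, x)).
Proof. by move=> sF x; apply: isd_cont (isd_sx sF _); exact: WE. Qed.

Let bound0 F : smoothf W F -> per F -> exists C, forall x, `|F (0, x)| <= C.
Proof.
by move=> sF pF; apply: (periodic_bounded P0 (cont0 sF)) => x; exact: pF.
Qed.

Let min0 F : smoothf W F -> per F -> (forall x, 0 < F (0, x)) ->
  exists2 c : R, 0 < c & forall x, c <= F (0, x).
Proof.
move=> sF pF F0; have cF := cont0 sF.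
have [||C HC] := @periodic_bounded R (fun x => (F (0, x))^-1) P P0.
- by move=> x; apply: cvgV; [rewrite gt_eqF|exact: cF].
- by move=> x; rewrite pF.
have C0 : 0 < C by apply: lt_le_trans (HC 0); rewrite normr_gt0 gt_eqF // invr_gt0.
exists C^-1 => [|x]; first by rewrite invr_gt0.
rewrite -[leRHS]invrK lef_pV2 ?posrE ?invr_gt0 //.
by apply: le_trans (HC x); exact: ler_norm.
Qed.

Let ds_time (h : R -> R) p : ds (fun p => h p.1) p = 0.
Proof. by rewrite /ds Dx_time mulr0. Qed.

Lemma radius_decay M : (forall x, n1 (0, x) < M) -> forall t x, 0 <= t < T -> n1 (t, x) + t < M.
Proof.
move=> HM t x tT.
exact: (@r2_bound R W Om oW OmW N u v su sv ds Dt ds_der dt_der a b k sp pp qq f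
  erefl erefl erefl erefl erefl erefl erefl ab1 r0 ut' vt' T P N0 OmE maxp pu pv
  (sm_fst oW) ds_time Dt_fst M HM t x tT).
Qed.

Context (Q : R) (n1Q : forall t x, 0 <= t < T -> (n1 (t, x))^-1 <= Q).
Context (star : forall x, 0 < u (0, x) * Dx v (0, x) - v (0, x) * Dx u (0, x)).

Let bdd := bdd T.

Let pol_bdd : forall j F, pol ds a b sp pp qq f j F -> bdd F.
Proof.
have [M HM] : exists M, forall x, `|n1 (0, x)| <= M.
  by apply: bound0 => // t x tT; rewrite /n1 pu ?pv.
have M0 : 0 <= M by exact: le_trans (HM 0).
have HM' x : n1 (0, x) < M + 1 by have := ler_norm (n1 (0, x)); have := HM x; lra.
have HS t x : 0 <= t < T -> n1 (t, x) <= (Num.sqrt (M + 1)) ^+ 2.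
  move=> tT; rewrite sqr_sqrtr ?addr_ge0 //; have := radius_decay HM' x tT.
  by case/andP: tT => h _; lra.
have S0 : 0 < Num.sqrt (M + 1) by rewrite sqrtr_gt0 ltr_wpDl.
have sp0 x : 0 < sp (0, x).
  have -> : sp (0, x) = e (0, x) * (u (0, x) * Dx v (0, x) - v (0, x) * Dx u (0, x)).
    by rewrite /sp /a /b /ds; ring.
  by rewrite mulr_gt0 // e0 //; exact: WE.
have [be be0 Hbe] := @s_lower_bound R W Om oW oOm OmW N u v su sv ds Dt ds_der dt_der a b k sp pp qq f la
  erefl erefl erefl erefl erefl erefl erefl ds_swap ab1 r0 ut' vt' T P N0 OmE WE maxp min0 per_ds pu pv
  ds_time (smooth_exp_time oW) Dt_exp_time T0 Q n1Q sp0.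
have be2 : 0 < be / 2 by rewrite divr_gt0.
have Hbe2 t x : 0 <= t < T -> 2 * (be / 2) <= sp (t, x).
  by move=> tT; rewrite mulrCA divff ?mulr1 //; exact: Hbe.
move=> j F pF.
exact: (@pol_bounded R W Om oW oOm OmW N u v su sv ds Dt ds_der dt_der a b k sp pp qq f la
  erefl erefl erefl erefl erefl erefl erefl ds_swap ab1 r0 ut' vt' T P N0 OmE WE maxp bound0 per_ds pu pv
  ds_time (smooth_exp_time oW) Dt_exp_time T0 Q n1Q _ HS S0 _ be2 Hbe2 j F pF).
Qed.

(** The inverse speed satisfies e_t = k f e with k f bounded, so that e exp(C t) is nondecreasing:
    the speed grows at most exponentially. *)
Let e_bound : exists C, forall t x, 0 <= t < T -> (e (t, x))^-1 <= C.
Proof.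
have laE p : Om p -> la p = k p * f p.
  exact: (@la_E R W Om oW oOm OmW N u v su sv ds Dt ds_der dt_der a b k sp qq f la
  erefl erefl erefl erefl erefl erefl ds_swap ab1 r0 ut' vt' p).
have [C HC] : bdd (fun p => k p * f p).
  by apply: (@pol_bdd 0); apply: pol_mul; [exact: pol_k|exact: (@pol_g R ds a b sp pp qq f 0 0 (leqnn 0))].
have C0 : 0 <= C by exact: le_trans (HC 0 0 D0).
have [c c0 Hc] := min0 se per_e (fun x => e0 (WE x D0)).
exists (expR (C * T) / c) => t x tT; have Wt := WE x tT.
have [t0 tT'] := andP tT.
have D s : 0 <= s <= t -> isd (fun s : R => e (s, x) * expR (C * s)) s
    (Dt e (s, x) * expR (C * s) + e (s, x) * (C * expR (C * s))).
  move=> /andP[s0 st]; have Ws : W (s, x) by apply: WE; rewrite s0 (le_lt_trans st).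
  have Dl : isd (fun t : R => C * t) s C.
    by apply: isd_eq (is_deriveM (is_derive_cst C s 1) (is_derive_id s 1)) _; rewrite /GRing.scale /=; ring.
  apply: isd_eq (is_deriveM (isd_st se Ws) (isd_chain (is_derive_expR _) Dl)) _.
  by rewrite /GRing.scale /=; ring.
have := @nondecr_on R _ _ 0 t t0 D.
rewrite mulr0 expR0 mulr1 => H.
have {H} : e (0, x) <= e (t, x) * expR (C * t).
  apply: H => s /andP[s0 st]; have sT : 0 < s < T by rewrite s0 (lt_trans st).
  have Os := OmE x sT; have Es := e0 (OmW Os).
  have -> : Dt e (s, x) = k (s, x) * f (s, x) * e (s, x) by rewrite -laE // /la divfK // gt_eqF.
  have sT' : 0 <= s < T by rewrite ltW //; case/andP: sT.
  have := HC s x sT'; rewrite ler_norml => /andP[h _].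
  have -> : k (s, x) * f (s, x) * e (s, x) * expR (C * s) + e (s, x) * (C * expR (C * s)) =
    (k (s, x) * f (s, x) + C) * (e (s, x) * expR (C * s)) by ring.
  by rewrite mulr_ge0 //; [lra|rewrite mulr_ge0 ?expR_ge0 // ltW].
move=> h; have := Hc x => h'.
have et := e0 Wt.
rewrite -(ler_pM2l et) mulfV ?gt_eqF // mulrA ler_pdivlMr // mul1r.
apply: le_trans (le_trans h' h) _.
by rewrite ler_wpM2l ?(ltW et) // ler_expR ler_wpM2l // ltW.
Qed.

Let pol_iter i F : pol ds a b sp pp qq f 0 F -> exists2 G, pol ds a b sp pp qq f i G &
  forall p, W p -> iter i ds F p = G p.
Proof.
move=> pF; elim: i => [|i [G pG EG]]; first by exists F.
have [G' pG' EG'] := @pol_ds R W oW N u v su sv ds ds_der a b k sp pp qq f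
  erefl erefl erefl erefl erefl erefl erefl ab1 r0 i G pG.
by exists G' => // p Wp; rewrite iterS (drv_eq ds_der oW EG Wp) EG'.
Qed.

Let Ds_slice t i F : 0 <= t < T -> smoothf W F -> forall x,
  iter i (Ds (fun x => e (t, x))) (fun x => F (t, x)) x = iter i ds F (t, x).
Proof.
move=> tT sF; have sI j : smoothf W (iter j ds F) by elim: j => [//|j IH]; exact: (drv_sm ds_der).
elim: i => [//|i IH] x; rewrite !iterS /Ds.
have -> : iter i (Ds (fun x => e (t, x))) (fun x => F (t, x)) = (fun x => iter i ds F (t, x)).
  by apply/funext => y; exact: IH.
by rewrite (derive1_slice (sI i)) //; exact: WE.
Qed.

Lemma flow_restart : exists2 B, 1 <= B & forall t, 0 <= t < T -> exists U V, [/\ xsmooth U /\ xsmooth V,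
    forall s x, U s (x + 2 * pi) = U s x /\ V s (x + 2 * pi) = V s x,
    forall x, U 0 x = u (t, x) /\ V 0 x = v (t, x),
    forall s x, U s x * U s x + V s x * V s x != 0 /\
       dx U s x * dx U s x + dx V s x * dx V s x != 0 &
    forall s x, 0 < s < existence_time N B ->
      isd (U ^~ x) s (- dx V s x * nflow N U V s x) /\
      isd (V ^~ x) s (dx U s x * nflow N U V s x)].
Proof.
(* Position as a differential polynomial: z is recovered from its components in the Frenet frame,
   hence is bounded with them. *)
have uE p : W p -> u p = pp p * a p + sp p * b p.
  by move=> Wp; rewrite -[LHS]mulr1 -(ab1 Wp) /pp /sp; ring.
have vE p : W p -> v p = pp p * b p - sp p * a p.
  by move=> Wp; rewrite -[LHS]mulr1 -(ab1 Wp) /pp /sp; ring.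
have pa j : pol ds a b sp pp qq f j a by exact: pol_a.
have pb j : pol ds a b sp pp qq f j b by exact: pol_b.
have ps j : pol ds a b sp pp qq f j sp by exact: pol_s.
have p_ j : pol ds a b sp pp qq f j pp by exact: pol_p.
have pq j : pol ds a b sp pp qq f j qq by exact: pol_q.
have pos j F : pol ds a b sp pp qq f j F -> exists2 C : R, 0 <= C & forall t x, 0 <= t < T -> `|F (t, x)| <= C.
  by move=> /pol_bdd[C HC]; exists C => //; exact: le_trans (HC 0 0 D0).
have [Cu Cu0 HCu] := pos 0%N _ (pol_add (pol_mul (p_ _) (pa _)) (pol_mul (ps _) (pb _))).
have [Cv Cv0 HCv] := pos 0%N _ (pol_add (pol_mul (p_ _) (pb _)) (pol_opp (pol_mul (ps _) (pa _)))).
have [Cq Cq0 HCq] := pos 0%N _ (pq _).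
have [Ce HCe] := e_bound.
(* Since a and b are first derivatives, four more give the fifth ones of u and v; for 1 / |z|^2
   three suffice. *)
have [Gu pGu EGu] := pol_iter 4 (pa 0%N); have [C5 C50 HC5] := pos _ _ pGu.
have [Gv pGv EGv] := pol_iter 4 (pb 0%N); have [C6 C60 HC6] := pos _ _ pGv.
have [Gq pGq EGq] := pol_iter 3 (pq 0%N); have [C7 C70 HC7] := pos _ _ pGq.
have Ce0 : 0 <= Ce.
  by apply: le_trans (HCe 0 0 D0); rewrite invr_ge0 ltW // e0 //; exact: WE.
pose B := 1 + (Cu + Cv + Cq + Ce + C5 + C6 + C7).
have B1 : 1 <= B by rewrite /B lerDl !addr_ge0.
exists B => // t tT; have Wt x : W (t, x) := WE x tT.
have sq : smoothf W qq by apply: smV => //.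
apply: (@short_time_existence R N B (fun x => u (t, x)) (fun x => v (t, x)) (fun x => qq (t, x)) (fun x => e (t, x))) => //.
- exact: (xsmooth_slice oW su Wt).
- exact: (xsmooth_slice oW sv Wt).
- exact: (xsmooth_slice oW sq Wt).
- exact: (xsmooth_slice oW se Wt).
- by move=> x; rewrite pu // pv // per_e // /qq pu // pv.
- by move=> x; exact: e0.
- by move=> x; rewrite (derive1_slice su) ?(derive1_slice sv) // !expr2 -expr2; exact: e2.
- by move=> x; rewrite /qq !expr2 mulVf // r0.
- move=> x; have := HCu t x tT; have := HCv t x tT; have := HCq t x tT; have := HCe t x tT.
  rewrite -uE // -vE // => h1 h2 h3 h4.
  by split; rewrite /B; lra.
- move=> x; rewrite !Ds_slice //.
  rewrite (iterSr 4 ds u) -/a (iterSr 4 ds v) -/b EGu // EGv // EGq //.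
  have := HC5 t x tT; have := HC6 t x tT; have := HC7 t x tT => h1 h2 h3.
  by split; rewrite /B; lra.
Qed.

End EquivariantFlow.

(** * The flow of profile curves *)

Section Velocity.
Context {R : realType}.

(** Derivative within D in little-o form; with D the time interval it is one-sided at t = 0, as in
    the definition of the flow. *)
Definition isd_in (D : set R) (f : R -> R) (t d : R) :=
  forall e : R, 0 < e -> exists2 r : R, 0 < r & forall s, `|s - t| < r -> D s ->
    `|f s - f t - d * (s - t)| <= e * `|s - t|.

Lemma isd_in_isd D f (t d r : R) : 0 < r -> (forall s, `|s - t| < r -> D s) ->
  isd_in D f t d -> isd f t d.
Proof.
move=> r0 HD H; apply/isdP => e e0; have [r' r'0 Hr'] := H e e0.
exists (Num.min r r') => [|s]; first by rewrite lt_min r0.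
by rewrite lt_min => /andP[h1 h2]; apply: Hr' => //; exact: HD.
Qed.

Lemma isd_isd_in D f (t d : R) : isd f t d -> isd_in D f t d.
Proof.
move=> /isdP H e e0; have [r r0 Hr] := H e e0.
by exists r => // s hs _; exact: Hr.
Qed.

Lemma isd_in_near D D' f g (t d r : R) : 0 < r -> D t ->
  (forall s, `|s - t| < r -> D' s -> D s) -> (forall s, D s -> `|s - t| < r -> g s = f s) ->
  isd_in D f t d -> isd_in D' g t d.
Proof.
move=> r0 Dt HD E H e e0; have [r' r'0 Hr'] := H e e0.
exists (Num.min r r') => [|s]; first by rewrite lt_min r0.
rewrite lt_min => /andP[h1 h2] Ds; have Ds' := HD s h1 Ds.
by rewrite !E ?subrr ?normr0 //; exact: Hr'.
Qed.

Lemma cvg_isd_in (D : set R) f (t d : R) :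
  (s - t)^-1 * (f s - f t) @[s --> within D (t^')] --> d -> isd_in D f t d.
Proof.
move=> /cvgrPdist_le H e e0; have := H e e0.
rewrite near_withinE near_withinE => /nbhs_ballP[r r0 Hr]; exists r => // s hs Ds.
have [->|st] := eqVneq s t; first by rewrite !subrr mulr0 subrr normr0 mulr0.
have {Hr} := Hr s; rewrite /ball /= distrC => /(_ hs st Ds) h.
have st0 : s - t != 0 by rewrite subr_eq0.
have -> : f s - f t - d * (s - t) = ((s - t)^-1 * (f s - f t) - d) * (s - t).
  by rewrite mulrBl mulrAC mulVf // mul1r.
by rewrite normrM ler_wpM2r // distrC.
Qed.

Lemma isd_in_cvg (D : set R) f (t d : R) : isd_in D f t d ->
  (s - t)^-1 * (f s - f t) @[s --> within D (t^')] --> d.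
Proof.
move=> H; apply/cvgrPdist_le => e e0; rewrite near_withinE near_withinE; have [r r0 Hr] := H e e0.
apply/nbhs_ballP; exists r => // s; rewrite /ball /= distrC => hs st Ds.
have st0 : s - t != 0 by rewrite subr_eq0.
rewrite distrC -(@ler_pM2r _ `|s - t|) ?normr_gt0 // -normrM mulrBl mulrAC mulVf // mul1r.
exact: Hr.
Qed.

Context {n : nat}.

Lemma isd_in_tens (D : set R) (c : R -> R * R) (t : R) (d : R * R) (x : 'rV[R]_n) :
  isd_in D (fun s => (c s).1) t d.1 -> isd_in D (fun s => (c s).2) t d.2 ->
  (s - t)^-1 *: (tens (c s) x - tens (c t) x) @[s --> within D (t^')] --> tens d x.
Proof.
move=> /isd_in_cvg h1 /isd_in_cvg h2.
rewrite (_ : (fun s => _) = (fun s => (((s - t)^-1 * ((c s).1 - (c t).1)) *: x,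
                                     ((s - t)^-1 * ((c s).2 - (c t).2)) *: x))); last first.
  apply/funext => s; rewrite /tens -!scalerA !scalerBl.
  by [].
have g1 : ((s - t)^-1 * ((c s).1 - (c t).1)) *: x @[s --> within D (t^')] --> d.1 *: x.
  exact: cvgZr_tmp.
have g2 : ((s - t)^-1 * ((c s).2 - (c t).2)) *: x @[s --> within D (t^')] --> d.2 *: x.
  exact: cvgZr_tmp.
exact: (cvg_pair g1 g2).
Qed.

Lemma tens_isd_in (D : set R) (c : R -> R * R) (t : R) (d : R * R) (i0 : 'I_n) :
  (s - t)^-1 *: (tens (c s) (delta_mx 0 i0) - tens (c t) (delta_mx 0 i0)) @[s --> within D (t^')]
    --> tens d (delta_mx 0 i0) ->
  isd_in D (fun s => (c s).1) t d.1 /\ isd_in D (fun s => (c s).2) t d.2.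
Proof.
move=> H; split; apply: cvg_isd_in.
- have C : {for tens d (delta_mx 0 i0), continuous (fun p : 'rV[R]_n * 'rV[R]_n => p.1 0 i0)}.
    by apply: (@continuous_comp _ _ _ fst (fun y : 'rV[R]_n => y 0 i0)); [exact: cvg_fst|exact: coord_continuous].
  have := cvg_comp _ _ H C; rewrite /= !mxE !eqxx /= mulr1; apply: cvg_trans.
  by apply: near_eq_cvg; near=> s; rewrite /= !mxE !eqxx /= !mulr1.
- have C : {for tens d (delta_mx 0 i0), continuous (fun p : 'rV[R]_n * 'rV[R]_n => p.2 0 i0)}.
    by apply: (@continuous_comp _ _ _ snd (fun y : 'rV[R]_n => y 0 i0)); [exact: cvg_snd|exact: coord_continuous].
  have := cvg_comp _ _ H C; rewrite /= !mxE !eqxx /= mulr1; apply: cvg_trans.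
  by apply: near_eq_cvg; near=> s; rewrite /= !mxE !eqxx /= !mulr1.
Unshelve. all: by end_near.
Qed.

(** The formula of [nflow] evaluated on the 2-jet of a curve. It equals f / |z'|, so that its
    product with J z' is the velocity - f nu. *)
Definition speed (N : R) (c c1 c2 : R * R) : R :=
  ((c1.1 * c2.2 - c1.2 * c2.1) * (c1.1 * c1.1 + c1.2 * c1.2)^-1
   - N * ((c1.1 * c.2 - c1.2 * c.1) * (c.1 * c.1 + c.2 * c.2)^-1)) * (c1.1 * c1.1 + c1.2 * c1.2)^-1.

Lemma mean_curvature_speed (c c1 c2 : R -> R * R) phi (x : 'rV[R]_n) e :
  (forall t : R, isd (fun t => (c t).1) t (c1 t).1) -> (forall t : R, isd (fun t => (c t).2) t (c1 t).2) ->
  (forall t : R, isd (fun t => (c1 t).1) t (c2 t).1) -> (forall t : R, isd (fun t => (c1 t).2) t (c2 t).2) ->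
  dotv x x = 1 -> orthonormal_frame (equivariant_map c) phi x e ->
  0 < dot2 (c phi) (c phi) -> 0 < dot2 (c1 phi) (c1 phi) ->
  mean_curvature_vector (equivariant_map c) phi x e =
  tens (- (c1 phi).2 * speed (n%:R - 1) (c phi) (c1 phi) (c2 phi),
        (c1 phi).1 * speed (n%:R - 1) (c phi) (c1 phi) (c2 phi)) x.
Proof.
move=> D1 D2 D3 D4 x1 He rr ss; rewrite (mean_curvature_equivariant D1 D2 D3 D4 x1 He rr ss).
congr (tens _ x); move: rr ss; rewrite /speed /dot2.
move: (c phi) (c1 phi) (c2 phi) => [a b] [a1 b1] [a2 b2] /= rr ss.
by congr (_, _) => /=; rewrite /GRing.scale /=; field; rewrite !gt_eqF.
Qed.

End Velocity.

(** * Concatenation of two solutions at a restart time *)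

Section Concatenation.
Context {R : realType} (t0 : R) (U0 : set (R * R)) (t00 : 0 < t0) (oU : open U0).
Context (UD : forall t x, 0 <= t <= t0 -> U0 (t, x)).

Let cl t : R := Num.max 0 (Num.min t t0).
Let sh t : R := Num.max t t0 - t0.

Let clP t : 0 <= cl t <= t0.
Proof. by rewrite /cl le_max lexx /= ge_max ge_min lexx orbT (ltW t00). Qed.

Let cont_cl : continuous cl.
Proof.
move=> t; apply: (@continuous_max _ _ (fun=> 0) (fun t => Num.min t t0)); first exact: cvg_cst.
by apply: (@continuous_min _ _ id (fun=> t0)); [exact: cvg_id|exact: cvg_cst].
Qed.

Let cont_sh : continuous sh.
Proof.
move=> t; apply: cvgB; last exact: cvg_cst.
by apply: (@continuous_max _ _ id (fun=> t0)); [exact: cvg_id|exact: cvg_cst].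
Qed.

Let cl_lo t : 0 <= t <= t0 -> cl t = t.
Proof. by move=> /andP[h1 h2]; rewrite /cl min_l // max_r. Qed.

Let cl_hi t : t0 <= t -> cl t = t0.
Proof. by move=> h; rewrite /cl min_r // max_r // ltW. Qed.

Let sh_lo t : t <= t0 -> sh t = 0.
Proof. by move=> h; rewrite /sh max_r // subrr. Qed.

Let sh_hi t : t0 <= t -> sh t = t - t0.
Proof. by move=> h; rewrite /sh max_l. Qed.

Let xsmooth_cl F : smoothf U0 F -> xsmooth (fun t x => F (cl t, x)).
Proof.
have J F' : smoothf U0 F' -> jcont (fun t x => F' (cl t, x)).
  move=> [s] [t x]; apply: (@continuous_comp _ _ _ (fun p : R * R => (cl p.1, p.2)) F'); last first.
    by apply: smooth_cont s _; exact: UD (clP _).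
  have c1 : {for (t, x), continuous (fun p : R * R => cl p.1)}  := @jc_fst R cl (@cont_cl) (t, x).
  have c2 : (p : R * R).2 @[p --> (t, x)] --> x by exact: cvg_snd.
  exact: (cvg_pair c1 c2).
move=> sF n; elim: n F sF => [|n IH] F sF; first by split => //; exact: J.
split; first exact: J.
exists (fun t x => Dx F (cl t, x)); first by move=> t x; apply: isd_sx sF _; exact: UD (clP _).
by apply: IH; exact: sm_drv.
Qed.

(** With the two clocks the concatenation is the sum F(cl t) + G(sh t) - F(t0): at each time at most
    one of the first two terms moves. No cases are needed to see that all spatial derivatives are
    jointly continuous. *)
Lemma concatenation F (G : R -> R -> R) : smoothf U0 F -> xsmooth G ->
  (forall x, G 0 x = F (t0, x)) -> exists Z : R -> R -> R, [/\ xsmooth Z,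
    forall t, 0 <= t <= t0 -> Z t = (fun x => F (t, x)),
    forall t, t0 <= t -> Z t = G (t - t0) & forall t, t <= 0 -> Z t = (fun x => F (0, x))].
Proof.
move=> sF xG G0; exists (fun t x => F (cl t, x) + G (sh t) x - F (t0, x)); split.
- move=> n; apply: csmD; first apply: csmD.
  + exact: xsmooth_cl.
  + by apply: csm_time => //; exact: xG.
  + apply: csmN; apply: (@csm_ext _ n (fun t x => F (cl ((fun=> t0) t), x))) => [t x|].
      by rewrite cl_hi.
    apply: (@csm_time _ n (fun t x => F (cl t, x)) (fun=> t0)) => [t|]; first exact: cvg_cst.
    exact: xsmooth_cl.
- move=> t tt; apply/funext => x; rewrite cl_lo // sh_lo ?G0 ?addrK //.
  by case/andP: tt.
- by move=> t tt; apply/funext => x; rewrite cl_hi // sh_hi // addrC addKr.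
- move=> t tt; apply/funext => x; have tt0 : t <= t0 by exact: le_trans tt (ltW t00).
  by rewrite sh_lo // G0 addrK /cl min_l // max_l.
Qed.

End Concatenation.

Lemma dx_slice {R : realType} (U : set (R * R)) (F : R * R -> R) (Z : R -> R -> R) (t x : R) :
  smoothf U F -> (forall x, U (t, x)) -> Z t = (fun x => F (t, x)) ->
  dx Z t x = Dx F (t, x) /\ dx (dx Z) t x = Dx (Dx F) (t, x).
Proof.
move=> sF Ut ZE; have E : dx Z t = (fun x => Dx F (t, x)).
  by apply/funext => y; rewrite /dx ZE (derive1_slice sF).
split; first by rewrite E.
by rewrite {1}/dx E (derive1_slice (sm_drv _ sF)).
Qed.

Section Glue.
Context {R : realType} (N t0 eps : R) (U0 : set (R * R)) (u v : R * R -> R).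
Context (t00 : 0 < t0) (eps0 : 0 < eps) (oU : open U0) (su : smoothf U0 u) (sv : smoothf U0 v).
Context (UD : forall t x, 0 <= t <= t0 -> U0 (t, x)).
Context (per : forall t x, 0 <= t <= t0 -> u (t, x + 2 * pi) = u (t, x) /\ v (t, x + 2 * pi) = v (t, x)).
Context (n10 : forall t x, 0 <= t <= t0 -> u (t, x) * u (t, x) + v (t, x) * v (t, x) != 0).
Context (n20 : forall t x, 0 <= t <= t0 -> Dx u (t, x) * Dx u (t, x) + Dx v (t, x) * Dx v (t, x) != 0).
Let sp p := speed N (u p, v p) (Dx u p, Dx v p) (Dx (Dx u) p, Dx (Dx v) p).
Context (ut : forall t x, 0 < t < t0 -> Dt u (t, x) = - Dx v (t, x) * sp (t, x)).
Context (vt : forall t x, 0 < t < t0 -> Dt v (t, x) = Dx u (t, x) * sp (t, x)).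
Context (X Y : R -> R -> R).
Context (perX : forall s x, X s (x + 2 * pi) = X s x /\ Y s (x + 2 * pi) = Y s x).
Context (m0 : forall s x, X s x * X s x + Y s x * Y s x != 0 /\
  dx X s x * dx X s x + dx Y s x * dx Y s x != 0).
Context (XYt : forall s x, 0 < s < eps ->
  isd (X ^~ x) s (- dx Y s x * nflow N X Y s x) /\ isd (Y ^~ x) s (dx X s x * nflow N X Y s x)).
Context (Z1 Z2 : R -> R -> R) (xZ1 : xsmooth Z1) (xZ2 : xsmooth Z2).
Context (Z1lo : forall t, 0 <= t <= t0 -> Z1 t = (fun x => u (t, x))).
Context (Z2lo : forall t, 0 <= t <= t0 -> Z2 t = (fun x => v (t, x))).
Context (Z1hi : forall t, t0 <= t -> Z1 t = X (t - t0)) (Z2hi : forall t, t0 <= t -> Z2 t = Y (t - t0)).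
Context (Z1neg : forall t, t <= 0 -> Z1 t = (fun x => u (0, x))).
Context (Z2neg : forall t, t <= 0 -> Z2 t = (fun x => v (0, x))).

Let dx_lo F Z t x : smoothf U0 F -> (forall t, 0 <= t <= t0 -> Z t = (fun x => F (t, x))) -> 0 <= t <= t0 ->
  dx Z t x = Dx F (t, x) /\ dx (dx Z) t x = Dx (Dx F) (t, x).
Proof.
by move=> sF ZE tt; apply: dx_slice sF _ (ZE t tt) => y; exact: UD.
Qed.

Let dx_hi Z (G : R -> R -> R) t x : (forall t, t0 <= t -> Z t = G (t - t0)) -> t0 <= t ->
  dx Z t x = dx G (t - t0) x /\ dx (dx Z) t x = dx (dx G) (t - t0) x.
Proof.
move=> ZE tt; have E : dx Z t = dx G (t - t0).
  by apply/funext => y; rewrite /dx ZE.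
by split; [rewrite E|rewrite {1}/dx E].
Qed.

(** Negative times reduce to time 0: the bootstrap asks for nondegeneracy at all times, and the
    concatenation is constant before 0. *)
Let lohi t : (exists2 s, 0 <= s <= t0 & Z1 t = Z1 s /\ Z2 t = Z2 s) \/ t0 <= t.
Proof.
have [h|h] := leP t0 t; [by right|left].
have [tn|tp] := leP t 0; last by exists t => //; rewrite !ltW.
have z0 : 0 <= (0 : R) <= t0 by rewrite lexx ltW.
by exists 0 => //; rewrite Z1neg ?Z2neg // Z1lo // Z2lo.
Qed.

Let m1 t x : Z1 t x * Z1 t x + Z2 t x * Z2 t x != 0.
Proof.
have [[s ss [-> ->]]|h] := lohi t; first by rewrite Z1lo // Z2lo //; exact: n10.
by rewrite Z1hi // Z2hi //; case: (m0 (t - t0) x).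
Qed.

Let m2 t x : dx Z1 t x * dx Z1 t x + dx Z2 t x * dx Z2 t x != 0.
Proof.
have [[s ss [E1 E2]]|h] := lohi t.
  have -> : dx Z1 t x = dx Z1 s x by rewrite /dx E1.
  have -> : dx Z2 t x = dx Z2 s x by rewrite /dx E2.
  have [-> _] := dx_lo x su Z1lo ss; have [-> _] := dx_lo x sv Z2lo ss; exact: n20.
have [-> _] := dx_hi x Z1hi h; have [-> _] := dx_hi x Z2hi h.
by case: (m0 (t - t0) x).
Qed.

Let perZ t x : Z1 t (x + 2 * pi) = Z1 t x /\ Z2 t (x + 2 * pi) = Z2 t x.
Proof.
have [[s ss [-> ->]]|h] := lohi t.
  by rewrite !Z1lo ?Z2lo //; exact: per.
by rewrite !Z1hi ?Z2hi //; exact: perX.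
Qed.

Let speed_eq (M a b a1 b1 a2 b2 a' b' a1' b1' a2' b2' : R) :
  a = a' -> b = b' -> a1 = a1' -> b1 = b1' -> a2 = a2' -> b2 = b2' ->
  speed M (a, b) (a1, b1) (a2, b2) = speed M (a', b') (a1', b1') (a2', b2').
Proof. by move=> -> -> -> -> -> ->. Qed.

Let mulN_eq (a b a' b' : R) : a = a' -> b = b' -> - a * b = - a' * b'.
Proof. by move=> -> ->. Qed.

Let mul_eq (a b a' b' : R) : a = a' -> b = b' -> a * b = a' * b'.
Proof. by move=> -> ->. Qed.

Let dr_u k := dr_u Z1 Z2 k.
Let dr_v k := dr_v Z1 Z2 k.

Let dr_nflow : diff_rat Z1 Z2 (nflow N Z1 Z2).
Proof.
have u0 : diff_rat Z1 Z2 Z1 := dr_u 0; have u1 : diff_rat Z1 Z2 (dx Z1) := dr_u 1; have u2 := dr_u 2; have v0 : diff_rat Z1 Z2 Z2 := dr_v 0; have v1 : diff_rat Z1 Z2 (dx Z2) := dr_v 1; have v2 := dr_v 2.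
have opp (f : R -> R -> R) : diff_rat Z1 Z2 f -> diff_rat Z1 Z2 (fun t x => - f t x).
  move=> rf; apply: (dr_ext (f := fun t x => -1 * f t x)) => [t x|]; first by rewrite mulN1r.
  exact: (dr_mul (dr_cst _ _ (-1)) rf).
apply: dr_mul; last exact: dr_inv2.
apply: dr_add.
  apply: dr_mul; last exact: dr_inv2.
  by apply: dr_add; [exact: (dr_mul u1 v2)|apply: opp; exact: (dr_mul v1 u2)].
apply: opp; apply: dr_mul; first exact: dr_cst.
apply: dr_mul; last exact: dr_inv1.
apply: (dr_ext (f := fun t x => dx Z1 t x * Z2 t x + -1 * (dx Z2 t x * Z1 t x))) => [t x|].
  by rewrite mulN1r.
exact: (dr_add (dr_mul u1 v0) (dr_mul (dr_cst _ _ (-1)) (dr_mul v1 u0))).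
Qed.

Let E1 t x := - dx Z2 t x * nflow N Z1 Z2 t x.
Let E2 t x := dx Z1 t x * nflow N Z1 Z2 t x.

Let dr_E1 : diff_rat Z1 Z2 E1.
Proof.
apply: dr_mul; last exact: dr_nflow.
apply: (dr_ext (f := fun t x => -1 * dx Z2 t x)) => [t x|]; first by rewrite mulN1r.
exact: (dr_mul (dr_cst _ _ (-1)) (dr_v 1)).
Qed.

Let dr_E2 : diff_rat Z1 Z2 E2.
Proof. exact: (dr_mul (dr_u 1) dr_nflow). Qed.

Let nflow_lo t x : 0 <= t <= t0 -> nflow N Z1 Z2 t x = sp (t, x).
Proof.
move=> tt; have [a1 a2] := dx_lo x su Z1lo tt; have [b1 b2] := dx_lo x sv Z2lo tt.
rewrite -[LHS]/(speed N (Z1 t x, Z2 t x) (dx Z1 t x, dx Z2 t x) (dx (dx Z1) t x, dx (dx Z2) t x)).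
have e1 : Z1 t x = u (t, x) by rewrite Z1lo.
have e2 : Z2 t x = v (t, x) by rewrite Z2lo.
exact: (speed_eq N e1 e2 a1 b1 a2 b2).
Qed.

Let nflow_hi t x : t0 <= t -> nflow N Z1 Z2 t x = nflow N X Y (t - t0) x.
Proof.
move=> tt; have [a1 a2] := dx_hi x Z1hi tt; have [b1 b2] := dx_hi x Z2hi tt.
rewrite -[LHS]/(speed N (Z1 t x, Z2 t x) (dx Z1 t x, dx Z2 t x) (dx (dx Z1) t x, dx (dx Z2) t x)).
rewrite -[RHS]/(speed N (X (t - t0) x, Y (t - t0) x) (dx X (t - t0) x, dx Y (t - t0) x)
  (dx (dx X) (t - t0) x, dx (dx Y) (t - t0) x)).
have e1 : Z1 t x = X (t - t0) x by rewrite Z1hi.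
have e2 : Z2 t x = Y (t - t0) x by rewrite Z2hi.
exact: (speed_eq N e1 e2 a1 b1 a2 b2).
Qed.

Let isd_off t x : 0 < t < t0 + eps -> t != t0 -> isd (Z1 ^~ x) t (E1 t x) /\ isd (Z2 ^~ x) t (E2 t x).
Proof.
move=> /andP[tp te]; rewrite neq_lt => /orP[h|h].
  have tt : 0 <= t <= t0 by rewrite !ltW.
  have tt' : 0 < t < t0 by rewrite tp h.
  have Ut := UD x tt.
  have [a1 a2] := dx_lo x su Z1lo tt; have [b1 b2] := dx_lo x sv Z2lo tt.
  have lo s : 0 < s < t0 -> 0 <= s <= t0 by move=> /andP[/ltW -> /ltW ->].
  split.
  - have E : Dt u (t, x) = E1 t x.
      by rewrite (ut x tt') /E1; exact: (mulN_eq (esym b1) (esym (nflow_lo x tt))).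
    rewrite -E.
    by apply: (near_oo_isd (f := fun s => u (s, x)) _ tt') (isd_st su Ut) => s /lo ss; rewrite Z1lo.
  - have E : Dt v (t, x) = E2 t x.
      by rewrite (vt x tt') /E2; exact: (mul_eq (esym a1) (esym (nflow_lo x tt))).
    rewrite -E.
    by apply: (near_oo_isd (f := fun s => v (s, x)) _ tt') (isd_st sv Ut) => s /lo ss; rewrite Z2lo.
have tt : t0 <= t by exact: ltW.
have ts : 0 < t - t0 < eps by rewrite subr_gt0 h ltrBlDl.
have tt' : t0 < t < t0 + eps by rewrite h.
have [a1 a2] := dx_hi x Z1hi tt; have [b1 b2] := dx_hi x Z2hi tt.
have [d1 d2] := XYt x ts; split.
- have E : - dx Y (t - t0) x * nflow N X Y (t - t0) x = E1 t x.
    by rewrite /E1; exact: (mulN_eq (esym b1) (esym (nflow_hi x tt))).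
  rewrite -E.
  apply: (near_oo_isd (f := fun s => X (s - t0) x) _ tt') (isd_translate (f := X ^~ x) d1) => s /andP[/ltW ss _].
  by rewrite Z1hi.
- have E : dx X (t - t0) x * nflow N X Y (t - t0) x = E2 t x.
    by rewrite /E2; exact: (mul_eq (esym a1) (esym (nflow_hi x tt))).
  rewrite -E.
  apply: (near_oo_isd (f := fun s => Y (s - t0) x) _ tt') (isd_translate (f := Y ^~ x) d2) => s /andP[/ltW ss _].
  by rewrite Z2hi.
Qed.

(** At the junction the right-hand side is continuous, being built from spatial derivatives, so that
    [isd_extend] supplies the time derivative there. *)
Let isd_Z t x : 0 < t < t0 + eps -> isd (Z1 ^~ x) t (E1 t x) /\ isd (Z2 ^~ x) t (E2 t x).
Proof.
move=> tt; have [->|tn] := eqVneq t t0; last exact: isd_off.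
pose r := Num.min t0 eps.
have r0 : 0 < r by rewrite lt_min t00.
have near s : `|s - t0| < r -> 0 < s < t0 + eps.
  by rewrite lt_min !ltr_norml => /andP[/andP[h1 h2] /andP[h3 h4]]; apply/andP; split; lra.
have cE Z : xsmooth Z -> continuous (Z ^~ x) by move=> xZ; apply: jc_t; exact: csm_jc (xZ 0%N).
split; [apply: (@isd_extend R (Z1 ^~ x) (E1 ^~ x) t0 r r0)|apply: (@isd_extend R (Z2 ^~ x) (E2 ^~ x) t0 r r0)].
- by apply: (cE E1); exact: (xsmooth_rat xZ1 xZ2 m1 m2 dr_E1).
- by move=> s _; exact: (cE Z1).
- by move=> s /near ss sn; have [] := isd_off x ss sn.
- by apply: (cE E2); exact: (xsmooth_rat xZ1 xZ2 m1 m2 dr_E2).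
- by move=> s _; exact: (cE Z2).
- by move=> s /near ss sn; have [] := isd_off x ss sn.
Qed.

Let smooth_Z : smooth_open [set p : R * R | 0 < p.1 < t0 + eps] (fun p => Z1 p.1 p.2) /\
   smooth_open [set p : R * R | 0 < p.1 < t0 + eps] (fun p => Z2 p.1 p.2).
Proof.
have S := @smooth_rat R Z1 Z2 xZ1 xZ2 m1 m2 0 (t0 + eps) E1 E2 dr_E1 dr_E2
    (fun t x tt => proj1 (isd_Z x tt)) (fun t x tt => proj2 (isd_Z x tt)).
by split; [exact: S (dr_u 0)|exact: S (dr_v 0)].
Qed.

Lemma glue_flows : [/\
  forall t x, Z1 t (x + 2 * pi) = Z1 t x /\ Z2 t (x + 2 * pi) = Z2 t x,
  forall t x, Z1 t x * Z1 t x + Z2 t x * Z2 t x != 0 /\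
    dx Z1 t x * dx Z1 t x + dx Z2 t x * dx Z2 t x != 0,
  forall t x, 0 < t < t0 + eps ->
     isd (Z1 ^~ x) t (- dx Z2 t x * nflow N Z1 Z2 t x) /\
     isd (Z2 ^~ x) t (dx Z1 t x * nflow N Z1 Z2 t x) &
  smooth_open [set p : R * R | 0 < p.1 < t0 + eps] (fun p => Z1 p.1 p.2) /\
  smooth_open [set p : R * R | 0 < p.1 < t0 + eps] (fun p => Z2 p.1 p.2)].
Proof. by split => //; exact: isd_Z. Qed.

End Glue.

(** * The profile curves of a given solution *)

Section Profile.
Context {R : realType} {n : nat} (i0 : 'I_n) (Ts : \bar R) (z : R -> R -> R * R).
Context (U : set (R * R)) (u v : R * R -> R) (su : smoothf U u) (sv : smoothf U v).
Context (Ut : forall t x, time_interval Ts t -> U (t, x)).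
Context (profileE : forall t x, time_interval Ts t -> z t x = (u (t, x), v (t, x))).
Context (imm : forall t, time_interval Ts t -> closed_immersed_in_Cstar (z t)).
Context (flow : forall t phi (x : 'rV[R]_n) (e : 'I_n -> R * 'rV[R]_n),
        time_interval Ts t -> unit_sphere x ->
        orthonormal_frame (equivariant_map (z t)) phi x e ->
        (s - t)^-1 *: (equivariant_map (z s) phi x - equivariant_map (z t) phi x)
          @[s --> within (time_interval Ts) (t^')]
          --> mean_curvature_vector (equivariant_map (z t)) phi x e).

Let c1 t x : R * R := (Dx u (t, x), Dx v (t, x)).
Let c2 t x : R * R := (Dx (Dx u) (t, x), Dx (Dx v) (t, x)).

Let dz1 t (x : R) : time_interval Ts t -> isd (fun x : R => (z t x).1) x (c1 t x).1.
Proof.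
move=> tT; apply: (isd_ext (f := fun x => u (t, x))) => [y|]; first by rewrite profileE.
by apply: isd_sx su _; exact: Ut.
Qed.

Let dz2 t (x : R) : time_interval Ts t -> isd (fun x : R => (z t x).2) x (c1 t x).2.
Proof.
move=> tT; apply: (isd_ext (f := fun x => v (t, x))) => [y|]; first by rewrite profileE.
by apply: isd_sx sv _; exact: Ut.
Qed.

Let ddz1 t (x : R) : time_interval Ts t -> isd (fun x : R => (c1 t x).1) x (c2 t x).1.
Proof. by move=> tT; apply: isd_sx (sm_drv _ su) _; exact: Ut. Qed.

Let ddz2 t (x : R) : time_interval Ts t -> isd (fun x : R => (c1 t x).2) x (c2 t x).2.
Proof. by move=> tT; apply: isd_sx (sm_drv _ sv) _; exact: Ut. Qed.

Lemma derive1_profile t x : time_interval Ts t -> derive1 (z t) x = (Dx u (t, x), Dx v (t, x)).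
Proof.
move=> tT; rewrite derive1E.
have D := is_derive_pair (dz1 x tT) (dz2 x tT).
have E : (fun x => ((z t x).1, (z t x).2)) = z t by apply/funext => y; rewrite -surjective_pairing.
by rewrite E in D; exact: (@derive_val _ _ _ _ _ _ _ D).
Qed.

Lemma profile_periodic t x : time_interval Ts t ->
  u (t, x + 2 * pi) = u (t, x) /\ v (t, x + 2 * pi) = v (t, x).
Proof.
move=> tT; have [P _ _] := imm tT; have := P x; rewrite !profileE //.
by case.
Qed.

Lemma sq_neq0 (a b : R) : (a, b) != 0 -> a * a + b * b != 0.
Proof.
apply: contra => /eqP h; have a0 : 0 <= a * a by rewrite -expr2 sqr_ge0.
have b0 : 0 <= b * b by rewrite -expr2 sqr_ge0.
have : a * a = 0 by lra.
have : b * b = 0 by lra.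
move=> /eqP; rewrite mulf_eq0 orbb => /eqP -> /eqP; rewrite mulf_eq0 orbb => /eqP ->.
by [].
Qed.

Lemma profile_neq0 t x : time_interval Ts t -> u (t, x) * u (t, x) + v (t, x) * v (t, x) != 0.
Proof. by move=> tT; have [_ P _] := imm tT; have := P x; rewrite !profileE // => /sq_neq0. Qed.

Lemma profile_immersed t x : time_interval Ts t ->
  Dx u (t, x) * Dx u (t, x) + Dx v (t, x) * Dx v (t, x) != 0.
Proof. by move=> tT; have [_ _ P] := imm tT; have := P x; rewrite derive1_profile // => /sq_neq0. Qed.

Lemma sq_gt0' (a b : R) : a * a + b * b != 0 -> 0 < a * a + b * b.
Proof. by rewrite lt_neqAle eq_sym => -> /=; rewrite addr_ge0 // -expr2 sqr_ge0. Qed.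

Let sp t x := speed (n%:R - 1) (u (t, x), v (t, x)) (c1 t x) (c2 t x).

Lemma profile_velocity t x : time_interval Ts t ->
  isd_in (time_interval Ts) (fun s => (z s x).1) t (- Dx v (t, x) * sp t x) /\
  isd_in (time_interval Ts) (fun s => (z s x).2) t (Dx u (t, x) * sp t x).
Proof.
move=> tT.
have rr : 0 < dot2 (z t x) (z t x) by rewrite profileE //; exact: sq_gt0' (profile_neq0 x tT).
have ss : 0 < dot2 (c1 t x) (c1 t x) by exact: sq_gt0' (profile_immersed x tT).
have d1 y := dz1 y tT; have d2 y := dz2 y tT; have d3 y := ddz1 y tT; have d4 y := ddz2 y tT.
have [e He] := frame_exists d1 d2 i0 rr ss.
have x1 : dotv (delta_mx 0 i0 : 'rV[R]_n) (delta_mx 0 i0) = 1.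
  rewrite /dotv (bigD1 i0) //= mxE !eqxx mulr1 big1 ?addr0 // => i ii.
  by rewrite mxE (negbTE ii) andbF mulr0.
have := flow tT x1 He.
rewrite (mean_curvature_speed d1 d2 d3 d4 x1 He rr ss) profileE //.
exact: (@tens_isd_in R n (time_interval Ts) (fun s => z s x) t).
Qed.

Lemma profile_equation t x : 0 < t -> (t%:E < Ts)%E ->
  Dt u (t, x) = - Dx v (t, x) * sp t x /\ Dt v (t, x) = Dx u (t, x) * sp t x.
Proof.
move=> t0 tTs; have tT : time_interval Ts t by split => //; exact: ltW.
have [r r0 Hr] : exists2 r : R, 0 < r & forall s, `|s - t| < r -> time_interval Ts s.
  (* A real bound beyond t inside the interval, since [Ts] may be infinite. *)
  have [T' tT' T'T] : exists2 T' : R, t < T' & (T'%:E <= Ts)%E.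
    case: Ts tTs => [T'| |//]; first by rewrite lte_fin => h; exists T'.
    by move=> _; exists (t + 1); rewrite ?ltrDl // leey.
  exists (Num.min t (T' - t)) => [|s]; first by rewrite lt_min t0 subr_gt0.
  rewrite lt_min !ltr_norml => /andP[/andP[h1 _] /andP[_ h2]]; split; first by lra.
  by apply: lt_le_trans T'T; rewrite lte_fin; lra.
have [V1 V2] := profile_velocity x tT.
have D1 := isd_in_isd r0 Hr V1; have D2 := isd_in_isd r0 Hr V2.
have near_eq (F : R * R -> R) (G : R -> R) : (forall s, time_interval Ts s -> G s = F (s, x)) ->
    \near t, G t = F (t, x).
  by move=> E; apply/nbhs_ballP; exists r => // s; rewrite /ball /= distrC => /Hr; exact: E.
split.
- have D := isd_near (near_eq u (fun s => (z s x).1) (fun s sT => congr1 fst (profileE x sT))) D1.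
  exact: isd_uniq (isd_st su (Ut x tT)) D.
- have D := isd_near (near_eq v (fun s => (z s x).2) (fun s sT => congr1 snd (profileE x sT))) D2.
  exact: isd_uniq (isd_st sv (Ut x tT)) D.
Qed.

Lemma profile_starshaped x : time_interval Ts 0 -> starshaped (z 0) ->
  0 < u (0, x) * Dx v (0, x) - v (0, x) * Dx u (0, x).
Proof.
move=> T0 /(_ x); rewrite /outward_normal derive1_profile // profileE //.
rewrite /dot2 /J /= /GRing.scale /= opprK !mulrN.
set m := (norm2 _)^-1; move=> h.
have m0 : 0 <= m by rewrite /m invr_ge0 /norm2 sqrtr_ge0.
have E : 0 < m * (u (0, x) * Dx v (0, x) - v (0, x) * Dx u (0, x)).
  by move: h; congr (0 < _); ring.
by move: E; case: (ltrgtP 0 m) m0 => // [m0 _|<-]; rewrite ?mul0r ?ltxx // pmulr_rgt0.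
Qed.

End Profile.

(** * Lower bound of the radius and criteria for a solution *)

Section Conclusion.
Context {R : realType}.

Lemma tube_bounded (F : R * R -> R) (b P : R) : 0 < P ->
  (forall t x, 0 <= t <= b -> {for (t, x), continuous F}) ->
  (forall t x, 0 <= t <= b -> F (t, x + P) = F (t, x)) ->
  exists C, forall t x, 0 <= t <= b -> `|F (t, x)| <= C.
Proof.
move=> P0 cF pF; pose K := `[0, b]%classic `*` `[0, P]%classic.
have cK : compact K by apply: compact_setX; exact: segment_compact.
have cFK : {within K, continuous F}.
  apply: continuous_in_subspaceT => -[t x]; rewrite inE => -[/= h _]; apply: cF.
  by move: h; rewrite in_itv.
have [M [_ HM]] := compact_bounded (continuous_compact cFK cK).
exists (M + 1) => t x tb; have [k Hk] := periodic_reduce x P0.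
rewrite -(@periodic_int R R (fun x => F (t, x)) P k x); last by move=> y; exact: pF.
apply: (HM (M + 1)); first by rewrite ltrDl.
by exists (t, x + k%:~R * P) => //; split; rewrite /= in_itv.
Qed.

Lemma norm2_ge0 (p : R * R) : 0 <= norm2 p.
Proof. exact: sqrtr_ge0. Qed.

Lemma min_radius_ge0 (c : R -> R * R) : (0 <= min_radius c)%E.
Proof. by apply: le_ereal_inf_tmp => _ [x _ <-]; rewrite lee_fin norm2_ge0. Qed.

(** The lower limit is a supremum of infima over neighbourhoods and is nonnegative; if it is not 0,
    one neighbourhood already has a positive infimum. *)
Lemma liminf_radius (z : R -> R -> R * R) (T : R) :
  limf_einf (fun t => min_radius (z t)) (at_left_ereal T%:E) <> 0%E ->
  exists d r : R, [/\ 0 < d, 0 < r & forall t x, T - r < t < T -> d <= norm2 (z t x)].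
Proof.
rewrite limf_einfE /=; set S := [set _ | _ in _] => S0.
have SS : (0 <= ereal_sup S)%E.
  apply: le_trans (_ : ereal_inf ((fun t => min_radius (z t)) @` setT) <= _)%E.
    by apply: le_ereal_inf_tmp => _ [t _ <-]; exact: min_radius_ge0.
  by apply: ereal_sup_ubound; exists setT => //; exact: filterT.
have {SS S0} : (0 < ereal_sup S)%E by rewrite lt_neqAle SS andbT eq_sym; apply/eqP.
move=> /ereal_sup_gt[_ [A nA <-]] A0.
have [d d0 dA] : exists2 d : R, 0 < d & (d%:E <= ereal_inf ((fun t => min_radius (z t)) @` A))%E.
  move: A0; case: (ereal_inf _) => [r| |//]; first by rewrite lte_fin => r0; exists r.
  by move=> _; exists 1; rewrite ?leey.
have [r r0 Hr] : exists2 r : R, 0 < r & forall t, T - r < t < T -> A t.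
  move: nA => /nbhs_ballP[r r0 Hr]; exists r => // t /andP[h1 h2].
  by apply: Hr => //; rewrite /ball /= ger0_norm ?subr_ge0 ?(ltW h2) // ltrBlDr -ltrBlDl.
exists d, r; split => // t x /Hr At; rewrite -lee_fin; apply: le_trans dA _.
apply: le_trans (_ : min_radius (z t) <= _)%E.
  by apply: ereal_inf_lbound; exists t.
by apply: ereal_inf_lbound; exists x.
Qed.

Lemma velocity_lmcf (n : nat) (D : set R) (z : R -> R -> R * R) (t phi : R) (c1 c2 : R -> R * R) :
  (forall x : R, isd (fun x : R => (z t x).1) x (c1 x).1) -> (forall x : R, isd (fun x : R => (z t x).2) x (c1 x).2) ->
  (forall x : R, isd (fun x : R => (c1 x).1) x (c2 x).1) -> (forall x : R, isd (fun x : R => (c1 x).2) x (c2 x).2) ->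
  dot2 (z t phi) (z t phi) != 0 -> dot2 (c1 phi) (c1 phi) != 0 ->
  isd_in D (fun s => (z s phi).1) t (- (c1 phi).2 * speed (n%:R - 1) (z t phi) (c1 phi) (c2 phi)) ->
  isd_in D (fun s => (z s phi).2) t ((c1 phi).1 * speed (n%:R - 1) (z t phi) (c1 phi) (c2 phi)) ->
  forall (x : 'rV[R]_n) (e : 'I_n -> R * 'rV[R]_n), unit_sphere x ->
    orthonormal_frame (equivariant_map (z t)) phi x e ->
    (s - t)^-1 *: (equivariant_map (z s) phi x - equivariant_map (z t) phi x)
      @[s --> within D (t^')] --> mean_curvature_vector (equivariant_map (z t)) phi x e.
Proof.
move=> D1 D2 D3 D4 rr ss V1 V2 x e x1 He.
rewrite (mean_curvature_speed D1 D2 D3 D4 x1 He (sq_gt0' rr) (sq_gt0' ss)).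
exact: (@isd_in_tens R n D (fun s => z s phi) t (_, _) x V1 V2).
Qed.

Lemma smooth_openU (V W : normedModType R) (A B : set V) (f : V -> W) :
  smooth_open A f -> smooth_open B f -> smooth_open (A `|` B) f.
Proof. by move=> sA sB s a [Aa|Ba]; [exact: sA|exact: sB]. Qed.

Lemma open_time_lt (c : R) : open [set p : R * R | p.1 < c].
Proof.
have oT : open [set: R * R] by exact: openT.
have sF : smoothf [set: R * R] (fun p : R * R => c - p.1).
  by apply: smB => //; [exact: sm_cst|exact: sm_fst].
rewrite (_ : [set p : R * R | _] = [set p | [set: R * R] p /\ 0 < (fun p : R * R => c - p.1) p]); first exact: open_pos.
by apply/seteqP; split => p /=; rewrite subr_gt0 => //; case.
Qed.

Lemma open_time_gt (c : R) : open [set p : R * R | c < p.1].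
Proof.
have oT : open [set: R * R] by exact: openT.
have sF : smoothf [set: R * R] (fun p : R * R => p.1 - c).
  by apply: smB => //; [exact: sm_fst|exact: sm_cst].
rewrite (_ : [set p : R * R | _] = [set p | [set: R * R] p /\ 0 < (fun p : R * R => p.1 - c) p]); first exact: open_pos.
by apply/seteqP; split => p /=; rewrite subr_gt0 => //; case.
Qed.

End Conclusion.

Lemma time_interval_fin {R : realType} (T t : R) : time_interval T%:E t <-> 0 <= t < T.
Proof. by rewrite /time_interval /= lte_fin; split => [[-> ->]|/andP[-> ->]]. Qed.

Lemma smooth_pairs {R : realType} (U : set (R * R)) (f1 f2 : R * R -> R) : open U ->
  smooth_open U f1 -> smooth_open U f2 -> smooth_open U (fun p => (f1 p, f2 p)).
Proof. by move=> oU h1 h2; exact ((smooth_pair (fun p => (f1 p, f2 p)) oU).2 (conj h1 h2)). Qed.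

Lemma velocity1_eq {R : realType} (N : R) D f (t : R) (a b : R) (p p2 p' p1' p2' : R * R) :
  isd_in D f t (- b * speed N p (a, b) p2) -> p = p' -> (a, b) = p1' -> p2 = p2' ->
  isd_in D f t (- p1'.2 * speed N p' p1' p2').
Proof. by move=> H <- <- <-. Qed.

Lemma velocity2_eq {R : realType} (N : R) D f (t : R) (a b : R) (p p2 p' p1' p2' : R * R) :
  isd_in D f t (a * speed N p (a, b) p2) -> p = p' -> (a, b) = p1' -> p2 = p2' ->
  isd_in D f t (p1'.1 * speed N p' p1' p2').
Proof. by move=> H <- <- <-. Qed.

Lemma le_of_near0 {R : realType} (s c : R) : 0 <= s -> `|s - 0| < c -> 0 <= s <= c.
Proof. by move=> s0; rewrite subr0 ger0_norm // s0 => /ltW. Qed.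

(** * Extension past the singular time *)

Section Extension.
Context {R : realType} {n : nat} (n2 : (2 <= n)%N) (Ts : \bar R) (z : R -> R -> R * R).
Context (U : set (R * R)) (u v : R * R -> R) (oU : open U) (su : smoothf U u) (sv : smoothf U v).
Context (Ut : forall t x, time_interval Ts t -> U (t, x)).
Context (zE : forall t x, time_interval Ts t -> z t x = (u (t, x), v (t, x))).
Context (imm : forall t, time_interval Ts t -> closed_immersed_in_Cstar (z t)).
Context (flow : forall t phi (x : 'rV[R]_n) (e : 'I_n -> R * 'rV[R]_n),
        time_interval Ts t -> unit_sphere x ->
        orthonormal_frame (equivariant_map (z t)) phi x e ->
        (s - t)^-1 *: (equivariant_map (z s) phi x - equivariant_map (z t) phi x)
          @[s --> within (time_interval Ts) (t^')]
          --> mean_curvature_vector (equivariant_map (z t)) phi x e).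

Let i0 : 'I_n := Ordinal (leq_trans (isT : 0 < 2)%N n2).
Let N : R := n%:R - 1.
Let N0 : 0 <= N. Proof. by rewrite subr_ge0 ler1n; exact: leq_trans n2. Qed.
Let per := profile_periodic zE imm.
Let eqn := profile_equation i0 su sv Ut zE imm flow.
Let n10 t x h := profile_neq0 zE imm (t := t) x h.
Let n20 t x h := profile_immersed su sv Ut zE imm (t := t) x h.
Let P0 : 0 < 2 * pi :> R. Proof. by rewrite mulr_gt0 // pi_gt0. Qed.

Section UpTo.
(** T is any real with [0, T) inside the interval of existence: an arbitrary later time in the proof
    that [Ts] is finite, and [Ts] itself thereafter. *)
Context (T : R) (TT : forall t, 0 <= t < T -> time_interval Ts t).
Let TT' t : 0 < t < T -> (t%:E < Ts)%E.
Proof. by move=> tT; have [] : time_interval Ts t by apply: TT; case/andP: tT => /ltW -> ->. Qed.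
Let D1 t x (h : 0 <= t < T) : U (t, x) := Ut x (TT h).
Let D2 t x (h : 0 <= t < T) : u (t, x + 2 * pi) = u (t, x) := proj1 (per x (TT h)).
Let D3 t x (h : 0 <= t < T) : v (t, x + 2 * pi) = v (t, x) := proj2 (per x (TT h)).
Let D4 t x (h : 0 <= t < T) := n10 x (TT h).
Let D5 t x (h : 0 <= t < T) := n20 x (TT h).
Let t_gt0 t : 0 < t < T -> 0 < t. Proof. by case/andP. Qed.
Let D6 t x (h : 0 < t < T) := proj1 (eqn x (t_gt0 h) (TT' h)).
Let D7 t x (h : 0 < t < T) := proj2 (eqn x (t_gt0 h) (TT' h)).

Lemma profile_radius_decay M : (forall x, u (0, x) * u (0, x) + v (0, x) * v (0, x) < M) ->
  forall t x, 0 <= t < T -> u (t, x) * u (t, x) + v (t, x) * v (t, x) + t < M.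
Proof. exact: (@radius_decay R N T U u v N0 oU su sv D1 D2 D3 D4 D5 D6 D7 M). Qed.

Lemma profile_restart Q : 0 < T ->
  (forall t x, 0 <= t < T -> (u (t, x) * u (t, x) + v (t, x) * v (t, x))^-1 <= Q) ->
  starshaped (z 0) ->
  exists2 B, 1 <= B & forall t, 0 <= t < T -> exists X Y, [/\ xsmooth X /\ xsmooth Y,
    forall s x, X s (x + 2 * pi) = X s x /\ Y s (x + 2 * pi) = Y s x,
    forall x, X 0 x = u (t, x) /\ Y 0 x = v (t, x),
    forall s x, X s x * X s x + Y s x * Y s x != 0 /\
       dx X s x * dx X s x + dx Y s x * dx Y s x != 0 &
    forall s x, 0 < s < existence_time N B ->
      isd (X ^~ x) s (- dx Y s x * nflow N X Y s x) /\
      isd (Y ^~ x) s (dx X s x * nflow N X Y s x)].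
Proof.
move=> T0 HQ star; have I0 : time_interval Ts 0 by apply: TT; rewrite lexx.
exact: (@flow_restart R N T U u v N0 T0 oU su sv D1 D2 D3 D4 D5 D6 D7 Q HQ
  (fun x => profile_starshaped su sv Ut zE x I0 star)).
Qed.

End UpTo.

(** By [profile_radius_decay], r^2 would be negative from the time M + 1 on. *)
Lemma existence_time_bounded : time_interval Ts 0 -> exists M : R, forall t, time_interval Ts t -> t <= M.
Proof.
move=> I0; have [M HM] : exists M, forall x, `|u (0, x) * u (0, x) + v (0, x) * v (0, x)| <= M.
  apply: (periodic_bounded P0) => x; last by have [-> ->] := per x I0.
  have c1 := isd_cont (isd_sx su (Ut x I0)); have c2 := isd_cont (isd_sx sv (Ut x I0)).
  by apply: cvgD; apply: cvgM.
have HM' x : u (0, x) * u (0, x) + v (0, x) * v (0, x) < M + 1.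
  by have := HM x; have := ler_norm (u (0, x) * u (0, x) + v (0, x) * v (0, x)); lra.
exists (M + 1) => t [t0 tT]; rewrite leNgt; apply/negP => tM.
have M0 : 0 <= M by exact: le_trans (HM 0).
have TT s : 0 <= s < t -> time_interval Ts s.
  by move=> /andP[s0 st]; split => //; apply: lt_trans tT; rewrite lte_fin.
have M1 : 0 <= M + 1 < t by rewrite tM addr_ge0.
have := profile_radius_decay TT HM' 0 M1.
have := sq_gt0' (n10 0 (TT _ M1)).
by lra.
Qed.

Context (T : R) (TsE : Ts = T%:E) (T0 : 0 < T).
Let tI t : 0 <= t < T -> time_interval Ts t. Proof. by move=> /time_interval_fin; rewrite TsE. Qed.

Lemma curvature_radius_bounded (d r : R) : 0 < d -> 0 < r ->
  (forall t x, T - r < t < T -> d <= norm2 (z t x)) ->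
  exists Q, forall t x, 0 <= t < T -> (u (t, x) * u (t, x) + v (t, x) * v (t, x))^-1 <= Q.
Proof.
move=> d0 r0 Hd; pose b := Num.max 0 (T - r / 2).
have bT : b < T by rewrite gt_max T0 /= ltrBlDr ltrDl divr_gt0.
have tb t : 0 <= t <= b -> time_interval Ts t.
  by move=> /andP[t0 tb]; apply: tI; rewrite t0 (le_lt_trans tb).
have [|t x h|C HC] := @tube_bounded R (fun p => (u p * u p + v p * v p)^-1) b (2 * pi) P0.
- move=> t x h; have It := tb t h.
  have [su'] := su; have [sv'] := sv.
  have c1 := smooth_cont su' (Ut x It); have c2 := smooth_cont sv' (Ut x It).
  by apply: cvgV; [exact: n10|apply: cvgD; apply: cvgM].
- by have [-> ->] := per x (tb t h).
exists (C + (d ^+ 2)^-1) => t x tT.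
have d2 : 0 < (d ^+ 2)^-1 by rewrite invr_gt0 exprn_gt0.
have C0 : 0 <= C by apply: le_trans (HC 0 0 _) => //; rewrite lexx le_max lexx.
have [h|h] := leP t b.
  have tb' : 0 <= t <= b by case/andP: tT => ->.
  by apply: le_trans (ler_norm _) _; apply: le_trans (HC t x tb') _; rewrite lerDl ltW.
have h1 : d <= norm2 (z t x).
  apply: Hd; case/andP: tT => _ ->; rewrite andbT.
  by apply: lt_trans h; rewrite lt_max; apply/orP; right; lra.
have It := tI tT; have p := sq_gt0' (n10 x It).
rewrite -[leLHS]add0r lerD // lef_pV2 ?posrE ?exprn_gt0 //.
move: h1; rewrite zE // /norm2 /dot2 /= => h1.
by rewrite -[leRHS]sqr_sqrtr ?(ltW p) // lerXn2r ?nnegrE ?sqrtr_ge0 // ltW.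
Qed.

Lemma extension_exists (d r : R) : 0 < d -> 0 < r -> starshaped (z 0) ->
  (forall t x, T - r < t < T -> d <= norm2 (z t x)) ->
  exists T' z', [/\ (Ts < T')%E, equivariant_lmcf n T' z' & z' 0 = z 0].
Proof.
move=> d0 r0 star Hd; have [Q HQ] := curvature_radius_bounded d0 r0 Hd.
have [B B1 HB] := profile_restart tI T0 HQ star.
set eps := existence_time N B in HB; have eps0 : 0 < eps by exact: existence_time_gt0.
(* Restarting at most eps / 2 before T leads past T; T / 2 keeps the restart time positive. *)
pose t0 := Num.max (T - eps / 2) (T / 2).
have t00 : 0 < t0 by rewrite lt_max divr_gt0 ?orbT.
have t0T : t0 < T by have T0' := T0; rewrite gt_max; apply/andP; split; lra.
have Tt0 : T < t0 + eps.
  have h : T - eps / 2 <= t0 by rewrite le_max lexx.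
  by lra.
have I0 : time_interval Ts 0 by apply: tI; rewrite lexx.
have [|X [Y [[xX xY] perXY XY0 XYn XYt]]] := HB t0; first by rewrite t0T ltW.
have lo t : 0 <= t <= t0 -> time_interval Ts t.
  by move=> /andP[h1 h2]; apply: tI; rewrite h1 (le_lt_trans h2).
have UD t x (h : 0 <= t <= t0) : U (t, x) := Ut x (lo t h).
have [Z1 [xZ1 Z1lo Z1hi Z1neg]] := concatenation t00 UD su xX (fun x => proj1 (XY0 x)).
have [Z2 [xZ2 Z2lo Z2hi Z2neg]] := concatenation t00 UD sv xY (fun x => proj2 (XY0 x)).
have e12 t x : 0 < t < t0 -> Dt u (t, x) = - Dx v (t, x) *
    speed N (u (t, x), v (t, x)) (Dx u (t, x), Dx v (t, x)) (Dx (Dx u) (t, x), Dx (Dx v) (t, x)) /\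
  Dt v (t, x) = Dx u (t, x) *
    speed N (u (t, x), v (t, x)) (Dx u (t, x), Dx v (t, x)) (Dx (Dx u) (t, x), Dx (Dx v) (t, x)).
  move=> /andP[h1 h2]; apply: eqn => //.
  by have [] : time_interval Ts t by apply: lo; rewrite !ltW.
have [perZ nZ Zt [s1 s2]] := @glue_flows R N t0 eps U u v t00 eps0 su sv UD
  (fun t x h => per x (lo t h)) (fun t x h => n10 x (lo t h)) (fun t x h => n20 x (lo t h))
  (fun t x h => proj1 (e12 t x h)) (fun t x h => proj2 (e12 t x h)) X Y perXY XYn XYt
  Z1 Z2 xZ1 xZ2 Z1lo Z2lo Z1hi Z2hi Z1neg Z2neg.
pose z' t x := (Z1 t x, Z2 t x).
have z'lo t : 0 <= t <= t0 -> z' t = z t.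
  by move=> h; apply/funext => x; rewrite /z' Z1lo // Z2lo // zE //; exact: lo.
have D1 := xsmooth_dx xZ1; have D2 := xsmooth_dx xZ2.
have DD1 := xsmooth_dx (proj2 D1); have DD2 := xsmooth_dx (proj2 D2).
pose c1 t x := (dx Z1 t x, dx Z2 t x); pose c2 t x := (dx (dx Z1) t x, dx (dx Z2) t x).
have zero : 0 <= (0 : R) <= t0 by rewrite lexx ltW.
exists (t0 + eps)%:E, z'; split; [by rewrite TsE lte_fin| |exact: z'lo]; split.
- pose A := U `&` [set p : R * R | p.1 < t0]; pose C := [set p : R * R | 0 < p.1 < t0 + eps].
  (* The concatenation is constant before time 0, hence need not be smooth across it. Near the
     initial time the given extension on [U] is used instead; both agree on [0, t0], so that the
     switch at t0 / 2 is invisible. *)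
  pose g1 p := if p.1 < t0 / 2 then u p else Z1 p.1 p.2.
  pose g2 p := if p.1 < t0 / 2 then v p else Z2 p.1 p.2.
  have oA : open A by apply: openI => //; exact: open_time_lt.
  have oC : open C.
    rewrite (_ : C = [set p : R * R | 0 < p.1] `&` [set p : R * R | p.1 < t0 + eps]).
      by apply: openI; [exact: open_time_gt|exact: open_time_lt].
    by apply/seteqP; split => p /=; [move=> /andP|move=> [p1 p2]; apply/andP].
  have gl (F : R * R -> R) (Z : R -> R -> R) : (forall t, 0 <= t <= t0 -> Z t = (fun x => F (t, x))) ->
      smoothf U F -> smooth_open C (fun p => Z p.1 p.2) ->
      smooth_open (A `|` C) (fun p => if p.1 < t0 / 2 then F p else Z p.1 p.2).
    move=> Zlo [sF] sZ; apply: smooth_openU.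
    - apply: (smooth_eq (f := F) oA) => [[t x] [_ /= tt]|]; last by apply: smooth_sub sF => p [].
      by case: ltP => // h; rewrite Zlo //; apply/andP; split; lra.
    - apply: (smooth_eq (f := fun p => Z p.1 p.2) oC) => [[t x] Cp|//]; have /andP[h1 h2] : 0 < t < t0 + eps := Cp.
      rewrite /=; case: ltP => // h; rewrite Zlo // (ltW h1) /=.
      by apply: (le_trans (ltW h)); lra.
  exists (A `|` C), (fun p => (g1 p, g2 p)); split.
  + exact: openU.
  + move=> [t x] /= /time_interval_fin /andP[h1 h2].
    have [h|h] := ltP t (t0 / 2); [left|right] => /=.
      by split => /=; [apply: UD; apply/andP; split; lra|lra].
    have tp : 0 < t by apply: lt_le_trans h; rewrite divr_gt0.
    by rewrite /C /= tp h2.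
  + have oAC : open (A `|` C) by exact: openU.
    exact: (smooth_pairs oAC (gl u Z1 Z1lo su s1) (gl v Z2 Z2lo sv s2)).
  + move=> [t x] /= /time_interval_fin /andP[h1 h2]; rewrite /z' /g1 /g2 /=.
    by case: ltP => // h; rewrite Z1lo ?Z2lo //; apply/andP; split; lra.
- move=> t _; split => x.
  + by rewrite /z'; have [-> ->] := perZ t x.
  + have [h _] := nZ t x; apply: contra h => /eqP[-> ->].
    by rewrite !mulr0 addr0.
  + have [_ h] := nZ t x; apply: contra h.
    rewrite derive1E (@derive_val _ _ _ _ _ _ _ (is_derive_pair (proj1 D1 t x) (proj1 D2 t x))).
    by move=> /eqP[-> ->]; rewrite !mulr0 addr0.
- move=> t phi x e /time_interval_fin tT x1 He.
  suff [V1 V2] : isd_in (time_interval (t0 + eps)%:E) (fun s => (z' s phi).1) t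
      (- (c1 t phi).2 * speed (n%:R - 1) (z' t phi) (c1 t phi) (c2 t phi)) /\
    isd_in (time_interval (t0 + eps)%:E) (fun s => (z' s phi).2) t
      ((c1 t phi).1 * speed (n%:R - 1) (z' t phi) (c1 t phi) (c2 t phi)).
    exact (@velocity_lmcf R n _ z' t phi (c1 t) (c2 t) (proj1 D1 t) (proj1 D2 t) (proj1 DD1 t) (proj1 DD2 t)
      (proj1 (nZ t phi)) (proj2 (nZ t phi)) V1 V2 x e x1 He).
  have [tp|tp] := ltP 0 t.
    have [V1 V2] : isd (Z1 ^~ phi) t (- dx Z2 t phi * nflow N Z1 Z2 t phi) /\
      isd (Z2 ^~ phi) t (dx Z1 t phi * nflow N Z1 Z2 t phi).
      by apply: Zt; rewrite tp; case/andP: tT.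
    by split; apply: isd_isd_in.
  have {tp tT} -> : t = 0 by apply/eqP; rewrite eq_le tp; case/andP: tT.
  (* At t = 0 a one-sided derivative is asked for; it is inherited from the given solution, with
     which z' coincides on [0, t0]. *)
  have [V1 V2] := profile_velocity i0 su sv Ut zE imm flow phi I0.
  have U0 x' : U (0, x') := Ut x' I0.
  have [a1 a2] := dx_slice phi su U0 (Z1lo 0 zero); have [b1 b2] := dx_slice phi sv U0 (Z2lo 0 zero).
  have e0 : (u (0, phi), v (0, phi)) = z' 0 phi.
    by rewrite (congr1 (fun h => h phi) (z'lo 0 zero)) zE.
  have e1 : (Dx u (0, phi), Dx v (0, phi)) = c1 0 phi by rewrite -a1 -b1.
  have e2 : (Dx (Dx u) (0, phi), Dx (Dx v) (0, phi)) = c2 0 phi by rewrite -a2 -b2.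
  have sI s : `|s - 0| < t0 -> time_interval (t0 + eps)%:E s -> 0 <= s <= t0.
    by move=> h [h1 _]; exact (le_of_near0 h1 h).
  have sI' s : time_interval Ts s -> `|s - 0| < t0 -> 0 <= s <= t0.
    by move=> [h1 _] h; exact (le_of_near0 h1 h).
  suff [W1 W2] : isd_in (time_interval (t0 + eps)%:E) (fun s => (z' s phi).1) 0 (- Dx v (0, phi) *
      speed N (u (0, phi), v (0, phi)) (Dx u (0, phi), Dx v (0, phi)) (Dx (Dx u) (0, phi), Dx (Dx v) (0, phi))) /\
    isd_in (time_interval (t0 + eps)%:E) (fun s => (z' s phi).2) 0 (Dx u (0, phi) *
      speed N (u (0, phi), v (0, phi)) (Dx u (0, phi), Dx v (0, phi)) (Dx (Dx u) (0, phi), Dx (Dx v) (0, phi))).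
    by split; [exact (velocity1_eq W1 e0 e1 e2)|exact (velocity2_eq W2 e0 e1 e2)].
  split.
  + apply: (isd_in_near t00 I0 _ _ V1) => s.
      by move=> h1 h2; apply: lo; exact: sI.
    by move=> h1 h2; exact (congr1 (fun h => (h phi).1) (z'lo s (sI' s h1 h2))).
  + apply: (isd_in_near t00 I0 _ _ V2) => s.
      by move=> h1 h2; apply: lo; exact: sI.
    by move=> h1 h2; exact (congr1 (fun h => (h phi).2) (z'lo s (sI' s h1 h2))).
Qed.

End Extension.

Theorem theorem1p14 (R : realType) (n : nat) (Tsing : \bar R)
    (z : R -> R -> R * R) :
  (2 <= n)%N ->
  (0 < Tsing)%E ->
  maximal_equivariant_lmcf n Tsing z ->
  starshaped (z 0) ->
  limf_einf (fun t => min_radius (z t)) (at_left_ereal Tsing) = 0%E.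
Proof.
move=> n2 T0 [[[U [g [oU DU sg zg]]] imm flow] maxi] star.
have [sg1 sg2] := (smooth_pair g oU).1 sg.
pose u p := (g p).1; pose v p := (g p).2.
have su : smoothf U u := Smoothf sg1; have sv : smoothf U v := Smoothf sg2.
have Ut t x : time_interval Tsing t -> U (t, x) by move=> tT; apply: DU.
have zE t x : time_interval Tsing t -> z t x = (u (t, x), v (t, x)).
  by move=> tT; rewrite (zg (t, x) tT) -surjective_pairing.
have I0 : time_interval Tsing 0 by split.
have [M HM] := existence_time_bounded n2 oU su sv Ut zE imm flow I0.
case: Tsing T0 maxi DU zg imm flow Ut zE I0 HM => [T| |//] T0 maxi DU zg imm flow Ut zE I0 HM; last first.
  have : (`|M| + 1 <= M) by apply: HM; split; rewrite ?ltry // addr_ge0.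
  by move=> h; exfalso; have := ler_norm M; lra.
apply: contrapT => /liminf_radius[d [r [d0 r0 Hd]]].
have T00 : 0 < T by rewrite -lte_fin.
have [T' [z' [TT' Hz' z0]]] := extension_exists n2 oU su sv Ut zE imm flow erefl T00 d0 r0 star Hd.
exact: maxi TT' Hz' z0.
Qed.
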